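(* Let $n=3$, $\underline\alpha=(\alpha_1,\alpha_2,\alpha_3)$ generic and $\mathbf h=(h_1>h_2>h_3)$ integers. For $D,D'\in\Phi\Gamma_{\mathrm{nc}}(\underline\alpha,\mathbf h)$, one has $D\cong D'$ if and only if $\mathrm{Ker}(f_D)=\mathrm{Ker}(f_{D'})$ (as subspaces of $\overline{\mathrm{Ext}}^1_{(\varphi,\Gamma)}(D_1,D_1)\oplus\overline{\mathrm{Ext}}^1_{(\varphi,\Gamma)}(C_1,C_1)$).
   Context: $E$ is a finite extension of $\mathbb Q_p$; $\mathcal R_A$ is the Robba ring of $\mathbb Q_p$ with coefficients in $A$; $\mathcal R_A(\delta)$ is the rank one $(\varphi,\Gamma)$-module of a continuous $\delta:\mathbb Q_p^\times\to A^\times$; $\mathrm{unr}(a)$ is the unramified character of $\mathbb Q_p^\times$ with $p\mapsto a$; $z^k$ is $x\mapsto x^k$. Hodge-Tate weights are normalized so that the cyclotomic character has weight $1$. Generic: $\alpha_i\neq\alpha_j$, $\alpha_i\alpha_j^{-1}\neq p$ for $i\ne j$. For a generic $m$-tuple $\underline a$ in $E^\times$ and integers $\mathbf k=(k_1>\dots>k_m)$, $\Phi\Gamma_{\mathrm{nc}}(\underline a,\mathbf k)$ is the set of isomorphism classes of crystalline $(\varphi,\Gamma)$-modules $M$ of rank $m$ over $\mathcal R_E$ with $\varphi$-eigenvalues $\underline a$ on $D_{\mathrm{cris}}(M)$ and Hodge-Tate weights $\mathbf k$ that are non-critical: for every $w\in S_m$, $M$ has a filtration by saturated $(\varphi,\Gamma)$-submodules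 with $i$-th graded piece $\mathcal R_E(\mathrm{unr}(a_{w^{-1}(i)})z^{k_i})$. Elements of $\mathrm{Ext}^1_{(\varphi,\Gamma)}(M,M)$ are viewed as deformations of $M$ over $\mathcal R_{E[\epsilon]/\epsilon^2}$. $\mathrm{Ext}^1_w(M,M)$ is the subspace of those that are successive extensions of $\mathcal R_{E[\epsilon]/\epsilon^2}(\mathrm{unr}(a_{w^{-1}(i)})z^{k_i}(1+\psi_i\epsilon))$ for some additive characters $\psi_i\in\mathrm{Hom}(\mathbb Q_p^\times,E)$; $\mathrm{Ext}^1_0(M,M)$ is the kernel of $\mathrm{Ext}^1_w(M,M)\to\mathrm{Hom}(\mathbb Q_p^\times,E)^m$, $\widetilde M\mapsto(\psi_i)$, which is independent of $w\in S_m$; $\overline{\mathrm{Ext}}^1_{(\varphi,\Gamma)}(M,M):=\mathrm{Ext}^1_{(\varphi,\Gamma)}(M,M)/\mathrm{Ext}^1_0(M,M)$. $D_1$ (resp. $C_1$) is the unique element of $\Phi\Gamma_{\mathrm{nc}}((\alpha_1,\alpha_2),(h_1,h_2))$ (resp. of $\Phi\Gamma_{\mathrm{nc}}((\alpha_1,\alpha_2),(h_2,h_3))$). Every $D\in\Phi\Gamma_{\mathrm{nc}}(\underline\alpha,\mathbf h)$ has two filtrations $$0\to D_1\to D\to\mathcal R_E(\mathrm{unr}(\alpha_3)z^{h_3})\to0,\qquad 0\to\mathcal R_E(\mathrm{unr}(\alpha_3)z^{h_1})\to D\to C_1\to0.$$ $f_D=(f_{\mathscr F},f_{\mathscr G}):\overline{\mathrm{Ext}}^1_{(\varphi,\Gamma)}(D_1,D_1)\oplus\overline{\mathrm{Ext}}^1_{(\varphi,\Gamma)}(C_1,C_1)\to\overline{\mathrm{Ext}}^1_{(\varphi,\Gamma)}(D,D)$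 is the sum of the two maps: $f_{\mathscr F}$ sends the class of $\widetilde D_1$ to the class of any deformation $\widetilde D$ of $D$ of the form $0\to\widetilde D_1\to\widetilde D\to\mathcal R_{E[\epsilon]/\epsilon^2}(\mathrm{unr}(\alpha_3)z^{h_3})\to0$, and $f_{\mathscr G}$ sends the class of $\widetilde C_1$ to the class of any deformation $\widetilde D$ of the form $0\to\mathcal R_{E[\epsilon]/\epsilon^2}(\mathrm{unr}(\alpha_3)z^{h_1})\to\widetilde D\to\widetilde C_1\to0$ (the classes in $\overline{\mathrm{Ext}}^1_{(\varphi,\Gamma)}(D,D)$ do not depend on the choices). *)

(* Defs.v *)
From HB Require Import structures.
From mathcomp Require Import all_boot all_order all_algebra all_fingroup all_field.
From mathcomp Require Import boolp classical_sets reals.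
Set Implicit Arguments.
Unset Strict Implicit.
Unset Printing Implicit Defensive.
Import Order.TTheory GRing.Theory Num.Theory.
Local Open Scope ring_scope.

HB.mixin Record isUltraNormed (R : realType) A of GRing.ComNzRing A := {
  unorm : A -> R;
  unorm_ge0 : forall x, 0 <= unorm x;
  unorm_eq0 : forall x, unorm x = 0 <-> x = 0;
  unorm1 : unorm 1 = 1;
  unormM_le : forall x y, unorm (x * y) <= unorm x * unorm y;
  unormB_le : forall x y, unorm (x - y) <= Num.max (unorm x) (unorm y);
  unorm_complete : forall u : nat -> A,
    (forall e, 0 < e -> exists N, forall m n, (N <= m)%N -> (N <= n)%N ->
       unorm (u m - u n) < e) ->
    exists l, forall e, 0 < e -> exists N, forall n, (N <= n)%N ->
       unorm (u n - l) < e
}.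

#[short(type="ultraRingType")]
HB.structure Definition UltraRing (R : realType) :=
  {A of isUltraNormed R A & GRing.ComNzRing A}.

HB.mixin Record isUltraMult (R : realType) K of UltraRing R K := {
  unormM : forall x y : K, unorm (x * y) = unorm x * unorm y }.

#[short(type="ultraFieldType")]
HB.structure Definition UltraField (R : realType) :=
  {K of UltraRing R K & GRing.Field K & isUltraMult R K}.

(* Q_p is characterized, up to unique isometric isomorphism, as a complete
   ultrametric valued field with |p| = 1/p in which Q is dense.              *)
HB.mixin Record isPadic (R : realType) (p : nat) K of UltraField R K := {
  padic_prime : prime p;
  unorm_p : unorm (p%:R : K) = (p%:R)^-1;
  rat_dense : forall (x : K) (e : R), 0 < e ->
    exists q : rat, unorm (x - ratr q) < e }.

#[short(type="padicNumType")]
HB.structure Definition PadicNum (R : realType) (p : nat) :=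
  {K of UltraField R K & isPadic R p K}.

HB.mixin Record extendsNorm (R : realType) (K : ultraFieldType R) A
    of UltraRing R A & GRing.ComAlgebra K A := {
  unorm_alg : forall x : K, unorm (x%:A : A) = unorm x }.

#[short(type="ultraAlgType")]
HB.structure Definition UltraAlg (R : realType) (K : ultraFieldType R) :=
  {A of UltraRing R A & GRing.ComAlgebra K A & extendsNorm R K A}.

#[short(type="ultraFieldExtType")]
HB.structure Definition UltraFieldExt (R : realType) (K : ultraFieldType R) :=
  {E of FieldExt K E & UltraField R E & UltraAlg R K E}.


Section NullFamilies.
Variable R : realType.
Implicit Types (I J : eqType) (e : R).

(* u tends to 0 along the complements of finite sets; for I = int this is
   convergence to 0 at both ends.                                            *)
Definition null_family I (u : I -> R) : Prop :=
  forall e, 0 < e -> exists F : seq I, forall i, i \notin F -> u i < e.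

Lemma null_le I (u v : I -> R) :
  (forall i, u i <= v i) -> null_family v -> null_family u.
Proof.
move=> uv nv e e0; have [F hF] := nv e e0.
by exists F => i iF; apply: le_lt_trans (uv i) (hF i iF).
Qed.

Lemma null_max I (u v : I -> R) : null_family u -> null_family v ->
  null_family (fun i => Num.max (u i) (v i)).
Proof.
move=> nu nv e e0; have [F hF] := nu e e0; have [G hG] := nv e e0.
exists (F ++ G) => i; rewrite mem_cat negb_or => /andP[iF iG].
by rewrite gt_max hF ?hG.
Qed.

Lemma null_scale I (u : I -> R) c : 0 <= c ->
  null_family u -> null_family (fun i => c * u i).
Proof.
move=> c0 nu e e0; have d0 : 0 < e / (c + 1) by rewrite divr_gt0 ?ltr_wpDl.
have [F hF] := nu _ d0; exists F => i /hF.
rewrite ltr_pdivlMr ?ltr_wpDl // => h; have [u0|u0] := ltP (u i) 0.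
  by apply: le_lt_trans e0; rewrite mulr_ge0_le0 // ltW.
by apply: le_lt_trans h; rewrite mulrC ler_wpM2l // lerDl.
Qed.

Lemma null_bounded I (u : I -> R) : null_family u ->
  exists2 B, 0 < B & forall i, u i <= B.
Proof.
move=> nu; have [F hF] := nu 1 ltr01.
suff [B B0 hB] : exists2 B, 0 < B & forall i, i \in F -> u i <= B.
  exists (Num.max B 1); first by rewrite lt_max B0.
  move=> i; rewrite le_max; have [iF|iF] := boolP (i \in F).
    by rewrite hB.
  by rewrite (ltW (hF i iF)) orbT.
elim: F {hF} => [|j F [B B0 hB]]; first by exists 1.
exists (Num.max B (u j)); first by rewrite lt_max B0.
move=> i; rewrite inE => /orP[/eqP->|iF]; rewrite le_max ?lexx ?orbT //.
by rewrite hB.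
Qed.

Lemma null_inj I J (h : I -> J) (u : J -> R) : injective h ->
  null_family u -> null_family (u \o h).
Proof.
move=> hi nu e e0; have [F hF] := nu e e0.
suff [G hG] : exists G : seq I, forall i, h i \in F -> i \in G.
  by exists G => i iG; apply: hF; apply: contra iG; apply: hG.
elim: F {hF} => [|j F [G hG]]; first by exists [::].
have [[i hij]|nij] := pselect (exists i, h i = j).
  exists (i :: G) => k; rewrite !inE -hij => /orP[/eqP/hi->|/hG->].
    by rewrite eqxx.
  by rewrite orbT.
exists G => k; rewrite inE => /orP[/eqP hk|/hG//].
by case: nij; exists k.
Qed.

Lemma null_mul2 I J (u : I -> R) (v : J -> R) :
  (forall i, 0 <= u i) -> (forall j, 0 <= v j) ->
  null_family u -> null_family v ->
  null_family (fun ij : I * J => u ij.1 * v ij.2).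
Proof.
move=> u0 v0 nu nv e e0.
have [B B0 hB] := null_bounded nu; have [C C0 hC] := null_bounded nv.
have [F hF] := nu _ (divr_gt0 e0 C0); have [G hG] := nv _ (divr_gt0 e0 B0).
exists [seq (i, j) | i <- F, j <- G] => -[i j] /= ijN.
have [iF|iF] := boolP (i \in F).
  have jG : j \notin G by apply: contra ijN => jG; apply/allpairsP; exists (i, j).
  apply: (@le_lt_trans _ _ (B * v j)); first by rewrite ler_wpM2r.
  by rewrite mulrC -ltr_pdivlMr ?hG.
apply: (@le_lt_trans _ _ (u i * C)); first by rewrite ler_wpM2l.
by rewrite -ltr_pdivlMr ?hF.
Qed.

End NullFamilies.

Section UnorderedSums.
Variables (R : realType) (A : ultraRingType R).
Local Notation norm := (@unorm R A).
Implicit Types (I J : eqType) (e : R).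

Definition has_usum I (u : I -> A) (l : A) : Prop :=
  forall e, 0 < e -> exists F : seq I, forall G : seq I,
    uniq G -> {subset F <= G} -> norm (\sum_(i <- G) u i - l) < e.

Definition usum I (u : I -> A) : A := xget 0 [set l | has_usum u l]%classic.

Lemma unorm0 : norm 0 = 0. Proof. exact/unorm_eq0. Qed.

Lemma unormN x : norm (- x) = norm x.
Proof.
suff h y : norm (- y) <= norm y.
  by apply/le_anti; rewrite h -{1}[x]opprK h.
by rewrite -sub0r (le_trans (unormB_le _ _)) // unorm0 ge_max unorm_ge0 lexx.
Qed.

Lemma unormD_le x y : norm (x + y) <= Num.max (norm x) (norm y).
Proof. by rewrite -[y in x + y]opprK -[norm y]unormN unormB_le. Qed.

Lemma unormBC x y : norm (x - y) = norm (y - x).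
Proof. by rewrite -unormN opprB. Qed.

Lemma unorm_sum_le I (s : seq I) (u : I -> A) e : 0 <= e ->
  (forall i, i \in s -> norm (u i) <= e) -> norm (\sum_(i <- s) u i) <= e.
Proof.
move=> e0 h; rewrite big_seq; elim/big_ind : _ => // [|x y hx hy].
  by rewrite unorm0.
by rewrite (le_trans (unormD_le _ _)) // ge_max hx.
Qed.

Lemma unorm_sum_lt I (s : seq I) (u : I -> A) e : 0 < e ->
  (forall i, i \in s -> norm (u i) < e) -> norm (\sum_(i <- s) u i) < e.
Proof.
move=> e0 h; rewrite big_seq; elim/big_ind : _ => // [|x y hx hy].
  by rewrite unorm0.
by rewrite (le_lt_trans (unormD_le _ _)) // gt_max hx.
Qed.

Lemma unorm_small x : (forall e, 0 < e -> norm x < e) -> x = 0.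
Proof.
move=> h; apply/unorm_eq0/le_anti; rewrite unorm_ge0 andbT leNgt.
by apply/negP => /h; rewrite ltxx.
Qed.

Lemma unormB_lt x y e : norm x < e -> norm y < e -> norm (x - y) < e.
Proof. by move=> hx hy; rewrite (le_lt_trans (unormB_le _ _))// gt_max hx. Qed.

Lemma unormD_lt x y e : norm x < e -> norm y < e -> norm (x + y) < e.
Proof. by move=> hx hy; rewrite (le_lt_trans (unormD_le _ _))// gt_max hx. Qed.

Lemma has_usum_uniq I (u : I -> A) l m : has_usum u l -> has_usum u m -> l = m.
Proof.
move=> ul um; apply/eqP; rewrite -subr_eq0; apply/eqP/unorm_small => e e0.
have [F hF] := ul e e0; have [G hG] := um e e0.
pose H := undup (F ++ G); have uH : uniq H := undup_uniq _.
have FH : {subset F <= H} by move=> i iF; rewrite mem_undup mem_cat iF.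
have GH : {subset G <= H} by move=> i iG; rewrite mem_undup mem_cat iG orbT.
rewrite (_ : l - m = (\sum_(i <- H) u i - m) - (\sum_(i <- H) u i - l)).
  by apply: unormB_lt; [apply: hG|apply: hF].
by rewrite opprB [RHS]addrC addrA subrK.
Qed.

Lemma usum_eq I (u : I -> A) l : has_usum u l -> usum u = l.
Proof.
by move=> ul; apply: xget_unique => // m um; apply: has_usum_uniq um ul.
Qed.

Lemma sub_uniq_sum I (u : I -> A) (F G : seq I) : uniq F -> uniq G ->
  {subset F <= G} ->
  \sum_(i <- G) u i - \sum_(i <- F) u i = \sum_(i <- G | i \notin F) u i.
Proof.
move=> uF uG FG; rewrite (bigID (mem F) predT) /= [X in X + _ - _](_ : _ = \sum_(i <- F) u i).
  by rewrite addrC addKr.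
rewrite -big_filter; apply: perm_big; apply: uniq_perm => //.
  exact: filter_uniq.
move=> i; rewrite mem_filter; apply/andP/idP => [[]//|iF]; split=> //.
exact: FG.
Qed.

Lemma usum_ex I (u : I -> A) : null_family (norm \o u) ->
  has_usum u (usum u).
Proof.
move=> nu; suff [l hl] : exists l, has_usum u l by rewrite (usum_eq hl).
have ek0 k : 0 < (k.+1%:R : R)^-1 by rewrite invr_gt0 ltr0Sn.
pose P k := fun F : seq I => forall i, i \notin F -> norm (u i) < k.+1%:R^-1.
have /choice[F hF] : forall k, exists F, P k F by move=> k; apply: nu.
pose G k := undup (flatten [seq F i | i <- iota 0 k.+1]).
have uG k : uniq (G k) := undup_uniq _.
have FG j k : (j <= k)%N -> {subset F j <= G k}.
  move=> jk i iF; rewrite mem_undup; apply/flattenP; exists (F j) => //.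
  by apply: map_f; rewrite mem_iota /= add0n ltnS.
have GG j k : (j <= k)%N -> {subset G j <= G k}.
  move=> jk i; rewrite mem_undup => /flattenP[s /mapP[a]].
  rewrite mem_iota /= add0n ltnS => aj -> ia.
  by apply: (FG a) => //; apply: leq_trans aj jk.
pose S k := \sum_(i <- G k) u i.
have inv_lt e : 0 < e -> exists N : nat, N.+1%:R^-1 < e.
  move=> e0; exists (Num.truncn e^-1).
  by rewrite invf_plt ?posrE // truncnS_gt.
have tail k H : uniq H -> {subset G k <= H} ->
    norm (\sum_(i <- H) u i - S k) < k.+1%:R^-1.
  move=> uH GH; rewrite /S sub_uniq_sum // -big_filter.
  apply: unorm_sum_lt => // i; rewrite mem_filter => /andP[iG _].
  by apply: hF; apply: contra iG; apply: FG.
have SC : forall e, 0 < e -> exists N, forall m n, (N <= m)%N -> (N <= n)%N ->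
    norm (S m - S n) < e.
  move=> e /inv_lt[N Ne]; exists N => m n Nm Nn.
  rewrite (_ : S m - S n = (S m - S N) - (S n - S N)); last first.
    by rewrite opprB addrA subrK.
  apply: lt_trans Ne; apply: unormB_lt; apply: tail => //; exact: GG.
have [l hl] := unorm_complete S SC; exists l => e e0.
have [N Ne] := inv_lt e e0; have [M hM] := hl e e0.
exists (G (maxn N M)) => H uH GH.
rewrite -(subrK (S (maxn N M)) (\sum_(i <- H) u i)) -addrA; apply: unormD_lt.
  apply: lt_trans (tail _ _ uH GH) _; apply: le_lt_trans Ne.
  by rewrite lef_pV2 ?posrE ?ltr0Sn // ler_nat ltnS leq_maxl.
by apply: hM; rewrite leq_maxr.
Qed.

Lemma usum_tail I (u : I -> A) (F : seq I) e : uniq F -> 0 < e ->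
  null_family (norm \o u) -> (forall i, i \notin F -> norm (u i) <= e) ->
  norm (usum u - \sum_(i <- F) u i) <= e.
Proof.
move=> uF e0 nu hF; have [G hG] := usum_ex nu e0.
pose H := undup (F ++ G); have uH : uniq H := undup_uniq _.
have FH : {subset F <= H} by move=> i iF; rewrite mem_undup mem_cat iF.
have GH : {subset G <= H} by move=> i iG; rewrite mem_undup mem_cat iG orbT.
rewrite (_ : _ - _ = (\sum_(i <- H) u i - \sum_(i <- F) u i)
    - (\sum_(i <- H) u i - usum u)); last first.
  by rewrite opprB [RHS]addrC addrA subrK.
rewrite (le_trans (unormB_le _ _)) // ge_max (ltW (hG _ uH GH)) andbT.
rewrite sub_uniq_sum // -big_filter; apply: unorm_sum_le; first exact: ltW.
by move=> i; rewrite mem_filter => /andP[iF _]; apply: hF.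
Qed.

Lemma usum_le I (u : I -> A) e : 0 < e ->
  null_family (norm \o u) -> (forall i, norm (u i) <= e) -> norm (usum u) <= e.
Proof.
move=> e0 nu h; have := @usum_tail _ u [::] e isT e0 nu (fun i _ => h i).
by rewrite big_nil subr0.
Qed.

Lemma usumD I (u v : I -> A) :
  null_family (norm \o u) -> null_family (norm \o v) ->
  usum (fun i => u i + v i) = usum u + usum v.
Proof.
move=> /usum_ex hu /usum_ex hv; apply: usum_eq => e e0.
have [F hF] := hu e e0; have [G hG] := hv e e0.
exists (F ++ G) => H uH FG; rewrite big_split /= opprD addrACA.
by apply: unormD_lt; [apply: hF|apply: hG] => // i ii; apply: FG;
   rewrite mem_cat ii ?orbT.
Qed.

Lemma usumZ I c (u : I -> A) : null_family (norm \o u) ->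
  usum (fun i => c * u i) = c * usum u.
Proof.
move=> /usum_ex hu; apply: usum_eq => e e0.
have c0 : 0 < norm c + 1 by rewrite ltr_wpDl ?unorm_ge0.
have [F hF] := hu _ (divr_gt0 e0 c0); exists F => G uG FG.
rewrite -mulr_sumr -mulrBr (le_lt_trans (unormM_le _ _)) //.
have := hF G uG FG; rewrite ltr_pdivlMr // => h; apply: le_lt_trans h.
by rewrite mulrC ler_wpM2l ?unorm_ge0 // lerDl.
Qed.

Lemma usum_bij I J (h : I -> J) (u : J -> A) : bijective h ->
  null_family (norm \o u) -> usum (u \o h) = usum u.
Proof.
move=> [g gK hK] /usum_ex hu; apply: usum_eq => e e0.
have [F hF] := hu e e0; exists (map g F) => G uG FG.
rewrite -(big_map h predT u); apply: hF.
  by rewrite map_inj_uniq //; apply: can_inj gK.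
move=> j jF; apply/mapP; exists (g j); last by rewrite hK.
by apply: FG; apply: map_f.
Qed.

Lemma null_section I J (u : I * J -> A) i : null_family (norm \o u) ->
  null_family (norm \o (fun j => u (i, j))).
Proof. by move=> nu; apply: (null_inj (h := pair i)) nu => x y []. Qed.

Lemma usum_fubini I J (u : I * J -> A) : null_family (norm \o u) ->
  usum (fun i => usum (fun j => u (i, j))) = usum u.
Proof.
move=> nu; apply: usum_eq => e e0.
have e20 : 0 < e / 2 by rewrite divr_gt0.
have e2e : e / 2 < e by rewrite ltr_pdivrMr // ltr_pMr // ltr1n.
have [F hF] := nu _ e20; have [F' hF'] := usum_ex nu e0.
exists (map fst (F ++ F')) => G uG FG.
pose J0 := undup (map snd (F ++ F')); have uJ : uniq J0 := undup_uniq _.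
pose GJ := [seq (i, j) | i <- G, j <- J0].
have uGJ : uniq GJ by apply: allpairs_uniq => // -[? ?] [? ?] _ _ [-> ->].
have sub : {subset F ++ F' <= GJ}.
  move=> [i j] ij; apply/allpairsP; exists (i, j); split=> //=.
    by apply: FG; apply/mapP; exists (i, j).
  by rewrite mem_undup; apply/mapP; exists (i, j).
rewrite -(subrK (\sum_(x <- GJ) u x) (\sum_(i <- G) _)) -addrA.
apply: unormD_lt; last first.
  by apply: hF' => // x xF'; apply: sub; rewrite mem_cat xF' orbT.
apply: le_lt_trans e2e; rewrite /GJ big_allpairs -sumrB.
apply: unorm_sum_le; first exact: ltW.
move=> i iG; apply: usum_tail => //; first exact: null_section.
move=> j jJ; apply/ltW/hF; apply: contra jJ => ijF.
by rewrite mem_undup; apply/mapP; exists (i, j) => //; rewrite mem_cat ijF.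
Qed.

Lemma usum_single I (u : I -> A) i0 :
  (forall i, i != i0 -> u i = 0) -> usum u = u i0.
Proof.
move=> h; apply: usum_eq => e e0; exists [:: i0] => G uG iG.
rewrite (bigD1_seq i0) //=; last by apply: iG; rewrite inE.
by rewrite big1 // addr0 subrr unorm0.
Qed.

End UnorderedSums.

Section RobbaRing.
Variables (R : realType) (A : ultraRingType R).
Local Notation norm := (@unorm R A).

(* \sum_n a_n X^n converges on the annulus rho < |X| < 1 for some rho < 1 *)
Definition robba_seq (a : int -> A) : Prop :=
  exists2 rho : R, 0 <= rho < 1 & forall s : R, rho < s < 1 ->
    null_family (fun n : int => norm (a n) * s ^ n).

Record robba := Robba { rcoef :> int -> A; _ : `[< robba_seq rcoef >] }.
HB.instance Definition _ := [isSub for rcoef].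
HB.instance Definition _ := [Choice of robba by <:].

Lemma robbaP (f : robba) : robba_seq f.
Proof. by case: f => f /= /asboolP. Qed.

Lemma robba_ext (f g : robba) : (forall n, f n = g n) -> f = g.
Proof. by move=> h; apply: val_inj; apply/funext. Qed.

Lemma robba_seq2 (a b : int -> A) : robba_seq a -> robba_seq b ->
  exists2 rho : R, 0 <= rho < 1 & forall s : R, rho < s < 1 ->
    null_family (fun n : int => norm (a n) * s ^ n) /\
    null_family (fun n : int => norm (b n) * s ^ n).
Proof.
move=> [r /andP[r0 r1] ha] [t /andP[t0 t1] hb]; exists (Num.max r t).
  by rewrite le_max r0 gt_max r1.
move=> s /andP[]; rewrite gt_max => /andP[rs ts] s1.
by split; [apply: ha; rewrite rs|apply: hb; rewrite ts].
Qed.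

Lemma robba_seq_le (a b : int -> A) : (forall n, norm (a n) <= norm (b n)) ->
  robba_seq b -> robba_seq a.
Proof.
move=> ab [r r01 hb]; exists r => // s rs; apply: null_le (hb s rs) => n.
have s0 : 0 < s by case/andP: r01 rs => r0 _ /andP[rs _]; apply: le_lt_trans rs.
by rewrite ler_wpM2r // exprz_ge0 // ltW.
Qed.

Lemma robba_seqD (a b : int -> A) : robba_seq a -> robba_seq b ->
  robba_seq (fun n => a n + b n).
Proof.
move=> ha hb; have [r r01 h] := robba_seq2 ha hb; exists r => // s rs.
have [na nb] := h s rs; apply: null_le (null_max na nb) => n.
have s0 : 0 < s by case/andP: r01 rs => r0 _ /andP[rs _]; apply: le_lt_trans rs.
rewrite -maxr_pMl ?exprz_ge0 ?(ltW s0) //.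
by rewrite ler_wpM2r ?unormD_le // exprz_ge0 // ltW.
Qed.

Lemma robba_seqN (a : int -> A) : robba_seq a -> robba_seq (fun n => - a n).
Proof. by apply: robba_seq_le => n; rewrite unormN. Qed.

Definition const_seq (c : A) (n : int) : A := if n == 0 then c else 0.

Lemma robba_seq_const c : robba_seq (const_seq c).
Proof.
exists 0; first by rewrite lexx ltr01.
move=> s _ e e0; exists [:: 0] => n; rewrite inE /const_seq => /negPf->.
by rewrite unorm0 mul0r.
Qed.

Definition conv (a b : int -> A) (k : int) : A := usum (fun i => a i * b (k - i)).

Lemma conv_null a b k : robba_seq a -> robba_seq b ->
  null_family (norm \o (fun i => a i * b (k - i))).
Proof.
move=> ha hb; have [r /andP[r0 r1] h] := robba_seq2 ha hb.
have [s rs] : exists s, r < s < 1 by exists ((r + 1) / 2); rewrite !midf_lt.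
have [na nb] := h s rs; have s0 : 0 < s by apply: le_lt_trans r0 (proj1 (andP rs)).
have p0 n : 0 <= s ^ n by rewrite exprz_ge0 // ltW.
have nab := null_mul2 (fun i => mulr_ge0 (unorm_ge0 (a i)) (p0 i))
  (fun i => mulr_ge0 (unorm_ge0 (b i)) (p0 i)) na nb.
have hi : injective (fun i : int => (i, k - i)) by move=> i j [].
apply: null_le (null_scale (p0 (- k)) (null_inj hi nab)) => i /=.
rewrite (le_trans (unormM_le _ _)) // mulrACA -expfzDr ?gt_eqF // subrKC.
by rewrite mulrCA -expfzDr ?gt_eqF // addNr expr0z mulr1.
Qed.

Lemma robba_seq_conv a b : robba_seq a -> robba_seq b -> robba_seq (conv a b).
Proof.
move=> ha hb; have [r r01 h] := robba_seq2 ha hb; exists r => // s rs.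
have s0 : 0 < s by case/andP: r01 rs => r0 _ /andP[rs _]; apply: le_lt_trans rs.
have [na nb] := h s rs.
have p0 n : 0 <= s ^ n by rewrite exprz_ge0 // ltW.
have nab := null_mul2 (fun i => mulr_ge0 (unorm_ge0 (a i)) (p0 i))
  (fun i => mulr_ge0 (unorm_ge0 (b i)) (p0 i)) na nb.
move=> e e0; have e20 : 0 < e / 2 by rewrite divr_gt0.
have [F hF] := nab _ e20; exists [seq ij.1 + ij.2 | ij <- F] => k kF.
have sk0 : 0 < s ^ k by rewrite exprz_gt0.
have : norm (conv a b k) <= e / 2 / s ^ k.
  apply: usum_le; [by rewrite divr_gt0|exact: conv_null|move=> i].
  rewrite (le_trans (unormM_le _ _)) // ler_pdivlMr //.
  have /hF/ltW/= : (i, k - i) \notin F.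
    by apply: contra kF => iF; apply/mapP; exists (i, k - i); rewrite //= subrKC.
  by rewrite mulrACA -expfzDr ?gt_eqF // subrKC.
rewrite ler_pdivlMr // => hk; apply: le_lt_trans hk _.
by rewrite ltr_pdivrMr // ltr_pMr // ltr1n.
Qed.

Lemma convC a b : robba_seq a -> robba_seq b -> conv a b = conv b a.
Proof.
move=> ha hb; apply/funext => k; rewrite /conv.
rewrite -(@usum_bij _ _ _ _ (fun i => k - i) (fun i => a i * b (k - i))).
- by congr usum; apply/funext => i /=; rewrite subKr mulrC.
- by exists (fun i => k - i) => i; rewrite subKr.
- exact: conv_null.
Qed.

Lemma convA a b c : robba_seq a -> robba_seq b -> robba_seq c ->
  conv a (conv b c) = conv (conv a b) c.
Proof.
move=> ha hb hc; apply/funext => k.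
pose u (il : int * int) := a il.1 * b il.2 * c (k - il.1 - il.2).
have nu : null_family (norm \o u).
  have [r1 /andP[r10 r11] hab] := robba_seq2 ha hb.
  have [r2 /andP[r20 r21] hbc] := robba_seq2 hb hc.
  pose r := Num.max r1 r2; have r1' : r < 1 by rewrite gt_max r11.
  have [s /andP[rs s1]] : exists s, r < s < 1 by exists ((r + 1) / 2); rewrite !midf_lt.
  move: rs; rewrite gt_max => /andP[r1s r2s].
  have s0 : 0 < s by apply: le_lt_trans r1s.
  have [na nb] : _ /\ _ := hab s ltac:(by rewrite r1s).
  have [_ nc] : _ /\ _ := hbc s ltac:(by rewrite r2s).
  have p0 n : 0 <= s ^ n by rewrite exprz_ge0 // ltW.
  have q0 (x : int -> A) i : 0 <= norm (x i) * s ^ i.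
    by rewrite mulr_ge0 ?unorm_ge0.
  have nab := null_mul2 (q0 a) (q0 b) na nb.
  have nabc := null_mul2 (fun ij => mulr_ge0 (q0 a ij.1) (q0 b ij.2)) (q0 c) nab nc.
  have hi : injective (fun il : int * int => (il, k - il.1 - il.2)).
    by move=> x y [].
  apply: null_le (null_scale (p0 (- k)) (null_inj hi nabc)) => -[i l] /=.
  rewrite /u /= (le_trans (unormM_le _ _)) //.
  apply: (@le_trans _ _ (norm (a i) * norm (b l) * norm (c (k - i - l)))).
    by rewrite ler_wpM2r ?unorm_ge0 ?unormM_le.
  rewrite [X in _ <= _ * (X * _)]mulrACA [X in _ <= _ * X]mulrACA -!expfzDr ?gt_eqF //.
  rewrite (_ : i + l + (k - i - l) = k); last by rewrite -[k - i - l]addrA -opprD subrKC.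
  by rewrite mulrCA -expfzDr ?gt_eqF // addNr expr0z mulr1.
transitivity (usum u).
  rewrite -(usum_fubini nu); congr usum; apply/funext => i.
  rewrite -usumZ; last exact: conv_null.
  by congr usum; apply/funext => l; rewrite /u /= mulrA.
pose h (ji : int * int) := (ji.2, ji.1 - ji.2).
have bh : bijective h.
  exists (fun il => (il.1 + il.2, il.1)) => -[x y]; rewrite /h /=.
    by rewrite subrKC.
  by rewrite addrC addKr.
rewrite -(usum_bij bh nu) -usum_fubini; last first.
  by apply: (null_inj (h := h)) nu; apply: bij_inj.
congr usum; apply/funext => j; rewrite mulrC -usumZ; last exact: conv_null.
congr usum; apply/funext => i; rewrite /u /h /= [RHS]mulrC.
by congr (_ * c _); rewrite opprB addrA addrNK.
Qed.

Lemma conv1 a : conv (const_seq 1) a = a.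
Proof.
apply/funext => k; rewrite /conv (@usum_single _ _ _ _ 0).
  by rewrite /const_seq eqxx mul1r subr0.
by move=> i /negPf i0; rewrite /const_seq i0 mul0r.
Qed.

Lemma convDl a b c : robba_seq a -> robba_seq b -> robba_seq c ->
  conv (fun n => a n + b n) c = (fun n => conv a c n + conv b c n).
Proof.
move=> ha hb hc; apply/funext => k.
rewrite /conv -usumD; [|exact: conv_null..].
by congr usum; apply/funext => i; rewrite mulrDl.
Qed.

Definition mk_robba a (ha : robba_seq a) : robba := Robba (asboolT ha).

Definition robba_add (f g : robba) := mk_robba (robba_seqD (robbaP f) (robbaP g)).
Definition robba_opp (f : robba) := mk_robba (robba_seqN (robbaP f)).
Definition robba_const c := mk_robba (robba_seq_const c).
Definition robba_mul (f g : robba) := mk_robba (robba_seq_conv (robbaP f) (robbaP g)).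

Fact robba_addA : associative robba_add.
Proof. by move=> f g h; apply: robba_ext => n /=; rewrite addrA. Qed.
Fact robba_addC : commutative robba_add.
Proof. by move=> f g; apply: robba_ext => n /=; rewrite addrC. Qed.
Fact robba_add0 : left_id (robba_const 0) robba_add.
Proof. by move=> f; apply: robba_ext => n /=; rewrite /const_seq if_same add0r. Qed.
Fact robba_addN : left_inverse (robba_const 0) robba_opp robba_add.
Proof. by move=> f; apply: robba_ext => n /=; rewrite /const_seq if_same addNr. Qed.
HB.instance Definition _ :=
  GRing.isZmodule.Build robba robba_addA robba_addC robba_add0 robba_addN.

Fact robba_mulA : associative robba_mul.
Proof.
by move=> f g h; apply: val_inj; rewrite /= convA //; apply: robbaP.
Qed.
Fact robba_mulC : commutative robba_mul.
Proof.
by move=> f g; apply: val_inj; rewrite /= convC //; apply: robbaP.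
Qed.
Fact robba_mul1 : left_id (robba_const 1) robba_mul.
Proof. by move=> f; apply: val_inj; rewrite /= conv1. Qed.
Fact robba_mulDl : left_distributive robba_mul robba_add.
Proof.
by move=> f g h; apply: val_inj; rewrite /= convDl //; apply: robbaP.
Qed.
Fact robba_1neq0 : robba_const 1 != 0.
Proof.
apply/eqP => /(congr1 (fun f : robba => f 0)) /=.
by rewrite /const_seq eqxx => /eqP; rewrite oner_eq0.
Qed.
HB.instance Definition _ := GRing.Zmodule_isComNzRing.Build robba
  robba_mulA robba_mulC robba_mul1 robba_mulDl robba_1neq0.

Definition robba_unit : {pred robba} := [pred f | `[< exists g : robba, g * f = 1 >]].
Definition robba_inv (f : robba) : robba :=
  xget f [set g : robba | g * f = 1]%classic.

Fact robba_mulVr : {in robba_unit, left_inverse 1 robba_inv *%R}.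
Proof.
move=> f /asboolP[g gf].
exact: (@xgetPex _ f [set g : robba | g * f = 1]%classic (ex_intro _ g gf)).
Qed.
Fact robba_unitP (f g : robba) : g * f = 1 -> robba_unit f.
Proof. by move=> gf; apply/asboolP; exists g. Qed.
Fact robba_inv_out : {in [predC robba_unit], robba_inv =1 id}.
Proof.
move=> f /asboolP nf; rewrite /robba_inv xgetPN // => g gf.
by apply: nf; exists g.
Qed.
HB.instance Definition _ := GRing.ComNzRing_hasMulInverse.Build robba
  robba_mulVr robba_unitP robba_inv_out.

End RobbaRing.

Section DualNumbers.
Variables (R : realType) (K : ultraFieldType R).

(* A[eps]/eps^2 : the pair (a, b) stands for a + b eps *)
Definition dual (A : Type) : Type := (A * A)%type.

Section Ring.
Variable A : ultraAlgType K.
Implicit Types x y z : dual A.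

HB.instance Definition _ := Choice.copy (dual A) (A * A)%type.
HB.instance Definition _ := GRing.Zmodule.copy (dual A) (A * A)%type.
HB.instance Definition _ := GRing.Lmodule.copy (dual A) (A * A)%type.

Definition dual_one : dual A := (1, 0).
Definition dual_mul x y : dual A := (x.1 * y.1, x.1 * y.2 + x.2 * y.1).

Fact dual_mulA : associative dual_mul.
Proof.
move=> [x x'] [y y'] [z z']; rewrite /dual_mul /= mulrA; congr pair.
by rewrite mulrDr mulrDl !mulrA addrA.
Qed.
Fact dual_mulC : commutative dual_mul.
Proof.
move=> [x x'] [y y']; rewrite /dual_mul /= mulrC; congr pair.
by rewrite addrC mulrC [y' * x]mulrC.
Qed.
Fact dual_mul1 : left_id dual_one dual_mul.
Proof. by move=> [x x']; rewrite /dual_mul /= !mul1r mul0r addr0. Qed.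
Fact dual_mulDl : left_distributive dual_mul +%R.
Proof.
move=> [x x'] [y y'] [z z']; rewrite /dual_mul /= mulrDl; congr pair.
by rewrite !mulrDl addrACA.
Qed.
Fact dual_1neq0 : dual_one != 0.
Proof. by apply/eqP => -[/eqP]; rewrite oner_eq0. Qed.
HB.instance Definition _ := GRing.Zmodule_isComNzRing.Build (dual A)
  dual_mulA dual_mulC dual_mul1 dual_mulDl dual_1neq0.

Fact dual_scaleAl (c : K) (x y : dual A) : c *: (x * y) = (c *: x : dual A) * y.
Proof.
apply: injective_projections; first exact: scalerAl.
by rewrite /= scalerDr -!scalerAl.
Qed.
HB.instance Definition _ :=
  GRing.Lmodule_isLalgebra.Build K (dual A) dual_scaleAl.
HB.instance Definition _ := GRing.Lalgebra_isComAlgebra.Build K (dual A).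

Definition dual_norm x : R := Num.max (unorm x.1) (unorm x.2).

Fact dual_norm_ge0 x : 0 <= dual_norm x.
Proof. by rewrite /dual_norm le_max unorm_ge0. Qed.
Fact dual_norm_eq0 x : dual_norm x = 0 <-> x = 0.
Proof.
split=> [h|->]; last by rewrite /dual_norm /= !unorm0 maxxx.
case: x h => [x y] /= h.
have [hx hy] : unorm x <= 0 /\ unorm y <= 0.
  by rewrite -h /dual_norm !le_max !lexx orbT.
by congr pair; apply/unorm_eq0/le_anti; rewrite unorm_ge0 andbT.
Qed.
Fact dual_norm1 : dual_norm 1 = 1.
Proof. by rewrite /dual_norm /= unorm1 unorm0 max_l. Qed.
Fact dual_normM x y : dual_norm (x * y) <= dual_norm x * dual_norm y.
Proof.
case: x y => [x x'] [y y'].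
have h (a b : A) (B C : R) : unorm a <= B -> unorm b <= C ->
    unorm (a * b) <= B * C.
  by move=> aB bC; rewrite (le_trans (unormM_le _ _)) // ler_pM ?unorm_ge0.
have [h1 h2] : (forall B C : A, unorm B <= Num.max (unorm B) (unorm C)) /\
    (forall B C : A, unorm C <= Num.max (unorm B) (unorm C)).
  by split=> B C; rewrite le_max lexx ?orbT.
rewrite {1}/dual_norm ge_max /= h ?h1 //=.
by rewrite (le_trans (unormD_le _ _)) // ge_max !h ?h1 ?h2.
Qed.
Fact dual_normB x y : dual_norm (x - y) <= Num.max (dual_norm x) (dual_norm y).
Proof.
case: x y => [x x'] [y y']; rewrite {1}/dual_norm ge_max /=.
apply/andP; split; apply: le_trans (unormB_le _ _) _;
  by rewrite ge_max !le_max !lexx ?orbT.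
Qed.
Fact dual_norm_complete (u : nat -> dual A) :
  (forall e, 0 < e -> exists N, forall m n, (N <= m)%N -> (N <= n)%N ->
     dual_norm (u m - u n) < e) ->
  exists l, forall e, 0 < e -> exists N, forall n, (N <= n)%N ->
     dual_norm (u n - l) < e.
Proof.
move=> uC.
have [l1 h1] : exists l : A, forall e, 0 < e -> exists N, forall n, (N <= n)%N ->
    unorm ((u n).1 - l) < e.
  apply: unorm_complete => e /uC[N hN]; exists N => m n Nm Nn.
  by have := hN m n Nm Nn; rewrite gt_max => /andP[].
have [l2 h2] : exists l : A, forall e, 0 < e -> exists N, forall n, (N <= n)%N ->
    unorm ((u n).2 - l) < e.
  apply: unorm_complete => e /uC[N hN]; exists N => m n Nm Nn.
  by have := hN m n Nm Nn; rewrite gt_max => /andP[].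
exists (l1, l2) => e e0; have [N1 H1] := h1 e e0; have [N2 H2] := h2 e e0.
exists (maxn N1 N2) => n; rewrite geq_max => /andP[n1 n2].
by rewrite gt_max H1 ?H2.
Qed.
HB.instance Definition _ := isUltraNormed.Build R (dual A) dual_norm_ge0
  dual_norm_eq0 dual_norm1 dual_normM dual_normB dual_norm_complete.

Fact dual_norm_alg (x : K) : unorm (x%:A : dual A) = unorm x.
Proof.
by rewrite /unorm /= /dual_norm /= unorm_alg scaler0 unorm0 max_l ?unorm_ge0.
Qed.
HB.instance Definition _ := extendsNorm.Build R K (dual A) dual_norm_alg.

Definition eps : dual A := (0, 1).
End Ring.
End DualNumbers.
Arguments eps {R K A}.

Section PhiGammaModules.
Variables (R : realType) (p : nat) (Qp : padicNumType R p).

Definition Zp_unit (x : Qp) : bool := unorm x == 1.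

Section Robba.
Variable A : ultraAlgType Qp.
Implicit Types f g : robba A.

(* The series with coefficients a, or 0 if a is not in the Robba ring; this
   default is never used below (phi and gamma in Z_p^* preserve the ring).   *)
Definition robba_of (a : int -> A) : robba A := insubd (0 : robba A) a.

Definition robba_X : robba A := robba_of (fun n => (n == 1)%:R).

(* f(g) = \sum_(n in Z) f_n g^n for a unit g, summed coefficientwise *)
Definition robba_subst g f : robba A :=
  robba_of (fun k => usum (fun n : int => f n * (g ^ n) k)).

Definition robba_phi f : robba A := robba_subst ((1 + robba_X) ^+ p - 1) f.

Definition padic_binom (x : Qp) (j : nat) : Qp :=
  (\prod_(i < j) (x - i%:R)) / (j`!)%:R.

(* (1 + X)^x for x in Z_p *)
Definition robba_1X_pow (x : Qp) : robba A :=
  robba_of (fun n => if n is Posz j then (padic_binom x j)%:A else 0).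

(* Gamma is identified with Z_p^* through the cyclotomic character *)
Definition robba_gamma (x : Qp) f : robba A := robba_subst (robba_1X_pow x - 1) f.

(* t = log(1 + X) *)
Definition robba_t : robba A :=
  robba_of (fun n => if n is Posz j.+1
                     then ((-1) ^+ j / j.+1%:R : Qp)%:A else 0).

(* Convergence f(y) -> l for y -> x in Z_p^*, y != x, in the Robba ring: on
   some annulus rho < |X| < 1, for the Gauss norm of every radius s in it.   *)
Definition robba_cvg (f : Qp -> robba A) (x : Qp) (l : robba A) : Prop :=
  exists2 rho : R, 0 <= rho < 1 & forall s e : R, rho < s < 1 -> 0 < e ->
    exists2 d : R, 0 < d & forall y, Zp_unit y -> y != x -> unorm (y - x) < d ->
      forall n : int, unorm ((f y - l) n) * s ^ n <= e.

Record pgmod := PGMod {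
  pg_car :> lmodType (robba A);
  pg_phi : pg_car -> pg_car;
  pg_gamma : Qp -> pg_car -> pg_car  (* only relevant on Z_p^* *)
}.
Arguments pg_phi {p0} : rename.
Arguments pg_gamma {p0} x u : rename.

Definition is_basis (M : lmodType (robba A)) m (b : 'I_m -> M) : Prop :=
  forall u : M, exists! c : 'rV[robba A]_m, u = \sum_i c 0 i *: b i.

Definition gamma_matrix (M : pgmod) m (b : 'I_m -> M)
    (G : Qp -> 'M[robba A]_m) : Prop :=
  forall x, Zp_unit x -> forall j, pg_gamma x (b j) = \sum_i G x i j *: b i.

Definition is_phiGamma (M : pgmod) (m : nat) : Prop :=
  [/\ forall (a : robba A) (u v : M),
        pg_phi (a *: u + v) = robba_phi a *: pg_phi u + pg_phi v,
      forall x, Zp_unit x -> forall (a : robba A) (u v : M),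
        pg_gamma x (a *: u + v) = robba_gamma x a *: pg_gamma x u + pg_gamma x v,
      (forall u : M, pg_gamma 1 u = u) /\
      (forall x y, Zp_unit x -> Zp_unit y -> forall u : M,
        pg_gamma (x * y) u = pg_gamma x (pg_gamma y u)),
      forall x, Zp_unit x -> forall u : M,
        pg_phi (pg_gamma x u) = pg_gamma x (pg_phi u) &
      exists b : 'I_m -> M, [/\ is_basis b, is_basis (pg_phi \o b) &
        exists2 G, gamma_matrix b G &
          forall x, Zp_unit x -> forall i j,
            robba_cvg (fun y => G y i j) x (G x i j)]].

(* The rank one module R_A(delta), on the basis 1 of R_A *)
Definition pg_char (delta : Qp -> A) : pgmod :=
  @PGMod ((robba A)^o : lmodType (robba A))
    (fun f => robba_const (delta p%:R) * robba_phi f)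
    (fun x f => robba_const (delta x) * robba_gamma x f).

Definition is_pgmap (M N : pgmod) (f : M -> N) : Prop :=
  [/\ forall (a : robba A) (u v : M), f (a *: u + v) = a *: f u + f v,
      forall u, f (pg_phi u) = pg_phi (f u) &
      forall x, Zp_unit x -> forall u, f (pg_gamma x u) = pg_gamma x (f u)].

Definition pg_iso (M N : pgmod) : Prop :=
  exists2 f : M -> N, is_pgmap f & bijective f.

Definition short_exact (L M N : pgmod) (i : L -> M) (q : M -> N) : Prop :=
  [/\ is_pgmap i, is_pgmap q, injective i,
      forall v, q v = 0 <-> exists u, v = i u & forall w, exists v, q v = w].

Definition is_pgsub (M : pgmod) (F : set M) : Prop :=
  [/\ F 0, forall (a : robba A) u v, F u -> F v -> F (a *: u + v),
      forall u, F u -> F (pg_phi u) &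
      forall x, Zp_unit x -> forall u, F u -> F (pg_gamma x u)].

Definition saturated (M : pgmod) (F : set M) : Prop :=
  forall (a : robba A) u, GRing.lreg a -> F (a *: u) -> F u.

(* F / F' is isomorphic to N, for (phi,Gamma)-submodules F' of F of M *)
Definition subquotient_iso (M : pgmod) (F' F : set M) (N : pgmod) : Prop :=
  exists q : M -> N,
   [/\ forall (a : robba A) u v, F u -> F v -> q (a *: u + v) = a *: q u + q v,
       forall u, F u -> q (pg_phi u) = pg_phi (q u),
       forall x, Zp_unit x -> forall u, F u -> q (pg_gamma x u) = pg_gamma x (q u),
       forall w, exists2 u, F u & q u = w &
       forall u, F u -> (q u = 0 <-> F' u)].

Definition triangulated (M : pgmod) m (delta : 'I_m -> Qp -> A) : Prop :=
  exists Fil : nat -> set M,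
   [/\ Fil 0%N = [set 0]%classic, Fil m = setT,
       forall i, (i <= m)%N -> is_pgsub (Fil i) /\ saturated (Fil i) &
       forall i : 'I_m, (Fil i `<=` Fil i.+1)%classic /\
         subquotient_iso (Fil i) (Fil i.+1) (pg_char (delta i))].

End Robba.
Arguments pg_phi {A p0} : rename.
Arguments pg_gamma {A p0} x u : rename.

Section Crystalline.
Variable E : ultraFieldExtType Qp.
Implicit Types M : pgmod E.
Local Notation t := (robba_t E).
Local Notation C := (@robba_const R E).

(* D_cris(M) = M[1/t]^Gamma.  Its elements are the fractions u/t^k with
   gamma(u)/gamma(t)^k = u/t^k for all gamma; as t is regular on M, equality of
   fractions is tested by cross-multiplying.                                 *)
Definition dcris M (u : M) (k : nat) : Prop :=
  forall x, Zp_unit x -> t ^+ k *: pg_gamma x u = (robba_gamma x t) ^+ k *: u.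

(* (v_i/t^k)_i is an E-basis of D_cris(M) *)
Definition dcris_basis M m (v : 'I_m -> M) (k : nat) : Prop :=
  (forall i, dcris (v i) k) /\
  (forall u j, dcris u j ->
     exists! c : 'rV[E]_m, t ^+ k *: u = t ^+ j *: \sum_i C (c 0 i) *: v i).

(* F is the matrix of phi on D_cris(M) in the basis (v_i/t^k)_i *)
Definition dcris_phi_matrix M m (v : 'I_m -> M) (k : nat) (F : 'M[E]_m) : Prop :=
  forall j, t ^+ k *: pg_phi (v j) =
            (robba_phi t) ^+ k *: \sum_i C (F i j) *: v i.

(* M of rank m is crystalline iff dim_E D_cris(M) = m *)
Definition crystalline M (m : nat) : Prop :=
  exists (v : 'I_m -> M) k, dcris_basis v k.

Definition phi_eigenvalues M m (a : m.-tuple E) : Prop :=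
  exists (v : 'I_m -> M) k (F : 'M[E]_m),
    [/\ dcris_basis v k, dcris_phi_matrix v k F &
        char_poly F = \prod_(i < m) ('X - (tnth a i)%:P)].

(* The Sen operator is the endomorphism of the R_E/t-module M/tM induced by
   nabla = lim_{gamma -> 1} (gamma - 1)/(chi(gamma) - 1); R_E/t embeds into the
   product of the E (x) Q_p(zeta_{p^n}), n >> 0, where it gives the Sen operators
   of the D_Sen,n(M).  The Hodge-Tate weights are its eigenvalues; the cyclotomic
   character has weight 1.                                                    *)
Definition nabla_matrix M m (b : 'I_m -> M) (N : 'M[robba E]_m) : Prop :=
  exists2 G, gamma_matrix b G & forall i j,
    robba_cvg (fun x => C ((x - 1)^-1)%:A * (G x i j - (i == j)%:R)) 1 (N i j).

Definition HT_weights M m (k : m.-tuple int) : Prop :=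
  exists (b : 'I_m -> M) (N : 'M[robba E]_m),
   [/\ is_basis b, nabla_matrix b N &
       exists Q : {poly robba E},
         char_poly N = \prod_(i < m) ('X - ((tnth k i)%:~R)%:P) + t *: Q].

Definition padic_val (x : Qp) : int :=
  xget 0 [set n : int | unorm x = (p%:R : R) ^ (- n)]%classic.

(* unr(a) z^k *)
Definition unr_z (a : E) (k : int) (x : Qp) : E :=
  a ^ padic_val x * (x%:A : E) ^ k.

Definition generic m (a : m.-tuple E) : Prop :=
  (forall i, tnth a i != 0) /\
  (forall i j, i != j -> tnth a i != tnth a j /\ tnth a i / tnth a j != p%:R).

Definition PhiGamma_nc m (a : m.-tuple E) (k : m.-tuple int) M : Prop :=
  [/\ is_phiGamma M m, crystalline M m, phi_eigenvalues M a, HT_weights M k &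
      forall w : 'S_m, triangulated M
        (fun i => unr_z (tnth a ((w^-1)%g i)) (tnth k i))].

End Crystalline.

Section Deformations.
Variable E : ultraFieldExtType Qp.
Local Notation Ee := (dual E).
Implicit Types M : pgmod E.

Definition robba_red (f : robba Ee) : robba E := robba_of (fun n => (f n).1).
Definition robba_incl (f : robba E) : robba Ee := robba_of (fun n => (f n, 0) : Ee).
Local Notation Eps := (robba_const (eps : Ee)).

Definition is_deform M (Mt : pgmod Ee) (pr : Mt -> M) : Prop :=
  [/\ exists m, is_phiGamma Mt m,
      forall (a : robba Ee) u v, pr (a *: u + v) = robba_red a *: pr u + pr v,
      (forall u, pr (pg_phi u) = pg_phi (pr u)) /\
      (forall x, Zp_unit x -> forall u, pr (pg_gamma x u) = pg_gamma x (pr u)),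
      forall w, exists u, pr u = w &
      forall u, pr u = 0 <-> exists v, u = Eps *: v].

(* A deformation of M over R_{E[eps]} is the same thing as the extension
   0 -> M -> Mt -> M -> 0 in which M -> Mt maps pr u to eps u.               *)
Record deform M := Deform {
  df_mod :> pgmod Ee;
  df_pr : df_mod -> M;
  df_ax : is_deform df_pr
}.
Arguments df_pr {M d} u : rename.

(* The class of M3 is the sum of those of M1 and M2 in Ext^1(M, M): sigma is a
   morphism from the fibre product M1 x_M M2, an extension of M by M (+) M, to M3
   inducing the identity on the quotient M and the addition M (+) M -> M.     *)
Definition baer_sum M (M1 M2 M3 : deform M) : Prop :=
  exists sigma : M1 -> M2 -> M3,
   [/\ forall (a : robba E) u1 u2 v1 v2, df_pr u1 = df_pr u2 -> df_pr v1 = df_pr v2 ->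
         sigma (robba_incl a *: u1 + v1) (robba_incl a *: u2 + v2) =
         robba_incl a *: sigma u1 u2 + sigma v1 v2,
       forall u1 u2, df_pr u1 = df_pr u2 ->
         sigma (pg_phi u1) (pg_phi u2) = pg_phi (sigma u1 u2),
       forall x, Zp_unit x -> forall u1 u2, df_pr u1 = df_pr u2 ->
         sigma (pg_gamma x u1) (pg_gamma x u2) = pg_gamma x (sigma u1 u2),
       forall u1 u2, df_pr u1 = df_pr u2 -> df_pr (sigma u1 u2) = df_pr u1 &
       forall u1 u2 u3, df_pr u3 = df_pr u1 + df_pr u2 ->
         sigma (Eps *: u1) (Eps *: u2) = Eps *: u3].

(* The elements of Hom(Q_p^*, E) *)
Definition add_char (psi : Qp -> E) : Prop :=
  (forall x y, x != 0 -> y != 0 -> psi (x * y) = psi x + psi y) /\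
  (forall x, x != 0 -> forall e : R, 0 < e -> exists2 d : R, 0 < d &
     forall y, y != 0 -> unorm (y - x) < d -> unorm (psi y - psi x) < e).

(* delta (1 + psi eps) *)
Definition deform_char (delta psi : Qp -> E) (x : Qp) : Ee :=
  (delta x, delta x * psi x).

(* Mt lies in Ext^1_w(M, M), with parameter (psi_i) in Hom(Q_p^*, E)^m *)
Definition in_Ext_w m (a : m.-tuple E) (k : m.-tuple int) (w : 'S_m) M
    (psi : 'I_m -> Qp -> E) (Mt : deform M) : Prop :=
  (forall i, add_char (psi i)) /\
  triangulated Mt
    (fun i => deform_char (unr_z (tnth a ((w^-1)%g i)) (tnth k i)) (psi i)).

(* Ext^1_0(M, M), which does not depend on w, is computed with w = 1 *)
Definition in_Ext_0 m (a : m.-tuple E) (k : m.-tuple int) M (Mt : deform M) : Prop :=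
  in_Ext_w a k 1%g (fun _ _ => 0) Mt.

Definition compatible_exact (L M N : pgmod E) (Lt Mt Nt : pgmod Ee)
    (prL : Lt -> L) (prM : Mt -> M) (prN : Nt -> N) : Prop :=
  exists (i : L -> M) (q : M -> N) (it : Lt -> Mt) (qt : Mt -> Nt),
   [/\ short_exact i q, short_exact it qt,
       forall u, prM (it u) = i (prL u) & forall v, prN (qt v) = q (prM v)].

Section KernelOfF.
Variables (a1 a2 a3 : E) (h1 h2 h3 : int) (D1 C1 D : pgmod E).

Definition const_char (delta : Qp -> E) : Qp -> Ee := deform_char delta (fun=> 0).

(* graph of f_F *)
Definition f_F (D1t : deform D1) (Dt : deform D) : Prop :=
  compatible_exact (N := pg_char (unr_z a3 h3))
    (Nt := pg_char (const_char (unr_z a3 h3))) (@df_pr _ D1t) (@df_pr _ Dt) robba_red.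

(* graph of f_G *)
Definition f_G (C1t : deform C1) (Dt : deform D) : Prop :=
  compatible_exact (L := pg_char (unr_z a3 h1))
    (Lt := pg_char (const_char (unr_z a3 h1))) robba_red (@df_pr _ Dt) (@df_pr _ C1t).

(* The inverse image of Ker(f_D) in Ext^1(D1, D1) (+) Ext^1(C1, C1) *)
Definition in_ker_f (D1t : deform D1) (C1t : deform C1) : Prop :=
  exists DF DG DS : deform D,
    [/\ f_F D1t DF, f_G C1t DG, baer_sum DF DG DS &
        in_Ext_0 [tuple a1; a2; a3] [tuple h1; h2; h3] DS].

End KernelOfF.
End Deformations.
End PhiGammaModules.

(* Main.v *)
Require Import Defs.
From HB Require Import structures.
From mathcomp Require Import all_boot all_order all_algebra all_fingroup.
From mathcomp Require Import boolp classical_sets reals.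
From mathcomp Require Import ring lra zify.
Set Implicit Arguments.
Unset Strict Implicit.
Unset Printing Implicit Defensive.
Import Order.TTheory GRing.Theory Num.Theory.
Local Open Scope ring_scope.

(* Over R = Robba ring, a non-critical crystalline D has coordinates (q1, q2, q3), q_i being the map
   onto R(unr(a_i) z^h3).  The pair (q1, q2) factors through C1, which is the set of (f, g) with
   f = c12 g modulo t^(h2 - h3); the kernel of q3 is D1, the set of (f, g) divisible by t^(h2 - h3)
   with quotients congruent in the same way modulo t^(h1 - h2).  Here c12 spans the
   (phi, Gamma)-invariant line of R(unr(a1 / a2))/t^M.  After scaling q1 and q2, what remains is the
   scalar A = A(D) comparing D1 -> C1 with the inclusion, and D is determined by A because
   (R/t^m)^{phi = 1, Gamma} = E.

   The classes c12 and c21 times the logarithm lift to cocycles of R, which give a 1-cocycle n with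
   values in the R-linear maps from C1 to D1.  Composed with D1 -> D -> C1 on either side, n and
   -n define deformations of D1 and of C1 whose images under f_D cancel, so their class lies in
   Ker(f_D).  If it lies in Ker(f_D') too, the matrix entry b21 of n times a nonzero multiple of
   A(D') - A(D) is a coboundary with values in t^m R; comparing modulo the cyclotomic factors of t
   shows that this forces A(D') = A(D). *)

(** * Bounds on the coefficients of elements of the Robba ring *)

(** The obstacle is [t]: its zeros zeta - 1 accumulate at the boundary of the disc, so R/t^m is not
    finite over E and no finite set of zeros controls it. The remedy is the factorization p^n t =
    P_n tau_n with P_n = phi^n(X). In the Robba ring P_n is a unit, and on a fixed circle tau_n
    tends to 1; so statements modulo t^m become statements on power series modulo tau_n^m for large
    n, where contraction arguments apply. The finitely many zeros of P_n are treated by Weierstrass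
    division and by averaging over Galois groups, and the two sides are glued by the elements [en].
    Equations S - lam phi(S) = B are solved by geometric series. Genericity is what makes c12 and
    c21 useful: modulo the cyclotomic factors of t, the class attached to lam is a power of lam
    times (1 - p lam)/(1 - lam). The lift of the logarithm times the class comes from
    log(phi(X)/X^p), whose Gamma-coboundary has a constant term proportional to the p-adic logarithm
    on Z_p^*. *)

Lemma geometric_small (R : realType) (x C e : R) : 0 <= x < 1 -> 0 < e ->
  exists N, forall n, (N <= n)%N -> C * x ^+ n < e.
Proof.
move=> /andP[x0 x1] e0; wlog C0 : C / 0 < C.
  move=> h; have [C0|C0] := ltP 0 C; first exact: h.
  exists 0%N => n _; apply: le_lt_trans e0.
  by rewrite mulr_le0_ge0 // exprn_ge0.
have [->|xn0] := eqVneq x 0.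
  by exists 1%N => n n1; rewrite expr0n eqn0Ngt n1 mulr0.
have xp : 0 < x by rewrite lt_neqAle eq_sym xn0.
have bern (h : R) n : 0 <= h -> 1 + n%:R * h <= (1 + h) ^+ n.
  move=> h0; elim: n => [|n IH]; first by rewrite mul0r addr0 expr0.
  rewrite exprS mulrDl mul1r -natr1 mulrDl mul1r addrA.
  rewrite lerD // -[leLHS]mulr1 ler_wpM2l // (le_trans _ IH) // lerDl.
  by rewrite mulr_ge0.
pose h := x^-1 - 1; have h0 : 0 < h by rewrite subr_gt0 invf_gt1.
exists (Num.truncn (C / e / h)).+1 => n Nn.
have xE : x = (1 + h)^-1 by rewrite /h addrC subrK invrK.
have p1 : 0 < (1 + h) ^+ n by rewrite exprn_gt0 // addr_gt0.
rewrite xE exprVn ltr_pdivrMr // mulrC -ltr_pdivrMr //.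
apply: lt_le_trans (bern _ _ (ltW h0)).
have : C / e < n%:R * h.
  rewrite -ltr_pdivrMr //; apply: lt_le_trans (truncnS_gt _) _.
  by rewrite ler_nat.
by move=> /lt_le_trans-> //; rewrite lerDr.
Qed.

Section Bounds.
Variables (R : realType) (A : ultraRingType R).
Local Notation rb := (robba A).
Implicit Types (f g h : rb) (s C D rho : R) (n : int).

Lemma robbaDE f g n : (f + g) n = f n + g n. Proof. by []. Qed.
Lemma robbaNE f n : (- f) n = - f n. Proof. by []. Qed.
Lemma robbaBE f g n : (f - g) n = f n - g n. Proof. by []. Qed.
Lemma robba0E n : (0 : rb) n = 0.
Proof. by rewrite /= /const_seq if_same. Qed.
Lemma robbaCE (c : A) n : robba_const c n = if n == 0 then c else 0.
Proof. by []. Qed.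
Lemma robba1E n : (1 : rb) n = (n == 0)%:R.
Proof. by rewrite /= /const_seq; case: eqP. Qed.
Lemma robbaME f g n : (f * g) n = usum (fun i => f i * g (n - i)).
Proof. by []. Qed.
Lemma robba_sumE (I : Type) (r : seq I) (F : I -> rb) n :
  (\sum_(i <- r) F i) n = \sum_(i <- r) F i n.
Proof.
elim/big_rec2 : _ => [|i x y _ <-]; first exact: robba0E.
by rewrite robbaDE.
Qed.

(** [usum_le] excludes the bound 0, which does occur for products with a factor of norm 0; it is
    reached as a limit of positive bounds. *)
Lemma usum_le0 (I : eqType) (u : I -> A) e : 0 <= e ->
  null_family (unorm \o u) -> (forall i, unorm (u i) <= e) -> unorm (usum u) <= e.
Proof.
move=> e0 nu h; apply/ler_addgt0Pr => d d0; apply: usum_le => //.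
  by rewrite ltr_wpDl.
by move=> i; rewrite (le_trans (h i)) // lerDl ltW.
Qed.

(** The inequality |f|_s <= C for the Gauss norm of radius s. A relation is used because the
    supremum may be infinite at radii where f does not converge. *)
Definition gle f s C := forall n, unorm (f n) * s ^ n <= C.

Lemma sz0 s n : 0 < s -> 0 <= s ^ n. Proof. by move=> s0; rewrite exprz_ge0 ?ltW. Qed.

Lemma gle_ge0 f s C : 0 < s -> gle f s C -> 0 <= C.
Proof. by move=> s0 h; apply: le_trans (h 0); rewrite mulr_ge0 ?unorm_ge0 ?sz0. Qed.

Lemma gle_mono f s C D : C <= D -> gle f s C -> gle f s D.
Proof. by move=> CD h n; apply: le_trans (h n) CD. Qed.

Lemma gle0 s C : 0 < s -> 0 <= C -> gle 0 s C.
Proof. by move=> s0 C0 n; rewrite robba0E unorm0 mul0r. Qed.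

Lemma gleD f g s C : 0 < s -> gle f s C -> gle g s C -> gle (f + g) s C.
Proof.
move=> s0 hf hg n; rewrite robbaDE.
apply: le_trans (_ : Num.max (unorm (f n)) (unorm (g n)) * s ^ n <= _).
  by rewrite ler_wpM2r ?sz0 ?unormD_le.
by case: (leP (unorm (f n))) => _; [apply: hg|apply: hf].
Qed.

Lemma gleN f s C : gle f s C -> gle (- f) s C.
Proof. by move=> hf n; rewrite robbaNE unormN. Qed.

Lemma gleB f g s C : 0 < s -> gle f s C -> gle g s C -> gle (f - g) s C.
Proof. by move=> s0 hf hg; apply: gleD => //; apply: gleN. Qed.

Lemma gle_sum (I : eqType) (r : seq I) (F : I -> rb) s C : 0 < s -> 0 <= C ->
  (forall i, i \in r -> gle (F i) s C) -> gle (\sum_(i <- r) F i) s C.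
Proof.
move=> s0 C0 h; rewrite big_seq; elim/big_ind : _ => // [|x y]; first exact: gle0.
exact: gleD.
Qed.

Lemma gleM f g s C D : 0 < s -> gle f s C -> gle g s D -> gle (f * g) s (C * D).
Proof.
move=> s0 hf hg n; have C0 := gle_ge0 s0 hf; have D0 := gle_ge0 s0 hg.
have sn : 0 < s ^ n by rewrite exprz_gt0.
rewrite -ler_pdivlMr // robbaME; apply: usum_le0.
- by rewrite divr_ge0 ?mulr_ge0 // ltW.
- by apply: conv_null; apply: robbaP.
- move=> i; apply: le_trans (unormM_le _ _) _; rewrite ler_pdivlMr //.
  rewrite -{2}(subrKC i n) expfzDr ?gt_eqF // mulrACA.
  by rewrite ler_pM ?mulr_ge0 ?unorm_ge0 ?sz0 ?hf ?hg.
Qed.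

Lemma gle1 s : gle 1 s 1.
Proof.
move=> n; rewrite robba1E; case: eqP => [->|_]; first by rewrite unorm1 expr0z mulr1.
by rewrite unorm0 mul0r.
Qed.

Lemma gle_const c s : gle (robba_const c) s (unorm c).
Proof.
move=> n; rewrite robbaCE; case: eqP => [->|_]; first by rewrite expr0z mulr1.
by rewrite unorm0 mul0r unorm_ge0.
Qed.

Lemma gleX f s C k : 0 < s -> gle f s C -> gle (f ^+ k) s (C ^+ k).
Proof.
move=> s0 hf; elim: k => [|k IH]; first by rewrite !expr0; apply: gle1.
by rewrite !exprS; apply: gleM.
Qed.

(** By [onann_null], boundedness on each circle of the open annulus already is convergence there;
    boundedness passes more easily to sums, products and limits. *)
Definition onann rho f := forall s, rho < s < 1 -> exists C, gle f s C.

(** A bound at a slightly larger radius makes the terms of positive degree decay geometrically, a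
    bound at a slightly smaller radius those of negative degree. *)
Lemma onann_null (a : int -> A) rho : 0 <= rho ->
  (forall s, rho < s < 1 -> exists C, forall n, unorm (a n) * s ^ n <= C) ->
  forall s, rho < s < 1 -> null_family (fun n => unorm (a n) * s ^ n).
Proof.
move=> r0 h s /andP[rs s1] e e0; have s0 : 0 < s by apply: le_lt_trans rs.
pose s1' := (rho + s) / 2; pose s2 := (s + 1) / 2.
have [h11 h12] : rho < s1' /\ s1' < s by rewrite !midf_lt.
have [h21 h22] : s < s2 /\ s2 < 1 by rewrite !midf_lt.
have s1'0 : 0 < s1' by apply: le_lt_trans h11.
have s20 : 0 < s2 by apply: lt_trans h21.
have [C1 hC1] := h s1' ltac:(by rewrite h11 (lt_trans h12)).
have [C2 hC2] := h s2 ltac:(by rewrite h22 (lt_trans _ h21)).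
have [N1 hN1] := @geometric_small R (s1' / s) C1 e
  ltac:(by rewrite divr_ge0 ?ltW //= ltr_pdivrMr ?mul1r) e0.
have [N2 hN2] := @geometric_small R (s / s2) C2 e
  ltac:(by rewrite divr_ge0 ?ltW //= ltr_pdivrMr ?mul1r) e0.
exists (map Posz (iota 0 N2) ++ map (fun k => - Posz k) (iota 0 N1)) => n.
rewrite mem_cat negb_or => /andP[n1 n2].
have [[k nk]|[k nk]] : (exists k : nat, n = k%:Z) \/ exists k : nat, n = - k%:Z.
- by case: (n) => k; [left; exists k|right; exists k.+1].
- have kN : (N2 <= k)%N.
    rewrite leqNgt; apply: contra n1 => kN; rewrite nk; apply: map_f.
    by rewrite mem_iota.
  apply: le_lt_trans (hN2 k kN); have := hC2 n; rewrite nk -!exprnP => hk.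
  rewrite expr_div_n mulrA ler_pdivlMr ?exprn_gt0 // mulrAC.
  by rewrite ler_wpM2r ?exprn_ge0 ?(ltW s0).
- have kN : (N1 <= k)%N.
    rewrite leqNgt; apply: contra n2 => kN; rewrite nk.
    by apply: (map_f (fun k => - Posz k)); rewrite mem_iota.
  apply: le_lt_trans (hN1 k kN); have := hC1 n; rewrite nk -!exprnN => hk.
  rewrite expr_div_n mulrA ler_wpM2r ?invr_ge0 ?exprn_ge0 ?(ltW s0) //.
  by rewrite -ler_pdivrMr ?exprn_gt0.
Qed.

Lemma onann_robba_seq (a : int -> A) rho : 0 <= rho < 1 ->
  (forall s, rho < s < 1 -> exists C, forall n, unorm (a n) * s ^ n <= C) -> robba_seq a.
Proof. by move=> r01 h; exists rho => //; apply: onann_null => //; case/andP: r01. Qed.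

Lemma robba_onann f : exists2 rho, 0 <= rho < 1 & onann rho f.
Proof.
have [rho r01 h] := robbaP f; exists rho => // s rs.
by have [B B0 hB] := null_bounded (h s rs); exists B.
Qed.

Lemma onann_le rho rho' f : rho <= rho' -> onann rho f -> onann rho' f.
Proof.
move=> rr h s /andP[rs s1]; apply: h; rewrite s1 andbT; exact: le_lt_trans rs.
Qed.

Lemma onannD rho f g : 0 <= rho -> onann rho f -> onann rho g -> onann rho (f + g).
Proof.
move=> r0 hf hg s rs; have [C hC] := hf s rs; have [D hD] := hg s rs.
have s0 : 0 < s by apply: le_lt_trans (proj1 (andP rs)).
exists (Num.max C D); apply: gleD => //.
  by apply: gle_mono hC; rewrite le_max lexx.
by apply: gle_mono hD; rewrite le_max lexx orbT.
Qed.

Lemma onannN rho f : onann rho f -> onann rho (- f).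
Proof. by move=> hf s rs; have [C hC] := hf s rs; exists C; apply: gleN. Qed.

Lemma onannB rho f g : 0 <= rho -> onann rho f -> onann rho g -> onann rho (f - g).
Proof. by move=> r0 hf hg; apply: onannD => //; apply: onannN. Qed.

Lemma onannM rho f g : 0 <= rho -> onann rho f -> onann rho g -> onann rho (f * g).
Proof.
move=> r0 hf hg s rs; have [C hC] := hf s rs; have [D hD] := hg s rs.
have s0 : 0 < s by apply: le_lt_trans (proj1 (andP rs)).
by exists (C * D); apply: gleM.
Qed.

Lemma onann_const rho c : onann rho (robba_const c).
Proof. by move=> s _; exists (unorm c); apply: gle_const. Qed.

Lemma onann1 rho : onann rho 1.
Proof. by move=> s _; exists 1; apply: gle1. Qed.

Lemma onannX rho f k : 0 <= rho -> onann rho f -> onann rho (f ^+ k).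
Proof.
by move=> r0 hf; elim: k => [|k IH]; [apply: onann1|rewrite exprS; apply: onannM].
Qed.

Definition plus f := forall n, n < 0 -> f n = 0.
Definition minus f := forall n, 0 <= n -> f n = 0.

Lemma plus0 : plus 0. Proof. by move=> n _; apply: robba0E. Qed.
Lemma plus_const c : plus (robba_const c).
Proof. by move=> n n0; rewrite robbaCE lt_eqF. Qed.
Lemma plus1 : plus 1. Proof. exact: plus_const. Qed.
Lemma plusD f g : plus f -> plus g -> plus (f + g).
Proof. by move=> hf hg n n0; rewrite robbaDE hf // hg // addr0. Qed.
Lemma plusN f : plus f -> plus (- f).
Proof. by move=> hf n n0; rewrite robbaNE hf // oppr0. Qed.
Lemma plusB f g : plus f -> plus g -> plus (f - g).
Proof. by move=> hf hg; apply: plusD => //; apply: plusN. Qed.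
Lemma usum_zero (I : eqType) (u : I -> A) : (forall i, u i = 0) -> usum u = 0.
Proof.
move=> h; apply: usum_eq => e e0; exists [::] => G _ _.
by rewrite big1 ?subr0 ?unorm0 // => i _; rewrite h.
Qed.
Lemma plusM f g : plus f -> plus g -> plus (f * g).
Proof.
move=> hf hg n n0; rewrite robbaME usum_zero // => i.
have [i0|i0] := ltP i 0; first by rewrite hf // mul0r.
by rewrite hg ?mulr0 // subr_lt0 (lt_le_trans n0).
Qed.
Lemma plusX f k : plus f -> plus (f ^+ k).
Proof. by move=> h; elim: k => [|k IH]; [apply: plus1|rewrite exprS; apply: plusM]. Qed.
Lemma plus_sum (I : Type) (r : seq I) (P : pred I) (F : I -> rb) :
  (forall i, P i -> plus (F i)) -> plus (\sum_(i <- r | P i) F i).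
Proof. by move=> h; elim/big_ind : _ => //; [apply: plus0|apply: plusD]. Qed.

Lemma gle_plus f s s' C : plus f -> 0 < s' -> s' <= s -> gle f s C -> gle f s' C.
Proof.
move=> hf s'0 ss hC n; have s0 : 0 < s by apply: lt_le_trans ss.
have [n0|n0] := ltP n 0; first by rewrite hf // unorm0 mul0r (gle_ge0 s0 hC).
apply: le_trans (hC n); rewrite ler_wpM2l ?unorm_ge0 //.
by case: n n0 => // k _; rewrite -!exprnP lerXn2r // nnegrE ltW.
Qed.

Lemma gle_minus f s s' C : minus f -> 0 < s -> s <= s' -> gle f s C -> gle f s' C.
Proof.
move=> hf s0 ss hC n; have s'0 : 0 < s' by apply: lt_le_trans ss.
have [n0|n0] := ltP n 0; last by rewrite hf // unorm0 mul0r (gle_ge0 s0 hC).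
apply: le_trans (hC n); rewrite ler_wpM2l ?unorm_ge0 //.
case: n n0 => // k _; rewrite NegzE -!exprnN lef_pV2 ?posrE ?exprn_gt0 //.
by rewrite lerXn2r // nnegrE ltW.
Qed.

(** Without polar part, a bound at a radius close to 1 dominates all smaller radii: such a series
    converges on the whole open disc. *)
Lemma plus_onann f : plus f -> onann 0 f.
Proof.
move=> hf s /andP[s0 s1]; have [rho /andP[r0 r1] h] := robba_onann f.
pose s' := (Num.max rho s + 1) / 2.
have h1 : Num.max rho s < s' by rewrite midf_lt // gt_max r1.
have h2 : s' < 1 by rewrite midf_lt // gt_max r1.
move: h1; rewrite gt_max => /andP[h1 h3].
have [C hC] := h s' ltac:(by rewrite h1 h2); exists C.
by apply: gle_plus hC => //; apply: ltW.
Qed.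

Definition robba_plus f : rb :=
  mk_robba (@robba_seq_le _ _ (fun n => if n < 0 then 0 else f n) f
    (fun n => match n < 0 as b return unorm (if b then 0 else f n) <= unorm (f n) with
      | true => eq_ind_r (fun z => z <= _) (unorm_ge0 _) (@unorm0 R A)
      | false => lexx _ end) (robbaP f)).
Definition robba_minus f : rb := f - robba_plus f.

Lemma robba_plusE f n : robba_plus f n = if n < 0 then 0 else f n.
Proof. by []. Qed.
Lemma robba_minusE f n : robba_minus f n = if n < 0 then f n else 0.
Proof. by rewrite robbaBE robba_plusE; case: ifP => _; rewrite ?subr0 ?subrr. Qed.
Lemma plus_plus f : plus (robba_plus f).
Proof. by move=> n n0; rewrite robba_plusE n0. Qed.
Lemma minus_minus f : minus (robba_minus f).
Proof. by move=> n n0; rewrite robba_minusE ltNge n0. Qed.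
Lemma plus_minusE f : robba_plus f + robba_minus f = f.
Proof. by rewrite addrC subrK. Qed.
Lemma gle_robba_plus f s C : 0 < s -> gle f s C -> gle (robba_plus f) s C.
Proof.
move=> s0 h n; rewrite robba_plusE; case: ifP => // _.
by rewrite unorm0 mul0r (gle_ge0 s0 h).
Qed.
Lemma gle_robba_minus f s C : 0 < s -> gle f s C -> gle (robba_minus f) s C.
Proof.
move=> s0 h n; rewrite robba_minusE; case: ifP => // _.
by rewrite unorm0 mul0r (gle_ge0 s0 h).
Qed.
Lemma robba_minusD f g : robba_minus (f + g) = robba_minus f + robba_minus g.
Proof.
apply: robba_ext => n; rewrite robbaDE !robba_minusE robbaDE.
by case: ifP => // _; rewrite addr0.
Qed.
Lemma robba_minus_plus f : plus f -> robba_minus f = 0.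
Proof.
move=> h; apply: robba_ext => n; rewrite robba_minusE robba0E.
by case: ifP => // /h.
Qed.
Lemma minus_eq0 f : robba_minus f = 0 -> plus f.
Proof.
move=> h n n0; have := congr1 (fun g : rb => g n) h.
by rewrite robba_minusE n0 robba0E.
Qed.

(** Starting from any finite bound C, k improvements give max(D, C theta^k). This replaces solving
    |f| <= max(D, theta |f|) for the exact Gauss norm, which [gle] avoids defining. *)
Lemma gle_contract f s C D theta : 0 < s -> 0 <= theta < 1 -> 0 <= D -> gle f s C ->
  (forall B, 0 <= B -> gle f s B -> gle f s (Num.max D (theta * B))) -> gle f s D.
Proof.
move=> s0 th D0 hC step; have C0 := gle_ge0 s0 hC; case/andP: (th) => t0 t1.
have it k : gle f s (Num.max D (C * theta ^+ k)).
  elim: k => [|k IH]; first by apply: gle_mono hC; rewrite mulr1 le_max lexx orbT.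
  apply: gle_mono (step _ _ IH); last by rewrite le_max D0.
  rewrite ge_max le_max lexx /= maxr_pMr // ge_max !le_max.
  rewrite exprS mulrCA lexx orbT andbT -[leRHS]mul1r.
  by rewrite ler_wpM2r // ltW.
move=> n; apply/ler_addgt0Pr => e e0; have [N hN] := geometric_small C th e0.
apply: le_trans (it N n) _; rewrite ge_max lerDl (ltW e0) /=.
by rewrite (le_trans (ltW (hN N _))) // lerDr.
Qed.

Lemma gle_contract0 f s C theta : 0 < s -> 0 <= theta < 1 -> gle f s C ->
  (forall B, 0 <= B -> gle f s B -> gle f s (theta * B)) -> f = 0.
Proof.
move=> s0 th hC step; have h : gle f s 0.
  apply: (gle_contract s0 th _ hC) => // B B0 hB; apply: gle_mono (step B B0 hB).
  by rewrite le_max lexx orbT.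
apply: robba_ext => n; rewrite robba0E; apply/unorm_eq0/le_anti.
by rewrite unorm_ge0 andbT -(pmulr_lle0 _ (exprz_gt0 n s0)) h.
Qed.

End Bounds.

(** * Limits of sequences and series on an annulus *)

Section Limits.
Variables (R : realType) (A : ultraRingType R).
Local Notation rb := (robba A).
Implicit Types (f g h F G : rb) (s C D rho e : R) (n : int) (u v : nat -> rb).

Definition mon n : rb.
Proof.
refine (@mk_robba R A (fun k => (k == n)%:R) _); exists 0; first by rewrite lexx ltr01.
move=> s _ e e0; exists [:: n] => k; rewrite inE => /negPf->.
by rewrite unorm0 mul0r.
Defined.

Lemma monE n k : mon n k = (k == n)%:R. Proof. by []. Qed.

Lemma mon_mulE n f k : (mon n * f) k = f (k - n).
Proof.
rewrite robbaME (@usum_single _ _ _ _ n).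
  by rewrite monE eqxx mul1r.
by move=> i /negPf i0; rewrite monE i0 mul0r.
Qed.

Lemma mon_mon n k : mon n * mon k = mon (n + k).
Proof. by apply: robba_ext => l; rewrite mon_mulE !monE subr_eq addrC. Qed.

Lemma mon0 : mon 0 = 1.
Proof. by apply: robba_ext => l; rewrite monE robba1E. Qed.

Lemma mon_exp n (k : nat) : mon n ^+ k = mon (n *+ k).
Proof.
elim: k => [|k IH]; first by rewrite mulr0n mon0.
by rewrite exprS IH mon_mon mulrS.
Qed.

Lemma gle_mon n s : 0 < s -> gle (mon n) s (s ^ n).
Proof.
move=> s0 k; rewrite monE; case: eqP => [->|_]; first by rewrite unorm1 mul1r.
by rewrite unorm0 mul0r sz0.
Qed.

Lemma onann_mon n rho : 0 <= rho -> onann rho (mon n).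
Proof.
by move=> r0 s /andP[rs _]; exists (s ^ n); apply: gle_mon; apply: le_lt_trans rs.
Qed.

Lemma plus_mon n : 0 <= n -> plus (mon n).
Proof. by move=> n0 k k0; rewrite monE; case: eqP => // kn; lia. Qed.

(** Convergence in the Frechet topology of the annulus: the threshold N depends on the radius. *)
Definition tends rho u F := forall s e, rho < s < 1 -> 0 < e ->
  exists N, forall k, (N <= k)%N -> gle (F - u k) s e.

Definition rcauchy rho u := forall s e, rho < s < 1 -> 0 < e ->
  exists N, forall k, (N <= k)%N -> gle (u k.+1 - u k) s e.

Lemma gle_chain u s e N : 0 < s -> 0 <= e ->
  (forall k, (N <= k)%N -> gle (u k.+1 - u k) s e) ->
  forall k m, (N <= k)%N -> (k <= m)%N -> gle (u m - u k) s e.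
Proof.
move=> s0 e0 h k m Nk; elim: m => [|m IH].
  by rewrite leqn0 => /eqP->; rewrite subrr; apply: gle0.
rewrite leq_eqVlt => /orP[/eqP->|km]; first by rewrite subrr; apply: gle0.
rewrite -(subrK (u m) (u m.+1)) -addrA; apply: gleD => //; last exact: IH.
by apply: h; apply: leq_trans Nk _.
Qed.

(** A single radius makes all coefficients Cauchy. The limit is then compared with [u k] through a
    later term whose coefficient is already close, which keeps the estimate uniform in the
    degree. *)
Lemma rcauchy_lim rho u : 0 <= rho < 1 -> (forall k, onann rho (u k)) ->
  rcauchy rho u -> exists2 F, tends rho u F & onann rho F.
Proof.
move=> /andP[r0 r1] ou cu.
have sp s : rho < s < 1 -> 0 < s by case/andP => rs _; apply: le_lt_trans rs.
have /choice[F0 hF0] : forall n : int, exists l, forall e, 0 < e -> exists N, forall k,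
    (N <= k)%N -> unorm (u k n - l) < e.
  move=> n; pose s := (rho + 1) / 2.
  have rs : rho < s < 1 by rewrite !midf_lt.
  have sn : 0 < s ^ n by rewrite exprz_gt0 // sp.
  apply: unorm_complete => e e0; have e20 : 0 < e * s ^ n / 2 by rewrite divr_gt0 // mulr_gt0.
  have [N hN] := cu s _ rs e20; exists N => k m Nk Nm.
  wlog km : k m Nk Nm / (k <= m)%N.
    by move=> h; case: (leqP k m) => km; [|rewrite unormBC]; apply: h => //; apply: ltnW.
  have := gle_chain (sp s rs) (ltW e20) hN Nk km n.
  rewrite robbaBE unormBC => /le_lt_trans h; rewrite -(ltr_pM2r sn); apply: h.
  by rewrite ltr_pdivrMr // ltr_pMr ?mulr_gt0 // ltr1n.
have key s e : rho < s < 1 -> 0 < e -> exists N, forall k, (N <= k)%N ->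
    forall n, unorm (F0 n - u k n) * s ^ n <= e.
  move=> rs e0; have [N hN] := cu s e rs e0; exists N => k Nk n.
  have sn : 0 < s ^ n by rewrite exprz_gt0 // sp.
  have [M hM] := hF0 n (e / s ^ n) (divr_gt0 e0 sn).
  have Mm := hM (maxn M k) (leq_maxl _ _).
  have := gle_chain (sp s rs) (ltW e0) hN Nk (leq_maxr M k) n.
  rewrite robbaBE -!ler_pdivlMr // => h.
  rewrite -(subrK (u (maxn M k) n) (F0 n)) -addrA; apply: le_trans (unormD_le _ _) _.
  by rewrite ge_max h andbT unormBC ltW.
have sF : robba_seq F0.
  apply: (@onann_robba_seq _ _ _ rho); first by rewrite r0.
  move=> s rs; have [N hN] := key s 1 rs ltr01.
  have [C hC] := ou N s rs; exists (Num.max 1 C) => n.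
  have sn : 0 < s ^ n by rewrite exprz_gt0 // sp.
  rewrite -ler_pdivlMr // -(subrK (u N n) (F0 n)).
  apply: le_trans (unormD_le _ _) _; rewrite ge_max !ler_pdivlMr // !le_max.
  by rewrite (hN N (leqnn _) n) (hC n) orbT.
exists (mk_robba sF) => [s e rs e0|s rs].
  by have [N hN] := key s e rs e0; exists N => k Nk n; rewrite robbaBE; apply: hN.
have [N hN] := key s 1 rs ltr01; have [C hC] := ou N s rs.
exists (Num.max 1 C); rewrite -(subrK (u N) (mk_robba sF)); apply: gleD.
- exact: sp rs.
- by apply: gle_mono (_ : 1 <= _) _; [rewrite le_max lexx|move=> n; apply: hN].
- by apply: gle_mono hC; rewrite le_max lexx orbT.
Qed.

Lemma tends_uniq rho u F G : 0 <= rho < 1 -> tends rho u F -> tends rho u G -> F = G.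
Proof.
move=> /andP[r0 r1] uF uG; apply/eqP; rewrite -subr_eq0; apply/eqP.
pose s := (rho + 1) / 2; have rs : rho < s < 1 by rewrite !midf_lt.
have s0 : 0 < s by apply: le_lt_trans (proj1 (andP rs)).
apply: robba_ext => n; rewrite robba0E; apply: unorm_small => e e0.
have sn : 0 < s ^ n by rewrite exprz_gt0.
have e20 : 0 < e * s ^ n / 2 by rewrite divr_gt0 // mulr_gt0.
have [N hN] := uF s _ rs e20; have [M hM] := uG s _ rs e20.
rewrite -(ltr_pM2r sn); apply: (@le_lt_trans _ _ (e * s ^ n / 2)).
  have -> : F - G = (F - u (maxn N M)) - (G - u (maxn N M)) by ring.
  by apply: gleB => //; [apply: hN; apply: leq_maxl|apply: hM; apply: leq_maxr].
by rewrite ltr_pdivrMr // ltr_pMr ?mulr_gt0 // ltr1n.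
Qed.

Lemma tends_coef0 rho u F n N : 0 <= rho < 1 -> tends rho u F ->
  (forall k, (N <= k)%N -> u k n = 0) -> F n = 0.
Proof.
move=> /andP[r0 r1] uF h.
pose s := (rho + 1) / 2; have rs : rho < s < 1 by rewrite !midf_lt.
have s0 : 0 < s by apply: le_lt_trans (proj1 (andP rs)).
apply: unorm_small => e e0; have sn : 0 < s ^ n by rewrite exprz_gt0.
have e20 : 0 < e * s ^ n / 2 by rewrite divr_gt0 // mulr_gt0.
have [M hM] := uF s _ rs e20; rewrite -(ltr_pM2r sn).
have := hM _ (leq_maxr N M) n; rewrite robbaBE (h _ (leq_maxl _ _)) subr0.
move=> /le_lt_trans-> //.
by rewrite ltr_pdivrMr // ltr_pMr ?mulr_gt0 // ltr1n.
Qed.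

Lemma tends_plus rho u F : 0 <= rho < 1 -> tends rho u F -> (forall k, plus (u k)) -> plus F.
Proof. by move=> r01 uF h n n0; apply: (tends_coef0 (N := 0) r01 uF) => k _; apply: h. Qed.

Lemma tends_cst rho F : 0 <= rho -> tends rho (fun=> F) F.
Proof.
move=> r0 s e /andP[rs _] e0; exists 0%N => k _; rewrite subrr.
by apply: gle0; [apply: le_lt_trans rs|apply: ltW].
Qed.

Lemma tends_le rho rho' u F : rho <= rho' -> tends rho u F -> tends rho' u F.
Proof.
by move=> rr h s e /andP[rs s1] e0; apply: h => //; rewrite s1 andbT (le_lt_trans rr).
Qed.

Lemma tendsD rho u v F G : 0 <= rho -> tends rho u F -> tends rho v G ->
  tends rho (fun k => u k + v k) (F + G).
Proof.
move=> r0 uF vG s e rs e0; have [N hN] := uF s e rs e0; have [M hM] := vG s e rs e0.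
have s0 : 0 < s by apply: le_lt_trans (proj1 (andP rs)).
exists (maxn N M) => k; rewrite geq_max => /andP[Nk Mk].
by rewrite opprD addrACA; apply: gleD => //; [apply: hN|apply: hM].
Qed.

Lemma tends_mulr0 rho u v : 0 <= rho -> tends rho u 0 ->
  (forall s, rho < s < 1 -> exists C, forall k, gle (v k) s C) ->
  tends rho (fun k => u k * v k) 0.
Proof.
move=> r0 u0 bv s e rs e0; have [C hC] := bv s rs.
have s0 : 0 < s by apply: le_lt_trans (proj1 (andP rs)).
have C0 := gle_ge0 s0 (hC 0%N); have C1 : 0 < C + 1 by rewrite ltr_wpDl.
have [N hN] := u0 s _ rs (divr_gt0 e0 C1); exists N => k Nk.
have := gleM s0 (hN k Nk) (gle_mono (ler_wpDr ler01 (lexx C)) (hC k)).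
by rewrite divfK ?gt_eqF // !sub0r mulNr.
Qed.

Lemma tendsB0 rho u F : tends rho u F <-> tends rho (fun k => u k - F) 0.
Proof.
split=> h s e rs e0; have [N hN] := h s e rs e0; exists N => k /hN;
  by rewrite sub0r opprB.
Qed.

Lemma tends_bnd rho u F s : 0 <= rho -> rho < s < 1 -> tends rho u F -> onann rho F ->
  (forall k, onann rho (u k)) -> exists C, forall k, gle (u k) s C.
Proof.
move=> r0 rs uF oF ou; have s0 : 0 < s by apply: le_lt_trans (proj1 (andP rs)).
have [N hN] := uF s 1 rs ltr01; have [C hC] := oF s rs.
have [D hD] : exists D, forall k, (k < N)%N -> gle (u k) s D.
  elim: N {hN} => [|N [D hD]]; first by exists 0.
  have [D' hD'] := ou N s rs; exists (Num.max D D') => k; rewrite ltnS leq_eqVlt.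
  case/orP => [/eqP->|/hD h]; first by apply: gle_mono hD'; rewrite le_max lexx orbT.
  by apply: gle_mono h; rewrite le_max lexx.
exists (Num.max (Num.max 1 C) D) => k; have [Nk|kN] := leqP N k; last first.
  by apply: gle_mono (hD k kN); rewrite le_max lexx orbT.
have -> : u k = F - (F - u k) by ring.
apply: gle_mono (_ : Num.max 1 C <= _) _; first by rewrite le_max lexx.
apply: gleB => //; first by apply: gle_mono hC; rewrite le_max lexx orbT.
by apply: gle_mono (hN k Nk); rewrite le_max lexx.
Qed.

Lemma tendsZ rho v F G : 0 <= rho -> onann rho F -> tends rho v G ->
  tends rho (fun k => F * v k) (F * G).
Proof.
move=> r0 oF vG; apply/tendsB0.
have -> : (fun k => F * v k - F * G) = (fun k => (v k - G) * F).
  by apply/funext => k; ring.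
apply: tends_mulr0 => //; first exact: (proj1 (tendsB0 _ _ _)).
by move=> s rs; have [C hC] := oF s rs; exists C.
Qed.

Lemma tends_shift rho u F : tends rho u F -> tends rho (fun k => u k.+1) F.
Proof.
move=> h s e rs e0; have [N hN] := h s e rs e0; exists N => k Nk.
by apply: hN; apply: leqW.
Qed.

Lemma rsum_lim rho v : 0 <= rho < 1 -> (forall k, onann rho (v k)) -> tends rho v 0 ->
  exists2 F, tends rho (fun K => \sum_(k < K) v k) F & onann rho F.
Proof.
move=> r01 ov v0; apply: rcauchy_lim => // [k|s e rs e0].
  elim: k => [|k IH]; last by rewrite big_ord_recr; apply: onannD => //; case/andP: r01.
  by rewrite big_ord0; have := @onann_const R A rho 0.
have [N hN] := v0 s e rs e0; exists N => k Nk.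
rewrite big_ord_recr /= [_ + v k]addrC addrK -[v k]opprK -[- v k]sub0r.
by apply: gleN; apply: hN.
Qed.

End Limits.

(** * Weierstrass division by a power series in which X^d dominates *)

Section Weierstrass.
Variables (R : realType) (A : ultraRingType R) (P : robba A) (d : nat) (c rho : R).
Local Notation rb := (robba A).
Hypotheses (c0 : 0 <= c) (r01 : 0 <= rho < 1) (d0 : (0 < d)%N).
Hypothesis Pplus : plus P.
Hypothesis Pdom : forall s, rho < s < 1 -> gle (P - mon A d) s c /\ c < s ^ d.

Let s0 s : rho < s < 1 -> 0 < s.
Proof. by case/andP: r01 => r0 _ /andP[rs _]; apply: le_lt_trans rs. Qed.

Let theta s : rho < s < 1 -> 0 <= c * s ^ (- d%:Z) < 1.
Proof.
move=> rs; have [_ h] := Pdom rs; have sd : 0 < s ^ d by rewrite exprz_gt0 ?s0.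
rewrite mulr_ge0 ?sz0 ?s0 //= -invr_expz ltr_pdivrMr ?mul1r //.
Qed.

(** In degrees at least d, where r vanishes, X^d y has the coefficients of -(P - X^d) y; dividing by
    X^d contracts y by the factor c / s^d < 1. *)
Lemma weierstrass_uniq (y r : rb) : plus y -> (forall k : int, d%:Z <= k -> r k = 0) ->
  P * y = r -> y = 0.
Proof.
move=> yp rd Pyr; have [t /andP[t0 t1] yt] := robba_onann y.
pose s := (Num.max rho t + 1) / 2.
have : Num.max rho t < s < 1 by rewrite !midf_lt // gt_max t1; case/andP: r01 => _ ->.
rewrite gt_max -andbA => /and3P[h1 h2 h3]; have rs : rho < s < 1 by rewrite h1.
have [C hC] := yt s ltac:(by rewrite h2); have [hP _] := Pdom rs.
apply: (gle_contract0 (s0 rs) (theta rs) hC) => B B0 hB k.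
have [k0|k0] := ltP k 0.
  by rewrite yp // unorm0 mul0r mulr_ge0 //; case/andP: (theta rs).
have := gleM (s0 rs) (gle_mon A (- d%:Z) (s0 rs)) (gleM (s0 rs) (gleN hP) hB).
move=> /(_ k); rewrite [leRHS]mulrA [s ^ (- d%:Z) * c]mulrC mon_mulE opprK.
suff -> : (- (P - mon A d) * y) (k + d) = y k by [].
have -> : - (P - mon A d) * y = mon A d * y - r by rewrite -Pyr; ring.
by rewrite robbaBE mon_mulE addrK rd ?subr0 // lerDr.
Qed.

(** Long division with X^d in place of P: [sh] divides by X^d and drops the lower terms, and the
    error (X^d - P) sh(v) of each step shrinks geometrically on the annulus. *)
Lemma weierstrass_div (f : rb) : plus f -> exists y r : rb, [/\ plus y, plus r,
  forall k : int, d%:Z <= k -> r k = 0 & f = P * y + r].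
Proof.
move=> fp; pose sh (g : rb) : rb := robba_plus (mon A (- d%:Z) * g).
pose v := fix v k := if k is k'.+1 then (mon A d - P) * sh (v k') else f.
have shp g : plus (sh g) by apply: plus_plus.
have vp k : plus (v k).
  by case: k => //= k; apply: plusM => //; apply: plusB => //; apply: plus_mon.
have vO k : onann rho (v k).
  by apply: onann_le (plus_onann (vp k)); case/andP: r01.
have vb s : rho < s < 1 -> exists2 C, 0 <= C &
    forall k, gle (v k) s (C * (c * s ^ (- d%:Z)) ^+ k).
  move=> rs; have [C hC] := vO 0%N s rs; exists C; first exact: gle_ge0 (s0 rs) hC.
  elim=> [|k IH]; first by rewrite mulr1.
  have [hP _] := Pdom rs; have := gleN hP; rewrite opprB /= => hP'.
  have h := gleM (s0 rs) hP' (gle_robba_plus (s0 rs) (gleM (s0 rs) (gle_mon A (- d%:Z) (s0 rs)) IH)).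
  apply: gle_mono h; rewrite exprS le_eqVlt; apply/orP; left; apply/eqP.
  by set x := s ^ _; ring.
have shb s : rho < s < 1 -> exists2 C, 0 <= C &
    forall k, gle (sh (v k)) s (C * (c * s ^ (- d%:Z)) ^+ k).
  move=> rs; have [C C0 hC] := vb s rs; exists (s ^ (- d%:Z) * C).
    by rewrite mulr_ge0 ?sz0 ?s0.
  move=> k; rewrite -mulrA; apply: gle_robba_plus; first exact: s0.
  by apply: gleM => //; [apply: s0|apply: gle_mon; apply: s0].
have tendsgeo (w : nat -> rb) : (forall s, rho < s < 1 -> exists2 C, 0 <= C &
    forall k, gle (w k) s (C * (c * s ^ (- d%:Z)) ^+ k)) -> tends rho w 0.
  move=> hw s e rs e0; have [C C0 hC] := hw s rs.
  have [N hN] := geometric_small C (theta rs) e0; exists N => k Nk.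
  by rewrite sub0r; apply: gleN; apply: gle_mono (hC k); apply: ltW; apply: hN.
have shO k : onann rho (sh (v k)).
  by apply: onann_le (plus_onann (shp _)); case/andP: r01.
have [y ty yO] := rsum_lim r01 shO (tendsgeo _ shb).
have yp : plus y.
  by apply: (tends_plus r01 ty) => k; apply: plus_sum => i _; apply: shp.
exists y, (f - P * y); split => //; [|move=> k kd|by rewrite addrC subrK].
  by apply: plusB => //; apply: plusM.
(* By telescoping, only the parts of the [v k] below degree d remain in the partial remainder. *)
have part K : f - P * (\sum_(k < K) sh (v k)) - v K =
    \sum_(k < K) (v k - mon A d * sh (v k)).
  elim: K => [|K IH]; first by rewrite !big_ord0 mulr0 subr0 subrr.
  by rewrite !big_ord_recr /= -IH; ring.
have low g : plus g -> (g - mon A d * sh g) k = 0.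
  move=> gp; rewrite robbaBE mon_mulE robba_plusE ifF ?mon_mulE ?opprK ?subrK ?subrr //.
  by apply/negbTE; rewrite -leNgt subr_ge0.
have cvg : tends rho (fun K => f - P * (\sum_(i < K) sh (v i)) - v K) (f - P * y).
  have -> : f - P * y = (f - P * y) - 0 by rewrite subr0.
  have r0 : 0 <= rho by case/andP: r01.
  have tN u F : tends rho u F -> tends rho (fun K => - u K) (- F).
    move=> h s e rs e0; have [N hN] := h s e rs e0; exists N => K NK.
    by rewrite -opprD; apply: gleN; apply: hN.
  apply: tendsD => //; last exact/tN/tendsgeo.
  apply: tendsD => //; first exact: tends_cst.
  by apply/tN/tendsZ => //; apply: onann_le (plus_onann Pplus).
apply: (tends_coef0 (N := 0) r01 cvg) => K _.
by rewrite part robba_sumE big1 // => i _; apply: low.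
Qed.

End Weierstrass.

(** * Binomial coefficients on the p-adic integers *)

Section UltraNorms.
Variables (R : realType) (A : ultraRingType R).

Lemma unorm_nat_le1 n : unorm (n%:R : A) <= 1.
Proof.
elim: n => [|n IH]; first by rewrite unorm0 ler01.
by rewrite -natr1 (le_trans (unormD_le _ _)) // ge_max IH unorm1 lexx.
Qed.

Lemma unorm_eqmax (x y : A) : unorm y < unorm x -> unorm (x + y) = unorm x.
Proof.
move=> yx; apply/le_anti/andP; split.
  by rewrite (le_trans (unormD_le _ _)) // ge_max lexx ltW.
rewrite leNgt; apply/negP => h; have : unorm x < unorm x.
  by rewrite -{1}(addrK y x) unormB_lt.
by rewrite ltxx.
Qed.

Lemma usum_seq (I : eqType) (u : I -> A) (s : seq I) : uniq s ->
  (forall i, i \notin s -> u i = 0) -> usum u = \sum_(i <- s) u i.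
Proof.
move=> us h; apply: usum_eq => e e0; exists s => G uG sG.
rewrite sub_uniq_sum // big1 ?unorm0 // => i; exact: h.
Qed.

Lemma robbaM_plus (f g : robba A) (k : nat) : plus f -> plus g ->
  (f * g) k = \sum_(i < k.+1) f (i : nat) * g (k - i)%N.
Proof.
move=> fp gp; rewrite robbaME (@usum_seq _ _ (map Posz (iota 0 k.+1))).
- rewrite big_map -(big_mkord xpredT (fun i : nat => f i * g (k - i)%N)).
  rewrite /index_iota subn0 big_seq [RHS]big_seq; apply: eq_bigr => i.
  by rewrite mem_iota ltnS /= => ik; rewrite subzn.
- by rewrite map_inj_uniq ?iota_uniq // => i j [].
- case=> [i|i] ii; last by rewrite fp // mul0r.
  rewrite (gp (k%:Z - i%:Z)) ?mulr0 //; rewrite subr_lt0 ltz_nat.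
  by rewrite ltnNge; apply: contra ii => ik; apply: map_f; rewrite mem_iota.
Qed.

Lemma robbaM_plus0 (f g : robba A) : plus f -> plus g -> (f * g) 0 = f 0 * g 0.
Proof. by move=> fp gp; rewrite (robbaM_plus 0 fp gp) big_ord1. Qed.

End UltraNorms.

Section UltraField.
Variables (R : realType) (K : ultraFieldType R).
Lemma unormV (x : K) : unorm x^-1 = (unorm x)^-1.
Proof.
have [->|x0] := eqVneq x 0; first by rewrite invr0 !unorm0 invr0.
have n0 : unorm x != 0 by apply/eqP => /unorm_eq0/eqP; rewrite (negbTE x0).
by apply: (mulfI n0); rewrite -unormM !divff // unorm1.
Qed.
Lemma unormX (x : K) n : unorm (x ^+ n) = unorm x ^+ n.
Proof. by elim: n => [|n IH]; rewrite ?expr0 ?unorm1 // !exprS unormM IH. Qed.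
End UltraField.

Section Padic.
Variables (R : realType) (p : nat) (Qp : padicNumType R p).
Local Notation pr := (p%:R : R).
Implicit Types (x y : Qp).

Lemma p_prime : prime p. Proof. exact: (@padic_prime R p Qp). Qed.
Lemma p_gt0 : (0 < p)%N. Proof. exact: prime_gt0 p_prime. Qed.
Lemma pr_gt1 : 1 < pr. Proof. by rewrite ltr1n prime_gt1 // p_prime. Qed.
Lemma pr_gt0 : 0 < pr. Proof. by rewrite ltr0n p_gt0. Qed.
Lemma prV_lt1 : 0 <= pr^-1 < 1.
Proof. by rewrite invr_ge0 ler0n /= invf_lt1 ?pr_gt0 // pr_gt1. Qed.
Lemma normp : unorm (p%:R : Qp) = pr^-1. Proof. exact: (@unorm_p R p Qp). Qed.

Lemma norm_pX k : unorm ((p ^ k)%:R : Qp) = pr ^- k.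
Proof. by rewrite natrX unormX normp exprVn. Qed.

Lemma norm_dvd n k : (p ^ k %| n)%N -> unorm (n%:R : Qp) <= pr ^- k.
Proof.
case/dvdnP => q ->; rewrite natrM unormM norm_pX -[leRHS]mul1r.
by rewrite ler_wpM2r ?unorm_nat_le1 // invr_ge0 exprn_ge0 // ltW // pr_gt0.
Qed.

Lemma norm_coprime n : ~~ (p %| n)%N -> unorm (n%:R : Qp) = 1.
Proof.
move=> pn; apply/le_anti; rewrite unorm_nat_le1 /= leNgt; apply/negP => n1.
have n0 : (0 < n)%N by rewrite lt0n; apply: contraNneq pn => ->.
have cop : coprime n p by rewrite coprime_sym prime_coprime // p_prime.
have [a b e _] := egcdnP p n0; move: e; rewrite (eqP cop) => e.
have : unorm (1 : Qp) < 1.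
  have -> : (1 : Qp) = a%:R * n%:R - b%:R * p%:R.
    by rewrite -!natrM e natrD addrC addKr.
  apply: unormB_lt; rewrite unormM.
    apply: le_lt_trans n1; rewrite -[leRHS]mul1r.
    by rewrite ler_wpM2r ?unorm_ge0 ?unorm_nat_le1.
  rewrite normp; apply: le_lt_trans (_ : 1 * pr^-1 < 1); last first.
    by rewrite mul1r; case/andP: prV_lt1.
  by rewrite ler_wpM2r ?unorm_nat_le1 //; case/andP: prV_lt1.
by rewrite unorm1 ltxx.
Qed.

Lemma norm_nat_neq0 n : (0 < n)%N -> 0 < unorm (n%:R : Qp).
Proof.
move=> n0; rewrite -(partnC p n0) natrM unormM p_part norm_pX.
rewrite norm_coprime ?mulr1 ?invr_gt0 ?exprn_gt0 ?pr_gt0 //.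
by rewrite -prime_coprime ?p_prime //; apply: (@pnat_coprime p); [rewrite pnat_id ?p_prime|apply: part_pnat].
Qed.

Lemma Qp_nat_neq0 n : (0 < n)%N -> (n%:R : Qp) != 0.
Proof.
by move=> n0; apply: contraTneq (norm_nat_neq0 n0) => ->; rewrite unorm0 ltxx.
Qed.

(** A rational q near x with |q| <= 1 has denominator prime to p. A Bezout inverse u of the
    denominator modulo p^k turns q into the integer [numq q * u], reduced modulo p^k to obtain a
    natural number. *)
Lemma zp_approx x e : unorm x <= 1 -> 0 < e -> exists n : nat, unorm (x - n%:R) < e.
Proof.
move=> x1 e0; have m0 : 0 < Num.min e 1 by rewrite lt_min e0 ltr01.
have [q hq] := rat_dense x _ m0; move: hq; rewrite lt_min => /andP[qe q1].
have nq1 : unorm (ratr q : Qp) <= 1.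
  rewrite -(subKr x (ratr q)) (le_trans (unormB_le _ _)) //.
  by rewrite ge_max x1 ltW.
have nint (z : int) : unorm (z%:~R : Qp) = unorm (`|z|%N%:R : Qp).
  by case: (intP z) => [|n|n] //; rewrite mulrNz unormN abszN.
pose b := `|denq q|%N; have b0 : (0 < b)%N by rewrite absz_gt0 denq_neq0.
have bE : (denq q)%:~R = b%:R :> Qp by rewrite -{1}(gez0_abs (ltW (denq_gt0 q))).
have pb : ~~ (p %| b)%N.
  apply/negP => pb; have pa : ~~ (p %| `|numq q|)%N.
    apply/negP => pa; have := coprime_num_den q; rewrite /coprime => /eqP g1.
    have : (p %| 1)%N by rewrite -g1 dvdn_gcd pa.
    by rewrite dvdn1 => /eqP pe; have := prime_gt1 p_prime; rewrite pe.
  have nb : unorm (b%:R : Qp) <= pr^-1 by have := @norm_dvd b 1; rewrite !expn1 expr1 => ->.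
  move: nq1; rewrite /ratr unormM unormV nint bE norm_coprime // mul1r.
  rewrite invf_le1 ?norm_nat_neq0 // => /le_trans/(_ nb).
  by rewrite leNgt; case/andP: prV_lt1 => _ ->.
have [k hk] := geometric_small 1 prV_lt1 e0.
have cop : coprimez (denq q) (p ^ k)%:Z.
  by rewrite /coprimez /gcdz /= eqz_nat -/(coprime _ _) coprimeXr // coprime_sym prime_coprime ?p_prime.
have [[u v] /= uv] := coprimezP _ _ cop.
pose c := `|(numq q * u %% (p ^ k)%:Z)%Z|%N.
have pk0 : (p ^ k)%:Z != 0 by rewrite eqz_nat -lt0n expn_gt0 p_gt0.
have cE : c%:Z = numq q * u - (numq q * u %/ (p ^ k)%:Z)%Z * (p ^ k)%:Z.
  by rewrite /c gez0_abs ?modz_ge0.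
exists c; rewrite -(subrK (ratr q) x) -addrA unormD_lt //.
have -> : ratr q - c%:R = (numq q - c%:Z * denq q)%:~R / b%:R :> Qp.
  rewrite /ratr bE rmorphB rmorphM /= bE mulrBl mulfK //; exact: Qp_nat_neq0.
rewrite unormM unormV (norm_coprime pb) invr1 mulr1 nint.
apply: le_lt_trans (hk k (leqnn k)); rewrite mul1r exprVn; apply: norm_dvd.
rewrite -[(p ^ k)%N]/`|(p ^ k)%:Z|%N -dvdzE cE.
have -> : numq q - (numq q * u - (numq q * u %/ (p ^ k)%:Z)%Z * (p ^ k)%:Z) * denq q
   = (numq q * v + (numq q * u %/ (p ^ k)%:Z)%Z * denq q) * (p ^ k)%:Z.
  set w := (_ %/ _)%Z; have uv' : v * (p ^ k)%:Z = 1 - u * denq q by rewrite -uv; ring.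
  transitivity (numq q * (1 - u * denq q) + w * (p ^ k)%:Z * denq q); first by ring.
  by rewrite -uv'; ring.
exact: dvdz_mull.
Qed.

Lemma padic_binomS x j : j.+1%:R * padic_binom x j.+1 = (x - j%:R) * padic_binom x j.
Proof.
rewrite /padic_binom big_ord_recr /= factS natrM.
move: (Qp_nat_neq0 (ltn0Sn j)) (Qp_nat_neq0 (fact_gt0 j)).
move: j.+1%:R j`!%:R => a b a0 b0; by field; rewrite a0 b0.
Qed.

Lemma padic_binom0 x : padic_binom x 0 = 1.
Proof. by rewrite /padic_binom big_ord0 fact0 divr1. Qed.

Lemma padic_binom_nat n j : padic_binom (n%:R : Qp) j = 'C(n, j)%:R.
Proof.
elim: j => [|j IH]; first by rewrite padic_binom0 bin0.
have h := Qp_nat_neq0 (ltn0Sn j); apply: (mulfI h).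
rewrite padic_binomS IH -natrM.
have [jn|nj] := leqP j n; last by rewrite !bin_small ?muln0 ?mulr0 // ltnW.
by rewrite -natrB // -natrM mul_bin_left.
Qed.

Lemma padic_binom_lipschitz x y j : unorm x <= 1 -> unorm y <= 1 ->
  unorm (padic_binom x j - padic_binom y j) <= unorm (x - y) / unorm (j`!%:R : Qp).
Proof.
move=> x1 y1; rewrite /padic_binom -mulrBl unormM unormV.
rewrite ler_wpM2r ?invr_ge0 ?unorm_ge0 //.
elim: j => [|j IH]; first by rewrite !big_ord0 subrr unorm0 unorm_ge0.
rewrite !big_ord_recr /=; set a := \prod_(i < j) _; set b := \prod_(i < j) (y - _).
have -> : a * (x - j%:R) - b * (y - j%:R) = (a - b) * (x - j%:R) + b * (x - y) by ring.
have jle z i : unorm z <= 1 -> unorm (z - i%:R) <= 1.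
  by move=> z1; rewrite (le_trans (unormB_le _ _)) // ge_max z1 unorm_nat_le1.
have b1 : unorm b <= 1.
  rewrite /b; elim/big_ind: _ => [|z w hz hw|i _]; [by rewrite unorm1| |exact: jle].
  by rewrite unormM -[leRHS]mulr1 ler_pM ?unorm_ge0.
rewrite (le_trans (unormD_le _ _)) // ge_max !unormM; apply/andP; split.
  by rewrite -[leRHS]mulr1 ler_pM ?unorm_ge0 ?jle.
by rewrite -[leRHS]mul1r ler_pM ?unorm_ge0.
Qed.

(** Binomial coefficients of natural numbers are integers; x is approximated by a natural number to
    precision |j!|, which is the loss in [padic_binom_lipschitz]. *)
Lemma padic_binom_le1 x j : unorm x <= 1 -> unorm (padic_binom x j) <= 1.
Proof.
move=> x1; pose d := unorm (j`!%:R : Qp).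
have d0 : 0 < d by apply: norm_nat_neq0; apply: fact_gt0.
have [n hn] := zp_approx x1 d0.
rewrite -(subrK (padic_binom n%:R j) (padic_binom x j)) (le_trans (unormD_le _ _)) //.
rewrite ge_max {2}padic_binom_nat unorm_nat_le1 andbT.
apply: le_trans (padic_binom_lipschitz j x1 (unorm_nat_le1 Qp n)) _.
by rewrite ler_pdivrMr // mul1r ltW.
Qed.

Lemma padic_binom_vandermonde x y k :
  \sum_(i < k.+1) padic_binom x i * padic_binom y (k - i) = padic_binom (x + y) k.
Proof.
elim: k => [|k IH]; first by rewrite big_ord1 !padic_binom0 mulr1.
have h := Qp_nat_neq0 (ltn0Sn k); apply: (mulfI h).
rewrite padic_binomS -IH !mulr_sumr.
transitivity (\sum_(i < k.+2) (i%:R * padic_binom x i * padic_binom y (k.+1 - i))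
  + \sum_(i < k.+2) (padic_binom x i * ((k.+1 - i)%:R * padic_binom y (k.+1 - i)))).
  rewrite -big_split /=; apply: eq_bigr => i _.
  have -> : k.+1%:R = i%:R + (k.+1 - i)%:R :> Qp by rewrite -natrD subnKC // -ltnS.
  move: (padic_binom x i) (padic_binom y _) ((i : nat)%:R) ((k.+1 - i)%:R) => a b c d; ring.
rewrite big_ord_recl !mul0r add0r [X in _ + X]big_ord_recr /= subnn mul0r mulr0 addr0.
rewrite -big_split /=; apply: eq_bigr => i _; have ik : (i <= k)%N by rewrite -ltnS.
rewrite /bump add1n padic_binomS subSS subSn // padic_binomS natrB //.
by move: (padic_binom x i) (padic_binom y (k - i)) ((i : nat)%:R) (k%:R) => a b c d; ring.
Qed.

End Padic.

(** * Frobenius and Gamma as substitutions *)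

Section Substitution.
Variables (R : realType) (p : nat) (Qp : padicNumType R p) (A : ultraAlgType Qp).
Local Notation rb := (robba A).
Implicit Types (f g h : rb) (s sigma C D rho : R) (n : int).

Lemma robba_ofE (a : int -> A) n : robba_seq a -> robba_of a n = a n.
Proof. by move=> ha; rewrite /robba_of insubdK //; apply/asboolP. Qed.

Lemma gle_expz g s sigma n : 0 < s -> 0 < sigma -> gle g s sigma ->
  (n < 0 -> gle g^-1 s sigma^-1) -> gle (g ^ n) s (sigma ^ n).
Proof.
move=> s0 sg0 hg; case: n => k h; first by rewrite -!exprnP; apply: gleX.
by rewrite NegzE -!exprnN -!exprVn; apply: gleX => //; apply: h.
Qed.

(** Convergence of f(g) on the circle of radius s: f converges at radius sigma, and sigma bounds g
    there. The alternative [f n = 0] exempts negative powers when f is a power series, so that no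
    bound on g^-1 is required. *)
Definition subst_adm g f s sigma := [/\ 0 < sigma,
  null_family (fun n : int => unorm (f n) * sigma ^ n) &
  forall n, f n = 0 \/ gle (g ^ n) s (sigma ^ n)].

Lemma subst_null g f s sigma k : 0 < s -> subst_adm g f s sigma ->
  null_family (unorm \o (fun n : int => f n * (g ^ n) k)).
Proof.
move=> s0 [sg0 nf hg]; apply: null_le (null_scale (sz0 (- k) s0) nf) => n /=.
apply: le_trans (unormM_le _ _) _; case: (hg n) => [->|/(_ k)].
  by rewrite unorm0 !mul0r mulr0.
rewrite -ler_pdivlMr ?exprz_gt0 // => h.
by rewrite [leRHS]mulrCA ler_wpM2l ?unorm_ge0 // -invr_expz mulrC.
Qed.

Lemma subst_coef_le g f s sigma C k : 0 < s -> subst_adm g f s sigma -> gle f sigma C ->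
  unorm (usum (fun n : int => f n * (g ^ n) k)) * s ^ k <= C.
Proof.
move=> s0 adm hC; have [sg0 nf hg] := adm; have C0 := gle_ge0 sg0 hC.
rewrite -ler_pdivlMr ?exprz_gt0 //; apply: usum_le0.
- by rewrite divr_ge0 // sz0.
- exact: subst_null adm.
- move=> n; apply: le_trans (unormM_le _ _) _; case: (hg n) => [->|/(_ k)].
    by rewrite unorm0 mul0r divr_ge0 // sz0.
  rewrite -ler_pdivlMr ?exprz_gt0 // => h; apply: le_trans (_ : unorm (f n) * (sigma ^ n / s ^ k) <= _).
    by rewrite ler_wpM2l ?unorm_ge0.
  by rewrite mulrA ler_wpM2r ?invr_ge0 ?sz0.
Qed.

(** [robba_of] returns 0 outside the Robba ring; admissibility on a whole annulus shows that this
    default is not taken. *)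
Lemma robba_subst_def g f rho : 0 <= rho < 1 ->
  (forall s, rho < s < 1 -> exists sigma, subst_adm g f s sigma) ->
  forall k, robba_subst g f k = usum (fun n : int => f n * (g ^ n) k).
Proof.
move=> r01 h k; rewrite /robba_subst robba_ofE //.
apply: (onann_robba_seq r01) => s rs; have [sigma adm] := h s rs.
have s0 : 0 < s by case/andP: r01 rs => r0 _ /andP[rs _]; apply: le_lt_trans rs.
have [sg0 nf _] := adm; have [B B0 hB] := null_bounded nf.
by exists B => n; apply: subst_coef_le adm _.
Qed.

Lemma subst_mon g n : robba_subst g (mon A n) = g ^ n.
Proof.
have e k : usum (fun i : int => mon A n i * (g ^ i) k) = (g ^ n) k.
  rewrite (@usum_single _ _ _ _ n) ?monE ?eqxx ?mul1r // => i /negPf i0.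
  by rewrite monE i0 mul0r.
apply: robba_ext => k; rewrite /robba_subst robba_ofE //.
by rewrite (_ : (fun k => _) = g ^ n); [apply: robbaP|apply/funext].
Qed.

Lemma subst_const g c : robba_subst g (robba_const c) = robba_const c.
Proof.
have e k : usum (fun i : int => robba_const c i * (g ^ i) k) = robba_const c k.
  rewrite (@usum_single _ _ _ _ 0).
    by rewrite expr0z robba1E !robbaCE eqxx; case: eqP; rewrite ?mulr1 ?mulr0.
  by move=> i /negPf i0; rewrite robbaCE i0 mul0r.
apply: robba_ext => k; rewrite /robba_subst robba_ofE //.
by rewrite (_ : (fun k => _) = robba_const c); [apply: robbaP|apply/funext].
Qed.

Lemma plus_exp0 g n k : plus g -> g 0 = 0 -> (k < n) -> 0 <= n -> (g ^ n) k = 0.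
Proof.
move=> gp g0; case: n => // n kn _; rewrite -exprnP.
have -> : g = mon A 1 * (mon A (- 1) * g) by rewrite mulrA mon_mon subrr mon0 mul1r.
have mp : plus (mon A (- 1) * g).
  move=> i i0; rewrite mon_mulE opprK; have [i1|i1] := ltP (i + 1) 0; first exact: gp.
  by have -> : i + 1 = 0 by lia.
by rewrite exprMn mon_exp natz mon_mulE (plusX n mp) // subr_lt0.
Qed.

Lemma subst_plus g f rho : plus g -> g 0 = 0 -> plus f -> 0 <= rho < 1 ->
  (forall s, rho < s < 1 -> exists sigma, subst_adm g f s sigma) ->
  plus (robba_subst g f).
Proof.
move=> gp g0 fp r01 h k k0; rewrite (robba_subst_def r01 h) usum_zero // => n.
have [n0|n0] := ltP n 0; first by rewrite fp // mul0r.
by rewrite plus_exp0 ?mulr0 // (lt_le_trans k0).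
Qed.

End Substitution.

Section FrobeniusGamma.
Variables (R : realType) (p : nat) (Qp : padicNumType R p) (A : ultraAlgType Qp).
Local Notation rb := (robba A).
Local Notation pr := (p%:R : R).
Implicit Types (f g h : rb) (s sigma C D rho : R) (n : int) (x y : Qp).

Lemma robba_XE : robba_X A = mon A 1.
Proof. by apply: robba_ext => n; rewrite /robba_X robba_ofE ?monE //; apply: (robbaP (mon A 1)). Qed.

Lemma norm_algnat (n : nat) : unorm (n%:R : A) = unorm (n%:R : Qp).
Proof. by rewrite -(@unorm_alg R Qp A) scaler_nat. Qed.

Lemma robba_seq_1X x : unorm x <= 1 ->
  robba_seq (fun n : int => if n is Posz j then (padic_binom x j)%:A else 0 : A).
Proof.
move=> x1; apply: (@onann_robba_seq _ _ _ 0); first by rewrite lexx ltr01.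
move=> s /andP[s0 s1]; exists 1 => -[j|j]; last by rewrite unorm0 mul0r.
rewrite unorm_alg -exprnP -[leRHS]mulr1 ler_pM ?unorm_ge0 ?exprn_ge0 ?(ltW s0) //.
  exact: padic_binom_le1.
by rewrite exprn_ile1 // ltW.
Qed.

Lemma onepE x (j : nat) : unorm x <= 1 -> robba_1X_pow A x j = (padic_binom x j)%:A.
Proof. by move=> x1; rewrite /robba_1X_pow robba_ofE //; apply: robba_seq_1X. Qed.

Lemma plus_onep x : unorm x <= 1 -> plus (robba_1X_pow A x).
Proof.
by move=> x1 [j|j] // _; rewrite /robba_1X_pow robba_ofE //; apply: robba_seq_1X.
Qed.

Lemma onepD x y : unorm x <= 1 -> unorm y <= 1 ->
  robba_1X_pow A x * robba_1X_pow A y = robba_1X_pow A (x + y).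
Proof.
move=> x1 y1; have xy1 : unorm (x + y) <= 1.
  by rewrite (le_trans (unormD_le _ _)) // ge_max x1.
apply: robba_ext => -[k|k]; last first.
  by rewrite plus_onep //; apply: plusM => //; apply: plus_onep.
rewrite robbaM_plus; [|exact: plus_onep..].
rewrite onepE // -padic_binom_vandermonde scaler_suml; apply: eq_bigr => i _.
by rewrite !onepE // -scalerAl mul1r scalerA.
Qed.

Lemma onep0 : robba_1X_pow A 0 = 1.
Proof.
apply: robba_ext => -[[|k]|k]; last by rewrite plus_onep ?unorm0 ?ler01 // robba1E.
  by rewrite onepE ?unorm0 ?ler01 // padic_binom0 scale1r robba1E.
rewrite onepE ?unorm0 ?ler01 // (padic_binom_nat Qp 0) bin_small // robba1E.
by rewrite scale0r.
Qed.

Lemma onep1 : robba_1X_pow A 1 = 1 + mon A 1.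
Proof.
have n1 : unorm (1 : Qp) <= 1 by rewrite unorm1.
apply: robba_ext => -[k|k]; last first.
  by rewrite plus_onep // robbaDE robba1E monE addr0.
rewrite onepE // (padic_binom_nat Qp 1) robbaDE robba1E monE scaler_nat.
by case: k => [|[|k]]; rewrite ?bin0 ?binn ?bin_small ?addr0 ?add0r.
Qed.

Lemma onepX x k : unorm x <= 1 -> robba_1X_pow A x ^+ k = robba_1X_pow A (x *+ k).
Proof.
move=> x1; elim: k => [|k IH]; first by rewrite mulr0n onep0.
rewrite exprS IH onepD ?mulrS // -mulr_natr unormM -[leRHS]mulr1.
by rewrite ler_pM ?unorm_ge0 ?unorm_nat_le1.
Qed.

Lemma onep_nat k : robba_1X_pow A k%:R = (1 + mon A 1) ^+ k.
Proof. by rewrite -onep1 onepX ?unorm1. Qed.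

Lemma onep_natE k (j : nat) : ((1 + mon A 1) ^+ k : rb) j = 'C(k, j)%:R.
Proof.
by rewrite -onep_nat onepE ?unorm_nat_le1 // padic_binom_nat scaler_nat.
Qed.

(** This is phi^N(X), see [phn_X]; its zeros are zeta - 1 with zeta^(p^N) = 1. *)
Definition PN N : rb := (1 + mon A 1) ^+ (p ^ N) - 1.

Lemma plus_onepX k : plus ((1 + mon A 1) ^+ k : rb).
Proof. by rewrite -onep_nat; apply: plus_onep; apply: unorm_nat_le1. Qed.

Lemma plus_PN N : plus (PN N).
Proof. by apply: plusB; [apply: plus_onepX|apply: plus1]. Qed.

Lemma PN0 N : PN N 0 = 0.
Proof. by rewrite robbaBE onep_natE bin0 robba1E subrr. Qed.

Lemma dvd_bin_pX N j : (0 < j < p ^ N)%N -> (p %| 'C(p ^ N, j))%N.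
Proof.
case/andP; case: j => // j _ jp; have pp := p_prime Qp.
apply/negPn/negP => pn; have : (p ^ N %| j.+1)%N.
  rewrite -(@Gauss_dvdl _ _ 'C(p ^ N, j.+1)); last first.
    by rewrite coprimeXl // prime_coprime.
  by rewrite -mul_bin_diag dvdn_mulr.
by move/(dvdn_leq (ltn0Sn j)); rewrite leqNgt jp.
Qed.

Lemma PN_dom N s : 0 < s <= 1 -> gle (PN N - mon A (p ^ N)%N) s pr^-1.
Proof.
move=> /andP[s0 s1] [j|j]; last first.
  have pl : plus (PN N - mon A (p ^ N)%N) by apply: plusB; [apply: plus_PN|apply: plus_mon].
  by rewrite pl // unorm0 mul0r invr_ge0 ler0n.
have ip : 0 <= pr^-1 by rewrite invr_ge0 ler0n.
rewrite robbaBE monE robbaBE onep_natE robba1E; case: j => [|j].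
  by rewrite bin0 subrr sub0r eqz_nat eq_sym gtn_eqF ?expn_gt0 ?(p_gt0 Qp) // oppr0 unorm0 mul0r.
rewrite subr0 eqz_nat; case: ltngtP => jp; last first.
- by rewrite jp binn subrr unorm0 mul0r.
- by rewrite bin_small // subrr unorm0 mul0r.
rewrite subr0 norm_algnat -exprnP -[leRHS]mulr1 ler_pM ?unorm_ge0 ?exprn_ge0 ?(ltW s0) //.
  by have := @norm_dvd R p Qp 'C(p ^ N, j.+1) 1; rewrite expn1 expr1; apply; apply: dvd_bin_pX.
by rewrite exprn_ile1 // ltW.
Qed.

(** Chosen so that, by Bernoulli, s^(p^N) > 1/2 >= 1/p beyond this radius: there the monomial
    X^(p^N) dominates the rest of [PN N], which has norm at most 1/p. *)
Definition rhoN N : R := 1 - (2 * (p ^ N)%:R)^-1.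

Lemma rhoN_bnd N s : 0 <= rhoN N < 1 /\ (rhoN N < s -> pr^-1 < s ^ (p ^ N)%N).
Proof.
have d0 : (0 < p ^ N)%N by rewrite expn_gt0 (p_gt0 Qp).
set d := (p ^ N)%N in d0 *; have dr : 0 < 2 * d%:R :> R by rewrite mulr_gt0 ?ltr0n.
have d1 : (2 * d%:R)^-1 <= 2^-1 :> R.
  by rewrite lef_pV2 ?posrE // -[leLHS]mulr1 ler_pM2l // ler1n.
have h2 : (2^-1 : R) <= 1 by rewrite invf_le1 // ler1n.
have r0 : 0 <= rhoN N by rewrite subr_ge0 (le_trans d1).
split; first by rewrite r0 /= ltrBlDr ltrDl invr_gt0.
move=> rs; have bern m : 1 - m%:R * (2 * d%:R)^-1 <= rhoN N ^+ m.
  elim: m => [|m IH]; first by rewrite mul0r subr0.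
  rewrite exprS; apply: le_trans (ler_wpM2l r0 IH); rewrite /rhoN -/d -natr1.
  set y := (2 * d%:R)^-1; have y0 : 0 <= y by rewrite invr_ge0 ltW.
  rewrite -subr_ge0; have -> : (1 - y) * (1 - m%:R * y) - (1 - (m%:R + 1) * y) = m%:R * y * y by ring.
  by rewrite !mulr_ge0.
apply: le_lt_trans (_ : rhoN N ^+ d < _); last first.
  by rewrite -exprnP ltrXn2r -?lt0n // nnegrE // (le_trans r0) // ltW.
apply: le_trans (bern d); rewrite invfM mulrCA divff ?mulr1 ?pnatr_eq0 -?lt0n //.
have -> : 1 - 2^-1 = 2^-1 :> R by field.
by rewrite lef_pV2 ?posrE ?(pr_gt0 Qp) // (ler_nat R 2 p) prime_gt1 // (p_prime Qp).
Qed.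

Lemma gle_PN N s : rhoN N < s <= 1 -> gle (PN N) s (s ^ (p ^ N)%N).
Proof.
move=> /andP[rs s1]; have [/andP[r0 _] h] := rhoN_bnd N s.
have s0 : 0 < s by apply: le_lt_trans rs.
rewrite -(subrK (mon A (p ^ N)%N) (PN N)); apply: gleD => //; last exact: gle_mon.
by apply: gle_mono (PN_dom N _); [apply/ltW/h|rewrite s0].
Qed.

Lemma phXE : (1 + robba_X A) ^+ p - 1 = PN 1.
Proof. by rewrite robba_XE /PN expn1. Qed.

(* The Frobenius and the action of Gamma are substitutions of units; this is a
   formal consequence of semilinearity for the ring [robba E].              *)
Hypothesis PN1_unit : PN 1 \is a GRing.unit.

(** The inverse is only assumed to exist. Writing it as X^-p (1 - (phi(X) - X^p) phi(X)^-1) bounds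
    it by contraction with ratio p^-1 / s^p. *)
Lemma gle_PN1V : exists2 rho, rhoN 1 <= rho < 1 &
  forall s, rho < s < 1 -> gle (PN 1)^-1 s (s ^ p)^-1.
Proof.
have [rho /andP[r0 r1] hr] := robba_onann (PN 1)^-1.
have [/andP[q0 q1] _] := rhoN_bnd 1 1.
exists (Num.max (rhoN 1) rho); first by rewrite le_max lexx gt_max q1.
move=> s /andP[]; rewrite gt_max => /andP[qs rs] s1; have [_ /(_ qs)] := rhoN_bnd 1 s.
rewrite expn1 => hs; have s0 : 0 < s by apply: le_lt_trans rs.
have sp : 0 < s ^ p by rewrite exprz_gt0.
have [C hC] := hr s ltac:(by rewrite rs).
apply: (gle_contract (theta := pr^-1 / s ^ p) s0 _ _ hC).
- apply/andP; split; last by rewrite ltr_pdivrMr // mul1r.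
  by rewrite divr_ge0 ?(ltW sp) // invr_ge0 ler0n.
- by rewrite invr_ge0 ltW.
move=> B B0 hB; have -> : (PN 1)^-1 = mon A (- p%:Z) * (1 - (PN 1 - mon A p) * (PN 1)^-1).
  rewrite mulrBl divrr // opprB addrCA subrr addr0 mulrA mon_mon addNr mon0 mul1r //.
apply: gle_mono (_ : (s ^ p)^-1 * Num.max 1 (pr^-1 * B) <= _) _.
  rewrite maxr_pMr ?invr_ge0 ?(ltW sp) // mulr1 ge_max !le_max lexx /=.
  by rewrite mulrA [_^-1 * pr^-1]mulrC lexx orbT.
rewrite invr_expz; apply: gleM => //; first exact: gle_mon.
apply: gleB => //; first by apply: gle_mono (gle1 A s); rewrite le_max lexx.
apply: gle_mono (_ : pr^-1 * B <= _) _; first by rewrite le_max lexx orbT.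
by apply: gleM => //; have := @PN_dom 1 s; rewrite expn1; apply; rewrite s0 ltW.
Qed.

(** Near the boundary phi(X) has norm at most s^p and its inverse at most s^-p, so radius s for
    phi(f) corresponds to radius s^p for f. *)
Lemma phi_adm rho : 0 <= rho < 1 -> exists2 rho', rho <= rho' < 1 &
  forall s, rho' < s < 1 -> rho < s ^ p < 1 /\
    forall f, onann rho f -> subst_adm (PN 1) f s (s ^ p).
Proof.
move=> /andP[r0 r1]; have [q /andP[q0 q1] hq] := gle_PN1V.
have [/andP[q0' _] _] := rhoN_bnd 1 1.
(* By Bernoulli s^p >= 1 - p (1 - s), which exceeds rho as soon as s > 1 - (1 - rho)/p. *)
pose rho' := Num.max q (Num.max rho (1 - (1 - rho) / p%:R)).
have p0 := pr_gt0 Qp.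
have r'1 : rho' < 1.
  by rewrite !gt_max q1 r1 /= ltrBlDr ltrDl divr_gt0 // subr_gt0.
exists rho'; first by rewrite r'1 !le_max lexx orbT.
move=> s /andP[]; rewrite !gt_max => /and3P[qs rs ss] s1.
have s0 : 0 < s by apply: le_lt_trans rs.
have sp1 : s ^ p < 1 by rewrite -exprnP exprn_ilt1 ?ltW // -lt0n (p_gt0 Qp).
have sp : rho < s ^ p.
  have bern m : (m <= p)%N -> 1 - m%:R * ((1 - s)) <= s ^+ m.
    elim: m => [|m IH] mp; first by rewrite mul0r subr0.
    rewrite exprS; apply: le_trans (ler_wpM2l (ltW s0) (IH (ltnW mp))).
    rewrite -natr1 -subr_ge0.
    have -> : s * (1 - m%:R * (1 - s)) - (1 - (m%:R + 1) * (1 - s)) = m%:R * (1 - s) * (1 - s) by ring.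
    by rewrite !mulr_ge0 // subr_ge0 ltW.
  apply: lt_le_trans (bern p (leqnn p)).
  have : (1 - s) * p%:R < 1 - rho.
    by rewrite -ltr_pdivlMr //; move: ss; set y := _ / _ => ss; lra.
  by rewrite mulrC; set y := _ * _ => ss'; lra.
split=> [|f hf]; first by rewrite sp.
have s'0 : 0 < s ^ p by rewrite exprz_gt0.
split=> // [|n]; first by apply: onann_null r0 hf _ _; rewrite sp.
right; apply: gle_expz => // [|_]; last by apply: hq; rewrite qs.
have := @gle_PN 1 s; rewrite expn1; apply; rewrite (ltW s1) andbT.
exact: le_lt_trans qs.
Qed.

End FrobeniusGamma.

Section GammaBounds.
Variables (R : realType) (p : nat) (Qp : padicNumType R p) (A : ultraAlgType Qp).
Local Notation rb := (robba A).
Implicit Types (f g h : rb) (s C D rho : R) (n : int).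
Variable x : Qp.
Hypothesis xu : unorm x = 1.
Local Notation g := (robba_1X_pow A x - 1 : rb).

Let x1 : unorm x <= 1. Proof. by rewrite xu. Qed.

Lemma plus_gX : plus g.
Proof. by apply: plusB; [apply: plus_onep|apply: plus1]. Qed.

Lemma gX0 : g 0 = 0.
Proof. by rewrite robbaBE onepE // padic_binom0 scale1r robba1E subrr. Qed.

Definition vX : rb := mon A (- 1) * g.

Lemma vXE : g = mon A 1 * vX.
Proof. by rewrite /vX mulrA mon_mon subrr mon0 mul1r. Qed.

Lemma plus_vX : plus vX.
Proof.
move=> n n0; rewrite mon_mulE opprK; have [i1|i1] := ltP (n + 1) 0; first exact: plus_gX.
by have -> : n + 1 = 0 by [lia]; apply: gX0.
Qed.

Lemma vX_coef (k : nat) : vX k = (padic_binom x k.+1)%:A.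
Proof. by rewrite mon_mulE opprK -[k%:Z + 1]/((k + 1)%N%:Z) addn1 robbaBE onepE // robba1E subr0. Qed.

Lemma vX0 : vX 0 = x%:A.
Proof.
rewrite (vX_coef 0); congr (_ *: _); rewrite -[LHS]mul1r -[1]/(1%:R) padic_binomS.
by rewrite padic_binom0 subr0 mulr1.
Qed.

Lemma gle_vX s : 0 < s <= 1 -> gle vX s 1.
Proof.
move=> /andP[s0 s1] [k|k]; last by rewrite plus_vX // unorm0 mul0r.
rewrite vX_coef unorm_alg -exprnP -[leRHS]mulr1 ler_pM ?unorm_ge0 ?exprn_ge0 ?(ltW s0) //.
  exact: padic_binom_le1.
by rewrite exprn_ile1 // ltW.
Qed.

Lemma gle_vXB s : 0 < s <= 1 -> gle (vX - robba_const x%:A) s s.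
Proof.
move=> /andP[s0 s1] [[|k]|k].
- by rewrite robbaBE vX0 robbaCE subrr unorm0 mul0r ltW.
- rewrite robbaBE robbaCE subr0 vX_coef unorm_alg -exprnP exprS mulrCA -[leRHS]mulr1.
  rewrite ler_wpM2l ?(ltW s0) // -[leRHS]mulr1 ler_pM ?unorm_ge0 ?exprn_ge0 ?(ltW s0) //.
    exact: padic_binom_le1.
  by rewrite exprn_ile1 // ltW.
- by rewrite robbaBE plus_vX // robbaCE subr0 unorm0 mul0r ltW.
Qed.

Lemma gle_gX s : 0 < s <= 1 -> gle g s s.
Proof.
move=> s01; case/andP: (s01) => s0 _; rewrite vXE -[s in gle _ _ s]mulr1.
by apply: gleM => //; [have := gle_mon A 1 s0|apply: gle_vX].
Qed.

Hypothesis gunit : g \is a GRing.unit.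

Lemma vX_unit : vX \is a GRing.unit.
Proof.
rewrite unitrM gunit andbT; apply/unitrPr; exists (mon A 1).
by rewrite mon_mon addNr mon0.
Qed.

Let xn : x != 0. Proof. by apply: contra_eq_neq xu => ->; rewrite unorm0 eq_sym oner_eq0. Qed.
Let xi := robba_const ((x^-1)%:A : A).

Let xi1 s : gle xi s 1.
Proof. by have := @gle_const _ A (x^-1)%:A s; rewrite unorm_alg unormV xu invr1. Qed.

Let vXVE : vX^-1 = xi * (1 - (vX - robba_const x%:A) * vX^-1).
Proof.
have -> : 1 - (vX - robba_const x%:A) * vX^-1 = robba_const x%:A * vX^-1.
  by rewrite mulrBl divrr ?vX_unit //; ring.
rewrite mulrA (_ : xi * _ = 1) ?mul1r //; apply: robba_ext => n.
rewrite robbaME (@usum_single _ _ _ _ 0).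
  rewrite robba1E subr0 !robbaCE eqxx; case: eqP => _; rewrite ?mulr0 //.
  by rewrite -scalerAl mul1r scalerA mulVf // scale1r.
by move=> i /negPf i0; rewrite robbaCE i0 mul0r.
Qed.

(** Up to power series, the polar part m of vX^-1 satisfies m = - x^-1 (vX - x) m; as |vX - x|_s <=
    s < 1, it contracts to 0. *)
Lemma plus_vXV : plus vX^-1.
Proof.
apply: minus_eq0; have [rho /andP[r0 r1] hr] := robba_onann vX^-1.
pose s := (rho + 1) / 2; have rs : rho < s < 1 by rewrite !midf_lt.
have s0 : 0 < s by apply: le_lt_trans (proj1 (andP rs)).
have [C hC] := hr s rs; have s1 : s < 1 by case/andP: rs.
apply: (gle_contract0 (theta := s) s0 _ (gle_robba_minus s0 hC)); first by rewrite ltW.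
move=> B B0 hB.
have -> : robba_minus vX^-1 = robba_minus (- xi * ((vX - robba_const x%:A) * robba_minus vX^-1)).
  rewrite {1}vXVE -{1}(plus_minusE vX^-1).
  set m := robba_minus vX^-1; set q := robba_plus vX^-1; set w := vX - _.
  have -> : xi * (1 - w * (q + m)) = (xi - xi * (w * q)) + - xi * (w * m) by ring.
  rewrite robba_minusD robba_minus_plus ?add0r //.
  apply: plusB; first exact: plus_const.
  apply: plusM; first exact: plus_const.
  apply: plusM; last exact: plus_plus.
  by apply: plusB; [apply: plus_vX|apply: plus_const].
apply: gle_robba_minus => //; rewrite -[s * B]mul1r; apply: gleM => //.
  by apply: gleN; apply: xi1.
by apply: gleM => //; apply: gle_vXB; rewrite s0 ltW.
Qed.

Lemma gle_vXV s : 0 < s < 1 -> gle vX^-1 s 1.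
Proof.
move=> /andP[s0 s1]; have [C hC] := plus_onann plus_vXV (introT andP (conj s0 s1)).
apply: (gle_contract (theta := s) s0 _ ler01 hC); first by rewrite ltW.
move=> B B0 hB; rewrite vXVE -[Num.max _ _]mul1r; apply: gleM => //.
apply: gleB => //; first by apply: gle_mono (gle1 A s); rewrite le_max lexx.
apply: gle_mono (_ : s * B <= _) _; first by rewrite le_max lexx orbT.
by apply: gleM => //; apply: gle_vXB; rewrite s0 ltW.
Qed.

Lemma gle_gXV s : 0 < s < 1 -> gle g^-1 s s^-1.
Proof.
move=> s01; case/andP: (s01) => s0 _.
have mu : mon A 1 \is a GRing.unit by apply/unitrPr; exists (mon A (- 1)); rewrite mon_mon subrr mon0.
have mi : (mon A 1)^-1 = mon A (- 1).
  by apply: (mulrI mu); rewrite divrr // mon_mon subrr mon0.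
rewrite vXE invrM ?vX_unit // mi -[s^-1]mul1r; apply: gleM => //; first exact: gle_vXV.
by have := gle_mon A (- 1) s0; rewrite -exprnN expr1.
Qed.

Lemma gamma_adm f rho s : 0 <= rho -> onann rho f -> rho < s < 1 -> subst_adm g f s s.
Proof.
move=> r0 hf rs; have s0 : 0 < s by apply: le_lt_trans (proj1 (andP rs)).
have s1 : s < 1 by case/andP: rs.
split=> // [|n]; first exact: onann_null hf _ rs.
right; apply: gle_expz => // [|_]; first by apply: gle_gX; rewrite s0 ltW.
by apply: gle_gXV; rewrite s0.
Qed.

Lemma gle_gamma f rho s C : 0 <= rho < 1 -> onann rho f -> rho < s < 1 -> gle f s C ->
  gle (robba_gamma x f) s C.
Proof.
move=> r01 hf rs hC k; have r0 : 0 <= rho by case/andP: r01.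
have s0 : 0 < s by apply: le_lt_trans (proj1 (andP rs)).
rewrite /robba_gamma (robba_subst_def r01).
  exact: subst_coef_le (gamma_adm r0 hf rs) hC.
by move=> s' rs'; exists s'; apply: gamma_adm hf rs'.
Qed.

Lemma plus_gamma f : plus f -> plus (robba_gamma x f).
Proof.
move=> fp; have r01 : 0 <= (0 : R) < 1 by rewrite lexx ltr01.
apply: (subst_plus plus_gX gX0 fp r01) => s rs; exists s.
by apply: gamma_adm (plus_onann fp) rs.
Qed.

End GammaBounds.

Section FrobeniusBounds.
Variables (R : realType) (p : nat) (Qp : padicNumType R p) (A : ultraAlgType Qp).
Local Notation rb := (robba A).
Hypothesis PN1_unit : PN A 1 \is a GRing.unit.
Implicit Types (f g h : rb) (s C D rho : R) (n : int).

Lemma phi_coef f : exists2 rho, 0 <= rho < 1 &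
  forall s, rho < s < 1 -> subst_adm (PN A 1) f s (s ^ p).
Proof.
have [rho r01 hf] := robba_onann f; have [rho' /andP[rr r1] h] := phi_adm PN1_unit r01.
exists rho' => [|s rs]; last by have [_ /(_ f hf)] := h s rs.
by rewrite r1 andbT (le_trans _ rr) //; case/andP: r01.
Qed.

Lemma robba_phiE f k : robba_phi f k = usum (fun n : int => f n * (PN A 1 ^ n) k).
Proof.
have [rho r01 h] := phi_coef f; rewrite /robba_phi phXE.
by apply: (robba_subst_def r01) => s rs; exists (s ^ p); apply: h.
Qed.

Lemma plus_phi f : plus f -> plus (robba_phi f).
Proof.
move=> fp k k0; rewrite robba_phiE usum_zero // => n.
have [n0|n0] := ltP n 0; first by rewrite fp // mul0r.
by rewrite (plus_exp0 (plus_PN _ _) (PN0 _ _)) ?mulr0 // (lt_le_trans k0).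
Qed.

(** A power series involves no negative powers of phi(X), so no bound on its inverse enters and
    every radius in (0, 1) is allowed. *)
Lemma gle_phi_plus f s sigma C : plus f -> 0 < s < 1 -> 0 < sigma < 1 ->
  gle (PN A 1) s sigma -> gle f sigma C -> gle (robba_phi f) s C.
Proof.
move=> fp /andP[s0 s1] sg01 hP hC k; rewrite robba_phiE.
have sg0 : 0 < sigma by case/andP: sg01.
apply: subst_coef_le (_ : subst_adm _ f s sigma) hC => //; split=> // [|n].
  by apply: onann_null (plus_onann fp) _ sg01.
have [n0|n0] := ltP n 0; first by left; apply: fp.
by right; apply: gle_expz => // n0'; move: n0; rewrite leNgt n0'.
Qed.

End FrobeniusBounds.

(** * Frobenius and Gamma as ring morphisms *)

Local Opaque robba_subst usum padic_binom.

Section MakeMorphism.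
Variables (S T : nzRingType) (f : S -> T).
Hypotheses (fB : zmod_morphism f) (fM : monoid_morphism f).
Definition mk_rmorphism : {rmorphism S -> T} :=
  HB.pack_for {rmorphism S -> T} f (GRing.isZmodMorphism.Build S T f fB)
    (GRing.isMonoidMorphism.Build S T f fM).
End MakeMorphism.

Section SemilinearModules.
Variables (R : realType) (p : nat) (Qp : padicNumType R p) (A : ultraAlgType Qp).
Local Notation rb := (robba A).
Implicit Types (x y : Qp) (a b c : rb).

Lemma Zp_unitM x y : Zp_unit x -> Zp_unit y -> Zp_unit (x * y).
Proof. by rewrite /Zp_unit unormM => /eqP-> /eqP->; rewrite mulr1. Qed.
Lemma Zp_unit1 : Zp_unit (1 : Qp).
Proof. by rewrite /Zp_unit unorm1. Qed.
Lemma Zp_unitV x : Zp_unit x -> Zp_unit x^-1.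
Proof. by rewrite /Zp_unit unormV => /eqP->; rewrite invr1. Qed.
Lemma Zp_unit_neq0 x : Zp_unit x -> x != 0.
Proof. by apply: contraTneq => ->; rewrite /Zp_unit unorm0 eq_sym oner_eq0. Qed.

Lemma basis_cancel (M : lmodType rb) m (b : 'I_m -> M) i a :
  is_basis b -> a *: b i = 0 -> a = 0.
Proof.
move=> bb ab; have [c [_ cu]] := bb 0.
have c0 : c = 0 by apply: cu; rewrite big1 // => j _; rewrite mxE scale0r.
have : c = \row_j (if j == i then a else 0).
  apply: cu; rewrite (bigD1 i) //= big1 ?addr0; last first.
    by move=> j /negPf ji; rewrite mxE ji scale0r.
  by rewrite mxE eqxx ab.
by move=> /rowP/(_ i); rewrite c0 !mxE eqxx.
Qed.

Lemma robba_phi1 : robba_phi (1 : rb) = 1.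
Proof. exact: (subst_const _ 1). Qed.
Lemma robba_gamma1 x : robba_gamma x (1 : rb) = 1.
Proof. exact: (subst_const _ 1). Qed.

Section Consequences.
Variables (D : pgmod A) (m : nat).
Hypothesis DP : is_phiGamma D m.

Lemma pg_phiD (u v : D) : pg_phi (u + v) = pg_phi u + pg_phi v.
Proof. by have [h _ _ _ _] := DP; have := h 1 u v; rewrite !scale1r robba_phi1 scale1r. Qed.
Lemma pg_phi0 : pg_phi (0 : D) = 0.
Proof. by apply: (addrI (pg_phi 0)); rewrite -pg_phiD !addr0. Qed.
Lemma pg_phiZ a (u : D) : pg_phi (a *: u) = robba_phi a *: pg_phi u.
Proof. by have [h _ _ _ _] := DP; have := h a u 0; rewrite pg_phi0 !addr0. Qed.
Lemma pg_phiN (u : D) : pg_phi (- u) = - pg_phi u.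
Proof. by apply: (addrI (pg_phi u)); rewrite -pg_phiD !subrr pg_phi0. Qed.
Lemma pg_phiB (u v : D) : pg_phi (u - v) = pg_phi u - pg_phi v.
Proof. by rewrite pg_phiD pg_phiN. Qed.
Variables (x : Qp).
Hypothesis xu : Zp_unit x.
Lemma pg_gammaD (u v : D) : pg_gamma x (u + v) = pg_gamma x u + pg_gamma x v.
Proof. by have [_ h _ _ _] := DP; have := h x xu 1 u v; rewrite !scale1r robba_gamma1 scale1r. Qed.
Lemma pg_gamma0 : pg_gamma x (0 : D) = 0.
Proof. by apply: (addrI (pg_gamma x 0)); rewrite -pg_gammaD !addr0. Qed.
Lemma pg_gammaZ a (u : D) : pg_gamma x (a *: u) = robba_gamma x a *: pg_gamma x u.
Proof. by have [_ h _ _ _] := DP; have := h x xu a u 0; rewrite pg_gamma0 !addr0. Qed.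
Lemma pg_gammaN (u : D) : pg_gamma x (- u) = - pg_gamma x u.
Proof. by apply: (addrI (pg_gamma x u)); rewrite -pg_gammaD !subrr pg_gamma0. Qed.
Lemma pg_gammaB (u v : D) : pg_gamma x (u - v) = pg_gamma x u - pg_gamma x v.
Proof. by rewrite pg_gammaD pg_gammaN. Qed.
Lemma pg_gamma1 (u : D) : pg_gamma 1 u = u.
Proof. by have [_ _ [h _] _ _] := DP. Qed.
Lemma pg_gammaM y (u : D) : Zp_unit y -> pg_gamma (x * y) u = pg_gamma x (pg_gamma y u).
Proof. by have [_ _ [_ h] _ _] := DP; move=> yu; apply: h. Qed.
Lemma pg_gammaVK (u : D) : pg_gamma x^-1 (pg_gamma x u) = u.
Proof.
have [_ _ [h1 h] _ _] := DP; rewrite -h ?Zp_unitV //.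
by rewrite mulVf ?h1 // Zp_unit_neq0.
Qed.
Lemma pg_phi_gamma (u : D) : pg_phi (pg_gamma x u) = pg_gamma x (pg_phi u).
Proof. by have [_ _ _ h _] := DP; apply: h. Qed.
End Consequences.

Variables (D : pgmod A) (m : nat).
Hypothesis DP : is_phiGamma D m.+1.

Let gamma_cancel x a (u : D) : Zp_unit x ->
  (forall c, c *: u = 0 -> c = 0) -> a *: pg_gamma x u = 0 -> a = 0.
Proof.
move=> xu hu au; have xVu := Zp_unitV xu.
have key c : robba_gamma x^-1 c = 0 -> c = 0.
  move=> gc; apply: hu; rewrite -(pg_gammaVK DP xVu (c *: u)).
  by rewrite (pg_gammaZ DP xVu) gc scale0r (pg_gamma0 DP) ?invrK.
apply/key/hu; rewrite -[u in LHS](pg_gammaVK DP xu) -(pg_gammaZ DP xVu) au.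
exact: pg_gamma0 DP _ xVu.
Qed.

Local Opaque robba_phi robba_gamma.
(** Multiplicativity of the substitutions is not proved on series but read off a module of positive
    rank: phi(a c) phi(u) and phi(a) phi(c) phi(u) both equal phi(a c u), and phi(u), a member of a
    basis, has no annihilator. The other identities follow in the same way. *)
Lemma robba_morphisms : exists (ph : {rmorphism rb -> rb}) (gm : Qp -> {rmorphism rb -> rb}),
  [/\ ph =1 @robba_phi _ _ _ A, forall x, Zp_unit x -> gm x =1 @robba_gamma _ _ _ A x,
      forall a, gm 1 a = a,
      forall x y, Zp_unit x -> Zp_unit y -> forall a, gm (x * y) a = gm x (gm y a) &
      forall x, Zp_unit x -> forall a, ph (gm x a) = gm x (ph a)].
Proof.
have [_ _ _ _ [b [bb bphi _]]] := DP; pose u := b ord0.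
have uc a : a *: u = 0 -> a = 0 by apply: basis_cancel.
have puc a : a *: pg_phi u = 0 -> a = 0 by apply: (basis_cancel (i := ord0) bphi).
have guc x a (xu : Zp_unit x) : a *: pg_gamma x u = 0 -> a = 0 by apply: gamma_cancel.
have eqc (v : D) a c : (forall d, d *: v = 0 -> d = 0) -> a *: v = c *: v -> a = c.
  move=> hv /eqP; rewrite -subr_eq0 -scalerBl => /eqP/hv/eqP; rewrite subr_eq0.
  by move/eqP.
have phM : monoid_morphism (@robba_phi _ _ _ A).
  split=> [|a c]; first exact: robba_phi1.
  by apply: (eqc _ _ _ puc); rewrite -(pg_phiZ DP) -scalerA !(pg_phiZ DP) scalerA.
have phB : zmod_morphism (@robba_phi _ _ _ A).
  move=> a c; apply: (eqc _ _ _ puc).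
  by rewrite scalerBl -!(pg_phiZ DP) -(pg_phiB DP) -scalerBl.
(* Outside Z_p^* the identity is taken, so that [gmf x] is a ring morphism for every x. *)
have [gmf [gmfE gmf_id]] : exists gmf : Qp -> rb -> rb,
    (forall x, Zp_unit x -> gmf x = @robba_gamma _ _ _ A x) /\
    (forall x, ~~ Zp_unit x -> gmf x = id).
  exists (fun x => if Zp_unit x then @robba_gamma _ _ _ A x else id).
  by split=> x => [->|/negPf->].
have gmM x : monoid_morphism (gmf x).
  have [xu|xu] := boolP (Zp_unit x); last by rewrite gmf_id //; split.
  rewrite (gmfE x xu); split=> [|a c]; first exact: robba_gamma1.
  apply: (eqc _ _ _ (fun c => guc x c xu)).
  by rewrite -(pg_gammaZ DP xu) -scalerA !(pg_gammaZ DP xu) scalerA.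
have gmB x : zmod_morphism (gmf x).
  have [xu|xu] := boolP (Zp_unit x); last by rewrite gmf_id.
  rewrite (gmfE x xu) => a c; apply: (eqc _ _ _ (fun c => guc x c xu)).
  by rewrite scalerBl -!(pg_gammaZ DP xu) -(pg_gammaB DP xu) -scalerBl.
have gm1 a : gmf 1 a = a.
  rewrite (gmfE 1 Zp_unit1); apply: (eqc _ _ _ uc).
  by rewrite -{1}(pg_gamma1 DP u) -(pg_gammaZ DP Zp_unit1) (pg_gamma1 DP).
have gmMM x y : Zp_unit x -> Zp_unit y -> forall a, gmf (x * y) a = gmf x (gmf y a).
  move=> xu yu a; have xyu := Zp_unitM xu yu.
  rewrite (gmfE _ xu) (gmfE _ yu) (gmfE _ xyu).
  have gc c : c *: pg_gamma (x * y) u = 0 -> c = 0 := @guc (x * y) c xyu.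
  apply: (eqc (pg_gamma (x * y) u) _ _ gc).
  have e1 := pg_gammaM DP xu (a *: u) yu.
  rewrite (pg_gammaZ DP yu a u) (pg_gammaZ DP xu) -(pg_gammaM DP xu u yu) in e1.
  exact: etrans (esym (pg_gammaZ DP xyu a u)) e1.
have phgm x : Zp_unit x -> forall a, robba_phi (gmf x a) = gmf x (robba_phi a).
  move=> xu a; rewrite (gmfE x xu).
  have pgc c : c *: pg_gamma x (pg_phi u) = 0 -> c = 0 by apply: gamma_cancel.
  have e1 := pg_phi_gamma DP xu (a *: u).
  rewrite (pg_gammaZ DP xu a u) (pg_phiZ DP (robba_gamma x a) (pg_gamma x u)) in e1.
  rewrite (pg_phiZ DP a u) (pg_gammaZ DP xu _ (pg_phi u)) (pg_phi_gamma DP xu u) in e1.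
  exact: (eqc (pg_gamma x (pg_phi u)) _ _ pgc e1).
exists (mk_rmorphism phB phM), (fun x => mk_rmorphism (gmB x) (gmM x)).
split; [by []| |exact: gm1|exact: gmMM|exact: phgm].
by move=> x xu a; rewrite -gmfE.
Qed.

End SemilinearModules.

(** * Logarithms *)

(** The ring-theoretic facts on phi and gamma used from here on, supplied once by [robba_morphisms].
    They also make every [PN n] a unit, being the image of the unit X under phi^n. *)
Record robba_ops (R : realType) (p : nat) (Qp : padicNumType R p) (A : ultraAlgType Qp) :=
  RobbaOps {
  op_phi : {rmorphism robba A -> robba A};
  op_gamma : Qp -> {rmorphism robba A -> robba A};
  op_phiE : op_phi =1 @robba_phi _ _ _ A;
  op_gammaE : forall x, Zp_unit x -> op_gamma x =1 @robba_gamma _ _ _ A x;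
  op_gamma1 : forall a, op_gamma 1 a = a;
  op_gammaM : forall x y, Zp_unit x -> Zp_unit y ->
    forall a, op_gamma (x * y) a = op_gamma x (op_gamma y a);
  op_phi_gamma : forall x, Zp_unit x -> forall a, op_phi (op_gamma x a) = op_gamma x (op_phi a)
}.

Section Constants.
Variables (R : realType) (A : ultraRingType R).
Local Notation rb := (robba A).
Local Notation C := (@robba_const R A).
Implicit Types (a b : A) (f : rb).

Lemma constM_coef a f n : (C a * f) n = a * f n.
Proof.
rewrite robbaME (@usum_single _ _ _ _ 0) ?robbaCE ?eqxx ?subr0 //.
by move=> i /negPf i0; rewrite robbaCE i0 mul0r.
Qed.
Lemma constD a b : C (a + b) = C a + C b.
Proof. by apply: robba_ext => n; rewrite robbaDE !robbaCE; case: eqP => _; rewrite ?addr0. Qed.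
Lemma constN a : C (- a) = - C a.
Proof. by apply: robba_ext => n; rewrite robbaNE !robbaCE; case: eqP => _; rewrite ?oppr0. Qed.
Lemma constB a b : C (a - b) = C a - C b. Proof. by rewrite constD constN. Qed.
Lemma constM a b : C (a * b) = C a * C b.
Proof. by apply: robba_ext => n; rewrite constM_coef !robbaCE; case: eqP => _; rewrite ?mulr0. Qed.
Lemma const0 : C 0 = 0. Proof. by []. Qed.
Lemma const1 : C 1 = 1. Proof. by []. Qed.
Lemma constX a n : C (a ^+ n) = C a ^+ n.
Proof. by elim: n => [|n IH]; rewrite ?expr0 // !exprS constM IH. Qed.
Lemma const_nat n : C n%:R = n%:R.
Proof. by elim: n => [|n IH] //; rewrite -!natr1 constD IH. Qed.
Lemma const_inj : injective C.
Proof. by move=> a b /(congr1 (fun f : rb => f 0)); rewrite !robbaCE eqxx. Qed.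
End Constants.

Section Logarithm.
Variables (R : realType) (p : nat) (Qp : padicNumType R p) (E : ultraFieldExtType Qp).
Local Notation rb := (robba E).
Local Notation C := (@robba_const R E).
Local Notation pr := (p%:R : R).
Implicit Types (f g u w L M : rb) (s rho beta : R) (n k : nat).

Lemma normE_nat n : unorm (n%:R : E) = unorm (n%:R : Qp).
Proof. exact: norm_algnat. Qed.
Lemma E_nat_neq0 n : (0 < n)%N -> (n%:R : E) != 0.
Proof.
move=> n0; have := norm_nat_neq0 Qp n0; rewrite -normE_nat.
by apply: contraTneq => ->; rewrite unorm0 ltxx.
Qed.
Lemma E_p_neq0 : (p%:R : E) != 0. Proof. exact: E_nat_neq0 (p_gt0 Qp). Qed.
Lemma normE_p : unorm (p%:R : E) = pr^-1. Proof. by rewrite normE_nat (normp Qp). Qed.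
Lemma normE_pV k : unorm ((p%:R : E) ^- k) = pr ^+ k.
Proof. by rewrite unormV unormX normE_p exprVn invrK. Qed.

Definition powdef u : rb := \sum_(2 <= i < p.+1) C ('C(p, i)%:R / p%:R) * u ^+ i.-1.

Lemma powdefE u : (1 + u) ^+ p - 1 = C p%:R * u * (1 + powdef u).
Proof.
have p2 : (2 <= p)%N by apply: prime_gt1; apply: (p_prime Qp).
rewrite [1 + u]addrC exprD1n -(big_mkord xpredT (fun i => u ^+ i *+ 'C(p, i))).
rewrite big_ltn // (@big_ltn _ _ _ 1) ?ltnS ?(ltnW p2) //.
rewrite expr0 bin0 bin1 mulr1n expr1 addrAC subrr add0r mulrDr mulr1; congr (_ + _).
  by rewrite const_nat mulr_natl.
rewrite mulr_sumr big_nat [RHS]big_nat; apply: eq_bigr => i /andP[i2 _].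
rewrite mulrACA -constM (_ : p%:R * _ = 'C(p, i)%:R); last by rewrite mulrC divfK ?E_p_neq0.
rewrite const_nat mulr_natl -exprS.
by rewrite prednK // (leq_trans _ i2).
Qed.

Lemma gle_powdef u s beta : 0 < s -> 0 <= beta <= 1 -> gle u s beta -> gle (powdef u) s (pr * beta).
Proof.
move=> s0 /andP[b0 b1] hu; have pp := pr_gt0 Qp.
apply: gle_sum => // [|i]; first by rewrite mulr_ge0 // ltW.
rewrite mem_index_iota => /andP[i2 _]; apply: gleM => //.
  apply: gle_mono (gle_const _ s); rewrite unormM unormV normE_p invrK -[leRHS]mul1r.
  by rewrite ler_wpM2r ?unorm_nat_le1 // ltW.
apply: gle_mono (gleX _ s0 hu); case: i i2 => [|[|i]] // _.
by rewrite /= exprS -[leRHS]mulr1 ler_wpM2l // exprn_ile1.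
Qed.

Lemma gle_powp u s beta : 0 < s -> 0 <= beta <= 1 -> gle u s beta ->
  gle ((1 + u) ^+ p - 1) s (Num.max pr^-1 (beta ^+ p.-1) * beta).
Proof.
move=> s0 /andP[b0 b1] hu; have pp := pr_gt0 Qp; have pri := p_prime Qp.
have p0 := prime_gt0 pri.
rewrite [1 + u]addrC exprD1n -(big_mkord xpredT (fun i => u ^+ i *+ 'C(p, i))).
rewrite big_ltn // expr0 bin0 mulr1n addrAC subrr add0r.
have m0 : 0 <= Num.max pr^-1 (beta ^+ p.-1) by rewrite le_max invr_ge0 ltW.
apply: gle_sum => // [|i]; first by rewrite mulr_ge0.
rewrite mem_index_iota => /andP[i1 ip]; rewrite -mulr_natl -const_nat.
have [->|ip'] := eqVneq i p.
  rewrite binn; apply: gle_mono (_ : 1 * beta ^+ p <= _) _.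
    by rewrite mul1r -{1}(prednK p0) exprSr ler_wpM2r // le_max lexx orbT.
  by rewrite const1; apply: gleM => //; [apply: gle1|apply: gleX].
apply: gle_mono (_ : pr^-1 * beta ^+ i <= _) _.
  apply: ler_pM; rewrite ?invr_ge0 ?exprn_ge0 ?(ltW pp) // ?le_max ?lexx //.
  by case: i i1 {ip ip'} => // i _; rewrite exprS -[leRHS]mulr1 ler_wpM2l // exprn_ile1.
apply: gleM => //; last exact: gleX.
apply: gle_mono (gle_const _ s); rewrite normE_nat.
have := @norm_dvd R p Qp 'C(p, i) 1; rewrite expn1 expr1; apply.
by apply: prime_dvd_bin => //; rewrite i1 ltn_neqAle ip' -ltnS.
Qed.

Lemma expr_pS u k : u ^+ (p ^ k.+1) = (1 + (u ^+ (p ^ k) - 1)) ^+ p.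
Proof. by rewrite addrC subrK -exprM -expnSr. Qed.

(** Raising to the power p multiplies the distance to 1 by at most [eta] < 1; once this distance is
    at most 1/p, each further step gains the full factor 1/p. The constant K absorbs the first N
    steps. *)
Lemma gle_pow_pk u s beta : 0 < s -> 0 <= beta < 1 -> gle (u - 1) s beta ->
  exists2 K, 0 <= K & forall k, gle (u ^+ (p ^ k) - 1) s (K * pr ^- k).
Proof.
move=> s0 /andP[b0 b1] hu; have pp := pr_gt0 Qp; have p2 := prime_gt1 (p_prime Qp).
pose eta := Num.max pr^-1 (beta ^+ p.-1).
have e1 : 0 <= eta < 1.
  rewrite le_max invr_ge0 ltW //= gt_max; case/andP: (prV_lt1 Qp) => _ -> /=.
  by rewrite exprn_ilt1 // -lt0n -ltnS (ltn_predK p2).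
have [e0 e1'] : 0 <= eta /\ eta < 1 by apply/andP.
have st1 k : gle (u ^+ (p ^ k) - 1) s (eta ^+ k * beta).
  elim: k => [|k IH]; first by rewrite expn0 !expr1 expr0 mul1r.
  have ek1 : eta ^+ k <= 1 by rewrite exprn_ile1 // ltW.
  have ekb : 0 <= eta ^+ k * beta <= 1.
    by rewrite mulr_ge0 ?exprn_ge0 //= mulr_ile1 ?exprn_ge0 // ltW.
  rewrite expr_pS; apply: gle_mono (gle_powp s0 ekb IH).
  rewrite exprS -mulrA ler_wpM2r //; first by case/andP: ekb.
  rewrite ge_max !le_max lexx /= lerXn2r ?nnegrE // ?orbT //; first by case/andP: ekb.
  by rewrite -[leRHS]mul1r ler_wpM2r.
have pV0 : 0 < pr^-1 by rewrite invr_gt0.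
have [N hN] := geometric_small beta e1 pV0.
exists (pr ^+ N) => [|k]; first by rewrite exprn_ge0 // ltW.
have [kN|Nk] := leqP k N.
  apply: gle_mono (st1 k); apply: le_trans (_ : 1 <= _).
    by rewrite mulr_ile1 ?exprn_ge0 // ?exprn_ile1 // ltW.
  rewrite ler_pdivlMr ?exprn_gt0 // mul1r ler_weXn2l // ltW //; exact: pr_gt1 Qp.
rewrite -(subnKC (ltnW Nk)); elim: (k - N)%N => [|j IH].
  rewrite addn0 divff ?expf_neq0 ?gt_eqF //; apply: gle_mono (st1 N).
  by rewrite mulr_ile1 ?exprn_ge0 // ?exprn_ile1 // ltW.
have st2 i : gle (u ^+ (p ^ (N + i)) - 1) s (pr^-1 * pr ^- i).
  elim: i {IH} => [|i IH].
    by rewrite addn0 divr1; apply: gle_mono (st1 N); rewrite mulrC ltW // hN.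
  have b01 : 0 <= pr^-1 * pr ^- i <= 1.
    have [h0 h1] := andP (prV_lt1 Qp).
    by rewrite mulr_ge0 ?invr_ge0 ?exprn_ge0 ?(ltW pp) //= mulr_ile1 ?invr_ge0 ?exprn_ge0 ?(ltW pp) // -?exprVn ?exprn_ile1 // ltW.
  rewrite addnS expr_pS; apply: gle_mono (gle_powp s0 b01 IH).
  have [h0 h1] := andP (prV_lt1 Qp); have [b0' b1'] := andP b01.
  have -> : pr^-1 * pr ^- i.+1 = pr^-1 * (pr^-1 * pr ^- i) by rewrite -!exprVn exprS.
  rewrite ler_wpM2r // ge_max lexx /=.
  apply: le_trans (_ : pr^-1 * pr ^- i <= _).
    have : (0 < p.-1)%N by rewrite -ltnS (ltn_predK p2).
    by case: (p.-1) => // q _; rewrite exprS -[leRHS]mulr1 ler_wpM2l // exprn_ile1.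
  rewrite -[leRHS]mulr1 ler_wpM2l // -exprVn exprn_ile1 // ltW //.
apply: gle_mono (st2 j.+1); rewrite exprD invfM mulrA divff ?expf_neq0 ?gt_eqF //.
by rewrite ler_wpM2r ?invr_ge0 ?exprn_ge0 ?(ltW pp) //; case/andP: (prV_lt1 Qp) => _ /ltW.
Qed.

(** log u is defined as the limit of (u^(p^k) - 1)/p^k: additivity and compatibility with phi and
    gamma are then nearly formal, unlike for the power series of the logarithm. *)
Definition logseq u k : rb := C (p%:R ^- k) * (u ^+ (p ^ k) - 1).

Definition near1 rho u := onann rho u /\
  forall s, rho < s < 1 -> exists2 beta, 0 <= beta < 1 & gle (u - 1) s beta.

Definition islog rho u L := onann rho L /\ tends rho (logseq u) L.

Lemma onann_logseq rho u k : 0 <= rho -> onann rho u -> onann rho (logseq u k).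
Proof.
move=> r0 hu; apply: onannM => //; first exact: onann_const.
by apply: onannB => //; [apply: onannX|apply: onann1].
Qed.

(** By [powdefE] consecutive terms differ by a factor 1 + eps k with eps k tending to 0, so log u is
    u - 1 times a convergent infinite product. The factor u - 1 is displayed because divisibility of
    logarithms is needed later. *)
Lemma islog_ex rho u : 0 <= rho < 1 -> near1 rho u ->
  exists Y, [/\ onann rho Y, islog rho u ((u - 1) * Y) & plus u -> plus Y].
Proof.
move=> r01 [hu h1]; have r0 : 0 <= rho by case/andP: r01.
pose eps k := powdef (u ^+ (p ^ k) - 1).
have [Y [Y0 YS]] : exists Y : nat -> rb, Y 0%N = 1 /\ forall k, Y k.+1 = Y k * (1 + eps k).
  by exists (fix Y k := if k is k'.+1 then Y k' * (1 + eps k') else 1).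
have LY k : logseq u k = (u - 1) * Y k.
  elim: k => [|k IH].
    by rewrite /logseq expr0 invr1 const1 mul1r expn0 expr1 Y0 mulr1.
  rewrite YS [RHS]mulrA -IH /logseq expr_pS (powdefE (u ^+ (p ^ k) - 1)).
  have -> : C (p%:R ^- k) = C (p%:R ^- k.+1) * C p%:R.
    by rewrite -constM exprSr invfM mulfVK ?E_p_neq0.
  rewrite -/(eps k); move: (eps k) (C (p%:R ^- k.+1)) (C p%:R) (u ^+ (p ^ k) - 1).
  by move=> a b c d; ring.
have epsO k : onann rho (eps k).
  rewrite /eps /powdef big_nat; elim/big_ind: _ => [|a b|i _].
  - by have := @onann_const R E rho 0.
  - exact: onannD.
  apply: onannM => //; first exact: onann_const.
  by apply: onannX => //; apply: onannB => //; [apply: onannX|apply: onann1].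
have YO k : onann rho (Y k).
  elim: k => [|k IH]; first by rewrite Y0; apply: onann1.
  by rewrite YS; apply: onannM => //; apply: onannD => //; apply: onann1.
have eps0 : tends rho eps 0.
  move=> s e rs e0; have [beta b01 hb] := h1 s rs.
  have s0 : 0 < s by apply: le_lt_trans (proj1 (andP rs)).
  have [K K0 hK] := gle_pow_pk s0 b01 hb.
  have [N1 hN1] := geometric_small K (prV_lt1 Qp) (ltr01 : 0 < 1 :> R).
  have [N2 hN2] := geometric_small (pr * K) (prV_lt1 Qp) e0.
  exists (maxn N1 N2) => k; rewrite geq_max => /andP[k1 k2].
  rewrite sub0r; apply: gleN; apply: gle_mono (gle_powdef s0 _ (hK k)).
    by rewrite mulrA -exprVn ltW // hN2.
  rewrite mulr_ge0 ?invr_ge0 ?exprn_ge0 ?ler0n //= -exprVn ltW // hN1 //.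
(* From some index on |eps k|_s <= 1, so the partial products stop growing. *)
have Ybnd s : rho < s < 1 -> exists B, forall k, gle (Y k) s B.
  move=> rs; have s0 : 0 < s by apply: le_lt_trans (proj1 (andP rs)).
  have [N hN] := eps0 s 1 rs ltr01.
  have [D hD] : exists D, forall k, (k <= N)%N -> gle (Y k) s D.
    elim: N {hN} => [|N [D hD]].
      by have [D hD] := YO 0%N s rs; exists D => k; rewrite leqn0 => /eqP->.
    have [D' hD'] := YO N.+1 s rs; exists (Num.max D D') => k.
    rewrite leq_eqVlt => /orP[/eqP->|/hD h]; first by apply: gle_mono hD'; rewrite le_max lexx orbT.
    by apply: gle_mono h; rewrite le_max lexx.
  exists D => k; have [kN|Nk] := leqP k N; first exact: hD.
  rewrite -(subnKC (ltnW Nk)); elim: (k - N)%N => [|j IH]; first by rewrite addn0; apply: hD.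
  rewrite addnS YS -[D]mulr1; apply: gleM => //; apply: gleD => //; first exact: gle1.
  by rewrite -[eps _]opprK -[- eps _]sub0r; apply: gleN; apply: hN; apply: leq_addr.
have [F tF FO] : exists2 F, tends rho Y F & onann rho F.
  apply: rcauchy_lim => // s e rs e0.
  have [N hN] := tends_mulr0 r0 eps0 Ybnd rs e0; exists N => k /hN.
  by rewrite YS sub0r mulrDr mulr1 addrAC subrr add0r => h; rewrite mulrC -[_ * _]opprK; apply: gleN.
have u1O : onann rho (u - 1) by apply: onannB => //; apply: onann1.
exists F; split=> // [|up].
  split; first exact: onannM.
  rewrite (_ : logseq u = fun k => (u - 1) * Y k); last by apply/funext.
  exact: tendsZ.
apply: (tends_plus r01 tF); elim=> [|k IH]; first by rewrite Y0; apply: plus1.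
rewrite YS; apply: plusM => //; apply: plusD; first exact: plus1.
rewrite /eps /powdef big_nat; apply: plus_sum => i _.
apply: plusM; first exact: plus_const.
by apply: plusX; apply: plusB; [apply: plusX|apply: plus1].
Qed.

Lemma islog_uniq rho u L M : 0 <= rho < 1 -> islog rho u L -> islog rho u M -> L = M.
Proof. by move=> r01 [_ hL] [_ hM]; apply: tends_uniq hL hM. Qed.

(** From ab - 1 = (a - 1) + (b - 1) + (a - 1)(b - 1) with a = u^(p^k), b = w^(p^k): after division
    by p^k the last term keeps a factor p^k times bounded factors. *)
Lemma islogM rho u w L M : 0 <= rho < 1 -> onann rho u -> onann rho w ->
  islog rho u L -> islog rho w M -> islog rho (u * w) (L + M).
Proof.
move=> r01 uO wO [LO tL] [MO tM]; have r0 : 0 <= rho by case/andP: r01.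
split; first exact: onannD.
have -> : logseq (u * w) = fun k => (logseq u k + logseq w k) +
    C (p%:R ^+ k) * (logseq u k * logseq w k).
  apply/funext => k; rewrite /logseq exprMn.
  set a := u ^+ _; set b := w ^+ _; set c := C _; set d := C _.
  have cd : d * c = 1 by rewrite /c /d -constM divff ?const1 // expf_neq0 // E_p_neq0.
  have -> : d * (c * (a - 1) * (c * (b - 1))) = (d * c) * c * ((a - 1) * (b - 1)) by ring.
  by rewrite cd; ring.
rewrite -[L + M]addr0; apply: tendsD => //; first exact: tendsD.
apply: tends_mulr0 => // [s e rs e0|s rs].
  have [N hN] := geometric_small 1 (prV_lt1 Qp) e0; exists N => k Nk.
  rewrite sub0r; apply: gleN; apply: gle_mono (gle_const _ s).
  by rewrite unormX normE_p -[leLHS]mul1r ltW // hN.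
have [B hB] := tends_bnd r0 rs tL LO (fun k => onann_logseq k r0 uO).
have [B' hB'] := tends_bnd r0 rs tM MO (fun k => onann_logseq k r0 wO).
exists (B * B') => k; apply: gleM => //; by apply: le_lt_trans (proj1 (andP rs)).
Qed.

Lemma islog_le rho rho' u L : rho <= rho' -> islog rho u L -> islog rho' u L.
Proof. by move=> rr [h1 h2]; split; [apply: onann_le h1|apply: tends_le h2]. Qed.

Lemma islogX rho u L n : 0 <= rho < 1 -> onann rho u -> islog rho u L ->
  islog rho (u ^+ n) (L *+ n).
Proof.
move=> r01 uO hL; have r0 : 0 <= rho by case/andP: r01.
elim: n => [|n IH].
  rewrite expr0 mulr0n; split; first by have := @onann_const R E rho 0.
  rewrite (_ : logseq 1 = fun=> 0); first exact: tends_cst.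
  by apply/funext => k; rewrite /logseq expr1n subrr mulr0.
by rewrite exprS mulrS; apply: islogM => //; apply: onannX.
Qed.

End Logarithm.

Section Operators.
Variables (R : realType) (p : nat) (Qp : padicNumType R p) (E : ultraFieldExtType Qp).
Variable O : robba_ops E.
Local Notation rb := (robba E).
Local Notation C := (@robba_const R E).
Local Notation pr := (p%:R : R).
Local Notation ph := (op_phi O).
Local Notation gm := (op_gamma O).
Local Notation X := (mon E 1).
Local Notation P := (PN E).
Implicit Types (f g u w L M : rb) (s rho beta : R) (n k : nat) (x y : Qp).

Lemma ph_C c : ph (C c) = C c.
Proof. by rewrite op_phiE; exact: subst_const. Qed.
Lemma gm_C x c : Zp_unit x -> gm x (C c) = C c.
Proof. by move=> xu; rewrite op_gammaE //; exact: subst_const. Qed.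

Lemma mon_unit n : mon E n \is a GRing.unit.
Proof. by apply/unitrPr; exists (mon E (- n%:Z)); rewrite mon_mon subrr mon0. Qed.
Lemma monV n : (mon E n)^-1 = mon E (- n%:Z).
Proof. by apply: (mulrI (mon_unit n)); rewrite divrr ?mon_unit // mon_mon subrr mon0. Qed.
Lemma C_unit c : c != 0 -> C c \is a GRing.unit.
Proof. by move=> c0; apply/unitrPr; exists (C c^-1); rewrite -constM divff // const1. Qed.

Lemma ph_X : ph X = P 1.
Proof. by rewrite op_phiE -[RHS]expr1 -phXE exprnP -[LHS]/(robba_subst _ _) subst_mon. Qed.
Lemma PN_0 : P 0 = X.
Proof. by rewrite /PN expn0 expr1 addrC addKr. Qed.
Lemma ph_1X : ph (1 + X) = (1 + X) ^+ p.
Proof. by rewrite rmorphD rmorph1 /= ph_X /PN expn1 addrC subrK. Qed.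
Lemma ph_PN n : ph (P n) = P n.+1.
Proof. by rewrite /PN rmorphB rmorphXn /= ph_1X rmorph1 -exprM -expnS. Qed.
Lemma PN_unit n : P n \is a GRing.unit.
Proof.
elim: n => [|n IH]; first by rewrite PN_0; apply: mon_unit.
by rewrite -ph_PN; apply: rmorph_unit.
Qed.
Lemma gm_X x : Zp_unit x -> gm x X = robba_1X_pow E x - 1.
Proof. by move=> xu; rewrite op_gammaE // -[LHS]/(robba_subst _ _) subst_mon. Qed.
Lemma gm_1X x : Zp_unit x -> gm x (1 + X) = robba_1X_pow E x.
Proof. by move=> xu; rewrite rmorphD rmorph1 /= gm_X // addrC subrK. Qed.
Lemma gX_unit x : Zp_unit x -> robba_1X_pow E x - 1 \is a GRing.unit.
Proof. by move=> xu; rewrite -gm_X //; apply: rmorph_unit; apply: mon_unit. Qed.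

Definition vx x : rb := vX E x.
Lemma gm_XE x : Zp_unit x -> gm x X = X * vx x.
Proof. by move=> xu; rewrite gm_X // vXE. Qed.
Lemma plus_vx x : Zp_unit x -> plus (vx x).
Proof. by move=> /eqP xu; apply: plus_vX. Qed.
Lemma plus_vxV x : Zp_unit x -> plus (vx x)^-1.
Proof. by move=> xu; apply: plus_vXV; [apply/eqP|apply: gX_unit]. Qed.
Lemma vx_unit x : Zp_unit x -> vx x \is a GRing.unit.
Proof. by move=> xu; apply: vX_unit; apply: gX_unit. Qed.
Lemma vx0 x : Zp_unit x -> vx x 0 = x%:A.
Proof. by move=> /eqP xu; apply: vX0. Qed.

Lemma plus_ph f : plus f -> plus (ph f).
Proof. by rewrite op_phiE => fp; apply: plus_phi fp; apply: PN_unit. Qed.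
Lemma plus_gm x f : Zp_unit x -> plus f -> plus (gm x f).
Proof.
by move=> xu fp; rewrite op_gammaE //; apply: plus_gamma => //; [apply/eqP|apply: gX_unit].
Qed.
Lemma gle_gm x f rho s K : Zp_unit x -> 0 <= rho < 1 -> onann rho f -> rho < s < 1 ->
  gle f s K -> gle (gm x f) s K.
Proof.
move=> xu r01 fO rs hf; rewrite op_gammaE //.
by apply: (gle_gamma _ (gX_unit xu) r01 fO rs hf); apply/eqP.
Qed.
Lemma onann_gm x f rho : Zp_unit x -> 0 <= rho < 1 -> onann rho f -> onann rho (gm x f).
Proof. by move=> xu r01 fO s rs; have [K hK] := fO s rs; exists K; exact: gle_gm xu r01 fO rs hK. Qed.
Lemma gle_ph_plus f s sigma K : plus f -> 0 < s < 1 -> 0 < sigma < 1 ->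
  gle (P 1) s sigma -> gle f sigma K -> gle (ph f) s K.
Proof. by move=> fp s01 g01 h1 h2; rewrite op_phiE; apply: (gle_phi_plus _ fp s01 g01 h1) => //; apply: PN_unit. Qed.

Lemma gle_PN_lt1 n s : 0 < s < 1 -> exists2 beta, 0 < beta < 1 & gle (P n) s beta.
Proof.
move=> /andP[s0 s1]; have m1 : s <= Num.max pr^-1 s by rewrite le_max lexx orbT.
have [h0 h1] := andP (prV_lt1 Qp).
exists (Num.max pr^-1 s); first by rewrite lt_max s0 orbT gt_max h1.
rewrite -(subrK (mon E (p ^ n)%N) (P n)); apply: gleD => //.
  by apply: gle_mono (@PN_dom R p Qp E n s _); rewrite ?le_max ?lexx // s0 ltW.
apply: gle_mono (gle_mon E _ s0); apply: le_trans m1.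
have : (0 < p ^ n)%N by rewrite expn_gt0 (p_gt0 Qp).
by case: (p ^ n)%N => // m _; rewrite -exprnP exprS -[leRHS]mulr1 ler_wpM2l ?exprn_ile1 ?(ltW s0) ?(ltW s1).
Qed.

Lemma gle_ph_le f s K : plus f -> 0 < s < 1 -> (forall sigma, 0 < sigma < 1 -> gle f sigma K) ->
  gle (ph f) s K.
Proof.
move=> fp s01 h; have [b b01 hb] := gle_PN_lt1 1 s01.
exact: gle_ph_plus hb (h b b01).
Qed.

Lemma gle_ph_self f s K : plus f -> pr^-1 <= s < 1 -> gle f s K -> gle (ph f) s K.
Proof.
move=> fp /andP[ps s1] hf; have s0 : 0 < s by apply: lt_le_trans ps; rewrite invr_gt0 (pr_gt0 Qp).
apply: (@gle_ph_plus f s s) => //; rewrite ?s0 //.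
rewrite -(subrK (mon E (p ^ 1)%N) (P 1)); apply: gleD => //.
  by apply: gle_mono (@PN_dom R p Qp E 1 s _) => //; rewrite s0 ltW.
apply: gle_mono (gle_mon E _ s0); rewrite expn1; case: (p) (p_gt0 Qp) => // m _.
by rewrite -exprnP exprS -[leRHS]mulr1 ler_wpM2l ?exprn_ile1 ?(ltW s0) ?(ltW s1).
Qed.

Fixpoint phn n : {rmorphism rb -> rb} := if n is n'.+1 then ph \o phn n' else idfun.
Lemma phn0 f : phn 0 f = f. Proof. by []. Qed.
Lemma phnS n f : phn n.+1 f = ph (phn n f). Proof. by []. Qed.
Lemma phnD n k f : phn (n + k) f = phn n (phn k f).
Proof. by elim: n => // n IH; rewrite addSn !phnS IH. Qed.
Lemma phn_X n : phn n X = P n.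
Proof. by elim: n => [|n IH]; rewrite ?PN_0 // phnS IH ph_PN. Qed.
Lemma phn_PN n k : phn n (P k) = P (n + k).
Proof. by rewrite -phn_X -phnD phn_X. Qed.
Lemma plus_phn n f : plus f -> plus (phn n f).
Proof. by move=> fp; elim: n => // n IH; rewrite phnS; apply: plus_ph. Qed.
Lemma phn_C n c : phn n (C c) = C c.
Proof. by elim: n => // n IH; rewrite phnS IH ph_C. Qed.
Lemma phn_gm n x f : Zp_unit x -> phn n (gm x f) = gm x (phn n f).
Proof. by move=> xu; elim: n => // n IH; rewrite !phnS IH op_phi_gamma. Qed.
Lemma gm_PN n x : Zp_unit x -> gm x (P n) = P n * phn n (vx x).
Proof. by move=> xu; rewrite -[in LHS]phn_X -phn_gm // gm_XE // rmorphM phn_X. Qed.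

Definition WN n : rb := mon E (- 1) * P n.
Lemma PN_W n : P n = X * WN n.
Proof. by rewrite mulrA mon_mon subrr mon0 mul1r. Qed.
Lemma plus_divX f : plus f -> f 0 = 0 -> plus (mon E (- 1) * f).
Proof.
move=> fp f0 i i0; rewrite mon_mulE opprK; have [i1|i1] := ltP (i + 1) 0; first exact: fp.
by have -> : i + 1 = 0 by lia.
Qed.
Lemma plus_WN n : plus (WN n).
Proof. by apply: plus_divX; [apply: plus_PN|apply: PN0]. Qed.
Lemma WN0 n : WN n 0 = (p ^ n)%:R.
Proof.
rewrite mon_mulE opprK add0r robbaBE (@onep_natE R p Qp E _ 1) bin1 robba1E subr0 //.
Qed.
(** The cyclotomic polynomial of order p^(n+1), evaluated at 1 + X. *)
Definition QN n : rb := phn n (WN 1).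
Lemma plus_QN n : plus (QN n). Proof. by apply: plus_phn; apply: plus_WN. Qed.
Lemma PN_Q n : P n.+1 = P n * QN n.
Proof. by have := congr1 (phn n) (PN_W 1); rewrite rmorphM phn_X phn_PN addn1. Qed.
Lemma QN_unit n : QN n \is a GRing.unit.
Proof. by have := PN_unit n.+1; rewrite PN_Q unitrM => /andP[]. Qed.

(** The quotient is required to be a power series: in the Robba ring itself every [PN n] and every
    [QN n] is a unit, so divisibility there says nothing. *)
Definition dvp g f := exists2 h, plus h & f = g * h.

Lemma dvp_plus g f : plus g -> dvp g f -> plus f.
Proof. by move=> gp [h hp ->]; apply: plusM. Qed.
Lemma dvp0 g : dvp g 0. Proof. by exists 0; [apply: plus0|rewrite mulr0]. Qed.
Lemma dvpD g f f' : dvp g f -> dvp g f' -> dvp g (f + f').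
Proof. by move=> [h hp ->] [h' hp' ->]; exists (h + h'); [apply: plusD|rewrite mulrDr]. Qed.
Lemma dvpN g f : dvp g f -> dvp g (- f).
Proof. by move=> [h hp ->]; exists (- h); [apply: plusN|rewrite mulrN]. Qed.
Lemma dvpB g f f' : dvp g f -> dvp g f' -> dvp g (f - f').
Proof. by move=> h h'; apply: dvpD => //; apply: dvpN. Qed.
Lemma dvpMr g f h : dvp g f -> plus h -> dvp g (f * h).
Proof. by move=> [k kp ->] hp; exists (k * h); [apply: plusM|rewrite mulrA]. Qed.
Lemma dvpMl g f h : dvp g f -> plus h -> dvp g (h * f).
Proof. by rewrite mulrC; apply: dvpMr. Qed.
Lemma dvp_refl g : dvp g g. Proof. by exists 1; [apply: plus1|rewrite mulr1]. Qed.
Lemma dvp_mull g h : plus h -> dvp g (g * h). Proof. by exists h. Qed.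
Lemma dvp_mulr g h : plus h -> dvp g (h * g). Proof. by rewrite mulrC; exists h. Qed.
Lemma dvp_trans g f h : dvp g f -> dvp f h -> dvp g h.
Proof. by move=> [k kp ->] [l lp_ ->]; exists (k * l); [apply: plusM|rewrite mulrA]. Qed.
Lemma dvpM g g' f f' : dvp g f -> dvp g' f' -> dvp (g * g') (f * f').
Proof. by move=> [k kp ->] [l lp_ ->]; exists (k * l); [apply: plusM|rewrite mulrACA]. Qed.
Lemma dvp_ph g f : dvp g f -> dvp (ph g) (ph f).
Proof. by move=> [k kp ->]; exists (ph k); [apply: plus_ph|rewrite rmorphM]. Qed.
Lemma dvp_phn n g f : dvp g f -> dvp (phn n g) (phn n f).
Proof. by move=> [k kp ->]; exists (phn n k); [apply: plus_phn|rewrite rmorphM]. Qed.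
Lemma dvp_X f : plus f -> f 0 = 0 -> dvp X f.
Proof.
move=> fp f0; exists (mon E (- 1) * f); first exact: plus_divX.
by rewrite mulrA mon_mon subrr mon0 mul1r.
Qed.
Lemma dvpX0 f : dvp X f -> f 0 = 0.
Proof. by move=> [h hp ->]; rewrite mon_mulE hp. Qed.
Lemma dvpX_C f : plus f -> dvp X (f - C (f 0)).
Proof.
move=> fp; apply: dvp_X; first by apply: plusB => //; apply: plus_const.
by rewrite robbaBE robbaCE eqxx subrr.
Qed.
Lemma dvp_PQ n k : (k < n)%N -> dvp (QN k) (P n).
Proof.
elim: n => // n IH; rewrite ltnS leq_eqVlt PN_Q => /orP[/eqP->|/IH h].
  by apply: dvp_mulr; apply: plus_PN.
by apply: dvpMr => //; apply: plus_QN.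
Qed.
Lemma dvp_PP n k : (k <= n)%N -> dvp (P k) (P n).
Proof.
elim: n => [|n IH]; first by rewrite leqn0 => /eqP->; apply: dvp_refl.
rewrite leq_eqVlt => /orP[/eqP->|/IH h]; first exact: dvp_refl.
by rewrite PN_Q; apply: dvpMr => //; apply: plus_QN.
Qed.

Lemma ph_coef0 f : plus f -> ph f 0 = f 0.
Proof.
move=> fp; have := dvp_ph (dvpX_C fp); rewrite rmorphB /= ph_C ph_X => h.
have := dvp_trans (dvp_PP (leq0n 1)) h; rewrite PN_0 => /dvpX0.
by rewrite robbaBE robbaCE eqxx => /eqP; rewrite subr_eq0 => /eqP.
Qed.
Lemma gm_coef0 x f : Zp_unit x -> plus f -> gm x f 0 = f 0.
Proof.
move=> xu fp; have [h hp e] := dvpX_C fp.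
have e' : gm x f - C (f 0) = X * (vx x * gm x h).
  by rewrite -{1}(gm_C (f 0) xu) -rmorphB e rmorphM gm_XE // mulrA.
have := congr1 (fun g : rb => g 0) e'; rewrite robbaBE robbaCE eqxx mon_mulE.
rewrite (_ : (vx x * gm x h) (0 - 1) = 0); last first.
  by apply: plusM => //; [apply: plus_vx|apply: plus_gm].
by move/eqP; rewrite subr_eq0 => /eqP.
Qed.

Lemma islog_gm x rho u L : Zp_unit x -> 0 <= rho < 1 -> onann rho u -> islog rho u L ->
  islog rho (gm x u) (gm x L).
Proof.
move=> xu r01 uO [LO tL]; have r0 : 0 <= rho by case/andP: r01.
split; first exact: onann_gm.
have e k : logseq (gm x u) k = gm x (logseq u k).
  by rewrite /logseq rmorphM rmorphB rmorphXn rmorph1 /= gm_C.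
move=> s eps rs e0; have [N hN] := tL s eps rs e0; exists N => k Nk.
rewrite e -rmorphB; apply: (gle_gm xu r01 _ rs (hN k Nk)).
by apply: onannB => //; apply: onann_logseq.
Qed.

Lemma islog_plus_gm x u L : Zp_unit x -> plus u -> islog 0 u L -> islog 0 (gm x u) (gm x L).
Proof. by move=> xu up; apply: islog_gm => //; [rewrite lexx ltr01|apply: plus_onann]. Qed.

Lemma islog_plus_ph u L : plus u -> plus L -> islog 0 u L -> islog 0 (ph u) (ph L).
Proof.
move=> up Lp [LO tL]; have e k : logseq (ph u) k = ph (logseq u k).
  by rewrite /logseq rmorphM rmorphB rmorphXn rmorph1 /= ph_C.
split; first by apply: plus_onann; apply: plus_ph.
move=> s eps rs e0; have [b b01 hb] := gle_PN_lt1 1 rs.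
have [N hN] := tL b eps b01 e0; exists N => k Nk; rewrite e -rmorphB.
apply: gle_ph_plus hb (hN k Nk) => //; apply: plusB => //.
by apply: plusM; [apply: plus_const|apply: plusB; [apply: plusX|apply: plus1]].
Qed.

Local Notation t := (robba_t E).

Lemma near1_onep x : unorm x <= 1 -> near1 0 (robba_1X_pow E x).
Proof.
move=> x1; split; first by apply: plus_onann; apply: plus_onep.
move=> s /andP[s0 s1]; exists s; first by rewrite ltW.
case=> [[|j]|j].
- by rewrite robbaBE onepE // padic_binom0 scale1r robba1E subrr unorm0 mul0r ltW.
- rewrite robbaBE onepE // robba1E subr0 unorm_alg -exprnP exprS mulrCA -[leRHS]mulr1.
  rewrite ler_wpM2l ?(ltW s0) // -[leRHS]mulr1 ler_pM ?unorm_ge0 ?exprn_ge0 ?(ltW s0) //.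
    exact: padic_binom_le1.
  by rewrite exprn_ile1 // ltW.
- by rewrite robbaBE plus_onep // robba1E subr0 unorm0 mul0r ltW.
Qed.

Lemma padic_binomN1 j : padic_binom (-1 : Qp) j = (-1) ^+ j.
Proof.
elim: j => [|j IH]; first by rewrite padic_binom0.
have h := Qp_nat_neq0 Qp (ltn0Sn j); apply: (mulfI h).
by rewrite padic_binomS IH exprS -natr1; ring.
Qed.

Lemma padic_binom_absorb x j :
  j.+1%:R * padic_binom x j.+1 = x * padic_binom (x - 1) j.
Proof.
elim: j => [|j IH]; first by rewrite padic_binomS !padic_binom0 subr0.
rewrite padic_binomS.
have h := Qp_nat_neq0 Qp (ltn0Sn j); apply: (mulfI h).
rewrite mulrCA IH mulrCA [RHS]mulrCA padic_binomS -natr1.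
by move: (padic_binom _ _) (j%:R) => a b; ring.
Qed.

(** By [padic_binom_absorb] the coefficient of degree j + 1 in [logseq] is x/(j+1) times the
    binomial coefficient of x p^k - 1, which tends to that of -1, namely (-1)^j. *)
Lemma islog_onep x L : unorm x <= 1 -> islog 0 (robba_1X_pow E x) L -> forall n : int,
  L n = if n is Posz j.+1 then (x * (-1) ^+ j / j.+1%:R)%:A else 0.
Proof.
move=> x1 [LO tL] n; have r01 : 0 <= (0 : R) < 1 by rewrite lexx ltr01.
have z1 k : unorm (x *+ (p ^ k)) <= 1.
  rewrite -mulr_natr unormM -[leRHS]mulr1 ler_pM ?unorm_ge0 ?unorm_nat_le1 //.
have lE k : logseq (robba_1X_pow E x) k n =
    if n is Posz j.+1 then (p%:R ^- k) * (padic_binom (x *+ (p ^ k)) j.+1)%:A else 0.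
  rewrite constM_coef robbaBE onepX //; case: n => [[|j]|j].
  - by rewrite onepE // padic_binom0 scale1r robba1E subrr mulr0.
  - by rewrite onepE // robba1E subr0.
  - by rewrite plus_onep // robba1E subr0 mulr0.
case: n lE => [[|j]|j] lE; [apply: (tends_coef0 (N := 0) r01 tL) => k _; exact: lE| |
  apply: (tends_coef0 (N := 0) r01 tL) => k _; exact: lE].
apply/eqP; rewrite -subr_eq0; apply/eqP; apply: unorm_small => e e0.
pose s : R := 2^-1; have s0 : 0 < s by rewrite invr_gt0.
have s1 : s < 1 by rewrite invf_lt1 // ltr1n.
have sj : 0 < s ^ j.+1 by rewrite exprz_gt0.
have esj : 0 < e * s ^ j.+1 / 2 by rewrite divr_gt0 // mulr_gt0.
have [N1 hN1] := tL s _ ltac:(by rewrite s0) esj.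
pose K := unorm x / unorm (j.+1%:R : Qp) / unorm (j`!%:R : Qp) * unorm x.
have [N2 hN2] := geometric_small K (prV_lt1 Qp) e0.
set k := maxn N1 N2; rewrite -(subrK (logseq (robba_1X_pow E x) k j.+1) (L _)).
rewrite -addrA; apply: unormD_lt.
  have := hN1 k (leq_maxl _ _) j.+1; rewrite robbaBE -ler_pdivlMr // => h.
  apply: le_lt_trans h _; rewrite mulrAC mulfK ?gt_eqF //.
  by rewrite ltr_pdivrMr // ltr_pMr // ltr1n.
have alg (a : Qp) : p%:R ^- k * a%:A = (p%:R ^- k * a)%:A :> E.
  by rewrite -!(in_algE E) rmorphM fmorphV rmorphXn rmorph_nat.
have p0 : (p%:R : Qp) ^+ k != 0 by rewrite expf_neq0 // Qp_nat_neq0 // (p_gt0 Qp).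
have j0 : (j.+1%:R : Qp) != 0 by apply: Qp_nat_neq0.
have xpk : x *+ p ^ k = x * p%:R ^+ k by rewrite -[LHS]mulr_natr natrX.
have bE : p%:R ^- k * padic_binom (x *+ p ^ k) j.+1 =
    x / j.+1%:R * padic_binom (x *+ p ^ k - 1) j.
  apply: (mulfI j0); rewrite mulrCA padic_binom_absorb xpk.
  by move: p0 j0; move: (p%:R ^+ k) (j.+1%:R) (padic_binom _ _) => a b c a0 b0; field; rewrite a0 b0.
have -> : x * (-1) ^+ j / j.+1%:R = x / j.+1%:R * padic_binom (- 1) j.
  by rewrite padic_binomN1 mulrAC.
rewrite lE alg bE -scalerBl unorm_alg -mulrBr unormM unormM unormV.
apply: le_lt_trans (hN2 k (leq_maxr _ _)).
have n1 : unorm (- 1 : Qp) <= 1 by rewrite unormN unorm1.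
have n2 : unorm (x *+ p ^ k - 1) <= 1.
  by rewrite (le_trans (unormB_le _ _)) // ge_max z1 unorm1 lexx.
apply: le_trans (_ : unorm x / unorm (j.+1%:R : Qp) *
  (unorm (x *+ p ^ k) / unorm (j`!%:R : Qp)) <= _).
  rewrite ler_wpM2l ?mulr_ge0 ?invr_ge0 ?unorm_ge0 //.
  by have := padic_binom_lipschitz j n2 n1; rewrite opprK subrK.
rewrite xpk /K unormM unormX (normp Qp) exprVn.
move: (unorm x) (unorm _) (unorm _) (p%:R ^- k) => a b c d.
by rewrite le_eqVlt; apply/orP; left; apply/eqP; ring.
Qed.

End Operators.

(** * The element t *)

Section LogT.
Variables (R : realType) (p : nat) (Qp : padicNumType R p) (E : ultraFieldExtType Qp).
Variable O : robba_ops E.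
Local Notation rb := (robba E).
Local Notation C := (@robba_const R E).
Local Notation pr := (p%:R : R).
Local Notation ph := (op_phi O).
Local Notation gm := (op_gamma O).
Local Notation phn := (phn O).
Local Notation X := (mon E 1).
Local Notation P := (PN E).
Local Notation t := (robba_t E).
Implicit Types (f g u w h r B : rb) (s rho beta theta : R) (n k m : nat) (x y : Qp).

Lemma zero_ann : 0 <= (0 : R) < 1. Proof. by rewrite lexx ltr01. Qed.

(** Both logarithms are known coefficientwise. Since gamma_x and phi send 1 + X to (1 + X)^x and (1
    + X)^p, uniqueness of logarithms then yields the formulas for gamma_x(t) and phi(t). *)
Lemma islog_onep_t x : unorm x <= 1 -> islog 0 (robba_1X_pow E x) (C x%:A * t).
Proof.
move=> x1; have [Y [_ hL _]] := islog_ex zero_ann (near1_onep E x1).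
have n1 : unorm (1 : Qp) <= 1 by rewrite unorm1.
have [Y1 [_ hL1 _]] := islog_ex zero_ann (near1_onep E n1).
have tE : t = (robba_1X_pow E 1 - 1) * Y1.
  rewrite /robba_t /robba_of -[RHS](valKd (0 : rb)); congr insubd.
  apply/funext => i; have e := islog_onep n1 hL1 i; rewrite [RHS]e.
  by case: i {e} => [[|j]|j] //; rewrite mul1r.
have -> : C x%:A * t = (robba_1X_pow E x - 1) * Y; last exact: hL.
apply: robba_ext => n; rewrite constM_coef tE (islog_onep _ hL1) ?unorm1 // (islog_onep x1 hL).
case: n => [[|j]|j]; rewrite ?mulr0 // mul1r -!(in_algE E) -rmorphM.
by rewrite mulrA.
Qed.

Lemma islog_t : islog 0 (1 + X) t.
Proof.
have := @islog_onep_t 1; rewrite unorm1 lexx onep1 => /(_ isT).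
by rewrite scale1r const1 mul1r.
Qed.

Lemma plus_1X : plus (1 + X : rb).
Proof. by apply: plusD; [apply: plus1|apply: plus_mon]. Qed.

Lemma t_coef (j : nat) : t j.+1 = ((-1) ^+ j / j.+1%:R)%:A.
Proof.
have h := islog_t; rewrite -onep1 in h.
by rewrite (islog_onep _ h) ?unorm1 // mul1r.
Qed.

Lemma plus_t : plus t.
Proof.
have h := islog_t; rewrite -onep1 in h.
by move=> [j|j] // _; rewrite (islog_onep _ h) ?unorm1.
Qed.

Lemma t0 : t 0 = 0.
Proof.
have h := islog_t; rewrite -onep1 in h.
by rewrite (islog_onep _ h) ?unorm1.
Qed.

Lemma gm_t x : Zp_unit x -> gm x t = C x%:A * t.
Proof.
move=> xu; have x1 : unorm x <= 1 by move/eqP: (xu) => ->.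
have h := islog_plus_gm O xu plus_1X islog_t; rewrite gm_1X // in h.
exact: islog_uniq zero_ann h (islog_onep_t x1).
Qed.

Lemma ph_t : ph t = C p%:R * t.
Proof.
have h := islog_plus_ph O plus_1X plus_t islog_t.
rewrite ph_1X -onep_nat in h.
apply: islog_uniq zero_ann h _; have := islog_onep_t (unorm_nat_le1 Qp p).
by rewrite scaler_nat.
Qed.

Lemma phn_t n : phn n t = C (p%:R ^+ n) * t.
Proof.
elim: n => [|n IH]; first by rewrite expr0 const1 mul1r.
by rewrite phnS IH rmorphM ph_C ph_t mulrA -constM exprSr.
Qed.

Definition ell : rb := mon E (- 1) * t.
Lemma t_ell : t = X * ell.
Proof. by rewrite mulrA mon_mon subrr mon0 mul1r. Qed.
Lemma plus_ell : plus ell. Proof. exact: plus_divX plus_t t0. Qed.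
Lemma ell0 : ell 0 = 1.
Proof. by rewrite mon_mulE opprK add0r (t_coef 0) expr0 divr1 scale1r. Qed.
(* [p^n t = PN n * tau n]: tau n collects the factors [QN k], k >= n, of t, where [QN k]
   vanishes at zeta - 1 for zeta of exact order p^(k+1). *)
Definition tau n : rb := phn n ell.
Lemma plus_tau n : plus (tau n). Proof. exact: plus_phn plus_ell. Qed.
Lemma PN_tau n : P n * tau n = C (p%:R ^+ n) * t.
Proof. by rewrite -phn_t t_ell rmorphM phn_X. Qed.
Lemma pX_neq0 n : (p%:R ^+ n : E) != 0.
Proof. by rewrite expf_neq0 // (E_p_neq0 E). Qed.
Lemma t_PN_tau n : t = C (p%:R ^- n) * (P n * tau n).
Proof. by rewrite PN_tau mulrA -constM mulVf ?pX_neq0 // mul1r. Qed.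
Lemma tau_PN n : tau n = (C (p%:R ^+ n) * (P n)^-1) * t.
Proof.
by rewrite mulrAC -PN_tau mulrC mulrA mulVr ?(PN_unit O) // mul1r.
Qed.
Lemma QN_tau n : QN O n * tau n.+1 = C p%:R * tau n.
Proof.
apply: (mulrI (PN_unit O n)); rewrite mulrA -PN_Q PN_tau mulrCA PN_tau mulrA -constM.
by rewrite exprS.
Qed.
Lemma tau_QN n : tau n = C p%:R^-1 * (QN O n * tau n.+1).
Proof. by rewrite QN_tau mulrA -constM mulVf ?(E_p_neq0 E) // mul1r. Qed.
Lemma dvp_tau_le n k : (n <= k)%N -> dvp (tau k) (tau n).
Proof.
elim: k => [|k IH]; first by rewrite leqn0 => /eqP->; apply: dvp_refl.
rewrite leq_eqVlt => /orP[/eqP->|]; first exact: dvp_refl.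
rewrite ltnS => /IH; apply: dvp_trans; rewrite (tau_QN k) mulrA.
by apply: dvp_mulr; apply: plusM; [apply: plus_const|apply: plus_QN].
Qed.
Lemma dvp_QN_tau n k : (n <= k)%N -> dvp (QN O k) (tau n).
Proof.
move=> nk; apply: dvp_trans (dvp_tau_le nk); rewrite (tau_QN k) mulrCA.
by apply: dvp_mull; apply: plusM; [apply: plus_const|apply: plus_tau].
Qed.
Lemma tau_mod_PN n : dvp (P n) (tau n - 1).
Proof.
have := dvp_phn O n (dvpX_C plus_ell).
by rewrite ell0 rmorphB phn_X phn_C const1.
Qed.

Lemma gle_phn f s K n : plus f -> pr^-1 <= s < 1 -> gle f s K -> gle (phn n f) s K.
Proof.
move=> fp s1 hf; elim: n => [|n IH] //; rewrite phnS.
by apply: gle_ph_self => //; apply: plus_phn.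
Qed.

Lemma gle_phn_le f s K n : plus f -> 0 < s < 1 ->
  (forall sigma, 0 < sigma < 1 -> gle f sigma K) -> gle (phn n f) s K.
Proof.
move=> fp; elim: n s => [|n IH] s s1 h; first exact: h.
by rewrite phnS; apply: gle_ph_le => //; [apply: plus_phn|move=> sg sg1; apply: IH].
Qed.

Lemma gle_PN_geo s : 0 < s < 1 -> exists2 K, 0 <= K & forall n, gle (P n) s (K * pr ^- n).
Proof.
move=> /andP[s0 s1]; have h : gle ((1 + X : rb) - 1) s s.
  by rewrite addrC addKr; have := gle_mon E 1 s0.
have b : 0 <= s < 1 by rewrite s1 ltW.
by have [K K0 hK] := gle_pow_pk s0 b h; exists K.
Qed.

(** [tau n - 1] is phi^n of a multiple of X, hence a multiple of [PN n], which decays like p^-n. *)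
Lemma tau_small s theta : 0 < s < 1 -> 0 < theta ->
  exists N, forall n, (N <= n)%N -> gle (tau n - 1) s theta.
Proof.
move=> s01 th; case/andP: (s01) => s0 s1; have [h hp hE] := dvpX_C plus_ell.
have [q0 q1] := andP (prV_lt1 Qp).
(* The bound [gle_phn] is uniform in n only from radius 1/p on; for power series the estimate passes
   down to s by monotonicity. *)
pose s' := Num.max s pr^-1; have s'1 : pr^-1 <= s' < 1 by rewrite le_max lexx orbT gt_max s1.
have s'0 : 0 < s' by rewrite lt_max s0.
have [K hK] : exists K, gle h s' K.
  by apply: (plus_onann hp); rewrite s'0; case/andP: s'1.
have [K' K'0 hK'] := @gle_PN_geo s' ltac:(by rewrite s'0; case/andP: s'1).
have [N hN] := geometric_small (K' * K) (prV_lt1 Qp) th.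
exists N => n Nn; have -> : tau n - 1 = P n * phn n h.
  have := congr1 (phn n) hE; rewrite ell0 rmorphB [phn n (C 1)]phn_C const1.
  by rewrite [phn n (X * h)]rmorphM phn_X.
apply: (@gle_plus _ _ _ s') => //.
- by apply: plusM; [apply: plus_PN|apply: plus_phn].
- by rewrite le_max lexx.
apply: gle_mono (gleM s'0 (hK' n) (gle_phn n hp s'1 hK)).
by rewrite mulrAC -exprVn ltW // hN.
Qed.

Lemma near_pow u s theta m : 0 < s -> 0 <= theta <= 1 -> gle (u - 1) s theta ->
  gle (u ^+ m - 1) s theta.
Proof.
move=> s0 /andP[th0 th1] hu; have u1 : gle u s 1.
  by rewrite -(subrK 1 u); apply: gleD => //; [apply: gle_mono hu|apply: gle1].
rewrite subrX1 -[theta]mulr1; apply: gleM => //.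
by apply: gle_sum => // i _; rewrite -(expr1n _ i); apply: gleX.
Qed.

Lemma tau_pow_small s m : 0 < s < 1 ->
  exists N, forall n, (N <= n)%N -> gle (tau n ^+ m - 1) s 2^-1.
Proof.
move=> s01; have h : 0 < (2^-1 : R) by rewrite invr_gt0.
have [N hN] := tau_small s01 h; exists N => n /hN.
apply: near_pow; first by case/andP: s01.
by rewrite ltW //= invf_le1 // ler1n.
Qed.

(** * Division by a power series close to 1 on one circle *)

Section Contraction.
Variables (q : rb) (s : R).
Hypotheses (s01 : 0 < s < 1) (qp : plus q) (qs : gle (q - 1) s 2^-1).
Let s0 : 0 < s. Proof. by case/andP: s01. Qed.
Let h12 : 0 <= (2^-1 : R) < 1.
Proof. by rewrite invr_ge0 ler0n invf_lt1 // ltr1n. Qed.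

(** Up to power series, B is 1 - q times its polar part, so the polar part is contracted by 1/2. *)
Lemma contract_sat B K : gle B s K -> plus (q * B) -> plus B.
Proof.
move=> hB qBp; apply: minus_eq0.
apply: (gle_contract0 s0 h12 (gle_robba_minus s0 hB)) => K' K'0 hK'.
have -> : robba_minus B = robba_minus ((1 - q) * robba_minus B).
  rewrite {1}(_ : B = q * B + (1 - q) * robba_plus B + (1 - q) * robba_minus B).
    rewrite robba_minusD robba_minus_plus ?add0r //.
    apply: plusD => //; apply: plusM (plus_plus _).
    by apply: plusB => //; apply: plus1.
  by rewrite -addrA -mulrDr plus_minusE; ring.
by apply: gle_robba_minus => //; apply: gleM => //; rewrite -opprB; apply: gleN.
Qed.

Lemma contract_reg B K : gle B s K -> q * B = 0 -> B = 0.
Proof.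
move=> hB qB; apply: (gle_contract0 s0 h12 hB) => K' K'0 hK'.
have -> : B = (1 - q) * B by rewrite mulrBl qB subr0 mul1r.
by apply: gleM => //; rewrite -opprB; apply: gleN.
Qed.

(** Subtracting q times the polar part [v 0] of f leaves the polar part [v 1] of (1 - q) [v 0], at
    most half as large, and so on. As the [v k] have negative powers only, a bound at radius s
    serves all larger radii. *)
Lemma contract_split f K : gle f s K -> exists r B, [/\ plus r, onann s B & f = r + q * B].
Proof.
move=> hf; pose ste g : rb := robba_minus ((1 - q) * g).
pose v := fix v k := if k is k'.+1 then ste (v k') else robba_minus f.
have vm k : minus (v k) by case: k => [|k]; apply: minus_minus.
have q1 : gle (1 - q) s 2^-1 by rewrite -opprB; apply: gleN.
have K0 := gle_ge0 s0 hf.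
have vb k : gle (v k) s (K * 2^-1 ^+ k).
  elim: k => [|k IH]; first by rewrite expr0 mulr1; apply: gle_robba_minus.
  by rewrite exprS mulrCA; apply: gle_robba_minus => //; apply: gleM.
have vO k : onann s (v k).
  move=> s' /andP[ss s1]; exists (K * 2^-1 ^+ k).
  by apply: gle_minus (vb k) => //; apply: ltW.
have s01' : 0 <= s < 1 by rewrite ltW //=; case/andP: s01.
have v0 : tends s v 0.
  move=> s' e /andP[ss s1] e0; have [N hN] := geometric_small K h12 e0.
  exists N => k Nk; rewrite sub0r; apply: gleN.
  by apply: gle_minus (gle_mono (ltW (hN k Nk)) (vb k)) => //; apply: ltW.
have [B tB BO] := rsum_lim s01' vO v0.
exists (f - q * B), B; split=> //; last by rewrite subrK.
have part k : f - q * (\sum_(i < k) v i) - v k = robba_plus f + \sum_(i < k) robba_plus ((1 - q) * v i).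
  elim: k => [|k IH].
    by rewrite !big_ord0 mulr0 subr0 addr0 /= /robba_minus opprB addrC subrK.
  rewrite !big_ord_recr /= addrA -IH /ste /robba_minus.
  set a := \sum_(i < k) v i; set b := robba_plus _; set c := v k; clearbody a b c; ring.
have qO : onann s q by apply: onann_le (plus_onann qp); apply: ltW.
have tN (u : nat -> rb) F : tends s u F -> tends s (fun k => - u k) (- F).
  move=> h s' e rs e0; have [N hN] := h s' e rs e0; exists N => k Nk.
  by rewrite -opprD; apply: gleN; apply: hN.
have cvg : tends s (fun k => f - q * (\sum_(i < k) v i) - v k) (f - q * B).
  rewrite -[X in tends _ _ X]subr0; have s0' := ltW s0.
  apply: tendsD => //; last exact: tN.
  apply: tendsD => //; first exact: tends_cst.
  by apply: tN; apply: tendsZ.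
apply: (tends_plus s01' cvg) => k; rewrite part; apply: plusD; first exact: plus_plus.
by apply: plus_sum => i _; apply: plus_plus.
Qed.
End Contraction.

Lemma Cp_unit n : C (p%:R ^+ n) \is a GRing.unit.
Proof. by apply: C_unit; apply: pX_neq0. Qed.

Lemma tau_t n : exists2 u, u \is a GRing.unit & tau n = u * t.
Proof.
exists (C (p%:R ^+ n) * (P n)^-1); last exact: tau_PN.
by rewrite unitrM Cp_unit unitrV (PN_unit O).
Qed.

(** [tau N] is t times a unit of the Robba ring, and for large N its m-th power is close to 1 on a
    circle where f converges. *)
Lemma robba_split m f : exists r B, plus r /\ f = r + t ^+ m * B.
Proof.
have [rho /andP[r0 r1] fO] := robba_onann f; pose s := (rho + 1) / 2.
have rs : rho < s < 1 by rewrite !midf_lt.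
have s01 : 0 < s < 1 by case/andP: rs => h ->; rewrite (le_lt_trans r0 h).
have [N hN] := tau_pow_small m s01; have [K hK] := fO s rs.
have [r [B [rp _ ->]]] := contract_split s01 (plusX m (@plus_tau N)) (hN N (leqnn N)) hK.
have [u _ tE] := tau_t N; exists r, (u ^+ m * B); split=> //.
by rewrite tE exprMn -mulrA mulrCA.
Qed.

(** The quotient by [tau n ^+ m] converges on a circle where [tau n ^+ m] is close to 1, so it has
    no polar part. The index N depends on m and rho only, not on f or B; [no_coboundary] and
    [delta_ex] rely on this uniformity. *)
Lemma dvp_tau_of_t m rho : 0 <= rho < 1 -> exists N, forall n, (N <= n)%N ->
  forall f B, plus f -> onann rho B -> f = t ^+ m * B -> dvp (tau n ^+ m) f.
Proof.
move=> /andP[r0 r1]; pose s := (rho + 1) / 2.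
have rs : rho < s < 1 by rewrite !midf_lt.
have s01 : 0 < s < 1 by case/andP: rs => h ->; rewrite (le_lt_trans r0 h).
have [N hN] := tau_pow_small m s01; exists N => n Nn f B fp BO fE.
pose B' := (C (p%:R ^- n) * P n) ^+ m * B.
have fE' : f = tau n ^+ m * B'.
  by rewrite fE (t_PN_tau n) /B' !exprMn; move: (C _) (P n) (tau n) => a b c; ring.
exists B' => //.
have B'O : onann rho B'.
  apply: onannM => //; apply: onannX => //; apply: onannM => //; first exact: onann_const.
  by apply: (onann_le r0); apply: plus_onann; apply: plus_PN.
have [K hK] := B'O s rs.
by apply: (contract_sat s01 (plusX m (@plus_tau n)) (hN n Nn) hK); rewrite -fE'.
Qed.

Lemma t_of_dvp_tau m n f : dvp (tau n ^+ m) f -> exists B, f = t ^+ m * B.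
Proof.
move=> [h hp ->]; have [u _ ->] := tau_t n; exists (u ^+ m * h).
by rewrite exprMn mulrAC mulrC mulrA.
Qed.

Lemma t_reg m f : t ^+ m * f = 0 -> f = 0.
Proof.
move=> tf; have [rho /andP[r0 r1] fO] := robba_onann f; pose s := (rho + 1) / 2.
have rs : rho < s < 1 by rewrite !midf_lt.
have s01 : 0 < s < 1 by case/andP: rs => h ->; rewrite (le_lt_trans r0 h).
have [N hN] := tau_pow_small m s01; have [K hK] := fO s rs.
apply: (contract_reg s01 (hN N (leqnn N)) hK).
by have [u _ ->] := tau_t N; rewrite exprMn -mulrA tf mulr0.
Qed.

Lemma t_regI m f g : t ^+ m * f = t ^+ m * g -> f = g.
Proof.
move=> /eqP; rewrite -subr_eq0 -mulrBr => /eqP/t_reg/eqP.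
by rewrite subr_eq0 => /eqP.
Qed.

(* Modulo t^m an idempotent: 1 modulo [PN n ^+ m] and 0 modulo [tau n ^+ m]. *)
Definition en n m : rb := 1 - (1 - tau n ^+ m) ^+ m.
Lemma plus_en n m : plus (en n m).
Proof.
apply: plusB; first exact: plus1.
by apply: plusX; apply: plusB; [apply: plus1|apply: plusX; apply: plus_tau].
Qed.
Lemma tau_pow_mod_PN n m : dvp (P n) (tau n ^+ m - 1).
Proof.
rewrite subrX1; apply: dvpMr (tau_mod_PN n) _.
by apply: plus_sum => i _; apply: plusX; apply: plus_tau.
Qed.
Lemma dvp_exp g f m : dvp g f -> dvp (g ^+ m) (f ^+ m).
Proof. by move=> [h hp ->]; exists (h ^+ m); [apply: plusX|rewrite exprMn]. Qed.
Lemma en_PN n m : dvp (P n ^+ m) (1 - en n m).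
Proof.
rewrite /en opprB addrC subrK; apply: dvp_exp; rewrite -opprB; apply: dvpN.
exact: tau_pow_mod_PN.
Qed.
Lemma en_tau n m : dvp (tau n ^+ m) (en n m).
Proof.
rewrite /en -[X in X - _](expr1n _ m) subrXX opprB addrC subrK.
apply: dvp_mull; apply: plus_sum => i _; apply: plusM; first exact/plusX/plus1.
by apply: plusX; apply: plusB; [apply: plus1|apply: plusX; apply: plus_tau].
Qed.
(** Chinese remainders: [en n m] shows that [P n ^+ m] and [tau n ^+ m] are comaximal, and their
    product is t^m up to a nonzero constant. *)
Lemma dvp_t_coprime n m f : plus f -> dvp (P n ^+ m) f -> dvp (tau n ^+ m) f -> dvp (t ^+ m) f.
Proof.
move=> fp fP ft; have -> : f = f * en n m + f * (1 - en n m) by ring.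
have tm : dvp (t ^+ m) (P n ^+ m * tau n ^+ m).
  rewrite -exprMn PN_tau exprMn mulrC; apply: dvp_mull.
  by apply: plusX; apply: plus_const.
apply: dvpD; first exact: (dvp_trans tm (dvpM fP (en_tau n m))).
by rewrite mulrC; exact: (dvp_trans tm (dvpM (en_PN n m) ft)).
Qed.
Lemma dvp_t_PN n m : dvp (P n ^+ m) (t ^+ m).
Proof.
rewrite (t_PN_tau n) mulrCA exprMn; apply: dvp_mull; apply: plusX.
by apply: plusM; [apply: plus_const|apply: plus_tau].
Qed.

End LogT.

(** * Eigenvectors of Frobenius *)

Section Eigen.
Variables (R : realType) (p : nat) (Qp : padicNumType R p) (E : ultraFieldExtType Qp).
Variable O : robba_ops E.
Local Notation rb := (robba E).
Local Notation C := (@robba_const R E).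
Local Notation pr := (p%:R : R).
Local Notation ph := (op_phi O).
Local Notation gm := (op_gamma O).
Local Notation phn := (phn O).
Local Notation X := (mon E 1).
Local Notation P := (PN E).
Local Notation t := (robba_t E).
Implicit Types (f g u w h r B : rb) (s rho beta theta : R) (x y : Qp) (mu lam : E).

Definition npos f := forall n : int, 0 < n -> f n = 0.
Lemma npos1 : npos 1. Proof. by move=> n n0; rewrite robba1E gt_eqF. Qed.
Lemma nposM f g : npos f -> npos g -> npos (f * g).
Proof.
move=> hf hg n n0; rewrite robbaME usum_zero // => i.
have [i0|i0] := ltP 0 i; first by rewrite hf // mul0r.
by rewrite hg ?mulr0 // subr_gt0 (le_lt_trans i0).
Qed.
Lemma nposX f n : npos f -> npos (f ^+ n).
Proof. by move=> h; elim: n => [|n IH]; [apply: npos1|rewrite exprS; apply: nposM]. Qed.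

Lemma npos_inv q g s theta : 0 < s -> 0 <= theta < 1 -> (forall n : int, 0 <= n -> (1 - q : rb) n = 0) ->
  gle (1 - q) s theta -> (exists K, gle g s K) -> q * g = 1 -> npos g.
Proof.
move=> s0 th q0 qs [K gK] qg; pose G : rb := mon E 1 * robba_plus (mon E (- 1) * g).
have GE n : G n = if 0 < n then g n else 0.
  rewrite /G mon_mulE robba_plusE mon_mulE opprK subrK subr_lt0.
  have -> : (n < 1) = ~~ (0 < n) by lia.
  by case: (0 < n).
suff G0 : G = 0 by move=> n n0; have := congr1 (fun f : rb => f n) G0; rewrite GE n0 robba0E.
have hG : gle G s K.
  by move=> n; rewrite GE; case: ifP => // _; rewrite unorm0 mul0r (gle_ge0 s0 gK).
apply: (gle_contract0 s0 th hG) => B B0 hB n; rewrite GE; case: ifP => [n0|_]; last first.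
  by rewrite unorm0 mul0r mulr_ge0 //; case/andP: th.
have -> : g n = ((1 - q) * G) n; last exact: gleM.
have np1 : npos (1 - q) by move=> i i0; apply: q0; apply: ltW.
have np2 : npos (g - G) by move=> i i0; rewrite robbaBE GE i0 subrr.
have -> : (1 - q) * G = g - 1 - (1 - q) * (g - G).
  have e : (1 - q) * g = g - 1 by rewrite mulrBl qg mul1r.
  by rewrite [in RHS]mulrBr e; move: ((1 - q) * G) => a; ring.
by rewrite [in RHS]robbaBE (nposM np1 np2) // subr0 robbaBE robba1E (gt_eqF n0) subr0.
Qed.

(** X^-p phi(X) is 1 plus negative powers of X, and the inverse of such a series has no positive
    powers: its part of positive degree is contracted to 0. *)
Lemma P1_npos : exists2 g, npos g & (P 1)^-1 = mon E (- p%:Z) * g.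
Proof.
have pE : (p ^ 1)%N = p by rewrite expn1.
pose q : rb := mon E (- p%:Z) * P 1; pose g : rb := mon E p%:Z * (P 1)^-1.
have mm : mon E (- p%:Z) * mon E p%:Z = 1 by rewrite mon_mon addNr mon0.
exists g; last by rewrite mulrA mm mul1r.
have qg : q * g = 1 by rewrite mulrACA mm mul1r divrr // (PN_unit O).
have [rho /andP[r0 r1] hg] := robba_onann g.
have [/andP[n0 n1] hs] := @rhoN_bnd R p Qp 1 ((Num.max rho (rhoN R p 1) + 1) / 2).
set s := _ / 2 in hs; have := @midf_lt R (Num.max rho (rhoN R p 1)) 1.
rewrite gt_max r1 n1 => /(_ isT); rewrite -/s gt_max => -[/andP[s1 s2] s3].
have s0 : 0 < s by apply: le_lt_trans s1.
have q1 : 1 - q = - (mon E (- p%:Z) * (P 1 - mon E (p ^ 1)%N)).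
  by rewrite pE mulrBr mm opprB.
have dom : gle (P 1 - mon E (p ^ 1)%N) s pr^-1 by apply: (@PN_dom R p Qp); rewrite s0 ltW.
have sp : 0 < s ^ p%:Z by rewrite exprz_gt0.
apply: (@npos_inv q g s (s ^ (- p%:Z) * pr^-1) s0 _ _ _ _ qg).
- rewrite mulr_ge0 ?sz0 ?invr_ge0 ?ler0n //= -invr_expz mulrC ltr_pdivrMr // mul1r.
  by have := hs s2; rewrite pE.
- have p0 : (p == 0)%N = false by apply: gtn_eqF; apply: p_gt0 Qp.
  move=> n nn; rewrite robbaBE robba1E mon_mulE opprK robbaBE robba1E.
  case: n nn => // n _; rewrite -PoszD onep_natE pE !eqz_nat addn_eq0 p0 andbF subr0.
  by case: n => [|n]; rewrite ?binn ?subrr // bin_small ?subrr // addSn ltnS leq_addl.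
- by rewrite q1; apply: gleN; apply: gleM => //; apply: gle_mon.
- by apply: hg; rewrite s1.
Qed.

(** phi(X^-(n+1)) involves only exponents at most -p (n+1). Hence the coefficient of X^-(j+1) in
    phi(f) depends only on the coefficients of X^-(n+1) in f with n < j, which vanish by
    induction. *)
Lemma ph_eigen_plus f mu : mu != 0 -> ph f = C mu * f -> plus f.
Proof.
move=> mu0 hf; have [g gn gE] := P1_npos.
suff key (j : nat) : f (- j.+1%:Z) = 0 by case=> [n|j] // _; rewrite NegzE.
elim/ltn_ind: j => j IH; apply: (mulfI mu0); rewrite mulr0 -constM_coef -hf op_phiE.
rewrite robba_phiE ?(PN_unit O) // usum_zero // => -[n|n].
  by rewrite -exprnP (plusX n (plus_PN E 1)) ?mulr0 // oppr_lt0.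
have [nj|jn] := ltnP n j; first by rewrite NegzE IH // mul0r.
rewrite NegzE -exprnN -exprVn gE exprMn mon_exp mon_mulE (nposX _ gn) ?mulr0 //.
have p2 := prime_gt1 (p_prime Qp); rewrite -mulNrn opprK.
have := leq_mul p2 (ltnSn n); nia.
Qed.

Lemma plusX0 f n : plus f -> (f ^+ n) 0 = f 0 ^+ n.
Proof.
move=> fp; elim: n => [|n IH]; first by rewrite !expr0 robba1E.
by rewrite !exprS robbaM_plus0 ?IH //; apply: plusX.
Qed.

Lemma plus_order f : plus f -> f != 0 -> exists k : nat, [/\ f k != 0, plus (mon E (- k%:Z) * f) &
  f = mon E k * (mon E (- k%:Z) * f)].
Proof.
move=> fp f0; have ex : exists k : nat, f k != 0.
  apply: contrapT => h; case/eqP: f0; apply: robba_ext => -[n|n]; last by rewrite fp // robba0E.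
  by rewrite robba0E; apply/eqP; apply/negPn/negP => fn; apply: h; exists n.
exists (ex_minn ex); case: ex_minnP => k fk hk; split=> //; last first.
  by rewrite mulrA mon_mon subrr mon0 mul1r.
move=> n n0; rewrite mon_mulE opprK; case e : (n + k) => [j|j]; last exact: fp.
by apply/eqP; apply: contraTT n0 => /hk; lia.
Qed.

(** As phi(X) = p X + ..., phi multiplies the leading coefficient of a power series of order k by
    p^k. *)
Lemma ph_order f mu : plus f -> ph f = C mu * f -> f != 0 ->
  exists k : nat, [/\ mu = p%:R ^+ k, f k != 0 & plus (mon E (- k%:Z) * f)].
Proof.
move=> fp hf /(plus_order fp)[k [fk gp fE]]; exists k; split=> //.
set g := mon E (- k%:Z) * f in gp fE.
have g0 : g 0 = f k by rewrite /g mon_mulE sub0r opprK.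
have phE : ph f = mon E k * (WN E 1 ^+ k * ph g).
  rewrite {1}fE rmorphM (_ : mon E k = X ^+ k); last by rewrite mon_exp natz.
  by rewrite rmorphXn /= (ph_X O) PN_W exprMn mulrA.
apply: (mulIf fk); have := congr1 (fun h : rb => h k) hf.
rewrite constM_coef phE mon_mulE subrr robbaM_plus0 ?plusX0 ?(ph_coef0 O) //.
- by rewrite g0 WN0 expn1 => ->.
- exact: plus_WN.
- exact: plusX (plus_WN _ _).
- exact: plus_ph.
Qed.

Lemma p_pow_inj j k : (p%:R ^+ j : E) = p%:R ^+ k -> j = k.
Proof.
have [h0 h1] := andP (prV_lt1 Qp); have pp : 0 < pr^-1 by rewrite invr_gt0 (pr_gt0 Qp).
move=> /(congr1 (@unorm R E)); rewrite !unormX (normE_p E) => /(ieexprIn pp).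
by apply; rewrite lt_eqF.
Qed.

(** Subtracting the multiple of t^k with the same leading coefficient leaves an eigenvector for p^k
    whose coefficient of degree k vanishes; by [ph_order] it is 0. *)
Lemma ph_eigen f mu : mu != 0 -> ph f = C mu * f ->
  exists (c : E) (k : nat), f = C c * t ^+ k /\ (c != 0 -> mu = p%:R ^+ k).
Proof.
move=> mu0 hf; have fp := ph_eigen_plus mu0 hf.
have [->|f0] := eqVneq f 0; first by exists 0, 0%N; rewrite const0 mul0r eqxx.
have [k [muk fk gp]] := ph_order fp hf f0; exists (f k), k; split=> //.
have tk : (t ^+ k : rb) = mon E k * ell E ^+ k by rewrite t_ell exprMn mon_exp natz.
apply/eqP; rewrite -subr_eq0; apply/negPn/negP => h.
have tp : plus (t ^+ k) by apply: plusX; apply: plus_t.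
have [j [muj fj _]] : exists j : nat, [/\ mu = p%:R ^+ j, (f - C (f k) * t ^+ k) j != 0 &
    plus (mon E (- j%:Z) * (f - C (f k) * t ^+ k))].
  apply: ph_order => //; first by apply: plusB => //; apply: plusM => //; apply: plus_const.
  rewrite rmorphB rmorphM ph_C rmorphXn /= hf (ph_t O) muk constX exprMn.
  by move: (C (f k)) (t ^+ k) => a b; ring.
have jk : j = k by apply: p_pow_inj; rewrite -muj muk.
case/eqP: fj; rewrite jk robbaBE constM_coef tk mon_mulE subrr plusX0; last exact: plus_ell.
by rewrite ell0 expr1n mulr1 subrr.
Qed.

Lemma tends_ph (u : nat -> rb) F : (forall k, plus (u k)) -> tends 0 u F -> tends 0 (fun k => ph (u k)) (ph F).
Proof.
move=> up tu s e rs e0; have [b b01 hb] := gle_PN_lt1 E 1 rs.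
have Fp := tends_plus (zero_ann R) tu up.
have [N hN] := tu b e b01 e0; exists N => k Nk; rewrite -rmorphB.
by apply: gle_ph_plus hb (hN k Nk) => //; apply: plusB.
Qed.

(** S is the sum of the lam^i phi^i(B). The last clause carries the vanishing of low coefficients
    over to S. *)
Lemma sum_ph lam B : plus B -> tends 0 (fun i => C (lam ^+ i) * phn i B) 0 ->
  exists S, [/\ plus S, S - C lam * ph S = B &
    forall n : int, (forall i, phn i B n = 0) -> S n = 0].
Proof.
move=> Bp h; pose v i : rb := C (lam ^+ i) * phn i B.
have vp i : plus (v i) by apply: plusM; [apply: plus_const|apply: plus_phn].
have [S tS _] := rsum_lim (zero_ann R) (fun i => plus_onann (vp i)) h.
have Sp : plus S by apply: (tends_plus (zero_ann R) tS) => k; apply: plus_sum.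
exists S; split=> // [|n hn]; last first.
  apply: (tends_coef0 (N := 0) (zero_ann R) tS) => k _; rewrite robba_sumE big1 // => i _.
  by rewrite /v constM_coef hn mulr0.
have sp k : plus (\sum_(i < k) v i) by apply: plus_sum.
have r0 : 0 <= (0 : R) by [].
have t1 : tends 0 (fun k => C lam * ph (\sum_(i < k) v i) + B) (C lam * ph S + B).
  apply: tendsD => //; last exact: tends_cst.
  by apply: tendsZ => //; [apply: onann_const|apply: tends_ph].
have t2 := tends_shift tS.
suff e : C lam * ph S + B = S by rewrite -{1}e addrC addKr.
apply: tends_uniq (zero_ann R) t1 _; rewrite (_ : (fun k => _) = fun k => \sum_(i < k.+1) v i) //.
apply/funext => k; rewrite big_ord_recl {2}/v expr0 const1 mul1r phn0 addrC; congr (_ + _).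
rewrite rmorph_sum mulr_sumr; apply: eq_bigr => i _.
by rewrite /v rmorphM ph_C mulrA -constM -exprS.
Qed.

(** The phi^i(B) are uniformly bounded on a circle of radius at least 1/p, so the series converges
    there, and on smaller circles by monotonicity. *)
Lemma sum_ph_small lam B : unorm lam < 1 -> plus B -> exists2 S, plus S & S - C lam * ph S = B.
Proof.
move=> l1 Bp; suff /(sum_ph Bp)[S [Sp hS _]] : tends 0 (fun i => C (lam ^+ i) * phn i B) 0.
  by exists S.
move=> s e /andP[s0 s1] e0.
pose s' := Num.max s pr^-1; have [q0 q1] := andP (prV_lt1 Qp).
have s'1 : pr^-1 <= s' < 1 by rewrite le_max lexx orbT gt_max s1.
have s'0 : 0 < s' by rewrite lt_max s0.
have [K hK] : exists K, gle B s' K by apply: (plus_onann Bp); rewrite s'0; case/andP: s'1.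
have l01 : 0 <= unorm lam < 1 by rewrite unorm_ge0.
have [N hN] := geometric_small K l01 e0; exists N => i Ni; rewrite sub0r; apply: gleN.
apply: (@gle_plus _ _ _ s') => //; first by apply: plusM; [apply: plus_const|apply: plus_phn].
  by rewrite le_max lexx.
apply: gle_mono (gleM s'0 (gle_const _ s') (gle_phn O i Bp s'1 hK)).
by rewrite unormX mulrC ltW // hN.
Qed.

(** An a priori estimate by contraction; it will give the continuity in x of the solutions
    [ws x]. *)
Lemma sum_ph_bound lam S s K : unorm lam < 1 -> plus S -> pr^-1 <= s < 1 ->
  gle (S - C lam * ph S) s K -> gle S s K.
Proof.
move=> l1 Sp s1 hK; have s0 : 0 < s.
  by case/andP: s1 => h _; apply: lt_le_trans h; rewrite invr_gt0 (pr_gt0 Qp).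
have [K' hK'] : exists K', gle S s K' by apply: (plus_onann Sp); rewrite s0; case/andP: s1.
have l01 : 0 <= unorm lam < 1 by rewrite unorm_ge0.
apply: (gle_contract s0 l01 (gle_ge0 s0 hK) hK') => B B0 hB.
rewrite -[X in gle X _ _](subrK (C lam * ph S)); apply: gleD => //.
  by apply: gle_mono hK; rewrite le_max lexx.
apply: gle_mono (_ : unorm lam * B <= _) _; first by rewrite le_max lexx orbT.
by apply: gleM => //; [apply: gle_const|apply: gle_ph_self].
Qed.

End Eigen.

(** * The action of Gamma modulo the cyclotomic factors of t *)

Section GammaNear.
Variables (R : realType) (p : nat) (Qp : padicNumType R p) (E : ultraFieldExtType Qp).
Variable O : robba_ops E.
Local Notation rb := (robba E).
Local Notation C := (@robba_const R E).
Local Notation pr := (p%:R : R).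
Local Notation ph := (op_phi O).
Local Notation gm := (op_gamma O).
Local Notation phn := (phn O).
Local Notation X := (mon E 1).
Local Notation P := (PN E).
Local Notation t := (robba_t E).
Local Notation onep := (robba_1X_pow E).
Implicit Types (f g u w h r B : rb) (s rho beta theta : R) (x y z a : Qp) (mu lam : E).

(** For a unit b, (1 + X)^b is gamma_b(1 + X), and phi commutes with gamma_b. A non-unit a is (a -
    1) + 1, where a - 1 is a unit. *)
Lemma ph_onep a : unorm a <= 1 -> ph (onep a) = onep a ^+ p.
Proof.
have un b : Zp_unit b -> ph (onep b) = onep b ^+ p.
  by move=> bu; rewrite -(gm_1X O bu) (op_phi_gamma O bu) (ph_1X O) rmorphXn.
move=> a1; have [/eqP a1'|a1'] := eqVneq (unorm a) 1; first exact: un.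
have ha : unorm a < unorm (- 1 : Qp) by rewrite unormN unorm1 lt_neqAle a1' a1.
have bu : Zp_unit (a - 1).
  by apply/eqP; rewrite addrC (unorm_eqmax ha) unormN unorm1.
have b1 : unorm (a - 1) <= 1 by move/eqP: bu => ->.
have n1 : unorm (1 : Qp) <= 1 by rewrite unorm1.
rewrite -{1 2}(subrK 1 a) -!(onepD E b1 n1) onep1 rmorphM un //.
by rewrite (ph_1X O) exprMn.
Qed.

Lemma phn_onep n a : unorm a <= 1 -> phn n (onep a) = onep a ^+ (p ^ n).
Proof.
move=> a1; elim: n => [|n IH]; first by rewrite expn0 expr1.
by rewrite phnS IH rmorphXn /= ph_onep // -exprM expnS.
Qed.

(** With x = 1 + a p^N one has gamma_x(X) - X = (1 + X) ((1 + X)^(a p^N) - 1), and the last factor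
    is phi^N of (1 + X)^a - 1, a multiple of X. *)
Lemma gm_near N x : Zp_unit x -> unorm (x - 1) <= pr ^- N ->
  exists h, [/\ plus h, gm x X - X = P N * h & forall s, 0 < s < 1 -> gle h s 1].
Proof.
move=> xu xN; have q0 : (p%:R ^+ N : Qp) != 0.
  by rewrite expf_neq0 // Qp_nat_neq0 // (p_gt0 Qp).
pose a := (x - 1) / p%:R ^+ N; have xE : x = 1 + a *+ (p ^ N).
  by rewrite -mulr_natr natrX mulfVK // addrC subrK.
have pN : 0 < pr ^+ N by rewrite exprn_gt0 // (pr_gt0 Qp).
have a1 : unorm a <= 1.
  rewrite /a unormM unormV unormX (normp Qp) -exprVn invrK -ler_pdivlMr // mul1r.
  exact: xN.
have n1 : unorm (1 : Qp) <= 1 by rewrite unorm1.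
have aN : unorm (a *+ p ^ N) <= 1.
  by rewrite -mulr_natr unormM -[leRHS]mulr1 ler_pM ?unorm_ge0 ?unorm_nat_le1.
have op : plus (onep a - 1) by apply: plusB; [apply: plus_onep|apply: plus1].
have o0 : (onep a - 1) 0 = 0.
  by rewrite robbaBE onepE // padic_binom0 scale1r robba1E subrr.
pose h0 : rb := mon E (- 1) * (onep a - 1).
have h0p : plus h0 by apply: plus_divX.
have hE : onep a - 1 = X * h0 by rewrite mulrA mon_mon subrr mon0 mul1r.
have g0 sg : 0 < sg < 1 -> gle h0 sg 1.
  move=> /andP[s0 s1] [j|j]; last by rewrite h0p // unorm0 mul0r.
  rewrite mon_mulE opprK robbaBE -PoszD addn1 onepE // robba1E subr0 unorm_alg.
  rewrite -[leRHS]mulr1 ler_pM ?unorm_ge0 ?exprz_ge0 ?(ltW s0) ?padic_binom_le1 //.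
  by rewrite -exprnP exprn_ile1 // ltW.
have pX : plus (1 + X : rb) by apply: plusD; [apply: plus1|apply: plus_mon].
exists ((1 + X) * phn N h0); split.
- by apply: plusM => //; apply: plus_phn.
- have e := congr1 (phn N) hE; rewrite rmorphB rmorph1 /= phn_onep // onepX // in e.
  rewrite [phn N (X * h0)]rmorphM phn_X in e.
  rewrite mulrCA -e (gm_X O xu) {1}xE -(onepD E n1 aN) onep1.
  by move: (onep _) => b; ring.
- move=> s s01; case/andP: (s01) => s0 s1; rewrite -[Y in gle _ _ Y]mul1r; apply: gleM => //.
    apply: gleD => //; first exact: gle1.
    by apply: gle_mono (gle_mon E 1 s0); rewrite expr1z ltW.
  exact: gle_phn_le.
Qed.

Lemma plus_poly r d : plus r -> (forall k : int, d%:Z <= k -> r k = 0) ->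
  r = \sum_(i < d) C (r i) * X ^+ i.
Proof.
move=> rp rd; apply: robba_ext => k; rewrite robba_sumE.
have e (i : 'I_d) : (C (r i) * X ^+ i) k = if k == i then r i else 0.
  by rewrite constM_coef mon_exp natz monE; case: eqP => _; rewrite ?mulr1 ?mulr0.
rewrite (eq_bigr _ (fun i _ => e i)) -big_mkcond /=.
case: k {e} => [k|k]; last by rewrite rp // big1.
have [kd|dk] := ltnP k d; last by rewrite rd // big1 // => i /eqP[ki]; have := ltn_ord i; lia.
by rewrite (big_pred1 (Ordinal kd)).
Qed.

Lemma PN_pdom N s : rhoN R p N < s < 1 ->
  gle (P N - mon E (p ^ N)%N) s pr^-1 /\ pr^-1 < s ^ (p ^ N)%N.
Proof.
move=> /andP[s1 s2]; have [/andP[r0 _] h] := @rhoN_bnd R p Qp N s; split; last exact: h.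
by apply: (@PN_dom R p Qp); rewrite (le_lt_trans r0 s1) ltW.
Qed.

Lemma PN_div N f : plus f -> exists y r : rb, [/\ plus y, plus r,
  forall k : int, (p ^ N)%:Z <= k -> r k = 0 & f = P N * y + r].
Proof.
have ip : 0 <= pr^-1 by rewrite invr_ge0.
have [r01 _] := @rhoN_bnd R p Qp N 0.
exact: (weierstrass_div ip r01 (plus_PN E N) (@PN_pdom N)).
Qed.

Lemma PN_div_uniq N (y r : rb) : plus y -> (forall k : int, (p ^ N)%:Z <= k -> r k = 0) ->
  P N * y = r -> y = 0.
Proof.
have ip : 0 <= pr^-1 by rewrite invr_ge0.
have [r01 _] := @rhoN_bnd R p Qp N 0.
exact: (weierstrass_uniq ip r01 (@PN_pdom N)).
Qed.

Lemma dvp_gm_PN N x f : Zp_unit x -> dvp (P N) f -> dvp (P N) (gm x f).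
Proof.
move=> xu [y yp ->]; rewrite rmorphM (gm_PN O N xu) -mulrA; apply: dvp_mull.
by apply: plusM; [apply: plus_phn; apply: plus_vx|apply: plus_gm].
Qed.

(** gamma_x preserves the multiples of [P N], so Weierstrass division reduces to polynomials, and
    then to X, where [gm_near] applies. *)
Lemma dvp_gm_sub N x f : Zp_unit x -> unorm (x - 1) <= pr ^- N -> plus f ->
  dvp (P N) (gm x f - f).
Proof.
move=> xu xN fp; have [h [hp hE _]] := gm_near xu xN.
have [y [r [yp rp rd ->]]] := PN_div N fp.
have -> : gm x (P N * y + r) - (P N * y + r) = (gm x (P N * y) - P N * y) + (gm x r - r).
  by rewrite rmorphD opprD addrACA.
apply: dvpD; first by apply: dvpB; [apply: dvp_gm_PN => //|]; apply: dvp_mull.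
rewrite (plus_poly rp rd) rmorph_sum -sumrB.
elim/big_ind: _ => [|a b|i _]; [exact: dvp0|exact: dvpD|].
rewrite rmorphM gm_C // -mulrBr rmorphXn /= subrXX hE; apply: dvpMl; last exact: plus_const.
apply: dvpMr; first exact: dvp_mull.
apply: plus_sum => j _; apply: plusM; apply: plusX; last exact: plus_mon.
by apply: plus_gm => //; apply: plus_mon.
Qed.

Lemma mon_expz n : (X ^ n : rb) = mon E n.
Proof.
case: n => n; first by rewrite -exprnP mon_exp natz.
by rewrite NegzE -exprnN -exprVn monV mon_exp mulNrn natz.
Qed.

Lemma vx_powz x s beta n : Zp_unit x -> 0 < s < 1 -> 0 <= beta <= 1 ->
  gle (vx E x - 1) s beta -> gle (vx E x ^ n - 1) s beta.
Proof.
move=> xu s01 b01 hv; case/andP: (s01) => s0 s1.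
have hV : gle (vx E x)^-1 s 1 by apply: gle_vXV => //; [apply/eqP|apply: (gX_unit O)].
case: n => n; first exact: near_pow.
rewrite NegzE -exprnN -exprVn; apply: near_pow => //.
have -> : (vx E x)^-1 - 1 = - (vx E x - 1) * (vx E x)^-1.
  by rewrite mulNr mulrBl divrr ?(vx_unit O) // mul1r opprB.
by rewrite -[beta]mulr1; apply: gleM => //; apply: gleN.
Qed.

(** Termwise, gamma_x(X^n) - X^n = X^n (v^n - 1) with v = gamma_x(X)/X, and |v^n - 1|_s <= beta
    holds for negative n as well. *)
Lemma gle_gm_sub x f rho s beta K : Zp_unit x -> 0 <= rho < 1 -> onann rho f -> rho < s < 1 ->
  0 <= beta <= 1 -> gle (vx E x - 1) s beta -> gle f s K -> gle (gm x f - f) s (beta * K).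
Proof.
move=> xu r01 fO rs b01 hv hf k; have r0 : 0 <= rho by case/andP: r01.
have s0 : 0 < s by apply: le_lt_trans (proj1 (andP rs)).
have s01 : 0 < s < 1 by rewrite s0; case/andP: rs.
have xu' : unorm x = 1 by apply/eqP.
have adm s' : rho < s' < 1 -> subst_adm (onep x - 1) f s' s'.
  by move=> rs'; apply: (gamma_adm xu' (gX_unit O xu) r0 fO rs').
have e1 : gm x f k = usum (fun n : int => f n * ((onep x - 1 : rb) ^ n) k).
  rewrite op_gammaE // -[LHS]/(robba_subst (onep x - 1) f k).
  by apply: (robba_subst_def r01) => s' rs'; exists s'; apply: adm.
have e2 : - f k = usum (fun n : int => - (f n * mon E n k)).
  rewrite (@usum_single _ _ _ _ k) ?monE ?eqxx ?mulr1 // => i /negPf i0.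
  by rewrite monE eq_sym i0 mulr0 oppr0.
have nu2 : null_family (unorm \o (fun n : int => - (f n * mon E n k))).
  move=> e e0; exists [:: k] => n; rewrite inE => /negPf nk.
  by rewrite -[_ n]/(unorm (- (f n * mon E n k))) monE eq_sym nk mulr0 oppr0 unorm0.
rewrite robbaBE e1 e2 -usumD //; last exact: subst_null (adm s rs).
have K0 := gle_ge0 s0 hf; case/andP: (b01) => b0 _.
rewrite -ler_pdivlMr ?exprz_gt0 //; apply: usum_le0.
- by rewrite divr_ge0 ?mulr_ge0 // sz0.
- apply: null_le (null_max (subst_null k s0 (adm s rs)) nu2) => n /=.
  exact: unormD_le.
move=> n; rewrite -mulrN -mulrDr; apply: le_trans (unormM_le _ _) _.
have -> : (onep x - 1 : rb) ^ n = mon E n * vx E x ^ n.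
  rewrite -(gm_X O xu) gm_XE // exprMz_comm ?mon_unit ?(vx_unit O) //; last exact: mulrC.
  by rewrite mon_expz.
have := gleM s0 (gle_mon E n s0) (vx_powz n xu s01 b01 hv); rewrite mulrBr mulr1.
move=> /(_ k); rewrite robbaBE -ler_pdivlMr ?exprz_gt0 // => h.
apply: le_trans (_ : unorm (f n) * (s ^ n * beta / s ^ k) <= _).
  by rewrite ler_wpM2l ?unorm_ge0.
rewrite mulrA ler_wpM2r ?invr_ge0 ?sz0 // mulrA mulrC ler_wpM2l //; exact: hf.
Qed.

Lemma vx_small s beta : 0 < s < 1 -> 0 < beta -> exists N, forall z, Zp_unit z ->
  unorm (z - 1) <= pr ^- N -> gle (vx E z - 1) s beta.
Proof.
move=> s01 b0; case/andP: (s01) => s0 s1; have [K K0 hK] := gle_PN_geo E s01.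
have [N hN] := geometric_small (s^-1 * K) (prV_lt1 Qp) b0; exists N => z zu zN.
have [h [hp hE hb]] := gm_near zu zN.
have -> : vx E z - 1 = mon E (- 1) * (P N * h).
  by rewrite -hE gm_XE // -{2}[X]mulr1 -mulrBr mulrA mon_mon addNr mon0 mul1r.
apply: gle_mono (gleM s0 (gle_mon E (- 1) s0) (gleM s0 (hK N) (hb s s01))).
by rewrite mulr1 mulrA -exprVn -exprN1 ltW // hN.
Qed.

Lemma Zp_unitV_near x y : Zp_unit x -> Zp_unit y ->
  Zp_unit (y / x) /\ unorm (y / x - 1) = unorm (y - x).
Proof.
move=> /eqP xu /eqP yu; have x0 : x != 0.
  by apply: contra_eq_neq xu => ->; rewrite unorm0 eq_sym oner_eq0.
rewrite /Zp_unit unormM unormV xu yu divr1 eqxx; split=> //.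
by rewrite -[1 in LHS](divff x0) -mulrBl unormM unormV xu divr1.
Qed.

(** gamma_y f - gamma_x f is gamma_x applied to gamma_z f - f with z = y/x close to 1, and gamma_x
    does not increase Gauss norms. *)
Lemma robba_cvg_gm f x : Zp_unit x -> robba_cvg (fun y => gm y f) x (gm x f).
Proof.
move=> xu; have [rho r01 fO] := robba_onann f; exists rho => // s e rs e0.
have r0 : 0 <= rho by case/andP: r01.
have s0 : 0 < s by apply: le_lt_trans (proj1 (andP rs)).
have s01 : 0 < s < 1 by rewrite s0; case/andP: rs.
have [K hK] := fO s rs; have K0 := gle_ge0 s0 hK.
have K1 : 0 < K + 1 by rewrite ltr_wpDl.
pose b := Num.min 1 (e / (K + 1)); have b0 : 0 < b by rewrite lt_min ltr01 divr_gt0.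
have [N hN] := vx_small s01 b0; have dN : 0 < pr ^- N by rewrite invr_gt0 exprn_gt0 // (pr_gt0 Qp).
exists (pr ^- N) => // y yu _ yx; have [zu ze] := Zp_unitV_near xu yu.
have x0 : x != 0 by apply: contraTneq xu => ->; rewrite /Zp_unit unorm0 eq_sym oner_eq0.
have hv := hN _ zu ltac:(by rewrite ze ltW).
have b1 : 0 <= b <= 1 by rewrite ltW //= ge_min lexx.
have := gle_gm_sub zu r01 fO rs b1 hv hK; set z := y / x in zu ze hv *.
have yE : y = x * z by rewrite /z mulrCA divff // mulr1.
have -> : gm y f - gm x f = gm x (gm z f - f) by rewrite {1}yE (op_gammaM O xu zu) rmorphB.
move=> h; have h' : gle (gm z f - f) s e.
  apply: gle_mono h; apply: le_trans (_ : e / (K + 1) * K <= _).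
    by rewrite ler_wpM2r // ge_min lexx orbT.
  by rewrite mulrAC ler_pdivrMr // ler_wpM2l ?(ltW e0) // lerDl.
apply: gle_gm => //; first exact: r01; last exact: rs.
by apply: onannB => //; apply: onann_gm.
Qed.

End GammaNear.

Section Congruences.
Variables (R : realType) (p : nat) (Qp : padicNumType R p) (E : ultraFieldExtType Qp).
Variable O : robba_ops E.
Local Notation rb := (robba E).
Local Notation C := (@robba_const R E).
Local Notation pr := (p%:R : R).
Local Notation ph := (op_phi O).
Local Notation gm := (op_gamma O).
Local Notation phn := (phn O).
Local Notation X := (mon E 1).
Local Notation P := (PN E).
Local Notation Q := (QN O).
Local Notation t := (robba_t E).
Local Notation om := (1 + mon E 1 : robba E).
Implicit Types (f g u w h r B q : rb) (s rho beta theta : R) (x z a : Qp) (c mu lam : E).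

Lemma dvp_Cl q c f : c != 0 -> dvp q (C c * f) -> dvp q f.
Proof.
move=> c0 h; have -> : f = C c^-1 * (C c * f) by rewrite mulrA -constM mulVf // mul1r.
by apply: dvpMl => //; apply: plus_const.
Qed.

Lemma dvp_cancel q g f : q \is a GRing.unit -> dvp (q * g) (q * f) -> dvp g f.
Proof. by move=> qu [h hp]; rewrite -mulrA => /(mulrI qu) ->; apply: dvp_mull. Qed.

Lemma dvp_gm x q k f : Zp_unit x -> dvp q (gm x q) -> dvp (q ^+ k) f -> dvp (q ^+ k) (gm x f).
Proof.
move=> xu hq [h hp ->]; rewrite rmorphM rmorphXn /=; apply: dvpMr; last exact: plus_gm.
exact: dvp_exp.
Qed.

(* gamma_x is trivial on R+/q and acts on q/q^2 through x *)
Definition unip x q := [/\ q \is a GRing.unit, plus q,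
  exists2 y, plus y & gm x q = q * y /\ dvp q (y - C x%:A) &
  forall g, plus g -> dvp q (gm x g - g)].

Lemma dvp_sub_exp q y u k : plus y -> plus u -> dvp q (y - u) -> dvp q (y ^+ k - u ^+ k).
Proof.
move=> yp up h; rewrite subrXX; apply: dvpMr => //.
by apply: plus_sum => i _; apply: plusM; apply: plusX.
Qed.

(** On q^i/q^(i+1) the operator gamma_x - c is multiplication by the constant x^i - c; while this is
    nonzero, one more factor q comes out of f. *)
Lemma unip_dvp q x c m j f : Zp_unit x -> unip x q ->
  (forall i, (j <= i < m)%N -> (x%:A : E) ^+ i != c) -> (j <= m)%N ->
  dvp (q ^+ j) f -> dvp (q ^+ m) (gm x f - C c * f) -> dvp (q ^+ m) f.
Proof.
move=> xu [qu qp [y yp [qy yx]] qg] xc jm hj hm.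
suff H k : (j + k <= m)%N -> dvp (q ^+ (j + k)) f by have := H (m - j)%N; rewrite subnKC //; apply.
elim: k => [|k IH]; first by rewrite addn0.
rewrite addnS => km; have [g gp gE] := IH (ltnW km); set i := (j + k)%N in gE km *.
suff [h hp hE] : dvp q g by exists h => //; rewrite gE hE mulrA -exprSr.
apply: (@dvp_Cl _ ((x%:A : E) ^+ i - c)); first by rewrite subr_eq0 xc // leq_addr.
have step : dvp q (y ^+ i * gm x g - C c * g).
  have e : gm x f - C c * f = q ^+ i * (y ^+ i * gm x g - C c * g).
    by rewrite gE rmorphM rmorphXn /= qy exprMn; move: (C c) (gm x g) (q ^+ i) (y ^+ i) => a b d e; ring.
  rewrite e -(subnK (ltnW km)) addnC exprD in hm.
  have := dvp_cancel (unitrX i qu) hm; case: (m - i)%N (subn_gt0 i m) => [|n _ [h hp ->]].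
    by rewrite km.
  by rewrite exprS -mulrA; apply: dvp_mull; apply: plusM => //; apply: plusX.
have -> : C ((x%:A : E) ^+ i - c) * g = (y ^+ i * gm x g - C c * g)
    - (y ^+ i - C x%:A ^+ i) * gm x g - C x%:A ^+ i * (gm x g - g).
  by rewrite constB constX; move: (C c) (gm x g) (C x%:A ^+ i) (y ^+ i) => a b d e; ring.
apply: dvpB; first apply: dvpB => //.
  by apply: dvpMr; [apply: dvp_sub_exp => //; apply: plus_const|apply: plus_gm].
by apply: dvpMl; [apply: qg|apply: plusX; apply: plus_const].
Qed.

Lemma unip_PN n x : Zp_unit x -> unorm (x - 1) <= pr ^- n -> unip x (P n).
Proof.
move=> xu xn; split; [exact: (PN_unit O)|exact: plus_PN| |by move=> g; apply: dvp_gm_sub].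
exists (phn n (vx E x)); first by apply: plus_phn; apply: plus_vx.
split; first exact: gm_PN.
by have := dvp_phn O n (dvpX_C (plus_vx E xu)); rewrite vx0 // rmorphB /= phn_X phn_C.
Qed.

Lemma gm_QN n x : Zp_unit x -> gm x (Q n) = Q n * (phn n.+1 (vx E x) * phn n (vx E x)^-1).
Proof.
move=> xu; have vu : phn n (vx E x) \is a GRing.unit by apply: rmorph_unit; apply: (vx_unit O).
have e := gm_PN O n.+1 xu; rewrite (PN_Q O) rmorphM gm_PN // in e.
apply: (mulrI (PN_unit O n)); apply: (mulrI vu).
have -> : phn n (vx E x) * (P n * gm x (Q n)) = P n * phn n (vx E x) * gm x (Q n) by ring.
rewrite [LHS]e [phn n (vx E x)^-1]rmorphV ?(vx_unit O) //.
have := divrr vu; move: (phn n (vx E x)) (P n) (Q n) (phn n.+1 _) => v a b d.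
move: (v^-1) => v' vv; have -> : v * (a * (b * (d * v'))) = a * b * d * (v * v') by ring.
by rewrite vv mulr1.
Qed.

Lemma dvp_gm_QN n x : Zp_unit x -> dvp (Q n) (gm x (Q n)).
Proof.
move=> xu; rewrite gm_QN //; apply: dvp_mull.
by apply: plusM; apply: plus_phn; [apply: plus_vx|apply: (plus_vxV O)].
Qed.

Lemma dvp_gm_tau n x : Zp_unit x -> dvp (tau O n) (gm x (tau O n)).
Proof.
move=> xu; have e : gm x (ell E) = ell E * (C x%:A * (vx E x)^-1).
  apply: (mulrI (rmorph_unit (gm x) (mon_unit E 1))); rewrite -rmorphM -t_ell gm_t // gm_XE //.
  rewrite {1}t_ell; have vu := vx_unit O xu; apply: (mulIr vu).
  move: (X) (ell E) (C _) vu; move: (vx E x) => v a b d vu.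
  by rewrite -!mulrA mulVr // mulr1; ring.
rewrite -phn_gm // e rmorphM; apply: dvp_mull; apply: plus_phn.
by apply: plusM; [apply: plus_const|apply: (plus_vxV O)].
Qed.

(** gamma_x(Q n)/Q n is phi^(n+1)(v)/phi^n(v) with v = gamma_x(X)/X. Modulo Q n the numerator is
    v(0) = x, because Q n divides phi^(n+1)(X), and the denominator is 1, because gamma_x fixes P n
    modulo P (n+1). *)
Lemma unip_QN n x : Zp_unit x -> unorm (x - 1) <= pr ^- n.+1 -> unip x (Q n).
Proof.
move=> xu xn; have vp := plus_vx E xu; have vVp := plus_vxV O xu.
have vV : phn n (vx E x) * phn n (vx E x)^-1 = 1.
  by rewrite -rmorphM divrr ?(vx_unit O) // rmorph1.
split; [exact: QN_unit|exact: plus_QN| |move=> g gp]; last first.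
  by apply: dvp_trans (dvp_gm_sub O xu xn gp); apply: dvp_PQ.
exists (phn n.+1 (vx E x) * phn n (vx E x)^-1); first by apply: plusM; apply: plus_phn.
split; first exact: gm_QN.
have h1 : dvp (Q n) (phn n.+1 (vx E x) - C x%:A).
  apply: dvp_trans (dvp_PQ O (ltnSn n)) _.
  by have := dvp_phn O n.+1 (dvpX_C vp); rewrite vx0 // rmorphB [phn _ X]phn_X [phn _ (C _)]phn_C.
have h2 : dvp (Q n) (phn n (vx E x) - 1).
  have := dvp_gm_sub O xu xn (plus_PN E n); rewrite gm_PN // (PN_Q O).
  by rewrite -[Y in _ - Y]mulr1 -mulrBr; apply: dvp_cancel (PN_unit O n).
have -> : phn n.+1 (vx E x) * phn n (vx E x)^-1 - C x%:A =
   (phn n.+1 (vx E x) - C x%:A) * phn n (vx E x)^-1 - C x%:A * (phn n (vx E x) - 1) * phn n (vx E x)^-1.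
  have -> : C x%:A * (phn n (vx E x) - 1) * phn n (vx E x)^-1 = C x%:A - C x%:A * phn n (vx E x)^-1.
    by rewrite -mulrA mulrBl vV mul1r mulrBr mulr1.
  by move: (phn _ _) (phn _ _) (C _) => a b d; ring.
apply: dvpB; first by apply: dvpMr => //; apply: plus_phn.
by apply: dvpMr; [apply: dvpMl => //; apply: plus_const|apply: plus_phn].
Qed.

Lemma QN_mod_P n : dvp (P n) (Q n - C p%:R).
Proof.
have := dvp_phn O n (dvpX_C (plus_WN E 1)).
by rewrite WN0 expn1 rmorphB [phn n X]phn_X [phn n (C _)]phn_C.
Qed.

Lemma dvp_QN_P n f : plus f -> dvp (Q n) (P n * f) -> dvp (Q n) f.
Proof.
move=> fp h; have [k kp kE] := QN_mod_P n; apply: (@dvp_Cl _ p%:R); first exact: E_p_neq0.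
have -> : C p%:R * f = Q n * f - P n * f * k.
  have -> : C p%:R = Q n - P n * k by rewrite -kE; ring.
  by ring.
by apply: dvpB; [apply: dvp_mull|apply: dvpMr].
Qed.

(** Otherwise c P_n = P_(n+1) h; the left side has degree p^n < p^(n+1), so uniqueness of
    Weierstrass division gives h = 0. *)
Lemma QN_proper n c : c != 0 -> ~ dvp (Q n) (C c).
Proof.
move=> c0 [h hp hE]; have e : P n.+1 * h = C c * P n by rewrite (PN_Q O) -mulrA -hE mulrC.
have h0 : h = 0.
  apply: PN_div_uniq hp _ e => k kn; rewrite constM_coef robbaBE robba1E.
  have k0 : (k == 0) = false.
    by apply: gt_eqF; apply: lt_le_trans kn; rewrite ltz_nat expn_gt0 (p_gt0 Qp).
  case: k kn k0 => // k kn k0; rewrite onep_natE k0 bin_small ?subrr ?mulr0 //.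
  by apply: leq_trans kn; rewrite ltn_exp2l // prime_gt1 // (p_prime Qp).
have := congr1 (fun g : rb => g 0) hE; rewrite h0 mulr0 robba0E robbaCE eqxx => /eqP.
by rewrite (negPf c0).
Qed.

Lemma plus_om k : plus (om ^+ k).
Proof. by apply: plusX; apply: plusD; [apply: plus1|apply: plus_mon]. Qed.

Lemma dvp_om n k : dvp (P n) (om ^+ (p ^ n * k) - 1).
Proof.
rewrite exprM subrX1; apply: dvp_mull; apply: plus_sum => i _.
by apply: plusX; apply: plus_om.
Qed.

(** With a = om^(p^n), S is a geometric sum in a^j, so (a^j - 1) S is a multiple of a^p - 1 = P n *
    Q n. As j is invertible modulo p, some multiple of a^j - 1 is P n times a series congruent to 1
    modulo Q n; then the unit P n cancels. *)
Lemma sum_om n j : ~~ (p %| j)%N -> dvp (Q n) (\sum_(z < p) om ^+ (p ^ n * (z * j))).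
Proof.
move=> pj; set S := \sum_(z < p) _; pose a : rb := om ^+ (p ^ n).
have ap i : plus (a ^+ i) by apply: plusX; apply: plus_om.
have SE : S = \sum_(z < p) (a ^+ j) ^+ z.
  by apply: eq_bigr => z _; rewrite /a -!exprM; congr (_ ^+ _); ring.
have aP : a - 1 = P n by [].
have aPS : a ^+ p - 1 = P n * Q n by rewrite -(PN_Q O) /a -exprM -expnSr.
have j0 : (0 < j)%N by case: j pj {S SE} => //; rewrite dvdn0.
have cjp : coprime j p by rewrite coprime_sym prime_coprime // (p_prime Qp).
have [j' [k jk]] : exists j' k, (j * j' = 1 + p * k)%N.
  case: (egcdnP p j0) => j' k e _; exists j', k.
  by rewrite mulnC e (eqP cjp) addnC mulnC.
pose s := \sum_(i < j) (a ^+ p) ^+ i; pose s' := \sum_(i < j') (a ^+ j) ^+ i.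
pose s'' := \sum_(i < k) (a ^+ p) ^+ i.
have e1 : (a ^+ j - 1) * S = P n * Q n * s.
  by rewrite SE -subrX1 -exprM mulnC exprM subrX1 aPS.
have e2 : (a ^+ j - 1) * s' = P n * (1 + a * Q n * s'').
  rewrite -subrX1 -exprM jk exprD expr1 exprM -[(a ^+ p) ^+ k](subrK 1) subrX1 aPS -/s'' -aP.
  by move: (Q n) => b; rewrite mulrDr mulr1; ring.
have e3 : S = Q n * (s' * s - a * s'' * S).
  apply: (mulrI (PN_unit O n)); have -> : P n * S = P n * (1 + a * Q n * s'') * S - P n * (a * Q n * s'') * S by ring.
  rewrite -e2; have -> : (a ^+ j - 1) * s' * S = s' * (P n * Q n * s) by rewrite -e1; ring.
  by ring.
rewrite e3; apply: dvp_mull; have sp : plus S by apply: plus_sum => i _; apply: plus_om.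
apply: plusB; apply: plusM => //; last apply: plusM; try exact: (ap 1%N);
  by apply: plus_sum => i _; apply: plusX.
Qed.

(** Representatives of the units modulo p^(n+1), that is, of the Galois group acting on R^+/Q n, in
    which 1 + X is a primitive root of unity of order p^(n+1). *)
Fixpoint reps n : seq nat := if n is n'.+1
  then [seq (y + p ^ n * z)%N | y <- reps n', z : nat <- iota 0 p] else iota 1 p.-1.

Lemma reps_coprime n k : k \in reps n -> ~~ (p %| k)%N.
Proof.
elim: n k => [|n IH] k /=.
  rewrite mem_iota => /andP[k1 k2]; rewrite gtnNdvd // -(prednK (p_gt0 Qp)).
  by move: k2; rewrite add1n.
by case/allpairsP => -[y z] [/IH /= hy _ ->]; rewrite expnS -mulnA dvdn_addl // dvdn_mulr.
Qed.

Lemma reps_size n : (0 < size (reps n))%N.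
Proof.
have := prime_gt1 (p_prime Qp); elim: n => [|n IH] p1 /=.
  by rewrite size_iota -ltnS (ltn_predK p1).
by rewrite size_allpairs size_iota muln_gt0 IH // ltnW.
Qed.

(** The trace of a root of unity is rational. Above level 0, the sum over z vanishes when p does not
    divide j; when it does, the trace is p times the one of j/p at the level below, transported by
    phi. *)
Lemma trace_om n j : exists c, dvp (Q n) (\sum_(x <- reps n) om ^+ (x * j) - C c).
Proof.
have p0 := p_gt0 Qp.
elim: n j => [|n IH] j.
  have [/dvdnP[j' ->]|pj] := boolP (p %| j)%N.
    exists (size (reps 0))%:R.
    have -> : C (size (reps 0))%:R = \sum_(x <- reps 0) 1.
      by rewrite const_nat big_const_seq count_predT iter_addr addr0.
    rewrite -sumrB.
    elim/big_ind: _ => [|a b|i _]; [exact: dvp0|exact: dvpD|].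
    have := dvp_om 1 (i * j'); rewrite expn1 (mulnC j') (mulnCA i p j').
    by apply: dvp_trans; apply: dvp_PQ.
  exists (-1); have := sum_om 0 pj; rewrite constN const1 opprK expn0.
  rewrite -(big_mkord xpredT (fun z : nat => om ^+ (1 * (z * j)))) /index_iota subn0.
  have io k : (0 < k)%N -> iota 0 k = 0%N :: iota 1 k.-1 by case: k.
  rewrite (io p p0) big_cons mul1n mul0n expr0 addrC.
  by under eq_bigr => i _ do rewrite mul1n.
have e : \sum_(x <- reps n.+1) om ^+ (x * j) =
    (\sum_(y <- reps n) om ^+ (y * j)) * \sum_(z < p) om ^+ (p ^ n.+1 * (z * j)).
  rewrite [reps n.+1]/= big_allpairs_dep mulr_suml; apply: eq_bigr => y _.
  rewrite -(big_mkord xpredT (fun z : nat => om ^+ (p ^ n.+1 * (z * j)))) /index_iota subn0 mulr_sumr.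
  by apply: eq_bigr => z _; rewrite -exprD mulnDl mulnA.
have rp : plus (\sum_(y <- reps n) om ^+ (y * j)) by apply: plus_sum => i _; apply: plus_om.
have [/dvdnP[j' jE]|pj] := boolP (p %| j)%N; last first.
  by exists 0; rewrite const0 subr0 e; apply: dvpMl => //; apply: sum_om.
have [c hc] := IH j'; exists (c * p%:R); rewrite e.
set S1 := \sum_(y <- _) _ in rp *; set S2 := \sum_(z < p) _.
have h1 : dvp (Q n.+1) (S1 - C c).
  have := dvp_ph O hc; rewrite rmorphB [ph (C c)]ph_C rmorph_sum.
  congr (dvp _ (_ - _)); apply: eq_bigr => y _.
  by rewrite rmorphXn /= ph_1X -exprM jE; congr (_ ^+ _); lia.
have h2 : dvp (Q n.+1) (S2 - C p%:R).
  have -> : C p%:R = \sum_(z < p) 1 by rewrite sumr_const card_ord const_nat.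
  rewrite /S2 -sumrB; elim/big_ind: _ => [|a b|i _]; [exact: dvp0|exact: dvpD|].
  have := dvp_om n.+2 (i * j'); rewrite jE.
  have -> : (p ^ n.+2 * (i * j') = p ^ n.+1 * (i * (j' * p)))%N by rewrite expnS; lia.
  by apply: dvp_trans; apply: dvp_PQ.
have -> : S1 * S2 - C (c * p%:R) = S1 * (S2 - C p%:R) + (S1 - C c) * C p%:R.
  by rewrite constM; ring.
by apply: dvpD; [apply: dvpMl|apply: dvpMr => //; apply: plus_const].
Qed.

Lemma unit_nat k : ~~ (p %| k)%N -> Zp_unit (k%:R : Qp).
Proof. by move=> pk; apply/eqP; apply: norm_coprime. Qed.

(** Weierstrass division by [P n.+1] reduces to polynomials in X, hence to powers of 1 + X, where
    [trace_om] applies. *)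
Lemma trace_const n f : plus f ->
  exists c, dvp (Q n) (\sum_(k <- reps n) gm k%:R f - C c).
Proof.
move=> fp; pose T f := \sum_(k <- reps n) gm k%:R f.
have TD f1 f2 : T (f1 + f2) = T f1 + T f2.
  by rewrite /T -big_split; apply: eq_bigr => k _; rewrite rmorphD.
have TZ c f1 : T (C c * f1) = C c * T f1.
  rewrite /T mulr_sumr big_seq [RHS]big_seq; apply: eq_bigr => k /reps_coprime/unit_nat ku.
  by rewrite rmorphM gm_C.
pose good f := exists c, dvp (Q n) (T f - C c).
have gD f1 f2 : good f1 -> good f2 -> good (f1 + f2).
  move=> [c1 h1] [c2 h2]; exists (c1 + c2); rewrite TD constD.
  by have := dvpD h1 h2; rewrite addrACA -opprD.
have gZ c f1 : good f1 -> good (C c * f1).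
  move=> [c1 h1]; exists (c * c1); rewrite TZ constM -mulrBr.
  by apply: dvpMl => //; apply: plus_const.
have gom j : good (om ^+ j).
  have [c hc] := trace_om n j; exists c; move: hc; congr (dvp _ (_ - _)).
  rewrite /T big_seq [RHS]big_seq; apply: eq_bigr => k /reps_coprime/unit_nat ku.
  by rewrite rmorphXn /= (gm_1X O ku) onep_nat -exprM.
have gX i j : good (X ^+ i * om ^+ j).
  elim: i j => [|i IH] j; first by rewrite expr0 mul1r.
  have -> : X ^+ i.+1 * om ^+ j = X ^+ i * om ^+ j.+1 + C (- 1) * (X ^+ i * om ^+ j).
    by rewrite constN const1 !exprS; move: (X) (_ ^+ i) => a b; ring.
  by apply: gD => //; apply: gZ.
have [y [r [yp rp rd ->]]] := PN_div n.+1 fp; apply: (gD); last first.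
  rewrite (plus_poly rp rd); elim/big_ind: _ => [|//|i _].
    by exists 0; rewrite /T big1 ?subrr //; [exact: dvp0|move=> i _; rewrite rmorph0].
  by apply: gZ; have := gX i 0%N; rewrite expr0 mulr1.
exists 0; rewrite const0 subr0 /T big_seq.
elim/big_ind: _ => [|a b|k /reps_coprime/unit_nat ku]; [exact: dvp0|exact: dvpD|].
apply: dvp_trans (dvp_PQ O (ltnSn n)) _.
by apply: dvp_gm_PN => //; apply: dvp_mull.
Qed.

Lemma inv_const n f : plus f -> (forall k, ~~ (p %| k)%N -> dvp (Q n) (gm k%:R f - f)) ->
  exists c, dvp (Q n) (f - C c).
Proof.
move=> fp h; have [c hc] := trace_const n fp; pose N := size (reps n).
have N0 : (N%:R : E) != 0 by apply: E_nat_neq0; apply: reps_size.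
exists (c / N%:R); apply: (dvp_Cl N0); rewrite mulrBr -constM [C _ * f]mulrC [N%:R * _]mulrC divfK //.
have -> : f * C N%:R - C c = (\sum_(k <- reps n) gm k%:R f - C c) - \sum_(k <- reps n) (gm k%:R f - f).
  by rewrite sumrB big_const_seq count_predT iter_addr addr0 const_nat mulr_natr; ring.
apply: dvpB => //; rewrite big_seq.
by elim/big_ind: _ => [|a b|k /reps_coprime/h]; [exact: dvp0|exact: dvpD|].
Qed.

End Congruences.

(** * Invariants modulo powers of t *)

Section Invariants.
Variables (R : realType) (p : nat) (Qp : padicNumType R p) (E : ultraFieldExtType Qp).
Variable O : robba_ops E.
Local Notation rb := (robba E).
Local Notation C := (@robba_const R E).
Local Notation pr := (p%:R : R).
Local Notation ph := (op_phi O).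
Local Notation gm := (op_gamma O).
Local Notation phn := (phn O).
Local Notation X := (mon E 1).
Local Notation P := (PN E).
Local Notation Q := (QN O).
Local Notation tau := (tau O).
Local Notation t := (robba_t E).
Implicit Types (f g u w h r B q : rb) (s rho beta theta : R) (x z a : Qp) (c mu lam : E).

Lemma norm_expB1_le y k : unorm (y - 1 : Qp) <= 1 -> unorm (y ^+ k - 1) <= unorm (y - 1).
Proof.
move=> y1; have yy : unorm y <= 1.
  by rewrite -(subrK 1 y) (le_trans (unormD_le _ _)) // ge_max y1 unorm1 lexx.
rewrite subrX1 unormM -[leRHS]mulr1 ler_wpM2l ?unorm_ge0 //.
by apply: unorm_sum_le => // i _; rewrite unormX exprn_ile1 ?unorm_ge0.
Qed.

Lemma norm_expp_sub1 y : unorm (y - 1 : Qp) < pr^-1 -> unorm (y ^+ p - 1) = pr^-1 * unorm (y - 1).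
Proof.
move=> y1; have [q0 q1] := andP (prV_lt1 Qp).
have y2 : unorm (y - 1) <= 1 by rewrite ltW // (lt_trans y1).
rewrite subrX1 unormM mulrC; congr (_ * _).
have -> : \sum_(i < p) y ^+ i = p%:R + \sum_(i < p) (y ^+ i - 1).
  by rewrite sumrB sumr_const card_ord addrC subrK.
rewrite unorm_eqmax (normp Qp) //; apply: unorm_sum_lt => [|i _].
  by rewrite invr_gt0 (pr_gt0 Qp).
exact: le_lt_trans (norm_expB1_le i y2) y1.
Qed.

(* 1 + p^2 generates an open subgroup of Z_p^*, also for p = 2 *)
Definition x0n n : nat := ((1 + p ^ 2) ^ (p ^ n))%N.

Lemma x0n_coprime n : ~~ (p %| x0n n)%N.
Proof.
rewrite Euclid_dvdX ?(p_prime Qp) // negb_and dvdn_addl ?dvdn_exp //.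
by rewrite dvdn1 gtn_eqF ?prime_gt1 ?(p_prime Qp).
Qed.

Lemma x0n_norm n : unorm ((x0n n)%:R - 1 : Qp) = pr ^- n.+2.
Proof.
have [q0 q1] := andP (prV_lt1 Qp); have pp := pr_gt0 Qp.
elim: n => [|n IH].
  by rewrite /x0n expn0 expn1 natrD addrC addKr norm_pX.
have -> : x0n n.+1 = (x0n n ^ p)%N by rewrite /x0n -expnM -expnSr.
rewrite natrX norm_expp_sub1 IH; first by rewrite -!exprVn exprS.
by rewrite exprSr invfM -[ltRHS]mul1r ltr_pM2r ?invr_gt0 // -exprVn exprn_ilt1.
Qed.

Lemma x0n_unit n : Zp_unit ((x0n n)%:R : Qp).
Proof. exact: (unit_nat Qp (x0n_coprime n)). Qed.

Lemma x0n_near n k : (k <= n.+2)%N -> unorm ((x0n n)%:R - 1 : Qp) <= pr ^- k.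
Proof.
move=> kn; rewrite x0n_norm -!exprVn ler_wiXn2l //; first by rewrite invr_ge0 ler0n.
by case/andP: (prV_lt1 Qp) => _ /ltW.
Qed.

Lemma x0n_pow_inj n : injective (fun i => (((x0n n)%:R : Qp)%:A : E) ^+ i).
Proof.
have k1 : (1 < x0n n)%N.
  rewrite /x0n -{1}(exp1n (p ^ n)) ltn_exp2r ?expn_gt0 ?(p_gt0 Qp) //.
  by rewrite addnC -[X in (X < _)%N]add0n ltn_add2r expn_gt0 (p_gt0 Qp).
have nz (a b : nat) : (a%:R : E) = b%:R -> (a <= b)%N -> a = b.
  move=> ab le; apply/eqP; rewrite eqn_leq le -subn_eq0 -leqn0 leqNgt; apply/negP => d0.
  by case/eqP: (E_nat_neq0 E d0); rewrite natrB // ab subrr.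
move=> i j /=; rewrite scaler_nat -!natrX => h; apply: (expnI k1).
by case/orP: (leq_total (x0n n ^ i) (x0n n ^ j)) => le; [|symmetry]; apply: nz le.
Qed.

Lemma tau_of_t m f B : plus f -> f = t ^+ m * B ->
  exists N, forall n, (N <= n)%N -> dvp (tau n ^+ m) f.
Proof.
move=> fp fE; have [rho r01 BO] := robba_onann B.
by have [N hN] := dvp_tau_of_t O m r01; exists N => n Nn; apply: hN fE.
Qed.

Lemma ph_tX m B : ph (t ^+ m * B) = t ^+ m * (C (p%:R ^+ m) * ph B).
Proof. by rewrite rmorphM rmorphXn /= ph_t exprMn -constX; ring. Qed.
Lemma gm_tX m x B : Zp_unit x -> gm x (t ^+ m * B) = t ^+ m * (C (x%:A ^+ m) * gm x B).
Proof. by move=> xu; rewrite rmorphM rmorphXn /= gm_t // exprMn -constX; ring. Qed.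

Lemma dvp_gmQ n x f : Zp_unit x -> dvp (Q n) f -> dvp (Q n) (gm x f).
Proof.
by move=> xu h; have := @dvp_gm R p Qp E O x (Q n) 1 f xu (dvp_gm_QN O n xu); rewrite expr1; apply.
Qed.

Lemma dvp_Qtau n k m f : (n <= k)%N -> (0 < m)%N -> dvp (tau n ^+ m) f -> dvp (Q k) f.
Proof.
move=> nk m0; apply: dvp_trans; apply: dvp_trans (dvp_QN_tau O nk) _.
by case: m m0 => // m _; rewrite exprS; apply: dvp_mull; apply: plusX; apply: plus_tau.
Qed.

(** u is first replaced by a power series r. Invariance modulo t^m gives invariance modulo Q n for
    large n, hence a constant c modulo Q n; the congruence is lifted to Q n ^+ m, since x^i differs
    from 1 on the graded pieces with 0 < i < m. Finally r - c is cut off by [en] and corrected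
    inside t^m R^+ to an exact fixed vector of phi, which is constant by [ph_eigen]. *)
Lemma inv_mod_t m u : (0 < m)%N -> (exists B, ph u - u = t ^+ m * B) ->
  (forall x, Zp_unit x -> exists B, gm x u - u = t ^+ m * B) ->
  exists c B, u = C c + t ^+ m * B.
Proof.
move=> m0 [Bp hBp] hg; have [r [B0 [rp uE]]] := robba_split O m u.
have hp : exists B, ph r - r = t ^+ m * B.
  exists (Bp - C (p%:R ^+ m) * ph B0 + B0); rewrite mulrDr mulrBr -ph_tX -hBp uE rmorphD.
  by move: (ph r) (ph _) (t ^+ m * B0) => a b d; ring.
have hgr x : Zp_unit x -> exists B, gm x r - r = t ^+ m * B.
  move=> xu; have [B hB] := hg x xu; exists (B - C (x%:A ^+ m) * gm x B0 + B0).
  rewrite mulrDr mulrBr -gm_tX // -hB uE rmorphD.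
  by move: (gm x r) (gm x _) (t ^+ m * B0) => a b d; ring.
have [B1 hB1] := hp; have pr1 : plus (ph r - r) by apply: plusB => //; apply: plus_ph.
have [N1 hN1] := tau_of_t pr1 hB1.
pose inv n x := dvp (Q n) (gm x r - r).
(* phi sends Q n to Q (n+1), and r is phi-invariant modulo Q (n+1); so each gamma_x has to be
   controlled at one level only. *)
have invS n x : (N1 <= n)%N -> Zp_unit x -> inv n x -> inv n.+1 x.
  move=> Nn xu h; have hQ : dvp (Q n.+1) (ph r - r) by apply: dvp_Qtau (hN1 n Nn).
  rewrite /inv; have -> : gm x r - r = ph (gm x r - r) - gm x (ph r - r) + (ph r - r).
    rewrite !rmorphB (op_phi_gamma O xu).
    by move: (gm x (ph r)) (gm x r) (ph r) => a b d; ring.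
  apply: dvpD => //; apply: dvpB; last exact: dvp_gmQ.
  exact: dvp_ph h.
have inv_le n k x : (N1 <= n)%N -> (n <= k)%N -> Zp_unit x -> inv n x -> inv k x.
  move=> Nn nk xu h; rewrite -(subnKC nk); elim: (k - n)%N => [|i IH]; first by rewrite addn0.
  by rewrite addnS; apply: invS => //; apply: leq_trans Nn (leq_addr _ _).
(* The level obtained from [tau_of_t] depends on x, but there are finitely many residues modulo
   p^(N1+1); the rest of Z_p^* is reached through [inv_near]. *)
have [n1 Nn1 hn1] : exists2 n1, (N1 <= n1)%N & forall k, (k < p ^ N1.+1)%N ->
    ~~ (p %| k)%N -> inv n1 k%:R.
  elim: (p ^ N1.+1)%N => [|M [n1 Nn1 hn1]]; first by exists N1.
  have [pM|pM] := boolP (p %| M)%N.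
    exists n1 => // k; rewrite ltnS leq_eqVlt => /orP[/eqP->|]; last exact: hn1.
    by rewrite pM.
  have Mu := unit_nat Qp pM; have [B hB] := hgr _ Mu.
  have pM1 : plus (gm M%:R r - r) by apply: plusB => //; apply: plus_gm.
  have [N2 hN2] := tau_of_t pM1 hB; exists (maxn n1 N2); first by rewrite leq_max Nn1.
  move=> k; rewrite ltnS leq_eqVlt => /orP[/eqP-> _|kM pk].
    by apply: (dvp_Qtau (leqnn _) m0); apply: hN2; rewrite leq_maxr.
  by apply: (inv_le n1); rewrite ?leq_maxl //; [apply: unit_nat|apply: hn1].
have inv_near n x : Zp_unit x -> unorm (x - 1) <= pr ^- n.+1 -> inv n x.
  by move=> xu xn; apply: dvp_trans (dvp_PQ O (ltnSn n)) (dvp_gm_sub O xu xn rp).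
have inv_nat k : ~~ (p %| k)%N -> inv n1 k%:R.
  move=> pk; pose q := (p ^ N1.+1)%N; have pq : (p %| q)%N by rewrite dvdn_exp.
  have pa : ~~ (p %| k %% q)%N by rewrite /dvdn modn_dvdm.
  have q0 : (0 < q)%N by rewrite expn_gt0 (p_gt0 Qp).
  have au := unit_nat Qp pa; have ku := unit_nat Qp pk.
  have [zu zE] := Zp_unitV_near au ku; set z := _ / _ in zu zE.
  have a0 : ((k %% q)%:R : Qp) != 0.
    by apply: contraTneq au => ->; rewrite /Zp_unit unorm0 eq_sym oner_eq0.
  have kE : k%:R = (k %% q)%:R * z by rewrite /z mulrCA divff // mulr1.
  have hz : inv n1 z.
    apply: (inv_le N1) => //; apply: inv_near => //; rewrite zE.
    rewrite {1}(divn_eq k q) natrD addrK; apply: norm_dvd; exact: dvdn_mull.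
  rewrite /inv kE op_gammaM //.
  have -> : gm (k %% q)%:R (gm z r) - r = gm (k %% q)%:R (gm z r - r) + (gm (k %% q)%:R r - r).
    by rewrite rmorphB; move: (gm _ _) (gm _ _) => a b; ring.
  by apply: dvpD; [apply: dvp_gmQ|apply: hn1 => //; rewrite ltn_mod].
have xu0 := x0n_unit 0; have [Bx hBx] := hgr _ xu0.
have px0 : plus (gm (x0n 0)%:R r - r) by apply: plusB => //; apply: plus_gm.
have [N2 hN2] := tau_of_t px0 hBx; pose n := maxn n1 N2.
have nn1 : (n1 <= n)%N by rewrite leq_maxl.
have nN1 := leq_trans Nn1 nn1.
have [c hc] : exists c, dvp (Q n) (r - C c).
  apply: inv_const => // k pk; apply: (inv_le n1) => //; [exact: unit_nat|exact: inv_nat].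
(* The index N2 belongs to the fixed element [x0n 0], and [x0n n] is one of its powers; so n may be
   chosen after N2. *)
have hx : dvp (tau n ^+ m) (gm (x0n n)%:R r - r).
  have -> : (x0n n)%:R = (x0n 0)%:R ^+ (p ^ n) :> Qp by rewrite /x0n expn0 expn1 natrX.
  elim: (p ^ n)%N => [|k IH]; first by rewrite expr0 op_gamma1 subrr; apply: dvp0.
  have ku : Zp_unit ((x0n 0)%:R ^+ k : Qp).
    by rewrite /Zp_unit unormX; move/eqP: xu0 => ->; rewrite expr1n.
  rewrite exprS op_gammaM //.
  have -> : gm (x0n 0)%:R (gm ((x0n 0)%:R ^+ k) r) - r =
    gm (x0n 0)%:R (gm ((x0n 0)%:R ^+ k) r - r) + (gm (x0n 0)%:R r - r).
    by rewrite rmorphB; move: (gm _ _) (gm _ _) => a b; ring.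
  apply: dvpD; last by apply: hN2; rewrite leq_maxr.
  by apply: dvp_gm => //; apply: dvp_gm_tau.
have hrc : dvp (Q n ^+ m) (r - C c).
  apply: (unip_dvp (x0n_unit n) (unip_QN O (x0n_unit n) (x0n_near _)) (c := 1) (j := 1)) => //.
    move=> i /andP[i0 _]; apply/eqP => h; have := @x0n_pow_inj n i 0%N.
    by rewrite /= h expr0 => /(_ erefl) e; rewrite e in i0.
  have -> : gm (x0n n)%:R (r - C c) - C 1 * (r - C c) = gm (x0n n)%:R r - r.
    rewrite const1 mul1r rmorphB gm_C ?x0n_unit //.
    by move: (gm _ _) (C c) => a b; ring.
  by apply: dvp_trans hx; apply: dvp_exp; apply: dvp_QN_tau.
pose e := en O n m; pose e' := en O n.+1 m; have phe : ph e = e'.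
  by rewrite /e /en rmorphB rmorphXn rmorphB rmorphXn rmorph1.
(* Modulo t^m R this is still r - c, as [e] is a multiple of [tau n ^+ m]. But it is also divisible
   by [P n ^+ m], which makes phi(u') - u' divisible by t^m with a power series as quotient. *)
pose u' := (r - C c) * (1 - e).
have up : plus u' by apply: plusM; apply: plusB; rewrite ?plus1 //; [apply: plus_const|apply: plus1|apply: plus_en].
have hN := hN1 n nN1.
have ttS i : dvp (tau i.+1 ^+ m) (tau i ^+ m) by apply: dvp_exp; apply: dvp_tau_le.
have [B2 B2p hB2] : dvp (t ^+ m) (ph u' - u').
  have -> : ph u' - u' = (ph r - r) * (1 - e') + (r - C c) * (e - e').
    rewrite /u' rmorphM [ph (r - C c)]rmorphB [ph (1 - e)]rmorphB phe rmorph1 [ph (C c)]ph_C.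
    by move: (ph r) (C c) => a b; ring.
  have ee : dvp (P n ^+ m) (e - e').
    have -> : e - e' = (1 - e') - (1 - e) by ring.
    apply: dvpB; last exact: en_PN; apply: dvp_trans (en_PN O n.+1 m).
    by apply: dvp_exp; apply: dvp_PP.
  have rc : plus (r - C c) by apply: plusB => //; apply: plus_const.
  have e1p : plus (1 - e') by apply: plusB; [apply: plus1|apply: plus_en].
  have eep : plus (e - e') by apply: plusB; apply: plus_en.
  have hP : dvp (P n.+1 ^+ m) ((r - C c) * (e - e')).
    have -> : P n.+1 ^+ m = Q n ^+ m * P n ^+ m by rewrite (PN_Q O) mulrC exprMn.
    exact: dvpM hrc ee.
  apply: (@dvp_t_coprime R p Qp E O n.+1 m).
  - exact: (plusD (plusM pr1 e1p) (plusM rc eep)).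
  - exact: (dvpD (dvpMl (en_PN O n.+1 m) pr1) hP).
  - exact: (dvpD (dvpMr (dvp_trans (ttS n) hN) e1p)
      (dvpMl (dvpB (dvp_trans (ttS n) (en_tau O n m)) (en_tau O n.+1 m)) rc)).
have pm1 : unorm (p%:R ^+ m : E) < 1.
  have [q0 q1] := andP (prV_lt1 Qp).
  by rewrite unormX (normE_p E) exprn_ilt1 // -lt0n.
(* As phi(t^m) = p^m t^m, this is the equation that makes u' + t^m S fixed by phi. *)
have [S Sp hS] := sum_ph_small O pm1 B2p.
have [c' [k [wE kE]]] : exists (c : E) (k : nat), u' + t ^+ m * S = C c * t ^+ k /\
    (c != 0 -> 1 = p%:R ^+ k :> E).
  apply: (ph_eigen (O := O)); first exact: oner_neq0.
  rewrite const1 mul1r rmorphD ph_tX -[ph u'](subrK u') hB2.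
  have -> : C (p%:R ^+ m) * ph S = S - B2 by rewrite -hS; ring.
  by ring.
have {wE kE} [c'' wE] : exists c'', u' + t ^+ m * S = C c''.
  exists (if c' == 0 then 0 else c'); rewrite wE; case: eqVneq kE => [->|c0 kE].
    by rewrite const0 mul0r.
  by have := kE isT; rewrite -(expr0 p%:R) => /p_pow_inj <-; rewrite expr0 mulr1.
have [Be hBe] := t_of_dvp_tau (en_tau O n m).
exists (c + c''), (B0 - S + (r - C c) * Be).
rewrite uE constD -wE mulrDr mulrCA -hBe -/e mulrBr /u'.
by move: (C c) (t ^+ m * S) (t ^+ m * B0) => a b d; ring.
Qed.

Lemma dvp_QN_PX n m f : plus f -> dvp (Q n) (P n ^+ m * f) -> dvp (Q n) f.
Proof.
move=> fp; elim: m => [|m IH]; first by rewrite expr0 mul1r.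
rewrite exprS -mulrA => /dvp_QN_P h; apply/IH/h.
by apply: plusM => //; apply: plusX; apply: plus_PN.
Qed.

(** T is a nonzero constant times [P n ^+ m * tau n.+1 ^+ m]: P n is comaximal with Q n, and
    [tau n.+1 ^+ m] is 1 modulo P (n+1), hence modulo Q n. *)
Lemma tX_QN n m : exists T, [/\ plus T, t ^+ m = Q n ^+ m * T &
  forall c, dvp (Q n) (T * C c) -> c = 0].
Proof.
pose a : E := p%:R ^- n.+1; have a0 : a != 0 by rewrite invr_eq0 expf_neq0 // (E_p_neq0 E).
exists (C (a ^+ m) * (P n ^+ m * tau n.+1 ^+ m)).
have Pp : plus (P n ^+ m) by apply: plusX; apply: plus_PN.
have tp : plus (tau n.+1 ^+ m) by apply: plusX; apply: plus_tau.
split.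
- by apply: plusM; [apply: plus_const|apply: plusM].
- by rewrite (t_PN_tau O n.+1) (PN_Q O) -/a !exprMn constX; ring.
move=> c; rewrite -!mulrA => /(dvp_Cl (expf_neq0 m a0)) h.
have {h} := dvp_QN_PX (plusM tp (plus_const c)) h.
have e : tau n.+1 ^+ m * C c = (tau n.+1 ^+ m - 1) * C c + C c by ring.
rewrite e => h; apply/eqP/negPn/negP => c0; apply: (QN_proper (O := O) (n := n) c0).
rewrite -[C c](addKr ((tau n.+1 ^+ m - 1) * C c)) addrC; apply: dvpB => //.
apply: dvpMr (plus_const c); apply: dvp_trans (dvp_PQ O (ltnSn n)) _.
exact: tau_pow_mod_PN.
Qed.

(** The identity is tested at the single element x = x0n N, modulo Q N ^+ m.+1. As x^i differs from
    x^m for i < m, the power series part r of H is divisible by Q N ^+ m. On the next graded piece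
    gamma_x acts as x^m, so the left side vanishes there, while the right side is lam l(x) k times
    the cofactor T of [tX_QN]. *)
Lemma no_coboundary m H lam (cc : rb) (l : Qp -> E) (s : Qp -> rb) :
  (forall n, exists2 k, k != 0 & dvp (Q n) (cc - C k)) -> plus cc ->
  (forall x, Zp_unit x -> plus (s x)) -> (forall n, l (x0n n)%:R != 0) ->
  (forall x, Zp_unit x ->
    gm x H - C (x%:A ^+ m) * H = C lam * t ^+ m * (C (l x) * cc + t * s x)) ->
  lam = 0.
Proof.
move=> hk ccp sp l0 hH; have [r [B0 [rp HE]]] := robba_split O m.+1 H.
have [rho r01 BO] := robba_onann B0; have r0 : 0 <= rho by case/andP: r01.
have [N hN] := dvp_tau_of_t O m.+1 r01.
have xu := x0n_unit N; have lx := l0 N; have sx := sp _ xu; have {hH} := hH _ xu.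
have ui := unip_QN O xu (x0n_near (leqnSn N.+1)); have inj := @x0n_pow_inj N.
move: (x0n N)%:R xu lx sx ui inj => x xu lx sx ui inj hx.
pose xm : E := x%:A ^+ m; pose G := C lam * t ^+ m * (C (l x) * cc).
have tp := plus_t E; have Gp : plus G.
  apply: plusM; apply: plusM => //; try exact: plus_const; exact: plusX.
pose D := gm x r - C xm * r - G.
have Dp : plus D.
  by apply: plusB => //; apply: plusB; [apply: plus_gm|apply: plusM => //; apply: plus_const].
have DE : D = t ^+ m.+1 * (C lam * s x - C (x%:A ^+ m.+1) * gm x B0 + C xm * B0).
  have e1 : gm x H = gm x r + t ^+ m.+1 * (C (x%:A ^+ m.+1) * gm x B0).
    by rewrite {1}HE rmorphD; congr (_ + _); apply: gm_tX.
  have e2 : gm x r - C xm * r = C lam * t ^+ m * (C (l x) * cc + t * s x)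
      - t ^+ m.+1 * (C (x%:A ^+ m.+1) * gm x B0) + C xm * (t ^+ m.+1 * B0).
    rewrite -hx e1 HE /xm; move: (gm x r) (gm x B0) (C _) (C _) (t ^+ m.+1) => a b d e f; ring.
  rewrite /D e2 /G !exprS.
  by move: (gm x B0) (s x) (C _) (C _) (C _) (C _) (t ^+ m) => a b d e f g h; ring.
have hD : dvp (Q N ^+ m.+1) D.
  apply: dvp_trans (dvp_exp m.+1 (dvp_QN_tau O (leqnn N))) (hN N (leqnn N) _ _ Dp _ DE).
  have cO c : onann rho (C c) by apply: onann_const.
  apply: onannD => //; last exact: onannM.
  apply: onannB => //; apply: onannM => //; last exact: onann_gm.
  by apply: (onann_le r0); apply: plus_onann.
have [T [Tp tE Tc]] := tX_QN N m.
have hr : dvp (Q N ^+ m) r.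
  apply: (unip_dvp xu ui (c := xm) (j := 0)) => //.
  - by move=> i /andP[_ im]; apply/eqP => /inj e; rewrite e ltnn in im.
  - by rewrite expr0; exists r => //; rewrite mul1r.
  have -> : gm x r - C xm * r = D + G by rewrite /D subrK.
  apply: dvpD; first by apply: dvp_trans hD; rewrite exprSr; apply: dvp_mull; apply: plus_QN.
  rewrite /G tE mulrAC mulrC; apply: dvpMr; first exact: dvp_mull.
  by apply: plusM; [apply: plus_const|apply: plusM => //; apply: plus_const].
have [g gp rE] := hr; have [qu qp [y yp [qy yx]] qg] := ui.
have DE2 : D = Q N ^+ m * (y ^+ m * gm x g - C xm * g - C lam * T * (C (l x) * cc)).
  rewrite /D /G rE rmorphM rmorphXn /= qy exprMn tE.
  by move: (gm x g) (Q N ^+ m) (y ^+ m) (C _) (C _) (C _) => a b d e f h; ring.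
rewrite DE2 exprSr in hD; have {hD} := dvp_cancel (unitrX m qu) hD => hD.
have [k k0 hcc] := hk N.
have : lam * l x * k = 0.
  apply: Tc; rewrite !constM.
  have -> : T * (C lam * C (l x) * C k) =
     (y ^+ m - C x%:A ^+ m) * gm x g + C xm * (gm x g - g)
     - (y ^+ m * gm x g - C xm * g - C lam * T * (C (l x) * cc))
     - C lam * C (l x) * T * (cc - C k).
    rewrite /xm constX; move: (gm x g) (y ^+ m) (C _ ^+ m) (C lam) (C (l x)) (C k) => a b d e f h.
    by ring.
  have xp : plus (C x%:A) by apply: plus_const.
  apply: dvpB; last by apply: dvpMl => //; apply: plusM => //; apply: plusM; apply: plus_const.
  apply: dvpB => //; apply: dvpD; last by apply: dvpMl; [apply: qg|apply: plus_const].
  by apply: dvpMr; [apply: dvp_sub_exp|apply: plus_gm].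
by move=> /eqP; rewrite !mulf_eq0 (negPf lx) (negPf k0) !orbF => /eqP.
Qed.

End Invariants.

(** * Cocycles modulo powers of t *)

Section RobbaCvg.
Variables (R : realType) (p : nat) (Qp : padicNumType R p) (A : ultraAlgType Qp).
Local Notation rb := (robba A).
Implicit Types (f g : Qp -> rb) (x : Qp).

Lemma robba_cvg_cst x (l : rb) : robba_cvg (fun=> l) x l.
Proof.
exists 0; first by rewrite lexx ltr01.
move=> s e /andP[s0 _] e0; exists 1 => // y _ _ _ n.
by rewrite subrr robba0E unorm0 mul0r ltW.
Qed.

Lemma robba_cvgD f g x l m : robba_cvg f x l -> robba_cvg g x m ->
  robba_cvg (fun y => f y + g y) x (l + m).
Proof.
move=> [r1 /andP[r10 r11] h1] [r2 /andP[r20 r21] h2].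
exists (Num.max r1 r2) => [|s e]; first by rewrite le_max r10 gt_max r11.
rewrite gt_max -andbA => /and3P[s1 s2 s3] e0.
have [d1 d10 H1] := h1 s e ltac:(by rewrite s1) e0.
have [d2 d20 H2] := h2 s e ltac:(by rewrite s2) e0.
exists (Num.min d1 d2) => [|y yu yx]; first by rewrite lt_min d10.
rewrite lt_min => /andP[y1 y2]; rewrite opprD addrACA.
by apply: gleD; [apply: le_lt_trans s1|apply: H1|apply: H2].
Qed.

Lemma robba_cvgM f g x l m : robba_cvg f x l -> robba_cvg g x m ->
  robba_cvg (fun y => f y * g y) x (l * m).
Proof.
move=> [r1 /andP[r10 r11] h1] [r2 /andP[r20 r21] h2].
have [r3 /andP[r30 r31] h3] := robba_onann l; have [r4 /andP[r40 r41] h4] := robba_onann m.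
exists (Num.max (Num.max r1 r2) (Num.max r3 r4)) => [|s e].
  by rewrite !le_max r10 !gt_max r11 r21 r31 r41.
rewrite !gt_max -!andbA => /and5P[s1 s2 s3 s4 s5] e0.
have s0 : 0 < s by apply: le_lt_trans s1.
have [Kl hl] := h3 s ltac:(by rewrite s3); have [Km hm] := h4 s ltac:(by rewrite s4).
pose K := Num.max 1 (Num.max Kl Km); have K1 : 1 <= K by rewrite le_max lexx.
have K0 : 0 < K by apply: lt_le_trans K1.
pose e' := Num.min 1 (e / K); have e'0 : 0 < e' by rewrite lt_min ltr01 divr_gt0.
have e'e : K * e' <= e by rewrite mulrC -ler_pdivlMr // ge_min lexx orbT.
have [d1 d10 H1] := h1 s e' ltac:(by rewrite s1) e'0.
have [d2 d20 H2] := h2 s e' ltac:(by rewrite s2) e'0.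
exists (Num.min d1 d2) => [|y yu yx]; first by rewrite lt_min d10.
rewrite lt_min => /andP[y1 y2].
have b1 : gle (f y - l) s e' := H1 y yu yx y1; have b2 : gle (g y - m) s e' := H2 y yu yx y2.
have -> : f y * g y - l * m = (f y - l) * (g y - m) + (l * (g y - m) + (f y - l) * m).
  by move: (f y) (g y) => a b; ring.
apply: gle_mono e'e _; apply: gleD => //; last apply: gleD => //.
- apply: gle_mono (gleM s0 b1 b2); rewrite ler_wpM2r ?(ltW e'0) //.
  by apply: le_trans K1; rewrite ge_min lexx.
- apply: gleM => //; apply: gle_mono hl.
  by rewrite !le_max lexx orbT.
- rewrite mulrC; apply: gleM => //; apply: gle_mono hm.
  by rewrite !le_max lexx !orbT.
Qed.

Lemma robba_cvgN f x l : robba_cvg f x l -> robba_cvg (fun y => - f y) x (- l).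
Proof.
move=> [r r01 h]; exists r => // s e rs e0; have [d d0 H] := h s e rs e0.
by exists d => // y yu yx yd; rewrite -opprD; apply: gleN; apply: H.
Qed.

Lemma robba_cvg_const (c : Qp -> A) x :
  (forall e : R, 0 < e -> exists2 d : R, 0 < d & forall y, Zp_unit y -> unorm (y - x) < d ->
    unorm (c y - c x) <= e) ->
  robba_cvg (fun y => robba_const (c y)) x (robba_const (c x)).
Proof.
move=> h; exists 0 => [|s e /andP[s0 _] e0]; first by rewrite lexx ltr01.
have [d d0 H] := h e e0; exists d => // y yu _ yd; rewrite -constB.
by apply: gle_mono (gle_const _ s); apply: H.
Qed.

Lemma robba_cvg_alg x n : robba_cvg (fun y => robba_const (y%:A ^+ n : A)) x (robba_const (x%:A ^+ n)).
Proof.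
elim: n => [|n IH].
  rewrite expr0 (_ : (fun y => _) = fun=> robba_const (1 : A)); first exact: robba_cvg_cst.
  by apply/funext => y; rewrite expr0.
have h : robba_cvg (fun y => robba_const (y%:A : A)) x (robba_const x%:A).
  apply: robba_cvg_const => e e0; exists e => // y _ yx.
  by rewrite -scalerBl unorm_alg ltW.
have := robba_cvgM h IH; rewrite -constM -exprS (_ : (fun y => _ * _) = fun y => robba_const (y%:A ^+ n.+1)) //.
by apply/funext => y; rewrite exprS constM.
Qed.
End RobbaCvg.

(** * The logarithm of phi(X)/X^p and the p-adic logarithm on Z_p^* *)

Section Kappa.
Variables (R : realType) (p : nat) (Qp : padicNumType R p) (E : ultraFieldExtType Qp).
Variable O : robba_ops E.
Local Notation rb := (robba E).
Local Notation C := (@robba_const R E).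
Local Notation pr := (p%:R : R).
Local Notation ph := (op_phi O).
Local Notation gm := (op_gamma O).
Local Notation phn := (phn O).
Local Notation X := (mon E 1).
Local Notation P := (PN E).
Local Notation rho := (rhoN R p 1).
Implicit Types (f g u w h r B q L : rb) (s beta theta : R) (x z a : Qp) (c mu lam : E).

Let r01 : 0 <= rho < 1. Proof. by have [] := @rhoN_bnd R p Qp 1 0. Qed.

(* The logarithm of phi(X) / X^p is the source of the cocycles below: modulo tau n it is
   a power series, and its Gamma-coboundary has constant term proportional to log. *)
Definition wkap : rb := ph X * (X ^+ p)^-1.

Lemma XpV : (X ^+ p)^-1 = mon E (- p%:Z).
Proof. by rewrite mon_exp natz monV. Qed.

Lemma kappa_ex : exists kap, islog rho wkap kap.
Proof.
suff h : near1 rho wkap by have [Y [_ hY _]] := islog_ex r01 h; eexists; exact: hY.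
have wE : wkap - 1 = mon E (- p%:Z) * (P 1 - mon E (p ^ 1)%N).
  by rewrite /wkap XpV (ph_X O) mulrBr mon_mon expn1 addNr mon0 mulrC.
have r0 : 0 <= rho by case/andP: r01.
split.
  rewrite -(subrK 1 wkap); apply: onannD => //; last exact: onann1.
  rewrite wE; apply: onannM => //; first exact: onann_mon.
  apply: onannB => //; last exact: onann_mon.
  by apply: (onann_le r0); apply: plus_onann; apply: plus_PN.
move=> s rs; have s0 : 0 < s by apply: le_lt_trans (proj1 (andP rs)).
have [hd hs] := @PN_pdom R p Qp E 1 s rs; rewrite expn1 in hs.
have sp : 0 < s ^ p%:Z by rewrite exprz_gt0.
exists (s ^ (- p%:Z) * pr^-1); last by rewrite wE; apply: gleM => //; apply: gle_mon.
rewrite mulr_ge0 ?sz0 ?invr_ge0 ?ler0n //= -invr_expz mulrC ltr_pdivrMr //.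
by rewrite mul1r.
Qed.

Lemma fermat_unit x : Zp_unit x -> unorm (x ^+ p.-1 - 1) < 1.
Proof.
move=> xu; have xu' : unorm x = 1 by apply/eqP.
have [q0 q1] := andP (prV_lt1 Qp); have x1 : unorm x <= 1 by rewrite xu'.
have [k hk] := zp_approx x1 (ltr01 : 0 < 1 :> R).
have kp : unorm ((k ^ p)%:R - k%:R : Qp) < 1.
  have le : (k <= k ^ p)%N.
    by case: k {hk} => // k; rewrite -{1}[k.+1]expn1 leq_pexp2l // (p_gt0 Qp).
  rewrite -natrB //; apply: le_lt_trans (_ : pr ^- 1 < _); last by rewrite expr1.
  by apply: norm_dvd; rewrite expn1 -eqn_mod_dvd // fermat_little // (p_prime Qp).
have xk : unorm (x ^+ p - (k ^ p)%:R) < 1.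
  rewrite natrX subrXX unormM -[ltRHS]mul1r; apply: le_lt_trans (_ : unorm (x - k%:R) * 1 < _).
    rewrite ler_wpM2l ?unorm_ge0 //; apply: unorm_sum_le => // i _.
    by rewrite unormM !unormX mulr_ile1 ?exprn_ge0 ?unorm_ge0 ?exprn_ile1 ?unorm_ge0 // ?unorm_nat_le1.
  by rewrite mulr1 mul1r.
have -> : unorm (x ^+ p.-1 - 1) = unorm (x ^+ p - x).
  have xE : x ^+ p = x * x ^+ p.-1 by rewrite -exprS prednK // (p_gt0 Qp).
  have -> : x ^+ p - x = x * (x ^+ p.-1 - 1) by rewrite xE mulrBr mulr1.
  by rewrite unormM xu' mul1r.
have -> : x ^+ p - x = (x ^+ p - (k ^ p)%:R) + ((k ^ p)%:R - k%:R) - (x - k%:R) by ring.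
by apply: unormB_lt => //; apply: unormD_lt.
Qed.

Lemma log_const c : unorm (c - 1) < 1 -> exists l, islog 0 (C c) (C l).
Proof.
move=> c1; have h : near1 0 (C c).
  split; first exact: onann_const.
  move=> s _; exists (unorm (c - 1)); first by rewrite unorm_ge0.
  by rewrite -const1 -constB; apply: gle_const.
have [Y [_ hL _]] := islog_ex (zero_ann R) h; move: (_ * Y) hL => L hL.
exists (L 0); suff <- : L = C (L 0) by [].
apply: robba_ext => n; rewrite robbaCE; case: eqP => [->//|n0].
case: hL => _ tL; apply: (tends_coef0 (N := 0) (zero_ann R) tL) => k _.
rewrite /logseq -constX -const1 -constB -constM robbaCE.
by case: eqP n0.
Qed.

Lemma alg_norm1 x : Zp_unit x -> unorm (x%:A : E) = 1.
Proof. by move=> /eqP xu; rewrite unorm_alg. Qed.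
Lemma alg_neq0 x : Zp_unit x -> (x%:A : E) != 0.
Proof. by move=> xu; apply: contra_eq_neq (alg_norm1 xu) => ->; rewrite unorm0 eq_sym oner_eq0. Qed.

(** After division by its constant term, gamma_x(X)/X is 1 plus a multiple of X of norm at most 1 on
    the disc; comparison with a radius s' > s gives distance s/s' < 1 to 1. *)
Lemma log_vx x : Zp_unit x -> exists L, [/\ plus L, L 0 = 0 & islog 0 (C (x%:A)^-1 * vx E x) L].
Proof.
move=> xu; set f := C _ * _; have fp : plus f by apply: plusM; [apply: plus_const|apply: plus_vx].
have f1p : plus (f - 1) by apply: plusB => //; apply: plus1.
have f10 : (f - 1) 0 = 0.
  by rewrite robbaBE constM_coef vx0 // mulVf ?alg_neq0 // robba1E subrr.
have hb s' : 0 < s' < 1 -> gle (f - 1) s' 1.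
  move=> /andP[s0 s1]; apply: gleB => //; last exact: gle1.
  rewrite -[Y in gle _ _ Y]mul1r; apply: gleM => //.
    by apply: gle_mono (gle_const _ _); rewrite unormV alg_norm1 // invr1.
  by apply: gle_vX; [apply/eqP|rewrite s0 ltW].
have h : near1 0 f.
  split; first exact: plus_onann.
  move=> s /andP[s0 s1]; pose s' := (s + 1) / 2; have /andP[ss' s'1] : s < s' < 1 by rewrite !midf_lt.
  have s'0 : 0 < s' by apply: lt_trans ss'.
  have b1 : s / s' < 1 by rewrite ltr_pdivrMr // mul1r.
  have b0 : 0 <= s / s' by rewrite divr_ge0 // ltW.
  exists (s / s') => [|[[|n]|n]]; first by rewrite b0.
  - by rewrite f10 unorm0 mul0r.
  - have := hb s' ltac:(by rewrite s'0) n.+1.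
    have -> : s ^ n.+1%:Z = s' ^ n.+1%:Z * (s / s') ^+ n.+1.
      by rewrite -!exprnP -exprMn mulrCA divff ?mulr1 // gt_eqF.
    move=> le1; rewrite mulrA -[leRHS]mul1r; apply: ler_pM => //.
    + by rewrite mulr_ge0 ?unorm_ge0 // sz0.
    + by rewrite exprn_ge0.
    + by rewrite exprS ler_piMr // exprn_ile1 // ltW.
  - by rewrite f1p // unorm0 mul0r.
have [Y [_ hL /(_ fp) Yp]] := islog_ex (zero_ann R) h; exists ((f - 1) * Y); split=> //.
  exact: plusM.
by rewrite robbaM_plus0 // f10 mul0r.
Qed.

Lemma wkap_gm x : Zp_unit x -> gm x wkap * vx E x ^+ p = wkap * ph (vx E x).
Proof.
move=> xu; have vu : vx E x ^+ p \is a GRing.unit by apply: unitrX; apply: (vx_unit O).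
have Xu : X ^+ p \is a GRing.unit by apply: unitrX; apply: mon_unit.
have e1 : gm x wkap = ph X * ph (vx E x) * (X ^+ p * vx E x ^+ p)^-1.
  rewrite /wkap rmorphM rmorphV // rmorphXn /= gm_XE // exprMn.
  by rewrite -(op_phi_gamma O xu) gm_XE // rmorphM.
have hv := mulVr vu; have iM := invrM Xu vu; rewrite e1 iM /wkap.
move: (vx E x ^+ p) hv => e; move: (e^-1) => d hv.
move: (ph X) (ph (vx E x)) ((X ^+ p)^-1) => a b c.
transitivity (a * c * b * (d * e)); first ring.
by rewrite hv mulr1.
Qed.

Variable kap : rb.
Hypothesis kapL : islog rho wkap kap.
Definition ukap x : rb := gm x kap - kap.

Let r0 : 0 <= rho. Proof. by case/andP: r01. Qed.
Let wO : onann rho wkap.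
Proof.
rewrite /wkap XpV; apply: onannM => //; last exact: onann_mon.
by apply: (onann_le r0); apply: plus_onann; rewrite (ph_X O); apply: plus_PN.
Qed.

(** Logarithms are taken in the relation [wkap_gm]. Since x need not be close to 1, gamma_x(X)/X is
    written as x v1 and the constants are collected into x^(1-p), which is close to 1 by
    [fermat_unit]. *)
Lemma ukapE x : Zp_unit x -> exists L l, [/\ plus L, L 0 = 0 & ukap x = ph L - L *+ p + C l].
Proof.
move=> xu; have [L [Lp L0 hL]] := log_vx xu; set a : E := x%:A.
have a0 : a != 0 by apply: alg_neq0.
pose c := (a ^+ p.-1)^-1; have [|l hl] := @log_const c.
  have an : a ^+ p.-1 != 0 by rewrite expf_neq0.
  have -> : c - 1 = - ((a ^+ p.-1 - 1) / a ^+ p.-1).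
    by rewrite mulrBl divff // mul1r opprB.
  rewrite unormN unormM unormV unormX alg_norm1 // expr1n invr1 mulr1.
  have -> : a ^+ p.-1 - 1 = (x ^+ p.-1 - 1)%:A.
    by rewrite -!(in_algE E) rmorphB rmorphXn rmorph1.
  by rewrite unorm_alg fermat_unit.
exists L, l; split=> //; set v1 := C a^-1 * vx E x in hL.
have v1p : plus v1 by apply: plusM; [apply: plus_const|apply: plus_vx].
have v1O : onann rho v1 by apply: (onann_le r0); apply: plus_onann.
have gO : onann rho (gm x wkap) by exact: onann_gm.
have vpO : onann rho (v1 ^+ p) by exact: onannX.
have l1 : islog rho (gm x wkap) (gm x kap) by exact: islog_gm.
have l2 : islog rho (v1 ^+ p) (L *+ p) by exact: (islogX p r01 v1O (islog_le r0 hL)).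
have h1 := islogM r01 gO vpO l1 l2.
have pv : plus (ph v1) by apply: plus_ph.
have pvO := plus_onann pv; have l3 := islog_plus_ph O v1p Lp hL.
have l4 := islogM (zero_ann R) pvO (@onann_const R E 0 c) l3 hl.
have pO : onann rho (ph v1 * C c).
  by apply: (onann_le r0); apply: plus_onann; apply: plusM => //; apply: plus_const.
have h2 := islogM r01 wO pO kapL (islog_le r0 l4).
have e : gm x wkap * v1 ^+ p = wkap * (ph v1 * C c).
  rewrite /v1 exprMn mulrCA wkap_gm // [ph (C a^-1 * vx E x)]rmorphM ph_C -constX.
  have -> : a^-1 ^+ p = a^-1 * c.
    by rewrite /c -exprVn -exprS prednK // (p_gt0 Qp).
  by rewrite constM; ring.
rewrite e in h1; have e2 := islog_uniq r01 h1 h2.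
rewrite /ukap -(addrK (L *+ p) (gm x kap)) e2.
by move: (ph L) (C l) (L *+ p) => b d f; ring.
Qed.

Lemma plus_ukap x : Zp_unit x -> plus (ukap x).
Proof.
move=> /ukapE[L [l [Lp _ ->]]]; apply: plusD; last exact: plus_const.
by apply: plusB; [apply: plus_ph|rewrite -mulr_natr -const_nat; apply: plusM => //; apply: plus_const].
Qed.

Lemma p1_neq0 : 1 - p%:R != 0 :> E.
Proof.
rewrite subr_eq0; apply: contraTneq (prV_lt1 Qp) => e.
by rewrite -(normE_p E) -e unorm1 ltxx andbF.
Qed.

(** The constant term of [ukap x] is log(x^(1-p)), so this is the p-adic logarithm of x. *)
Definition lg x : E := ukap x 0 / (1 - p%:R).

Lemma ukapM x y : Zp_unit x -> Zp_unit y -> ukap (x * y) = ukap x + gm x (ukap y).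
Proof.
move=> xu yu; rewrite /ukap op_gammaM // rmorphB.
by move: (gm x kap) (gm x _) => a b; ring.
Qed.

Lemma lgM x y : Zp_unit x -> Zp_unit y -> lg (x * y) = lg x + lg y.
Proof.
by move=> xu yu; rewrite /lg ukapM // robbaDE gm_coef0 ?mulrDl //; apply: plus_ukap.
Qed.

Lemma gle_WN n s : 0 < s < 1 -> gle (WN E n.+1) s (Num.max pr^-1 s).
Proof.
move=> /andP[s0 s1] [[|k]|k].
- rewrite WN0 expr0z mulr1 (normE_nat E) norm_pX le_max -exprVn exprS.
  have [q0 q1] := andP (prV_lt1 Qp).
  by rewrite ler_piMr // exprn_ile1 // ltW.
- rewrite mon_mulE opprK -PoszD robbaBE addn1 onep_natE robba1E subr0 le_max.
  apply/orP; right; rewrite -exprnP exprS mulrCA -[leRHS]mulr1 ler_wpM2l ?(ltW s0) //.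
  by rewrite mulr_ile1 ?unorm_ge0 ?exprn_ge0 ?(ltW s0) ?unorm_nat_le1 // exprn_ile1 // ltW.
- by rewrite plus_WN // unorm0 mul0r le_max invr_ge0 ler0n.
Qed.

(** For x close to 1, v = gamma_x(X)/X has a logarithm without normalization. It is a multiple of v
    - 1, hence of P (n+1)/X by [gm_near]. *)
Lemma ukap_near n x : Zp_unit x -> unorm (x - 1) <= pr ^- n.+1 ->
  exists L y, [/\ plus y, L = WN E n.+1 * y, ukap x = ph L - L *+ p & islog 0 (vx E x) L].
Proof.
move=> xu xn; have [h [hp hE hb]] := gm_near O xu xn.
have vp := plus_vx E xu.
have vE : vx E x - 1 = WN E n.+1 * h.
  have e : X * (vx E x - 1) = X * (WN E n.+1 * h).
    by rewrite mulrBr mulr1 -(gm_XE O xu) hE (PN_W E n.+1) mulrA.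
  exact: (mulrI (mon_unit E 1)) e.
have nv : near1 0 (vx E x).
  split; first exact: plus_onann.
  move=> s s01; exists (Num.max pr^-1 s).
    have [q0 q1] := andP (prV_lt1 Qp); case/andP: (s01) => s0 s1.
    by rewrite le_max q0 gt_max q1 s1.
  by rewrite vE -[Y in gle _ _ Y]mulr1; apply: gleM; [case/andP: s01|apply: gle_WN|apply: hb].
have [Y [_ hL /(_ vp) Yp]] := islog_ex (zero_ann R) nv.
exists ((vx E x - 1) * Y), (h * Y); split=> //; [exact: plusM|by rewrite vE mulrA|].
have Lp : plus ((vx E x - 1) * Y) by apply: plusM => //; apply: plusB => //; apply: plus1.
move: (_ * Y) Lp hL => L Lp hL.
have vO : onann rho (vx E x) by apply: (onann_le r0); apply: plus_onann.
have gO : onann rho (gm x wkap) by exact: onann_gm.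
have vpO : onann rho (vx E x ^+ p) by exact: onannX.
have l1 : islog rho (gm x wkap) (gm x kap) by exact: islog_gm.
have l2 : islog rho (vx E x ^+ p) (L *+ p) by exact: (islogX p r01 vO (islog_le r0 hL)).
have h1 := islogM r01 gO vpO l1 l2.
have pv : plus (ph (vx E x)) by apply: plus_ph.
have pO : onann rho (ph (vx E x)) by apply: (onann_le r0); apply: plus_onann.
have h2 := islogM r01 wO pO kapL (islog_le r0 (islog_plus_ph O vp Lp hL)).
rewrite wkap_gm // in h1; have e2 := islog_uniq r01 h1 h2.
rewrite /ukap -(addrK (L *+ p) (gm x kap)) e2.
by move: (ph L) (L *+ p) => b d; ring.
Qed.

Lemma lg_near L x : Zp_unit x -> plus L -> ukap x = ph L - L *+ p -> lg x = L 0.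
Proof.
have eL : (L *+ p) 0 = p%:R * L 0 by rewrite -[L *+ p]mulr_natl -const_nat constM_coef.
move=> xu Lp e; rewrite /lg e robbaBE (ph_coef0 O Lp) eL.
by rewrite -{1}[L 0]mul1r -mulrBl mulrC mulrA mulVf ?mul1r ?p1_neq0.
Qed.

(** lg x is the limit of the (x^(p^k) - 1)/p^k, and for x = x0n n all of these have the same norm
    p^-(n+2). *)
Lemma lg_x0n n : lg (x0n p n)%:R != 0.
Proof.
have xu := x0n_unit Qp n; have [L [y [yp LE ue hL]]] := ukap_near xu (x0n_near Qp (leqnSn n.+1)).
have Lp : plus L by rewrite LE; apply: plusM => //; apply: plus_WN.
rewrite (lg_near xu Lp ue); apply/eqP => L0; case: hL => _ tL.
have [q0 q1] := andP (prV_lt1 Qp); have pp := pr_gt0 Qp.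
pose s : R := 2^-1; have s01 : 0 < s < 1 by rewrite invr_gt0 ltr0n invf_lt1 // ltr1n.
have d0 : 0 < pr ^- n.+2 / 2 by rewrite divr_gt0 // invr_gt0 exprn_gt0.
have [N /(_ N (leqnn N) 0)] := tL s _ s01 d0.
rewrite robbaBE L0 sub0r unormN expr0z mulr1 constM_coef robbaBE robba1E plusX0; last exact: plus_vx.
rewrite vx0 // unormM (normE_pV E).
have xk k : unorm ((((x0n p n)%:R : Qp)%:A : E) ^+ (p ^ k) - 1) = pr ^- k * pr ^- n.+2.
  have -> : (((x0n p n)%:R : Qp)%:A : E) ^+ (p ^ k) - 1 = ((x0n p (n + k))%:R - 1 : Qp)%:A.
    have -> : (x0n p (n + k))%:R = (x0n p n)%:R ^+ (p ^ k) :> Qp.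
      by rewrite -natrX /x0n -expnM -expnD.
    by rewrite -!(in_algE E) rmorphB rmorphXn rmorph1.
  by rewrite unorm_alg x0n_norm -invfM -exprD !addnS addnC.
rewrite xk mulrA divff ?mul1r ?gt_eqF ?exprn_gt0 // => h.
have : pr ^- n.+2 / 2 < pr ^- n.+2.
  by rewrite ltr_pdivrMr // ltr_pMr ?ltr1n // invr_gt0 exprn_gt0.
by rewrite ltNge h.
Qed.

Lemma lg_cvg x : Zp_unit x -> robba_cvg (fun y => C (lg y)) x (C (lg x)).
Proof.
move=> xu; have [r /andP[rr0 r1] h] := robba_cvg_gm O kap xu.
apply: robba_cvg_const => e e0; pose d := unorm ((1 - p%:R)^-1 : E).
have d0 : 0 <= d by apply: unorm_ge0.
have [s rs] : exists s, r < s < 1 by exists ((r + 1) / 2); rewrite !midf_lt.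
have [dl dl0 H] := h s (e / (d + 1)) rs ltac:(by rewrite divr_gt0 // ltr_wpDl).
exists dl => // y yu yx; have [->|yx'] := eqVneq y x; first by rewrite subrr unorm0 ltW.
have := H y yu yx' yx 0; rewrite expr0z mulr1 => le.
have -> : lg y - lg x = (gm y kap - gm x kap) 0 / (1 - p%:R).
  rewrite /lg -mulrBl /ukap !robbaBE; congr (_ * _).
  by move: (gm y kap 0) (gm x kap 0) (kap 0) => a b c; ring.
rewrite unormM -/d; apply: le_trans (ler_wpM2r d0 le) _.
by rewrite mulrAC ler_pdivrMr ?ltr_wpDl // ler_wpM2l ?(ltW e0) // lerDl.
Qed.

End Kappa.

(** * The coboundary of [kap] modulo powers of [PN n] *)

Section WeightClass.
Variables (R : realType) (p : nat) (Qp : padicNumType R p) (E : ultraFieldExtType Qp).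
Variable O : robba_ops E.
Local Notation rb := (robba E).
Local Notation C := (@robba_const R E).
Local Notation pr := (p%:R : R).
Local Notation ph := (op_phi O).
Local Notation gm := (op_gamma O).
Local Notation phn := (phn O).
Local Notation X := (mon E 1).
Local Notation P := (PN E).
Local Notation Q := (QN O).
Local Notation W := (WN E).
Local Notation tau := (tau O).
Local Notation t := (robba_t E).
Implicit Types (f g u w h r B q L : rb) (s beta theta : R) (x y z a : Qp) (c mu lam : E).

Variable kap : rb.
Hypothesis kapL : islog (rhoN R p 1) (wkap O) kap.
Local Notation ukap := (ukap O kap).
Local Notation lg := (lg O kap).

Variable M : nat.
Hypothesis M0 : (0 < M)%N.
Let e0 := en O 0 M.
Let e1 := en O 1 M.
(** phi - p applied to e0. For x close to 1, [ukap x] is phi - p applied to log v, and log v agrees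
    with [lg x] times e0 at the zeros of the relevant P n; so [lg x] times wh is the expected value
    of [ukap x] up to coboundaries. *)
Let wh := e1 - C p%:R * e0.

Let e0p : plus e0. Proof. exact: plus_en. Qed.
Let e1p : plus e1. Proof. exact: plus_en. Qed.
Let whp : plus wh. Proof. by apply: plusB => //; apply: plusM => //; apply: plus_const. Qed.

Lemma dvp_exp1 q n f : (0 < n)%N -> plus q -> dvp (q ^+ n) f -> dvp q f.
Proof.
case: n => // n _ qp; apply: dvp_trans; rewrite exprS; apply: dvp_mull; exact: plusX.
Qed.

Lemma ph_en n : ph (en O n M) = en O n.+1 M.
Proof. by rewrite /en rmorphB rmorphXn rmorphB rmorphXn rmorph1. Qed.

Local Opaque en.

Lemma dvp_gm_en n x : Zp_unit x -> dvp (t ^+ M) (gm x (en O n M) - en O n M).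
Proof.
move=> xu; have ep := plus_en O n M; have gp := plus_gm O xu ep.
apply: (@dvp_t_coprime R p Qp E O n M); first exact: plusB.
  have e : gm x (en O n M) - en O n M = (1 - en O n M) - gm x (1 - en O n M).
    rewrite [gm x (1 - en O n M)]rmorphB [gm x 1]rmorph1.
    by move: (gm x (en O n M)) (en O n M) => a b; ring.
  rewrite e; apply: dvpB; first exact: en_PN.
  by apply: dvp_gm; [|apply: dvp_gm_PN => //; apply: dvp_refl|apply: en_PN].
apply: dvpB; last exact: en_tau.
by apply: dvp_gm; [|apply: dvp_gm_tau|apply: en_tau].
Qed.

Lemma dvp_gm_wh x : Zp_unit x -> dvp (t ^+ M) (gm x wh - wh).
Proof.
move=> xu; have -> : gm x wh - wh = (gm x e1 - e1) - C p%:R * (gm x e0 - e0).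
  rewrite [gm x wh]rmorphB [gm x (C _ * e0)]rmorphM gm_C //.
  rewrite /wh; move: (gm x e1) (gm x e0) (C _) => a b c; move: e1 e0 => d e; ring.
apply: dvpB; first exact: dvp_gm_en.
by apply: dvpMl; [apply: dvp_gm_en|apply: plus_const].
Qed.

Lemma e0_0 : e0 0 = 1.
Proof.
have h := en_PN O 0 M; rewrite -/e0 in h.
have /dvpX0 : dvp X (1 - e0) by rewrite -PN_0; apply: dvp_exp1 M0 (plus_PN _ _) h.
by rewrite robbaBE robba1E => /eqP; rewrite subr_eq0 => /eqP <-.
Qed.

Lemma wh0 : wh 0 = 1 - p%:R.
Proof.
rewrite robbaBE constM_coef e0_0 mulr1; congr (_ - _).
by rewrite /e1 -ph_en (ph_coef0 O e0p) e0_0.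
Qed.

Lemma e0_W n : exists z : rb, [/\ plus z, e0 = W n * z & z 0 = p%:R ^- n].
Proof.
have [h hp hE] := en_tau O 0 M; rewrite -/e0 in hE.
have eW : ell E = C (p%:R ^- n) * (W n * tau n).
  apply: (mulrI (mon_unit E 1)); rewrite -t_ell {1}(t_PN_tau O n) (PN_W E n).
  by ring.
have eE : e0 = W n * (C (p%:R ^- n) * tau n * (ell E ^+ M.-1 * h)).
  rewrite hE -(prednK M0) exprS /= -/(ell E).
  have -> : tau 0 = ell E by [].
  by rewrite {1}eW; ring.
have zp : plus (C (p%:R ^- n) * tau n * (ell E ^+ M.-1 * h)).
  apply: plusM; first by apply: plusM; [apply: plus_const|apply: plus_tau].
  by apply: plusM => //; apply: plusX; apply: plus_ell.
move: (C (p%:R ^- n) * tau n * (ell E ^+ M.-1 * h)) zp eE => z zp eE; exists z; split=> //.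
have := congr1 (fun f : rb => f 0) eE.
have Wp : plus (W n) by exact: plus_WN.
rewrite e0_0 (robbaM_plus0 Wp zp) WN0 natrX => e.
by apply: (mulfI (pX_neq0 E n)); rewrite divff ?pX_neq0.
Qed.

(** log v and its constant term times e0 are both multiples of W (n+1) = P (n+1)/X; their difference
    also vanishes at 0, so it is a multiple of P (n+1), and phi - p is applied to it. *)
Lemma ukap_mod n x : Zp_unit x -> unorm (x - 1) <= pr ^- n.+1 ->
  dvp (P n.+1) (ukap x - C (lg x) * wh).
Proof.
move=> xu xn; have [L [y [yp LE ue _]]] := ukap_near kapL xu xn.
have Lp : plus L by rewrite LE; apply: plusM => //; apply: plus_WN.
have [z [zp zE z0]] := e0_W n.+1; rewrite (lg_near xu Lp ue).
have L0 : L 0 = p%:R ^+ n.+1 * y 0.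
  have Wp : plus (W n.+1) by exact: plus_WN.
  by rewrite LE (robbaM_plus0 Wp yp) WN0 natrX.
have h : dvp (P n.+1) (L - C (L 0) * e0).
  have -> : L - C (L 0) * e0 = W n.+1 * (y - C (L 0) * z).
    by rewrite zE {1}LE; move: (C _) => a; ring.
  have yz : plus (y - C (L 0) * z) by apply: plusB => //; apply: plusM => //; apply: plus_const.
  rewrite (PN_W E n.+1) mulrC; apply: dvpM; first exact: dvp_refl.
  apply: dvp_X => //; rewrite robbaBE constM_coef z0 L0 mulrAC divff ?pX_neq0 //.
  by rewrite mul1r subrr.
have -> : ukap x - C (L 0) * wh = ph (L - C (L 0) * e0) - C p%:R * (L - C (L 0) * e0).
  rewrite ue [ph (L - _)]rmorphB [ph (_ * e0)]rmorphM ph_C -[L *+ p]mulr_natl -const_nat.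
  by rewrite /wh /e0 ph_en -/e1; move: (C _) (C _) (ph L) => a b c; ring.
apply: dvpB; last by apply: dvpMl => //; apply: plus_const.
by have := dvp_ph O h; rewrite ph_PN; apply: dvp_trans; apply: dvp_PP.
Qed.

(** Successive approximation: on P^j/P^(j+1) the operator gamma_x - 1 is the constant x^j - 1,
    nonzero for j > 0, and dividing the error by it gives the next correction. The passage from j =
    0 to 1 is [ukap_mod]. *)
Lemma rho_step n j : (j <= M)%N -> exists2 rh, plus rh &
  dvp (P n.+1 ^+ j) (ukap (x0n p n)%:R - C (lg (x0n p n)%:R) * wh - (gm (x0n p n)%:R rh - rh)).
Proof.
have xu := x0n_unit Qp n; have xn := x0n_near Qp (leqnSn n.+1).
have um := ukap_mod xu xn; have [Pu Pp [y yp [qy yx]] qg] := unip_PN O xu xn.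
have inj := @x0n_pow_inj R p Qp E n.
move: (x0n p n)%:R xu xn um qy yx qg inj => x xu xn um qy yx qg inj.
have dp : plus (ukap x - C (lg x) * wh) by apply: dvp_plus um.
elim: j => [|j IH] jM.
  by exists 0; [exact: plus0|rewrite rmorph0 subrr subr0 expr0; exists (ukap x - C (lg x) * wh); rewrite ?mul1r].
have [->|j0] := posnP j.
  by exists 0; [exact: plus0|rewrite rmorph0 subrr subr0 expr1].
have [rh rhp [z zp zE]] := IH (ltnW jM).
pose c := (x%:A : E) ^+ j - 1; have c0 : c != 0.
  rewrite subr_eq0; apply/eqP => h; have := inj j 0%N.
  by rewrite /= h expr0 => /(_ erefl) e; rewrite e in j0.
pose ze : rb := C c^-1 * z; have zep : plus ze by apply: plusM => //; apply: plus_const.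
have zc : z = C c * ze by rewrite /ze mulrA -constM divff // mul1r.
exists (rh + P n.+1 ^+ j * ze); first by apply: plusD => //; apply: plusM => //; apply: plusX.
have e1' : gm x (P n.+1 ^+ j * ze) = P n.+1 ^+ j * (y ^+ j * gm x ze).
  by rewrite rmorphM rmorphXn /= qy exprMn mulrA.
have -> : ukap x - C (lg x) * wh - (gm x (rh + P n.+1 ^+ j * ze) - (rh + P n.+1 ^+ j * ze)) =
   P n.+1 ^+ j * (C c * ze - (y ^+ j * gm x ze - ze)).
  rewrite [gm x (rh + _)]rmorphD e1'.
  have -> : P n.+1 ^+ j * (C c * ze - (y ^+ j * gm x ze - ze)) =
    P n.+1 ^+ j * z - P n.+1 ^+ j * (y ^+ j * gm x ze - ze) by rewrite zc mulrBr.
  by rewrite -zE; move: (ukap x - _) (gm x rh) (y ^+ j * _) (P _ ^+ j) => a b d e; ring.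
have -> : C c * ze - (y ^+ j * gm x ze - ze) =
   - ((y ^+ j - C x%:A ^+ j) * gm x ze + C x%:A ^+ j * (gm x ze - ze)).
  by rewrite /c constB constX const1; move: (gm x ze) (y ^+ j) (C _ ^+ j) => a b d; ring.
rewrite exprSr; apply: dvpM; first exact: dvp_refl.
apply: dvpN; apply: dvpD.
  by apply: dvpMr; [apply: dvp_sub_exp => //; apply: plus_const|apply: plus_gm].
by apply: dvpMl; [apply: qg|apply: plusX; apply: plus_const].
Qed.

Section Average.
Variables (n : nat) (rh : rb).
Hypothesis rhp : plus rh.
Let PM := P n.+1 ^+ M.
Let x0 : Qp := (x0n p n)%:R.
Let dd x := ukap x - C (lg x) * wh - (gm x rh - rh).
Hypothesis dd0 : dvp PM (dd x0).

Let PMp : plus PM. Proof. by apply: plusX; apply: plus_PN. Qed.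

Let ddp x : Zp_unit x -> plus (dd x).
Proof.
move=> xu; have up := plus_ukap kapL xu; apply: plusB.
  by apply: plusB => //; apply: plusM => //; apply: plus_const.
by apply: plusB => //; apply: plus_gm.
Qed.

Let ddM x y : Zp_unit x -> Zp_unit y -> dvp PM (dd (x * y) - (dd x + gm x (dd y))).
Proof.
move=> xu yu; have -> : dd (x * y) - (dd x + gm x (dd y)) = C (lg y) * (gm x wh - wh).
  have e : gm x (dd y) = gm x (ukap y) - C (lg y) * gm x wh - (gm x (gm y rh) - gm x rh).
    by rewrite /dd [LHS]rmorphB [gm x (_ - _ * _)]rmorphB [gm x (_ * wh)]rmorphM gm_C // [gm x (_ - rh)]rmorphB.
  rewrite e /dd (lgM kapL xu yu) (ukapM O kap xu yu) constD op_gammaM //.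
  move: (ukap x) (gm x (ukap y)) (gm x wh) (gm x (gm y rh)) (gm x rh) (C (lg x)) (C (lg y)).
  by move=> a b c d f g h; ring.
apply: dvpMl; last exact: plus_const.
by apply: dvp_trans (dvp_gm_wh xu); apply: dvp_t_PN.
Qed.

Let dvp_gmPM x f : Zp_unit x -> dvp PM f -> dvp PM (gm x f).
Proof. by move=> xu; apply: dvp_gm => //; apply: dvp_gm_PN => //; apply: dvp_refl. Qed.

(** Gamma is commutative and dd vanishes at x0, so dd x is invariant under gamma_x0 modulo P^M;
    being 0 modulo P, it is 0 modulo P^M by [unip_dvp]. *)
Let dd_near x : Zp_unit x -> unorm (x - 1) <= pr ^- n.+1 -> dvp PM (dd x).
Proof.
move=> xu xn; have xu0 := x0n_unit Qp n; have xn0 := x0n_near Qp (leqnSn n.+1).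
apply: (unip_dvp xu0 (unip_PN O xu0 xn0) (c := 1) (j := 1)) => //.
- move=> i /andP[i0 _]; apply/eqP => h; have := @x0n_pow_inj R p Qp E n i 0%N.
  by rewrite /= h expr0 => /(_ erefl) e; rewrite e in i0.
- rewrite expr1; apply: dvpB; first exact: ukap_mod.
  exact: dvp_gm_sub.
rewrite const1 mul1r -/x0; have h1 := ddM xu0 xu; have h2 := ddM xu xu0.
have -> : gm x0 (dd x) - dd x = (dd (x * x0) - (dd x + gm x (dd x0)))
   - (dd (x0 * x) - (dd x0 + gm x0 (dd x))) + gm x (dd x0) - dd x0.
  rewrite [x * x0]mulrC; move: (dd _) (gm x (dd x0)) (dd x0) (dd x) (gm x0 _) => a b c d e.
  by ring.
by apply: dvpB => //; apply: dvpD; [apply: dvpB|apply: dvp_gmPM].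
Qed.

Let dd_cong x y : Zp_unit x -> Zp_unit y -> unorm (y - x) <= pr ^- n.+1 -> dvp PM (dd y - dd x).
Proof.
move=> xu yu xy; have [zu ze] := Zp_unitV_near xu yu; set z := y / x in zu ze.
have x00 : x != 0 by apply: contraTneq xu => ->; rewrite /Zp_unit unorm0 eq_sym oner_eq0.
have yE : y = x * z by rewrite /z mulrCA divff // mulr1.
have -> : dd y - dd x = (dd (x * z) - (dd x + gm x (dd z))) + gm x (dd z).
  by rewrite -yE; move: (gm x _) (dd y) (dd x) => a b c; ring.
by apply: dvpD; [apply: ddM|apply: dvp_gmPM => //; apply: dd_near; rewrite ?ze].
Qed.

(** Modulo P^M, dd is a 1-cocycle that depends only on the class of x modulo p^(n+1); averaging over
    this finite group exhibits it as a coboundary. *)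
Lemma rho_average : exists2 rh', plus rh' & forall x, Zp_unit x ->
  dvp PM (ukap x - C (lg x) * wh - (gm x rh' - rh')).
Proof.
pose q := (p ^ n.+1)%N; have q0 : (0 < q)%N by rewrite expn_gt0 (p_gt0 Qp).
have pq : (p %| q)%N by rewrite dvdn_exp.
pose S := \sum_(i < q | ~~ (p %| i)%N) dd i%:R.
have Sp : plus S by apply: plus_sum => i pi; apply: ddp; apply: unit_nat.
pose N := #|[pred i : 'I_q | ~~ (p %| i)%N]|.
have N0 : (N%:R : E) != 0.
  apply: E_nat_neq0; apply/card_gt0P.
  have q1 : (1 < q)%N by rewrite -(exp1n n.+1) ltn_exp2r // prime_gt1 // (p_prime Qp).
  by exists (Ordinal q1); rewrite inE /= dvdn1 gtn_eqF // prime_gt1 // (p_prime Qp).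
have key x : Zp_unit x -> dvp PM (C N%:R * dd x + gm x S - S).
  move=> xu; have x1 : unorm x <= 1 by move/eqP: xu => ->.
  have e0' : 0 < pr ^- n.+1 by rewrite invr_gt0 exprn_gt0 // (pr_gt0 Qp).
  have [k hk] := zp_approx x1 e0'.
  have pk : ~~ (p %| k)%N.
    apply: contraTN xu => pk; rewrite /Zp_unit lt_eqF //.
    have [p0' p1'] := andP (prV_lt1 Qp).
    rewrite -(subrK k%:R x); apply: unormD_lt; first apply: lt_le_trans hk _.
      by rewrite -exprVn exprn_ile1 // ltW.
    by apply: le_lt_trans p1'; have := @norm_dvd R p Qp k 1; rewrite expn1 expr1; apply.
  (* k approximates x modulo p^(n+1), and multiplication by k permutes the residues prime to p. *)
  pose h (i : 'I_q) : 'I_q := Ordinal (ltn_pmod (k * i) q0).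
  have kq : coprime q k by rewrite coprimeXl // prime_coprime // (p_prime Qp).
  have hi : injective h.
    move=> i j /(congr1 val) /= /eqP ij; apply/val_inj; wlog le : i j ij / (j <= i)%N.
      by move=> H; case/orP: (leq_total i j) => le; [symmetry; apply: H; rewrite // eq_sym|apply: H].
    have lm : (k * j <= k * i)%N by rewrite leq_mul2l le orbT.
    move: ij; rewrite (eqn_mod_dvd _ lm) -mulnBr Gauss_dvdr // => d.
    apply/eqP; rewrite eqn_leq le andbT -subn_eq0; apply/eqP.
    apply/eqP; rewrite -leqn0 leqNgt; apply/negP => lt.
    by have := leq_trans (dvdn_leq lt d) (leq_subr _ _); rewrite leqNgt ltn_ord.
  have SE : S = \sum_(i < q | ~~ (p %| i)%N) dd (h i)%:R.
    rewrite {1}/S (reindex_inj hi); apply: eq_bigl => i /=.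
    rewrite /dvdn modn_dvdm // -/(dvdn p (k * i)) Euclid_dvdM ?(p_prime Qp) //.
    by rewrite (negPf pk).
  have -> : C N%:R * dd x + gm x S - S = \sum_(i < q | ~~ (p %| i)%N)
     ((dd (x * i%:R) - dd (h i)%:R) - (dd (x * i%:R) - (dd x + gm x (dd i%:R)))).
    rewrite {2}SE /S rmorph_sum const_nat mulr_natl /N -sumr_const -big_split /=.
    rewrite -sumrB; apply: eq_bigr => i _.
    have alg (a b c : rb) : c - b = (a - b) - (a - c) by ring.
    exact: alg.
  elim/big_ind: _ => [|a b|i pi]; [exact: dvp0|exact: dvpD|].
  have iu := unit_nat Qp pi; have xiu : Zp_unit (x * i%:R).
    by rewrite /Zp_unit unormM; move/eqP: xu => ->; move/eqP: iu => ->; rewrite mulr1.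
  apply: dvpB; last exact: ddM.
  have hu : ~~ (p %| h i)%N.
    rewrite /= /dvdn modn_dvdm // -/(dvdn p (k * i)) Euclid_dvdM ?(p_prime Qp) //.
    by rewrite (negPf pk).
  apply: dd_cong => //; first exact: unit_nat.
  have -> : x * i%:R - (h i)%:R = (x - k%:R) * i%:R + ((k * i)%N %/ q * q)%:R.
    have := congr1 (fun j : nat => j%:R : Qp) (divn_eq (k * i) q).
    by rewrite natrD natrM /= => e; rewrite mulrBl e; ring.
  rewrite (le_trans (unormD_le _ _)) // ge_max; apply/andP; split.
    rewrite unormM -[leRHS]mulr1 ler_pM ?unorm_ge0 ?unorm_nat_le1 //; exact: ltW.
  by apply: norm_dvd; apply: dvdn_mull.
exists (rh - C N%:R^-1 * S).
  by apply: plusB => //; apply: plusM => //; apply: plus_const.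
move=> x xu; apply: (dvp_Cl N0); have := key x xu; rewrite /dd.
have -> : gm x (rh - C N%:R^-1 * S) = gm x rh - C N%:R^-1 * gm x S.
  by rewrite [LHS]rmorphB [gm x (_ * S)]rmorphM gm_C.
have NV : C N%:R * C N%:R^-1 = 1 by rewrite -constM divff.
congr (dvp _ _).
move: (C N%:R) (C N%:R^-1) NV (ukap x) (C (lg x) * wh) (gm x rh) (gm x S) => a b ab c d e f.
transitivity (a * (c - d - (e - rh)) + a * b * (f - S)); last ring.
by rewrite ab; ring.
Qed.
End Average.

Lemma rho_ex n : exists2 rh, plus rh & forall x, Zp_unit x ->
  dvp (P n.+1 ^+ M) (ukap x - C (lg x) * wh - (gm x rh - rh)).
Proof. by have [rh rhp h] := rho_step n (leqnn M); apply: rho_average h. Qed.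

End WeightClass.

(* For lam different from 1 and 1/p, R(lam)/t^M has a (phi, Gamma)-invariant generator [wc], and
   [l * wc], with l a multiple of the logarithm on Z_p^*, lifts to a cocycle in t^M [weta], [wb] of
   the Robba ring twisted by lam. *)
Record weight_class (R : realType) (p : nat) (Qp : padicNumType R p) (E : ultraFieldExtType Qp)
  (O : robba_ops E) (l : Qp -> E) (lam : E) (M : nat) := WeightClass {
  wc : robba E; weta : robba E; ws : Qp -> robba E;
  wc_plus : plus wc;
  wc_const : forall n, exists2 k, k != 0 & dvp (QN O n) (wc - robba_const k);
  wc_gm : forall x, Zp_unit x -> exists B, op_gamma O x wc - wc = robba_t E ^+ M * B;
  wc_ph : exists B, robba_const lam * op_phi O wc - wc = robba_t E ^+ M * B;
  ws_plus : forall x, Zp_unit x -> plus (ws x);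
  wb := fun x => robba_const (l x) * wc + robba_t E ^+ M * ws x;
  wb_ph : forall x, Zp_unit x -> wb x - robba_const lam * op_phi O (wb x) =
    op_gamma O x (robba_t E ^+ M * weta) - robba_t E ^+ M * weta;
  wb_gm : forall x y, Zp_unit x -> Zp_unit y -> wb (x * y) = wb x + op_gamma O x (wb y);
  ws_cvg : forall x, Zp_unit x -> robba_cvg ws x (ws x) }.

(** * Construction of the invariant class and of its lift *)

Section WeightClassExists.
Variables (R : realType) (p : nat) (Qp : padicNumType R p) (E : ultraFieldExtType Qp).
Variable O : robba_ops E.
Local Notation rb := (robba E).
Local Notation C := (@robba_const R E).
Local Notation pr := (p%:R : R).
Local Notation ph := (op_phi O).
Local Notation gm := (op_gamma O).
Local Notation phn := (phn O).
Local Notation X := (mon E 1).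
Local Notation P := (PN E).
Local Notation Q := (QN O).
Local Notation tau := (tau O).
Local Notation t := (robba_t E).
Implicit Types (f g u w h r B q L : rb) (s beta theta : R) (x y z a : Qp) (c mu : E).

Variable kap : rb.
Hypothesis kapL : islog (rhoN R p 1) (wkap O) kap.
Local Notation ukap := (ukap O kap).
Local Notation lg := (lg O kap).
Variables (M : nat) (lam : E).
Hypotheses (M0 : (0 < M)%N) (lam0 : lam != 0) (lam1 : lam != 1) (lamp : p%:R * lam != 1).
Hypothesis lamM : unorm (lam * p%:R ^+ M) < 1.
Local Notation e0 := (en O 0 M).
Local Notation e1 := (en O 1 M).
Local Notation wh := (e1 - C p%:R * e0).

Lemma dvp_X_coef n f : dvp (X ^+ n) f -> forall k : int, k < n%:Z -> f k = 0.
Proof. by move=> [h hp ->] k kn; rewrite mon_exp natz mon_mulE hp // subr_lt0. Qed.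

(** Here [lamM] enters: an eigenvector c t^k means lam = p^-k, and k >= M would contradict |lam p^M|
    < 1. *)
Lemma eigen_tX f : C lam * ph f = f ->
  exists c k, f = C c * t ^+ k /\ (c != 0 -> (k < M)%N).
Proof.
move=> hf; have lV : lam^-1 != 0 by rewrite invr_eq0.
have [|c [k [fE hk]]] := @ph_eigen R p Qp E O f _ lV.
  by rewrite -{2}hf mulrA -constM mulVf // const1 mul1r.
exists c, k; split=> // /hk lk; rewrite ltnNge; apply/negP => Mk; move: lamM.
have -> : lam = p%:R ^- k by rewrite -lk invrK.
have pX := pX_neq0 E; have -> : (p%:R ^- k * p%:R ^+ M : E) = p%:R ^- (k - M).
  by rewrite -{1}(subnK Mk) exprD invfM mulfVK.
rewrite (normE_pV E) ltNge exprn_ege1 // ltW //; exact: pr_gt1 Qp.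
Qed.

Lemma C_in_t c n B : (0 < n)%N -> C c = t ^+ n * B -> c = 0.
Proof.
move=> n0 hB; have [N hN] := tau_of_t O (plus_const c) hB.
apply/eqP/negPn/negP => c0; apply: (QN_proper (O := O) (n := N) c0).
exact: dvp_Qtau (hN N (leqnn N)).
Qed.

(** By [eigen_tX] only multiples of t^k with k < M can occur, and nonzero ones are not in t^M R.
    This rigidity turns congruences modulo t^M into exact identities. *)
Lemma eigen_zero f B : C lam * ph f = f -> f = t ^+ M * B -> f = 0.
Proof.
move=> /eigen_tX[c [k [fE hk]]] fB; have [c0|c0] := eqVneq c 0; first by rewrite fE c0 const0 mul0r.
have kM := hk c0; case/eqP: c0.
apply: (@C_in_t c (M - k) B); first by rewrite subn_gt0.
by apply: (@t_regI _ _ _ _ O k); rewrite mulrC -fE fB mulrA -exprD subnKC // ltnW.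
Qed.

(** lam may have large norm; the series of the lam^i phi^i(e0 - 1) still converges, since X^M
    divides e0 - 1 and therefore [P i ^+ M], of size p^(-iM), divides phi^i(e0 - 1). *)
Lemma U_ex : exists U, [/\ plus U, U - C lam * ph U = e0 - 1 & dvp (X ^+ M) U].
Proof.
have e0p := plus_en O 0 M; have Bp : plus (e0 - 1) by apply: plusB => //; apply: plus1.
have [z zp zE] : dvp (X ^+ M) (e0 - 1).
  by rewrite -PN_0 -opprB; apply: dvpN; apply: en_PN.
have phz i : phn i (e0 - 1) = P i ^+ M * phn i z by rewrite zE rmorphM rmorphXn /= phn_X.
have [|U [Up UE U0]] := @sum_ph R p Qp E O lam (e0 - 1) Bp.
  move=> s e /andP[s0 s1] e0'; pose s' := Num.max s pr^-1; have [q0 q1] := andP (prV_lt1 Qp).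
  have s'1 : pr^-1 <= s' < 1 by rewrite le_max lexx orbT gt_max s1.
  have s'0 : 0 < s' by rewrite lt_max s0.
  have s'01 : 0 < s' < 1 by rewrite s'0; case/andP: s'1.
  have [Kz hz] := plus_onann zp s'01; have [K K0 hK] := gle_PN_geo E s'01.
  have l01 : 0 <= unorm (lam * p%:R ^+ M) < 1 by rewrite unorm_ge0.
  have [N hN] := geometric_small (K ^+ M * Kz) l01 e0'; exists N => i Ni.
  rewrite sub0r; apply: gleN; apply: (@gle_plus _ _ _ s') => //.
  - by apply: plusM; [apply: plus_const|apply: plus_phn].
  - by rewrite le_max lexx.
  rewrite phz; apply: gle_mono (ltW (hN i Ni)) _.
  have -> : K ^+ M * Kz * unorm (lam * p%:R ^+ M) ^+ i = unorm (lam ^+ i) * ((K * pr ^- i) ^+ M * Kz).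
    rewrite unormM !unormX (normE_p E) !exprMn -!exprVn -!exprM [(M * i)%N]mulnC.
    by move: (K ^+ M) (unorm lam ^+ i) (_ ^+ (i * M)) => a b c; ring.
  apply: gleM => //; first exact: gle_const.
  by apply: gleM => //; [apply: gleX|apply: gle_phn].
exists U; split=> //; have h n : n < M%:Z -> U n = 0.
  by move=> nM; apply: U0 => i; apply: (dvp_X_coef (n := M)) nM; rewrite phz; apply: dvpMr;
    [apply: dvp_exp; rewrite -PN_0; apply: dvp_PP|apply: plus_phn].
exists (mon E (- M%:Z) * U).
  by move=> n n0; rewrite mon_mulE opprK h // -subr_gt0 opprD addrCA subrr addr0 oppr_gt0.
by rewrite mon_exp natz mulrA mon_mon subrr mon0 mul1r.
Qed.

(** V solves V - lam phi(V) = e0, and c is the combination of V and e0 whose right side is wh; since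
    wh lies in t^M R, c is invariant there. Modulo Q 0 it is (1 - p lam)/(1 - lam), and c = lam
    phi(c) + wh carries this to Q n with a factor lam^n. *)
Lemma c_ex : exists c : rb, [/\ plus c, c - C lam * ph c = wh,
  forall x, Zp_unit x -> exists B, gm x c - c = t ^+ M * B &
  forall n, exists2 k, k != 0 & dvp (Q n) (c - C k)].
Proof.
have [U [Up UE UX]] := U_ex; have e0p := plus_en O 0 M.
have l1 : 1 - lam != 0 by rewrite subr_eq0 eq_sym.
have lp1 : 1 - p%:R * lam != 0 by rewrite subr_eq0 eq_sym.
pose d := (1 - lam)^-1; pose V := U + C d.
have Vp : plus V by apply: plusD => //; apply: plus_const.
have VE : V - C lam * ph V = e0.
  have -> : V - C lam * ph V = (U - C lam * ph U) + C (d * (1 - lam)).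
    by rewrite /V [ph (U + _)]rmorphD [ph (C d)]ph_C constM constB const1; move: (ph U) => a; ring.
  by rewrite UE /d mulVf // const1 subrK.
(* This is lam^-1 - p, so that in c - lam phi(c) the terms in e0 add up to -p e0 and e1 gets the
   coefficient 1. *)
pose k1 := lam^-1 * (1 - p%:R * lam).
pose c : rb := C k1 * V - C lam^-1 * e0.
have cp : plus c by apply: plusB; apply: plusM => //; apply: plus_const.
have lV : C lam * C lam^-1 = 1 by rewrite -constM divff.
have cE : c - C lam * ph c = wh.
  have phc : ph c = C k1 * ph V - C lam^-1 * e1.
    by rewrite /c [LHS]rmorphB [ph (_ * V)]rmorphM [ph (_ * e0)]rmorphM !ph_C ph_en.
  rewrite phc /c; have kE : C k1 = C lam^-1 - C p%:R.
    by rewrite -constB /k1 mulrBr mulr1 mulrCA mulVf // mulr1.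
  have -> : C k1 * V - C lam^-1 * e0 - C lam * (C k1 * ph V - C lam^-1 * e1) =
    C k1 * (V - C lam * ph V) - C lam^-1 * e0 + (C lam * C lam^-1) * e1.
    by move: (ph V) (C k1) => a f; ring.
  by rewrite VE lV kE; ring.
have gV x : Zp_unit x -> exists B, gm x V - V = t ^+ M * B.
  move=> xu; have -> : gm x V - V = gm x U - U.
    by rewrite /V [gm x (U + _)]rmorphD gm_C //; move: (gm x U) => a; ring.
  have [g gp gE] := dvp_gm_en O M 0 xu.
  have [S Sp SE] := sum_ph_small O lamM gp; exists S; apply/eqP; rewrite -subr_eq0; apply/eqP.
  set F := _ - _ - _; have hF : C lam * ph F = F.
    have e2 : (gm x U - U) - C lam * ph (gm x U - U) = t ^+ M * g.
      rewrite -gE; have -> : gm x e0 - e0 = gm x (e0 - 1) - (e0 - 1).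
        by rewrite [gm x (e0 - 1)]rmorphB rmorph1; move: (gm x e0) => a; ring.
      rewrite -UE [gm x (U - _)]rmorphB [gm x (C _ * _)]rmorphM gm_C // -(op_phi_gamma O xu).
      by rewrite [ph (_ - U)]rmorphB; move: (ph (gm x U)) (ph U) (gm x U) => a b f; ring.
    have e3 : t ^+ M * S - C lam * ph (t ^+ M * S) = t ^+ M * g.
      by rewrite ph_tX -SE constM; move: (ph S) (t ^+ M) => a b; ring.
    have e4 : F - C lam * ph F = 0.
      have phF : ph F = ph (gm x U - U) - ph (t ^+ M * S) by exact: rmorphB.
      rewrite phF /F -(subrr (t ^+ M * g)) -{1}e2 -e3.
      by move: (ph (gm x U - U)) (ph (t ^+ M * S)) (gm x U) => a b f; ring.
    by apply/eqP; rewrite -subr_eq0 -opprB e4 oppr0.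
  (* F is b t^k with k < M, yet it vanishes to order M at 0, because U does and gamma preserves
     this. *)
  have [b [k [FE hk]]] := eigen_tX hF.
  have [b0|b0] := eqVneq b 0; first by rewrite FE b0 const0 mul0r.
  have kM := hk b0; have F0 : F k = 0.
    apply: (dvp_X_coef (n := M)); last by rewrite ltz_nat.
    apply: dvpB; last by rewrite t_ell exprMn -mulrA; apply: dvp_mull; apply: plusM => //; apply: plusX; apply: plus_ell.
    apply: dvpB => //; have := @dvp_gm R p Qp E O x X M U xu _ UX; apply.
    by rewrite gm_XE //; apply: dvp_mull; apply: plus_vx.
  move: F0; rewrite FE constM_coef t_ell exprMn mon_exp natz mon_mulE subrr plusX0; last exact: plus_ell.
  by rewrite ell0 expr1n mulr1 => /eqP; rewrite (negPf b0).
exists c; split=> //.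
  move=> x xu; have [B1 hB1] := gV x xu; have [B2 _ hB2] := dvp_gm_en O M 0 xu.
  exists (C k1 * B1 - C lam^-1 * B2); rewrite mulrBr mulrCA -hB1 mulrCA -hB2.
  rewrite /c [gm x (_ - _)]rmorphB [gm x (_ * V)]rmorphM [gm x (_ * e0)]rmorphM !gm_C //.
  by move: (gm x V) (gm x e0) => a b; ring.
have c0 : c 0 = (1 - p%:R) / (1 - lam).
  have := congr1 (fun f : rb => f 0) cE; rewrite robbaBE constM_coef (ph_coef0 O cp) wh0 // => <-.
  by rewrite -{2}[c 0]mul1r -mulrBl mulrC mulrA mulVf // mul1r.
pose k0 := (1 - p%:R * lam) / (1 - lam).
have k00 : k0 != 0 by rewrite mulf_neq0 ?invr_eq0.
suff H n : dvp (Q n) (c - C (lam ^+ n * k0)).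
  by move=> n; exists (lam ^+ n * k0) => //; rewrite mulf_neq0 ?expf_neq0.
have cE' : c = C lam * ph c + wh by rewrite -cE addrC subrK.
have Q0 m k : (m <= k)%N -> dvp (Q k) (en O m M).
  by move=> mk; apply: dvp_Qtau (en_tau O m M).
elim: n => [|n IH].
  (* Modulo Q 0, phi(c) is c(0), e1 is 1 and e0 is 0. *)
  rewrite expr0 mul1r; have kE : k0 = lam * c 0 + 1.
    rewrite c0 /k0; apply: (mulIf l1); rewrite divfK // mulrDl mul1r -mulrA divfK //.
    by ring.
  have -> : c - C k0 = C lam * (ph c - C (c 0)) - (1 - e1) - C p%:R * e0.
    by rewrite {1}cE' kE constD constM const1; move: (ph c) (C _) (C _) => a b f; ring.
  have PQ : dvp (Q 0) (P 1) by apply: dvp_PQ.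
  apply: dvpB; last by apply: dvpMl; [apply: Q0|apply: plus_const].
  apply: dvpB; last by apply: dvp_trans PQ _; apply: dvp_exp1 M0 (plus_PN _ _) (en_PN O 1 M).
  apply: dvpMl; last exact: plus_const.
  by have := dvp_ph O (dvpX_C cp); rewrite ph_X rmorphB [ph (C _)]ph_C; apply: dvp_trans.
have -> : c - C (lam ^+ n.+1 * k0) = C lam * (ph c - C (lam ^+ n * k0)) + wh.
  by rewrite {1}cE' exprS -mulrA constM; move: (ph c) (C _) (C _) => a b f; ring.
apply: dvpD; last first.
  by apply: dvpB; [apply: Q0|apply: dvpMl; [apply: Q0|apply: plus_const]].
apply: dvpMl; last exact: plus_const.
by have := dvp_ph O IH; rewrite rmorphB [ph (C _)]ph_C.
Qed.

(** Two local solutions are glued by [e]. Modulo [P n ^+ M] the element is kap - rh, whose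
    coboundary is given by [rho_ex]; modulo [tau n ^+ M] it is kap - r, an element of t^M R, and wh
    vanishes there too. *)
Lemma delta_ex : exists weta, forall x, Zp_unit x ->
  dvp (t ^+ M) (gm x (t ^+ M * weta) - t ^+ M * weta - C (lg x) * wh).
Proof.
have [r [B [rp kE]]] := robba_split O M kap; have [rho0 r01 BO] := robba_onann B.
have rr0 : 0 <= rho0 by case/andP: r01.
have [N0 hN0] := dvp_tau_of_t O M r01; pose n := N0.+1.
have [rh rhp hrh] := rho_ex kapL M0 N0.
have [Be hBe] := t_of_dvp_tau (en_tau O n M).
pose g := r - rh; have gp : plus g by apply: plusB.
pose e := en O n M; have ep : plus e by apply: plus_en.
exists (B + g * Be) => x xu.
have -> : t ^+ M * (B + g * Be) = (kap - r) + g * e.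
  by rewrite /e hBe kE; move: (t ^+ M) => a; ring.
have gep : plus (g * e) by apply: plusM.
have g1ep : plus (g * (1 - e)) by apply: plusM => //; apply: plusB => //; apply: plus1.
have whp : plus wh.
  by apply: plusB; [apply: plus_en|apply: plusM; [apply: plus_const|apply: plus_en]].
have up := plus_ukap kapL xu.
have D1p : plus (ukap x - (gm x r - r)) by apply: plusB => //; apply: plusB => //; apply: plus_gm.
have e1' : gm x ((kap - r) + g * e) - ((kap - r) + g * e) - C (lg x) * wh =
   (ukap x - (gm x r - r)) + (gm x (g * e) - g * e) - C (lg x) * wh.
  rewrite [gm x (_ + g * e)]rmorphD [gm x (kap - r)]rmorphB /ukap.
  by move: (gm x kap) (gm x r) (gm x (g * e)) (g * e) => a b d f; ring.
rewrite e1'; apply: (@dvp_t_coprime R p Qp E O n M).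
- exact: (plusB (plusD D1p (plusB (plus_gm O xu gep) gep)) (plusM (plus_const (lg x)) whp)).
- have -> : (ukap x - (gm x r - r)) + (gm x (g * e) - g * e) - C (lg x) * wh =
      (ukap x - C (lg x) * wh - (gm x rh - rh)) - (gm x (g * (1 - e)) - g * (1 - e)).
    have e2 : gm x (g * (1 - e)) = gm x r - gm x rh - gm x (g * e).
      by rewrite mulrBr mulr1 [LHS]rmorphB /g [gm x (r - rh)]rmorphB.
    rewrite e2 /g; move: (gm x r) (gm x rh) (gm x _) (ukap x) (C _ * wh) => a b d f h.
    by ring.
  have he : dvp (P n ^+ M) (g * (1 - e)) by apply: dvpMl => //; apply: en_PN.
  have hPP := dvp_gm_PN O xu (dvp_refl (P n)).
  exact: (dvpB (hrh x xu) (dvpB (dvp_gm xu hPP he) he)).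
- have h1 : dvp (tau n ^+ M) (ukap x - (gm x r - r)).
    apply: (hN0 n (leqnSn N0) _ (C (x%:A ^+ M) * gm x B - B) D1p).
      apply: onannB => //; apply: onannM => //; first exact: onann_const.
      exact: onann_gm.
    have hB : t ^+ M * B = kap - r by rewrite kE addrC addKr.
    rewrite mulrBr -gm_tX // hB [gm x (kap - r)]rmorphB /ukap.
    by move: (gm x kap) (gm x r) => a b; ring.
  have he : dvp (tau n ^+ M) (g * e) by apply: dvpMl => //; apply: en_tau.
  have hk k : (k <= n)%N -> dvp (tau n ^+ M) (en O k M).
    by move=> kn; apply: dvp_trans (en_tau O k M); apply: dvp_exp; apply: dvp_tau_le.
  apply: dvpB; last first.
    apply: dvpMl; last exact: plus_const.
    by apply: dvpB; [apply: hk|apply: dvpMl; [apply: hk|apply: plus_const]].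
  exact: (dvpD h1 (dvpB (dvp_gm xu (dvp_gm_tau O n xu) he) he)).
Qed.

(** [s x] is chosen so that b x = lg x * c + t^M s x satisfies the phi-part of the cocycle relation;
    the Gamma-part then follows from uniqueness and the continuity from the a priori bound. *)
Lemma weight_class_ex : exists W : weight_class O lg lam M, True.
Proof.
have [c [cp cE cg ck]] := c_ex; have [et hde] := delta_ex.
have /choice[d hd] : forall x, exists f : rb, Zp_unit x ->
    plus f /\ gm x (t ^+ M * et) - t ^+ M * et - C (lg x) * wh = t ^+ M * f.
  move=> x; have [xu|/negP xu] := boolP (Zp_unit x); last by exists 0.
  by have [f fp fE] := hde x xu; exists f.
have /choice[s hs] : forall x, exists f : rb, Zp_unit x ->
    plus f /\ f - C (lam * p%:R ^+ M) * ph f = d x.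
  move=> x; have [xu|/negP xu] := boolP (Zp_unit x); last by exists 0.
  have [dp _] := hd x xu; have [S Sp SE] := sum_ph_small O lamM dp.
  by exists S.
have sp x : Zp_unit x -> plus (s x) by move=> /hs[].
have [wB hwB] : exists B, wh = t ^+ M * B.
  have [B0 h0] := t_of_dvp_tau (en_tau O 0 M); have [B1 h1] := t_of_dvp_tau (en_tau O 1 M).
  by exists (B1 - C p%:R * B0); rewrite h0 h1; move: (t ^+ M) (C _) => a f; ring.
pose b x := C (lg x) * c + t ^+ M * s x.
have bp x : Zp_unit x -> b x - C lam * ph (b x) = gm x (t ^+ M * et) - t ^+ M * et.
  move=> xu; have [_ dE] := hd x xu; have [_ sE] := hs x xu.
  have phb : ph (b x) = C (lg x) * ph c + t ^+ M * (C (p%:R ^+ M) * ph (s x)).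
    by rewrite [LHS]rmorphD [ph (_ * c)]rmorphM ph_C ph_tX.
  have e : gm x (t ^+ M * et) - t ^+ M * et = t ^+ M * d x + C (lg x) * wh by rewrite -dE subrK.
  rewrite e -sE -cE phb /b (constM lam).
  by move: (ph c) (ph (s x)) (C (lg x)) (t ^+ M) => a f g h; ring.
have bM x y : Zp_unit x -> Zp_unit y -> b (x * y) = b x + gm x (b y).
  move=> xu yu; have xyu : Zp_unit (x * y) by exact: Zp_unitM.
  have [B1 hB1] := cg x xu; apply/eqP; rewrite -subr_eq0; apply/eqP.
  have gb : gm x (b y) = C (lg y) * gm x c + t ^+ M * (C (x%:A ^+ M) * gm x (s y)).
    by rewrite [LHS]rmorphD [gm x (_ * c)]rmorphM gm_C // gm_tX.
  (* The defect of the relation is fixed by lam phi, and it lies in t^M R because c is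
     Gamma-invariant modulo t^M. *)
  apply: (@eigen_zero _ (s (x * y) - s x - C (x%:A ^+ M) * gm x (s y) - C (lg y) * B1)); last first.
    rewrite gb /b (lgM kapL xu yu) (constD (lg x)) [RHS]mulrBr [t ^+ M * (C (lg y) * B1)]mulrCA -hB1.
    by move: (gm x c) (gm x (s y)) (C (lg x)) (C (lg y)) (t ^+ M) => a f g h i; ring.
  set F := b (x * y) - _; have phF : C lam * ph F = C lam * ph (b (x * y)) - C lam * ph (b x) - gm x (C lam * ph (b y)).
    rewrite /F [ph (_ - _)]rmorphB [ph (_ + gm x _)]rmorphD (op_phi_gamma O xu).
    by rewrite [gm x (C _ * _)]rmorphM gm_C //; move: (ph _) (ph _) (gm x _) => a f g; ring.
  have e z : Zp_unit z -> C lam * ph (b z) = b z - (gm z (t ^+ M * et) - t ^+ M * et).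
    by move=> zu; rewrite -(bp z zu) opprB addrC subrK.
  rewrite phF !e // op_gammaM // [gm x (b y - _)]rmorphB [gm x (_ - t ^+ M * et)]rmorphB /F.
  have alg (A B g h i j : rb) : A - (h - j) - (B - (i - j)) - (g - (h - i)) = A - (B + g) by ring.
  exact: alg.
have sc x : Zp_unit x -> robba_cvg s x (s x).
  (* After cancelling t^M, the right side d is a combination of continuous functions; [sum_ph_bound]
     transfers its continuity to s. *)
  move=> xu; pose D y := C (y%:A ^+ M) * gm y et - (et + C (lg y) * wB).
  have dD y : Zp_unit y -> d y = D y.
    move=> yu; have [_ dE] := hd y yu; apply: (t_regI O (m := M)); rewrite -dE hwB gm_tX // /D.
    by move: (gm y et) (C _) (C _) (t ^+ M) => a f g h; ring.
  have [rho /andP[r0 r1] hD] : robba_cvg D x (D x).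
    apply: robba_cvgD.
      by apply: robba_cvgM; [apply: robba_cvg_alg|apply: robba_cvg_gm].
    apply: robba_cvgN; apply: robba_cvgD; first exact: robba_cvg_cst.
    by apply: robba_cvgM; [apply: lg_cvg|apply: robba_cvg_cst].
  have [q0 q1] := andP (prV_lt1 Qp).
  exists (Num.max rho pr^-1) => [|s' e /andP[]]; first by rewrite le_max r0 gt_max r1.
  rewrite gt_max => /andP[s1 s2] s3 e0'; have [dl dl0 H] := hD s' e ltac:(by rewrite s1) e0'.
  exists dl => // y yu yx yd; apply: (sum_ph_bound (O := O) lamM).
  - by apply: plusB; apply: sp.
  - by rewrite ltW.
  have [_ sE] := hs x xu; have [_ sE'] := hs y yu.
  have -> : s y - s x - C (lam * p%:R ^+ M) * ph (s y - s x) = D y - D x.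
    rewrite -!dD // -sE -sE' [ph (_ - _)]rmorphB.
    by move: (ph (s y)) (ph (s x)) (C _) => a f g; ring.
  exact: H.
exists (@WeightClass R p Qp E O lg lam M c et s cp ck cg
  (ex_intro _ (- wB) (etrans (esym (opprB c (C lam * ph c))) (etrans (congr1 -%R cE) (etrans (congr1 -%R hwB) (esym (mulrN _ _)))))) sp bp bM sc).
by [].
Qed.

End WeightClassExists.

(** * The Robba ring over the dual numbers *)

Local Transparent robba_subst robba_phi robba_gamma.

Section DualRobba.
Variables (R : realType) (p : nat) (Qp : padicNumType R p) (E : ultraFieldExtType Qp).
Local Notation Ee := (dual E : ultraAlgType Qp).
Local Notation rb := (robba E).
Local Notation rbe := (robba Ee).
Local Notation pr := (p%:R : R).
Local Notation Eps := (robba_const (eps : Ee)).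
Implicit Types (a b c d : rb) (f g : rbe).

Lemma dnormE (x : Ee) : unorm x = Num.max (unorm x.1) (unorm x.2).
Proof. by []. Qed.

Lemma dnorm_max (x : Ee) (s e : R) : 0 <= s -> unorm x.1 * s <= e -> unorm x.2 * s <= e ->
  unorm x * s <= e.
Proof. by move=> s0 h1 h2; rewrite dnormE maxr_pMl // ge_max h1 h2. Qed.

Lemma pair_robba_seq a b : robba_seq (fun n => (a n, b n) : Ee).
Proof.
have [r1 /andP[h1 h2] ha] := robba_onann a; have [r2 /andP[h3 h4] hb] := robba_onann b.
apply: (@onann_robba_seq _ _ _ (Num.max r1 r2)); first by rewrite le_max h1 gt_max h2.
move=> s; rewrite gt_max -andbA => /and3P[s1 s2 s3].
have s0 : 0 < s by apply: le_lt_trans s1.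
have [K hK] := ha s ltac:(by rewrite s1); have [L hL] := hb s ltac:(by rewrite s2).
exists (Num.max K L) => n; apply: dnorm_max; first exact: sz0.
  by rewrite le_max hK.
by rewrite le_max hL orbT.
Qed.

(** The element a + b eps; by [mk_red_im] every series over the dual numbers has this form. *)
Definition mk a b : rbe := mk_robba (pair_robba_seq a b).

Lemma dnorm_le_seq f (u : int -> E) : (forall n, unorm (u n) <= unorm (f n)) -> robba_seq u.
Proof.
move=> h; have [r r01 hf] := robbaP f; exists r => // s rs; apply: null_le (hf s rs) => n.
have s0 : 0 < s by case/andP: r01 rs => r0 _ /andP[rs _]; apply: le_lt_trans rs.
by rewrite ler_wpM2r // sz0.
Qed.
Lemma fst_seq f : robba_seq (fun n => (f n).1).
Proof. by apply: (@dnorm_le_seq f) => n; rewrite dnormE le_max lexx. Qed.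
Lemma snd_seq f : robba_seq (fun n => (f n).2).
Proof. by apply: (@dnorm_le_seq f) => n; rewrite dnormE le_max lexx orbT. Qed.

Definition im f : rb := robba_of (fun n => (f n).2).
Lemma reE f n : robba_red f n = (f n).1.
Proof. by rewrite /robba_red robba_ofE //; apply: fst_seq. Qed.
Lemma imE f n : im f n = (f n).2.
Proof. by rewrite /im robba_ofE //; apply: snd_seq. Qed.
Lemma mk_red_im f : f = mk (robba_red f) (im f).
Proof. by apply: robba_ext => n; rewrite /= reE imE; case: (f n). Qed.
Lemma red_mk a b : robba_red (mk a b) = a.
Proof. by apply: robba_ext => n; rewrite reE. Qed.
Lemma im_mk a b : im (mk a b) = b.
Proof. by apply: robba_ext => n; rewrite imE. Qed.
Lemma mk_inj a b c d : mk a b = mk c d -> a = c /\ b = d.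
Proof. by move=> h; rewrite -(red_mk a b) -{2}(im_mk a b) h red_mk im_mk. Qed.

Lemma has_usum_pair (I : eqType) (u : I -> Ee) (x y : E) :
  has_usum (fun i => (u i).1) x -> has_usum (fun i => (u i).2) y -> has_usum u ((x, y) : Ee).
Proof.
move=> h1 h2 e e0; have [F hF] := h1 e e0; have [G hG] := h2 e e0.
exists (F ++ G) => H uH FG; rewrite dnormE gt_max.
have s1 : (\sum_(i <- H) u i - ((x, y) : Ee)).1 = \sum_(i <- H) (u i).1 - x.
  by congr (_ - _); elim/big_rec2: _ => // i a b _ <-.
have s2 : (\sum_(i <- H) u i - ((x, y) : Ee)).2 = \sum_(i <- H) (u i).2 - y.
  by congr (_ - _); elim/big_rec2: _ => // i a b _ <-.
rewrite s1 s2 hF ?hG // => i iF; apply: FG; by rewrite mem_cat iF ?orbT.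
Qed.

Lemma usum_pair (I : eqType) (u v : I -> E) : null_family (unorm \o u) -> null_family (unorm \o v) ->
  usum (fun i => (u i, v i) : Ee) = (usum u, usum v).
Proof. by move=> nu nv; apply: usum_eq; apply: has_usum_pair; apply: usum_ex. Qed.

Lemma mkD a b c d : mk a b + mk c d = mk (a + c) (b + d).
Proof. by apply: robba_ext. Qed.
Lemma mkN a b : - mk a b = mk (- a) (- b).
Proof. by apply: robba_ext. Qed.
Lemma mkM a b c d : mk a b * mk c d = mk (a * c) (a * d + b * c).
Proof.
apply: robba_ext => n; have conv (x y : rb) := @conv_null R E x y n (robbaP x) (robbaP y).
have e1 : mk (a * c) (a * d + b * c) n = ((a * c) n, (a * d) n + (b * c) n) by [].
rewrite e1 [LHS]robbaME !robbaME -usumD // -usum_pair //.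
by apply: null_le (null_max (conv a d) (conv b c)) => i /=; exact: unormD_le.
Qed.
Lemma mk10 : mk 1 0 = 1.
Proof.
apply: robba_ext => n; have e : mk 1 0 n = ((1 : rb) n, (0 : rb) n) by [].
by rewrite e [RHS]robba1E robba1E robba0E; case: eqP.
Qed.
Lemma mk_const (x y : E) : mk (robba_const x) (robba_const y) = robba_const ((x, y) : Ee).
Proof. by apply: robba_ext => n; rewrite /= /const_seq; case: eqP. Qed.
Lemma mk01 : mk 0 1 = Eps.
Proof. by rewrite -mk_const. Qed.
Lemma mk_incl a : robba_incl a = mk a 0.
Proof.
rewrite /robba_incl /robba_of -[RHS](valKd (0 : rbe)); congr insubd.
apply/funext => n; have e : mk a 0 n = (a n, (0 : rb) n) by [].
by rewrite [RHS]e robba0E.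
Qed.
Lemma mk00 : mk 0 0 = 0.
Proof.
apply: robba_ext => n; have e : mk 0 0 n = ((0 : rb) n, (0 : rb) n) by [].
by rewrite e [RHS]robba0E robba0E.
Qed.

Lemma mkX a n : mk a 0 ^+ n = mk (a ^+ n) 0.
Proof.
elim: n => [|n IH]; first by rewrite !expr0 mk10.
by rewrite !exprS IH mkM mul0r mulr0 addr0.
Qed.
Lemma mk_unit a : a \is a GRing.unit -> mk a 0 \is a GRing.unit /\ (mk a 0)^-1 = mk a^-1 0.
Proof.
move=> au; have h : mk a 0 * mk a^-1 0 = 1 by rewrite mkM divrr // mul0r mulr0 addr0 mk10.
have mu : mk a 0 \is a GRing.unit by apply/unitrPr; exists (mk a^-1 0).
by split=> //; apply: (mulrI mu); rewrite divrr.
Qed.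
Lemma mk_expz a (n : int) : a \is a GRing.unit -> mk a 0 ^ n = mk (a ^ n) 0.
Proof.
move=> au; case: n => n; first by rewrite -!exprnP mkX.
by have [mu e] := mk_unit au; rewrite NegzE -!exprnN -!exprVn e mkX.
Qed.

(** The element substituted for X has no eps-part, nor have its powers, so the substitution acts on
    each component separately. *)
Lemma subst_mk (g a b : rb) rho : g \is a GRing.unit -> 0 <= rho < 1 ->
  (forall s, rho < s < 1 -> exists sigma, subst_adm g a s sigma) ->
  (forall s, rho < s < 1 -> exists sigma, subst_adm g b s sigma) ->
  robba_subst (mk g 0) (mk a b) = mk (robba_subst g a) (robba_subst g b).
Proof.
move=> gu r01 ha hb; have Ha := robba_subst_def r01 ha; have Hb := robba_subst_def r01 hb.
suff e k : usum (fun n : int => mk a b n * (mk g 0 ^ n) k) =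
    mk (robba_subst g a) (robba_subst g b) k.
  apply: robba_ext => k; rewrite -e /robba_subst.
  rewrite robba_ofE // (_ : (fun k => _) = mk (robba_subst g a) (robba_subst g b)).
    exact: robbaP.
  by apply/funext.
have [r0 r1] := andP r01; have [s rs] : exists s, rho < s < 1.
  by exists ((rho + 1) / 2); rewrite !midf_lt.
have s0 : 0 < s by apply: le_lt_trans (proj1 (andP rs)).
have [sa hsa] := ha s rs; have [sb hsb] := hb s rs.
rewrite [RHS]/= Ha Hb -usum_pair; [|exact: subst_null hsa|exact: subst_null hsb].
congr usum; apply/funext => n; rewrite mk_expz //.
have e : mk (g ^ n) 0 k = ((g ^ n) k, (0 : rb) k) by [].
rewrite e robba0E; apply: injective_projections; first by [].
by rewrite /= mulr0 add0r.
Qed.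

Lemma mk_onep x : unorm x <= 1 -> robba_1X_pow Ee x = mk (robba_1X_pow E x) 0.
Proof.
move=> x1; apply: robba_ext => n.
have e : mk (robba_1X_pow E x) 0 n = (robba_1X_pow E x n, (0 : rb) n) by [].
rewrite e robba0E; case: n {e} => j; last by rewrite !plus_onep.
by rewrite !onepE //; apply: injective_projections => //=; rewrite scaler0.
Qed.

Lemma mk_XE : robba_X Ee = mk (mon E 1) 0.
Proof.
rewrite robba_XE; apply: robba_ext => n.
have e : mk (mon E 1) 0 n = ((n == 1)%:R, (0 : rb) n) by [].
by rewrite e robba0E monE; case: eqP.
Qed.

Variable O : robba_ops E.

Lemma phi_mk a b : robba_phi (mk a b) = mk (robba_phi a) (robba_phi b).
Proof.
have u1 := PN_unit O 1.
have e : (1 + robba_X Ee) ^+ p - 1 = mk (PN E 1) 0.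
  by rewrite mk_XE -mk10 mkD addr0 mkX mkN mkD subr0 /PN expn1.
rewrite /robba_phi e phXE.
have [r1 /andP[h1 h2] ha] := phi_coef u1 a; have [r2 /andP[h3 h4] hb] := phi_coef u1 b.
apply: (@subst_mk _ _ _ (Num.max r1 r2)) => //; first by rewrite le_max h1 gt_max h2.
  by move=> s; rewrite gt_max -andbA => /and3P[s1 s2 s3]; exists (s ^ p); apply: ha; rewrite s1.
by move=> s; rewrite gt_max -andbA => /and3P[s1 s2 s3]; exists (s ^ p); apply: hb; rewrite s2.
Qed.

Lemma gamma_mk x a b : Zp_unit x -> robba_gamma x (mk a b) = mk (robba_gamma x a) (robba_gamma x b).
Proof.
move=> xu; have xu' : unorm x = 1 by apply/eqP.
have e : robba_1X_pow Ee x - 1 = mk (robba_1X_pow E x - 1) 0.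
  by rewrite mk_onep ?xu' // -mk10 mkN mkD subr0.
rewrite /robba_gamma e; have gu := gX_unit O xu.
have [r1 /andP[h1 h2] ha] := robba_onann a; have [r2 /andP[h3 h4] hb] := robba_onann b.
apply: (@subst_mk _ _ _ (Num.max r1 r2)) => //; first by rewrite le_max h1 gt_max h2.
  by move=> s; rewrite gt_max -andbA => /and3P[s1 s2 s3]; exists s; apply: (gamma_adm xu' gu h1 ha); rewrite s1.
by move=> s; rewrite gt_max -andbA => /and3P[s1 s2 s3]; exists s; apply: (gamma_adm xu' gu h3 hb); rewrite s2.
Qed.

Lemma cvg_mk (u v : Qp -> rb) x a b : robba_cvg u x a -> robba_cvg v x b ->
  robba_cvg (fun y => mk (u y) (v y)) x (mk a b).
Proof.
move=> [r1 /andP[r10 r11] h1] [r2 /andP[r20 r21] h2].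
exists (Num.max r1 r2) => [|s e]; first by rewrite le_max r10 gt_max r11.
rewrite gt_max -andbA => /and3P[s1 s2 s3] e0.
have [d1 d10 H1] := h1 s e ltac:(by rewrite s1) e0.
have [d2 d20 H2] := h2 s e ltac:(by rewrite s2) e0.
exists (Num.min d1 d2) => [|y yu yx]; first by rewrite lt_min d10.
rewrite lt_min => /andP[y1 y2] n; have s0 : 0 < s by apply: le_lt_trans s1.
by apply: dnorm_max; [apply: sz0|apply: H1|apply: H2].
Qed.

End DualRobba.

(** * Deformations given by cocycles *)

Local Opaque robba_subst robba_phi robba_gamma.

Section DualScalars.
Variables (R : realType) (p : nat) (Qp : padicNumType R p) (E : ultraFieldExtType Qp).
Local Notation Ee := (dual E : ultraAlgType Qp).
Local Notation rb := (robba E).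
Local Notation rbe := (robba Ee).
Implicit Types (f g : rbe).

Lemma redD f g : robba_red (f + g) = robba_red f + robba_red g.
Proof. by rewrite {1}(mk_red_im f) {1}(mk_red_im g) mkD red_mk. Qed.
Lemma imD f g : im (f + g) = im f + im g.
Proof. by rewrite {1}(mk_red_im f) {1}(mk_red_im g) mkD im_mk. Qed.
Lemma redM f g : robba_red (f * g) = robba_red f * robba_red g.
Proof. by rewrite {1}(mk_red_im f) {1}(mk_red_im g) mkM red_mk. Qed.
Lemma imM f g : im (f * g) = robba_red f * im g + im f * robba_red g.
Proof. by rewrite {1}(mk_red_im f) {1}(mk_red_im g) mkM im_mk. Qed.
Lemma red1 : robba_red (1 : rbe) = 1. Proof. by rewrite -mk10 red_mk. Qed.
Lemma im1 : im (1 : rbe) = 0. Proof. by rewrite -mk10 im_mk. Qed.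
End DualScalars.

(** The pair (u, v) stands for u + v eps. The alias keeps the module structure over the dual Robba
    ring apart from the product structure over the Robba ring. *)
Definition dmodT (R : realType) (p : nat) (Qp : padicNumType R p) (E : ultraFieldExtType Qp)
  (M : lmodType (robba E)) : Type := (M * M)%type.

Section DualModule.
Variables (R : realType) (p : nat) (Qp : padicNumType R p) (E : ultraFieldExtType Qp).
Local Notation Ee := (dual E : ultraAlgType Qp).
Local Notation rb := (robba E).
Local Notation rbe := (robba Ee).
Variable M : lmodType (robba E).
Local Notation T := (dmodT M).

HB.instance Definition _ := Choice.copy T (M * M)%type.
HB.instance Definition _ := GRing.Zmodule.copy T (M * M)%type.

Definition dscale (f : rbe) (u : T) : T := (robba_red f *: u.1, robba_red f *: u.2 + im f *: u.1).

Fact dscaleA f g u : dscale f (dscale g u) = dscale (f * g) u.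
Proof.
rewrite /dscale redM imM /=; congr pair; first by rewrite scalerA.
by rewrite scalerDr !scalerA scalerDl addrA.
Qed.
Fact dscale1 : left_id 1 dscale.
Proof. by case=> u v; rewrite /dscale red1 im1 /= !scale1r scale0r addr0. Qed.
Fact dscaleDr : right_distributive dscale +%R.
Proof.
move=> f [u v] [u' v']; rewrite /dscale /=; congr pair; first by rewrite scalerDr.
by rewrite !scalerDr addrACA.
Qed.
Fact dscaleDl u : {morph dscale^~ u : f g / f + g}.
Proof.
move=> f g; rewrite /dscale redD imD; congr pair; first by rewrite scalerDl.
by rewrite !scalerDl addrACA.
Qed.
HB.instance Definition _ := GRing.Zmodule_isLmodule.Build rbe T dscaleA dscale1 dscaleDr dscaleDl.

Lemma dscaleE (f : rbe) (u : T) :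
  f *: u = (robba_red f *: u.1, robba_red f *: u.2 + im f *: u.1).
Proof. by []. Qed.

Lemma dsumE (I : Type) (r : seq I) (F : I -> T) :
  \sum_(i <- r) F i = (\sum_(i <- r) (F i).1, \sum_(i <- r) (F i).2).
Proof.
by elim: r => [|i r IH]; rewrite ?big_nil // !big_cons IH.
Qed.

(** The system is triangular: first components determine the reductions of the coefficients, and
    second components then their eps-parts. *)
Lemma lift_basis m (b w : 'I_m -> M) : is_basis b -> is_basis (fun i => (b i, w i) : T).
Proof.
move=> hb [u v]; have [c [cE cU]] := hb u; have [d [dE dU]] := hb (v - \sum_i c 0 i *: w i).
have sE (e : 'rV[rbe]_m) : \sum_i e 0 i *: ((b i, w i) : T) =
    (\sum_i robba_red (e 0 i) *: b i,
     \sum_i robba_red (e 0 i) *: w i + \sum_i im (e 0 i) *: b i).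
  by rewrite dsumE -big_split.
exists (\row_i mk (c 0 i) (d 0 i)); split.
  rewrite sE; congr pair; first by rewrite {1}cE; apply: eq_bigr => i _; rewrite mxE red_mk.
  have e1 : \sum_i robba_red ((\row_i mk (c 0 i) (d 0 i)) 0 i) *: w i = \sum_i c 0 i *: w i.
    by apply: eq_bigr => i _; rewrite mxE red_mk.
  have e2 : \sum_i im ((\row_i mk (c 0 i) (d 0 i)) 0 i) *: b i = \sum_i d 0 i *: b i.
    by apply: eq_bigr => i _; rewrite mxE im_mk.
  by rewrite e1 e2 -dE addrC subrK.
move=> e; rewrite sE => -[e1 e2].
have c1 : c = \row_i robba_red (e 0 i).
  by apply: cU; rewrite e1; apply: eq_bigr => i _; rewrite mxE.
have d1 : d = \row_i im (e 0 i).
  apply: dU; rewrite e2 c1; have -> : \sum_i (\row_i robba_red (e 0 i)) 0 i *: w i = \sum_i robba_red (e 0 i) *: w i.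
    by apply: eq_bigr => i _; rewrite mxE.
  by rewrite addrC addKr; apply: eq_bigr => i _; rewrite mxE.
by apply/rowP => i; rewrite mxE c1 d1 !mxE -mk_red_im.
Qed.

End DualModule.

Section Deformation.
Variables (R : realType) (p : nat) (Qp : padicNumType R p) (E : ultraFieldExtType Qp).
Variable O : robba_ops E.
Local Notation Ee := (dual E : ultraAlgType Qp).
Local Notation rb := (robba E).
Local Notation rbe := (robba Ee).
Local Notation Eps := (robba_const (eps : Ee)).

Definition linf (M N : lmodType (robba E)) (f : M -> N) :=
  forall (a : rb) u v, f (a *: u + v) = a *: f u + f v.

Section Linf.
Variables (M N : lmodType (robba E)) (f : M -> N).
Hypothesis fl : linf f.
Lemma linf0 : f 0 = 0.
Proof. by have := fl (-1) 0 0; rewrite scaler0 addr0 scaleN1r addNr. Qed.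
Lemma linfD u v : f (u + v) = f u + f v.
Proof. by have := fl 1 u v; rewrite !scale1r. Qed.
Lemma linfZ a u : f (a *: u) = a *: f u.
Proof. by have := fl a u 0; rewrite !addr0 linf0 addr0. Qed.
Lemma linfN u : f (- u) = - f u.
Proof. by rewrite -scaleN1r linfZ scaleN1r. Qed.
Lemma linfB u v : f (u - v) = f u - f v.
Proof. by rewrite linfD linfN. Qed.
Lemma linf_sum (I : Type) (r : seq I) (F : I -> M) : f (\sum_(i <- r) F i) = \sum_(i <- r) f (F i).
Proof. by elim: r => [|i r IH]; rewrite ?big_nil ?linf0 // !big_cons linfD IH. Qed.
End Linf.

(** The operators of the deformation are (1 + eps Np) phi and (1 + eps Ng) gamma. The relations are
    stated on images of phi and gamma, which avoids inverses; [coc_cvg] expresses continuity without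
    a basis, by finitely many fixed linear maps with continuous coefficients. *)
Record cocycle (M : pgmod E) (Np : M -> M) (Ng : Qp -> M -> M) : Prop := Cocycle {
  coc_lin : linf Np;
  coc_M : forall x y, Zp_unit x -> Zp_unit y -> forall u,
    Ng (x * y) (pg_gamma x (pg_gamma y u)) =
    Ng x (pg_gamma x (pg_gamma y u)) + pg_gamma x (Ng y (pg_gamma y u));
  coc_P : forall x, Zp_unit x -> forall u,
    Np (pg_phi (pg_gamma x u)) + pg_phi (Ng x (pg_gamma x u)) =
    Ng x (pg_gamma x (pg_phi u)) + pg_gamma x (Np (pg_phi u));
  coc_cvg : exists (r : nat) (f : 'I_r -> Qp -> rb) (T : 'I_r -> M -> M),
    [/\ forall i, linf (T i), forall i x, Zp_unit x -> robba_cvg (f i) x (f i x) &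
        forall x, Zp_unit x -> forall u, Ng x u = \sum_i f i x *: T i u] }.

Definition dmod (M : pgmod E) (Np : M -> M) (Ng : Qp -> M -> M) : pgmod Ee :=
  @PGMod R p Qp Ee (dmodT M : lmodType rbe)
    (fun u : dmodT M => (pg_phi u.1, pg_phi u.2 + Np (pg_phi u.1)) : dmodT M)
    (fun x (u : dmodT M) => (pg_gamma x u.1, pg_gamma x u.2 + Ng x (pg_gamma x u.1)) : dmodT M).

Lemma robba_cvg_sum (A : ultraAlgType Qp) m (f : 'I_m -> Qp -> robba A) x (l : 'I_m -> robba A) :
  (forall i, robba_cvg (f i) x (l i)) ->
  robba_cvg (fun y => \sum_i f i y) x (\sum_i l i).
Proof.
move=> h; elim: (index_enum _) => [|i r IH].
  rewrite big_nil (_ : (fun y => _) = fun=> 0); first exact: robba_cvg_cst.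
  by apply/funext => y; rewrite big_nil.
rewrite big_cons (_ : (fun y => _) = fun y => f i y + \sum_(j <- r) f j y).
  exact: robba_cvgD.
by apply/funext => y; rewrite big_cons.
Qed.

Variables (M : pgmod E) (m : nat) (Np : M -> M) (Ng : Qp -> M -> M).
Hypotheses (MP : is_phiGamma M m) (NC : cocycle Np Ng).

Lemma coc_gl x : Zp_unit x -> linf (Ng x).
Proof.
have [r [f [T [Tl _ NE]]]] := coc_cvg NC; move=> xu a u v; rewrite !NE // scaler_sumr -big_split.
by apply: eq_bigr => i _; rewrite Tl scalerDr !scalerA [f i x * a]mulrC.
Qed.

Lemma red_im_phi (g : rbe) : robba_phi g = mk (robba_phi (robba_red g)) (robba_phi (im g)).
Proof. by rewrite {1}(mk_red_im g) (phi_mk O). Qed.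
Lemma red_im_gamma x (g : rbe) : Zp_unit x ->
  robba_gamma x g = mk (robba_gamma x (robba_red g)) (robba_gamma x (im g)).
Proof. by move=> xu; rewrite {1}(mk_red_im g) (gamma_mk O). Qed.

Lemma zpu1 : Zp_unit (1 : Qp). Proof. by rewrite /Zp_unit unorm1. Qed.

Lemma dmod_phiGamma : is_phiGamma (dmod Np Ng) m.
Proof.
have [phl gml [g1 gM] pg [b [bb pb [G bG Gc]]]] := MP.
have Npl := coc_lin NC; have Ngl := coc_gl.
have phD u v : pg_phi (u + v) = pg_phi u + pg_phi v :> M.
  by have := phl 1 u v; rewrite -(op_phiE O) rmorph1 !scale1r.
have ph0 : pg_phi 0 = 0 :> M by have := phD 0 0; rewrite addr0 -{1}[pg_phi 0]addr0 => /addrI.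
have phZ a u : pg_phi (a *: u) = robba_phi a *: pg_phi u :> M.
  by have := phl a u 0; rewrite !addr0 ph0 addr0.
have gmD x u v : Zp_unit x -> pg_gamma x (u + v) = pg_gamma x u + pg_gamma x v :> M.
  by move=> xu; have := gml x xu 1 u v; rewrite -(op_gammaE O xu) rmorph1 !scale1r.
have gm0 x : Zp_unit x -> pg_gamma x 0 = 0 :> M.
  by move=> xu; have := gmD x 0 0 xu; rewrite addr0 -{1}[pg_gamma x 0]addr0 => /addrI.
have gmZ x a u : Zp_unit x -> pg_gamma x (a *: u) = robba_gamma x a *: pg_gamma x u :> M.
  by move=> xu; have := gml x xu a u 0; rewrite !addr0 gm0 // addr0.
have alg (A B F H K : M) : A + B + F + (H + K) = A + H + B + (F + K).
  by rewrite addrACA [A + B + H]addrAC.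
split.
- move=> a [u v] [u' v']; rewrite !dscaleE /= [robba_phi a]red_im_phi red_mk im_mk.
  have e1 : pg_phi (robba_red a *: v + im a *: u + v') =
    robba_phi (robba_red a) *: pg_phi v + robba_phi (im a) *: pg_phi u + pg_phi v'.
    by rewrite !phD !phZ.
  have e2 : Np (pg_phi (robba_red a *: u + u')) =
    robba_phi (robba_red a) *: Np (pg_phi u) + Np (pg_phi u') by rewrite phl Npl.
  congr pair; first exact: phl.
  by apply: etrans (congr2 (fun y z => y + z) e1 e2) _; rewrite scalerDr; exact: alg.
- move=> x xu a [u v] [u' v']; rewrite !dscaleE /= [robba_gamma x a]red_im_gamma // red_mk im_mk.
  have e1 : pg_gamma x (robba_red a *: v + im a *: u + v') =
    robba_gamma x (robba_red a) *: pg_gamma x v + robba_gamma x (im a) *: pg_gamma x u + pg_gamma x v'.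
    by rewrite !gmD // !gmZ.
  have e2 : Ng x (pg_gamma x (robba_red a *: u + u')) =
    robba_gamma x (robba_red a) *: Ng x (pg_gamma x u) + Ng x (pg_gamma x u').
    by rewrite gml // Ngl.
  congr pair; first exact: gml.
  by apply: etrans (congr2 (fun y z => y + z) e1 e2) _; rewrite scalerDr; exact: alg.
- split=> [[u v]|x y xu yu [u v]] /=.
    have N1 w : Ng 1 w = 0.
      have := coc_M NC zpu1 zpu1 w; rewrite mulr1 !g1 => /eqP.
      by rewrite -{1}[Ng 1 w]addr0 => /eqP/addrI.
    by rewrite !g1 N1 addr0.
  rewrite !gM //; congr pair; rewrite gmD // -addrA; congr (_ + _).
  by rewrite (coc_M NC xu yu) addrC.
- move=> x xu [u v] /=; congr pair; first exact: pg.
  rewrite phD pg // -addrA [pg_phi (Ng _ _) + _]addrC (coc_P NC xu) gmD // -addrA.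
  by congr (_ + _); rewrite addrC.
exists (fun i => (b i, 0) : dmodT M); split.
- exact: lift_basis.
- have := lift_basis (fun i => Np (pg_phi (b i))) pb; congr is_basis; apply/funext => i /=.
  by rewrite ph0 add0r.
have [r [f [T [Tl fc NE]]]] := coc_cvg NC.
have /choice[cs hcs] : forall u : M, exists c : 'I_m -> rb, u = \sum_i c i *: b i.
  by move=> u; have [c [cE _]] := bb u; exists (c 0).
pose Tm i k l := cs (T i (b l)) k.
pose H x k j := \sum_(i < r) f i x * \sum_l (Tm i k l * G x l j).
exists (fun x => \matrix_(k, j) mk (G x k j) (H x k j)) => [x xu j|x xu k j]; last first.
  rewrite mxE (_ : (fun y => _) = fun y => mk (G y k j) (H y k j)); last by apply/funext => y; rewrite mxE.
  apply: cvg_mk; first exact: Gc.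
  apply: robba_cvg_sum => i; apply: robba_cvgM; first exact: fc.
  by apply: robba_cvg_sum => l; apply: robba_cvgM; [apply: robba_cvg_cst|apply: Gc].
rewrite dsumE /= gm0 // add0r; congr pair.
  by rewrite (bG x xu j); apply: eq_bigr => k _; rewrite mxE red_mk.
have -> : \sum_i (robba_red ((\matrix_(k, j) mk (G x k j) (H x k j)) i j) *: 0
     + im ((\matrix_(k, j) mk (G x k j) (H x k j)) i j) *: b i) = \sum_k H x k j *: b k.
  by apply: eq_bigr => k _; rewrite scaler0 add0r mxE im_mk.
rewrite (bG x xu j) NE //.
have -> : \sum_(i < r) f i x *: T i (\sum_l G x l j *: b l) =
    \sum_(i < r) \sum_k (f i x * \sum_l (Tm i k l * G x l j)) *: b k.
  apply: eq_bigr => i _; rewrite (linf_sum (Tl i)) scaler_sumr.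
  under eq_bigr => l _ do rewrite (linfZ (Tl i)) (hcs (T i (b l))) !scaler_sumr.
  rewrite exchange_big; apply: eq_bigr => k _; rewrite mulr_sumr scaler_suml.
  by apply: eq_bigr => l _; rewrite !scalerA; congr (_ *: _); rewrite /Tm; ring.
by rewrite exchange_big; apply: eq_bigr => k _; rewrite scaler_suml.
Qed.

Lemma dmod_deform : is_deform (Mt := dmod Np Ng) (fun u : dmodT M => u.1).
Proof.
split; first by exists m; exact: dmod_phiGamma.
- by [].
- by [].
- by move=> w; exists ((w, 0) : dmodT M).
have redE : robba_red Eps = 0 by rewrite -mk01 red_mk.
have imE' : im Eps = 1 by rewrite -mk01 im_mk.
move=> [u v]; split=> [u0|[w e]].
  have {}u0 : u = 0 by exact: u0.
  by exists ((v, 0) : dmodT M); rewrite u0 dscaleE redE imE' /= !scale0r scale1r add0r.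
have := congr1 fst e; rewrite dscaleE redE /= scale0r; exact.
Qed.

End Deformation.

(** * Coordinates on triangulated modules *)

Section Coordinates.
Variables (R : realType) (p : nat) (Qp : padicNumType R p) (E : ultraFieldExtType Qp).
Variable O : robba_ops E.
Local Notation rb := (robba E).
Local Notation C := (@robba_const R E).
Local Notation pr := (p%:R : R).
Local Notation ph := (op_phi O).
Local Notation gm := (op_gamma O).
Local Notation t := (robba_t E).
Local Notation "x ^A k" := ((x%:A : E) ^ (k : int)) (at level 30).
Implicit Types (f g : rb) (x y : Qp) (a b c : E) (k : int).

Lemma padic_val_eq (x : Qp) (n : int) : unorm x = pr ^ (- n) -> padic_val x = n.
Proof.
move=> xn; apply: xget_unique => //= k; rewrite xn => e; apply: oppr_inj.
by apply: (ieexprIz (pr_gt0 Qp)) (esym e); rewrite gt_eqF // (pr_gt1 Qp).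
Qed.

Lemma unr_zp a k : unr_z a k (p%:R : Qp) = a * p%:R ^ k.
Proof.
rewrite /unr_z (@padic_val_eq _ 1) ?expr1z; last by rewrite (normp Qp) exprN1.
by rewrite scaler_nat.
Qed.

Lemma unr_zu a k x : Zp_unit x -> unr_z a k x = x ^A k.
Proof. by move=> /eqP xu; rewrite /unr_z (@padic_val_eq _ 0) ?xu // expr0z mul1r. Qed.

(** By [ph_eigen] f = c t^j. Gamma is tested at x0n 0, whose powers are distinct: this forces j = k
    - k', and the phi-eigenvalue then forces a = b. *)
Lemma hom_char f a b k k' : a != 0 -> b != 0 ->
  C (b * p%:R ^ k') * ph f = C (a * p%:R ^ k) * f ->
  (forall x, Zp_unit x -> C (x ^A k') * gm x f = C (x ^A k) * f) ->
  f = 0 \/ [/\ a = b, k' <= k & exists c, f = C c * t ^+ `|k - k'|%N].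
Proof.
move=> a0 b0 hp hg; have p0 := E_p_neq0 E; have pz j : p%:R ^ j != 0 :> E by rewrite expfz_neq0.
have bp0 : b * p%:R ^ k' != 0 by rewrite mulf_neq0.
pose mu := (a * p%:R ^ k) / (b * p%:R ^ k').
have mu0 : mu != 0 by rewrite mulf_neq0 ?invr_eq0 ?mulf_neq0.
have hm : ph f = C mu * f.
  have -> : mu = (b * p%:R ^ k')^-1 * (a * p%:R ^ k) by rewrite mulrC.
  by rewrite constM -mulrA -hp mulrA -constM mulVf // const1 mul1r.
have [c [j [fE hj]]] := ph_eigen mu0 hm.
have [c0|c0] := eqVneq c 0; [by left; rewrite fE c0 const0 mul0r|right].
have xu := x0n_unit Qp 0; have inj := @x0n_pow_inj R p Qp E 0; have {hg} := hg _ xu.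
move: (x0n p 0)%:R xu inj => x xu inj hg; have x0 : (x%:A : E) != 0 by exact: alg_neq0.
have xj : x ^A k = x ^A k' * x ^A j.
  apply: (mulIf c0); apply: (@const_inj R E); apply: (t_regI O (m := j)).
  have ge : gm x f = C c * (C (x%:A ^+ j) * t ^+ j).
    by rewrite fE [LHS]rmorphM (gm_C O c xu) rmorphXn /= (gm_t O xu) exprMn constX.
  have e := hg; rewrite ge fE in e; rewrite !constM -[x ^A j]/(x%:A ^+ j).
  move: (C (x ^A k)) (C (x ^A k')) (C c) (C (x%:A ^+ j)) (t ^+ j) e => A F B G T e.
  transitivity (A * (B * T)); first ring.
  by rewrite -e; ring.
have kj : k - k' = j.
  have e : x ^A (k - k') = (x%:A : E) ^+ j.
    by rewrite expfzDr // xj mulrAC -expfzDr // subrr expr0z mul1r.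
  case: (k - k') e => n e; first by congr Posz; apply: inj.
  have : (x%:A : E) ^+ (j + n.+1) = x%:A ^+ 0.
    by rewrite exprD -e NegzE -exprnN mulVf ?expf_neq0 // expr0.
  by move/inj; rewrite addnS.
have ab : a = b.
  have e := hj c0; have kE : k = j%:Z + k' by rewrite -kj subrK.
  have : a * p%:R ^ k = p%:R ^+ j * (b * p%:R ^ k') by rewrite -e /mu divfK.
  by rewrite kE expfzDr // mulrCA mulrA [RHS]mulrA => /(mulIf (pz k')) /(mulfI (pz j)).
split=> //; first by rewrite -subr_ge0 kj.
by exists c; rewrite kj absz_nat.
Qed.

Section Twisted.
Variable D : pgmod E.
Implicit Types (K : D -> Prop) (q r : D -> rb).

(** On K, q is a (phi, Gamma)-map to the rank one module of unr(a) z^k. The set K is a parameter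
    because the maps attached to a filtration are only equivariant on its steps. *)
Definition tw K q a k := [/\ forall (e : rb) u v, K u -> K v -> q (e *: u + v) = e * q u + q v,
  forall u, K u -> q (pg_phi u) = C (a * p%:R ^ k) * ph (q u) &
  forall x, Zp_unit x -> forall u, K u -> q (pg_gamma x u) = C (x ^A k) * gm x (q u)].

Lemma factor K q r a b k k' w : is_pgsub K -> tw K q a k -> tw K r b k' -> a != 0 -> b != 0 ->
  K w -> q w = 1 -> (forall u, K u -> q u = 0 -> r u = 0) ->
  (forall u, K u -> r u = q u * r w) /\
  (r w = 0 \/ [/\ a = b, k' <= k & exists c, r w = C c * t ^+ `|k - k'|%N]).
Proof.
move=> [K0 Kl Kp Kg] [ql qp qg] [rl rp rg] a0 b0 Kw qw hr.
have e u : K u -> r u = q u * r w.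
  move=> Ku; have Kv : K (- q u *: w + u) by apply: Kl.
  have : r (- q u *: w + u) = 0 by apply: hr => //; rewrite ql // qw mulr1 addNr.
  by rewrite rl // mulNr addrC => /eqP; rewrite subr_eq0 => /eqP.
split=> //; apply: hom_char => //.
  by rewrite -rp // e ?qp // ?qw ?rmorph1 ?mulr1 //; apply: Kp.
by move=> x xu; rewrite -rg // e ?qg // ?qw ?rmorph1 ?mulr1 //; apply: Kg.
Qed.

Lemma subquotient_tw (F' F : set D) a k : subquotient_iso F' F (pg_char (unr_z a k)) ->
  exists q, [/\ tw F q a k, forall f, exists2 u, F u & q u = f & forall u, F u -> (q u = 0 <-> F' u)].
Proof.
move=> [q [ql qp qg qo qk]]; exists q; split=> //; split=> //.
  by move=> u Fu; rewrite qp //= unr_zp op_phiE.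
by move=> x xu u Fu; rewrite qg //= unr_zu // op_gammaE.
Qed.
End Twisted.

Lemma perm_tuple m (s : m.-tuple 'I_m) : uniq s -> exists w : 'S_m, forall r, (w^-1)%g r = tnth s r.
Proof.
move=> us; have inj : injective (tnth s) by apply/tuple_uniqP.
by exists ((perm inj)^-1)%g => r; rewrite invgK permE.
Qed.

(** w is chosen so that a_i is at the bottom of the filtration and a_k on the top quotient. *)
Lemma flag3 (D : pgmod E) (a : 3.-tuple E) (h : 3.-tuple int) (i j k : 'I_3) :
  (forall w : 'S_3, triangulated D (fun r => unr_z (tnth a ((w^-1)%g r)) (tnth h r))) ->
  uniq [:: i; j; k] -> exists q2 q1 q0 : D -> rb,
  [/\ [/\ tw (fun=> True) q2 (tnth a k) (tnth h (inord 2)),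
       tw (fun u => q2 u = 0) q1 (tnth a j) (tnth h (inord 1)) &
       tw (fun u => q2 u = 0 /\ q1 u = 0) q0 (tnth a i) (tnth h (inord 0))],
   is_pgsub (fun u => q2 u = 0) /\ is_pgsub (fun u => q2 u = 0 /\ q1 u = 0),
   [/\ exists u, q2 u = 1, exists2 u, q2 u = 0 & q1 u = 1 &
       exists2 u, q2 u = 0 /\ q1 u = 0 & q0 u = 1] &
   forall u, q2 u = 0 -> q1 u = 0 -> q0 u = 0 -> u = 0].
Proof.
move=> tri us; have [w hw] := @perm_tuple 3 [tuple i; j; k] us.
have [Fil [F0 F3 Fs Fq]] := tri w.
have [_ /subquotient_tw[q2 [t2 o2 k2]]] := Fq (inord 2).
have [s12 /subquotient_tw[q1 [t1 o1 k1]]] := Fq (inord 1).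
have [s01 /subquotient_tw[q0 [t0 o0 k0]]] := Fq (inord 0).
have e2 : (inord 2 : 'I_3) = 2%N :> nat by rewrite inordK.
have e1 : (inord 1 : 'I_3) = 1%N :> nat by rewrite inordK.
have e0 : (inord 0 : 'I_3) = 0%N :> nat by rewrite inordK.
rewrite hw (_ : tnth _ _ = k) ?e2 in t2 o2 k2; last by rewrite (tnth_nth i) e2.
rewrite hw (_ : tnth [tuple i; j; k] _ = j) ?e1 in t1 o1 k1 s12; last by rewrite (tnth_nth i) e1.
rewrite hw (_ : tnth [tuple i; j; k] _ = i) ?e0 in t0 o0 k0 s01; last by rewrite (tnth_nth i) e0.
have k2' u : q2 u = 0 <-> Fil 2%N u by apply: k2; rewrite F3.
have k1' u : q2 u = 0 /\ q1 u = 0 <-> Fil 1%N u.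
  split=> [[/k2' F2 /(proj1 (k1 u F2))]//|F1]; have F2 := s12 u F1.
  by split; [apply/k2'|apply/(k1 u F2)].
have E2 : (fun u => q2 u = 0) = Fil 2%N by apply/funext => u; apply/propext.
have E1 : (fun u => q2 u = 0 /\ q1 u = 0) = Fil 1%N by apply/funext => u; apply/propext.
have E3 : (fun=> True) = Fil 3 by rewrite F3.
exists q2, q1, q0; rewrite E1 E2 E3; split=> //.
- by split; [have [] := Fs 2%N isT|have [] := Fs 1%N isT].
- split; first by have [u _ hu] := o2 1; exists u.
    by have [u Fu hu] := o1 1; exists u.
  by have [u Fu hu] := o0 1; exists u.
move=> u u2 u1 u0; have F1 : Fil 1%N u by apply/k1'.
by have := proj1 (k0 u F1) u0; rewrite F0.
Qed.

Lemma flag2 (D : pgmod E) (a : 2.-tuple E) (h : 2.-tuple int) (i j : 'I_2) :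
  (forall w : 'S_2, triangulated D (fun r => unr_z (tnth a ((w^-1)%g r)) (tnth h r))) ->
  uniq [:: i; j] -> exists q1 q0 : D -> rb,
  [/\ tw (fun=> True) q1 (tnth a j) (tnth h (inord 1)) /\
       tw (fun u => q1 u = 0) q0 (tnth a i) (tnth h (inord 0)),
   is_pgsub (fun u => q1 u = 0),
   (exists u, q1 u = 1) /\ (exists2 u, q1 u = 0 & q0 u = 1) &
   forall u, q1 u = 0 -> q0 u = 0 -> u = 0].
Proof.
move=> tri us; have [w hw] := @perm_tuple 2 [tuple i; j] us.
have [Fil [F0 F2 Fs Fq]] := tri w.
have [_ /subquotient_tw[q1 [t1 o1 k1]]] := Fq (inord 1).
have [s01 /subquotient_tw[q0 [t0 o0 k0]]] := Fq (inord 0).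
have e1 : (inord 1 : 'I_2) = 1%N :> nat by rewrite inordK.
have e0 : (inord 0 : 'I_2) = 0%N :> nat by rewrite inordK.
rewrite hw (_ : tnth [tuple i; j] _ = j) ?e1 in t1 o1 k1; last by rewrite (tnth_nth i) e1.
rewrite hw (_ : tnth [tuple i; j] _ = i) ?e0 in t0 o0 k0 s01; last by rewrite (tnth_nth i) e0.
have k1' u : q1 u = 0 <-> Fil 1%N u by apply: k1; rewrite F2.
have E1 : (fun u => q1 u = 0) = Fil 1%N by apply/funext => u; apply/propext.
have E2 : (fun=> True) = Fil 2 by rewrite F2.
exists q1, q0; rewrite E1 E2; split=> //.
- by have [] := Fs 1%N isT.
- split; first by have [u _ hu] := o1 1; exists u.
  by have [u Fu hu] := o0 1; exists u.
move=> u u1 u0; have F1 : Fil 1%N u by apply/k1'.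
by have := proj1 (k0 u F1) u0; rewrite F0.
Qed.

End Coordinates.

Section Structure.
Variables (R : realType) (p : nat) (Qp : padicNumType R p) (E : ultraFieldExtType Qp).
Variable O : robba_ops E.
Local Notation rb := (robba E).
Local Notation C := (@robba_const R E).
Local Notation ph := (op_phi O).
Local Notation gm := (op_gamma O).
Local Notation t := (robba_t E).
Local Notation tw := (tw O).
Implicit Types (f g : rb) (x y : Qp) (a b c : E) (m n : nat).

Definition tm m f := exists B, f = t ^+ m * B.
Lemma tm0 m : tm m 0. Proof. by exists 0; rewrite mulr0. Qed.
Lemma tmD m f g : tm m f -> tm m g -> tm m (f + g).
Proof. by move=> [B ->] [B' ->]; exists (B + B'); rewrite mulrDr. Qed.
Lemma tmN m f : tm m f -> tm m (- f).
Proof. by move=> [B ->]; exists (- B); rewrite mulrN. Qed.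
Lemma tmB m f g : tm m f -> tm m g -> tm m (f - g).
Proof. by move=> h h'; apply: tmD => //; apply: tmN. Qed.
Lemma tmMl m f g : tm m f -> tm m (g * f).
Proof. by move=> [B ->]; exists (g * B); rewrite mulrCA. Qed.
Lemma tmMr m f g : tm m f -> tm m (f * g).
Proof. by rewrite mulrC; apply: tmMl. Qed.
Lemma tm_le m n f : (m <= n)%N -> tm n f -> tm m f.
Proof. by move=> mn [B ->]; exists (t ^+ (n - m) * B); rewrite mulrA -exprD subnKC. Qed.
Lemma tm_Cl m a f : a != 0 -> tm m (C a * f) -> tm m f.
Proof.
move=> a0 h; have -> : f = C a^-1 * (C a * f) by rewrite mulrA -constM mulVf // mul1r.
exact: tmMl.
Qed.
Lemma tm_C m c : (0 < m)%N -> tm m (C c) -> c = 0.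
Proof. by move=> m0 [B hB]; apply: (C_in_t O m0 hB). Qed.

Section Coords3.
Variables (D : pgmod E) (a : 3.-tuple E) (h : 3.-tuple int).
Hypothesis a0 : forall i, tnth a i != 0.
Hypothesis an : forall i j, i != j -> tnth a i != tnth a j.
Hypothesis tri : forall w : 'S_3,
  triangulated D (fun r => unr_z (tnth a ((w^-1)%g r)) (tnth h r)).
Local Notation H0 := (tnth h (inord 0)).
Local Notation H1 := (tnth h (inord 1)).
Local Notation H2 := (tnth h (inord 2)).
Local Notation m2 := `|H1 - H2|%N.
Local Notation m := `|H0 - H2|%N.

Lemma Ct_reg c n f : c != 0 -> f * (C c * t ^+ n) = 0 -> f = 0.
Proof.
move=> c0 h0; apply: (mulrI (C_unit c0)); rewrite mulr0; apply: (@t_reg R p Qp E O n).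
by apply: etrans h0; ring.
Qed.

Lemma tw0 (K : D -> Prop) q b (k : int) : is_pgsub K -> tw K q b k -> q 0 = 0.
Proof.
by move=> [K0 _ _ _] [ql _ _]; have := ql (-1) 0 0 K0 K0; rewrite scaler0 addr0 mulN1r addNr.
Qed.

Lemma tw_sub (K K' : D -> Prop) q b (k : int) : (forall u, K u -> K' u) -> tw K' q b k -> tw K q b k.
Proof.
by move=> KK [q1 q2 q3]; split=> [e u v /KK Ku /KK Kv|u /KK|x xu u /KK]; [apply: q1|apply: q2|apply: q3].
Qed.

Lemma pgsubT : is_pgsub (fun _ : D => True). Proof. by []. Qed.

Variable q : 'I_3 -> D -> rb.
Hypothesis qt : forall r, tw (fun=> True) (q r) (tnth a r) H2.
Hypothesis qo : forall r, exists u, q r u = 1.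

(** The maps q j and q k come from different filtrations and are compared within one of them. By
    [hom_char] a map to the module of a_k kills the graded pieces with another eigenvalue; hence q k
    has the kernel of the top quotient map, and on it q j is a nonzero multiple of t^m2 times the
    middle one. *)
Lemma flag_analysis (i j k : 'I_3) : uniq [:: i; j; k] -> exists (q1 q0 : D -> rb) c1,
  [/\ c1 != 0, is_pgsub (fun u => q k u = 0 /\ q1 u = 0),
   tw (fun u => q k u = 0 /\ q1 u = 0) q0 (tnth a i) H0,
   [/\ forall u, q k u = 0 -> q j u = q1 u * (C c1 * t ^+ m2),
       exists2 w, q k w = 0 & q1 w = 1 &
       exists2 w, q k w = 0 /\ q1 w = 0 & q0 w = 1] &
   forall u, q k u = 0 -> q1 u = 0 -> q0 u = 0 -> u = 0].
Proof.
move=> us; have [ij ik jk] : [/\ i != j, i != k & j != k].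
  by move: us; rewrite /= !inE negb_or andbT; case/andP => /andP[].
have [q2 [q1 [q0 [[t2 t1 t0] [K1 K0] [[w2 h2] [w1 w1K h1] [w0 w0K h0]] inj]]]] := flag3 O tri us.
have kill1 b r : tw (fun=> True) r b H2 -> b != 0 -> tnth a i != b ->
    forall u, q2 u = 0 -> q1 u = 0 -> r u = 0.
  move=> tr b0 ib u u2 u1; have hr v : q2 v = 0 /\ q1 v = 0 -> q0 v = 0 -> r v = 0.
    by move=> [v2 v1] v0; rewrite (inj v v2 v1 v0); apply: tw0 pgsubT tr.
  have [e [z|[ab]]] := factor K0 t0 (tw_sub (fun _ _ => I) tr) (a0 i) b0 w0K h0 hr.
    by rewrite e // z mulr0.
  by case/eqP: ib.
have fac2 b r : tw (fun=> True) r b H2 -> b != 0 -> tnth a i != b ->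
    (forall u, q2 u = 0 -> r u = q1 u * r w1) /\ (r w1 = 0 \/
    [/\ tnth a j = b, H2 <= H1 & exists c, r w1 = C c * t ^+ m2]).
  move=> tr b0 ib; apply: (factor K1 t1 (tw_sub (fun _ _ => I) tr) (a0 j) b0 w1K h1).
  by move=> u u2 u1; apply: kill1 tr b0 ib u u2 u1.
have fac3 b r : tw (fun=> True) r b H2 -> b != 0 -> (forall u, q2 u = 0 -> r u = 0) ->
    (forall u, r u = q2 u * r w2) /\ (r w2 = 0 \/
    [/\ tnth a k = b, H2 <= H2 & exists c, r w2 = C c * t ^+ `|H2 - H2|]).
  move=> tr b0 k1; have [e z] := factor pgsubT t2 tr (a0 k) b0 I h2 (fun u _ => k1 u).
  by split=> // u; apply: e.
have nz r : (exists u, q r u = 1) -> ~ forall u, q r u = 0.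
  by move=> [u hu] H; have /eqP := hu; rewrite H eq_sym oner_eq0.
have same u : q k u = 0 <-> q2 u = 0.
  have ki : forall u, q2 u = 0 -> q k u = 0.
    move=> v v2; have [e [z|[]]] := fac2 _ _ (qt k) (a0 k) (an ik); first by rewrite e // z mulr0.
    by move=> ab; case/eqP: (an jk).
  have [e z] := fac3 _ _ (qt k) (a0 k) ki; split; last exact: ki.
  case: z => [z|[_ _ [c z]]]; first by case: (nz k (qo k)) => v; rewrite e z mulr0.
  have [c0|c0] := eqVneq c 0.
    by case: (nz k (qo k)) => v; rewrite e z c0 const0 mul0r mulr0.
  by rewrite e z; apply: Ct_reg.
have E1 : (fun u => q2 u = 0 /\ q1 u = 0) = (fun u => q k u = 0 /\ q1 u = 0).
  by apply/funext => u; apply/propext; split=> -[/same ? ?].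
have [e z] := fac2 _ _ (qt j) (a0 j) (an ij).
have kj : q j w1 != 0.
  apply/eqP => z0; have kills v : q2 v = 0 -> q j v = 0 by move=> v2; rewrite e // z0 mulr0.
  have [e3 [z3|[ab]]] := fac3 _ _ (qt j) (a0 j) kills.
    by apply: (nz j (qo j)) => v; rewrite e3 z3 mulr0.
  by case/eqP: (an jk).
case: z kj => [->|[_ _ [c z]] kj]; first by rewrite eqxx.
have c0 : c != 0 by apply: contraNneq kj => c0; rewrite z c0 const0 mul0r.
exists q1, q0, c; rewrite -E1; split=> //.
  split; first by move=> u /same u2; rewrite e // z.
    by exists w1 => //; apply/same.
  by exists w0.
by move=> u /same u2; apply: inj.
Qed.

Lemma coords_pair (i j k : 'I_3) B : uniq [:: i; j; k] -> exists u, q k u = 0 /\ q j u = t ^+ m2 * B.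
Proof.
move=> us; have [q1 [q0 [c [c0 _ _ [e [w w2 w1] _] _]]]] := flag_analysis us.
have [ql _ _] := qt k; have qz r := tw0 pgsubT (qt r).
exists ((C c^-1 * B) *: w + 0); have k0 : q k ((C c^-1 * B) *: w + 0) = 0.
  by rewrite ql // w2 mulr0 add0r qz.
split=> //; have [ql' _ _] := qt j; rewrite ql' // qz addr0 e // w1 mul1r.
have ce : C c^-1 * C c = 1 by rewrite -constM mulVf.
transitivity ((C c^-1 * C c) * (t ^+ m2 * B)); first ring.
by rewrite ce mul1r.
Qed.

Lemma coords_tm (i j k : 'I_3) u : uniq [:: i; j; k] -> q k u = 0 -> tm m2 (q j u).
Proof.
move=> us uk; have [q1 [q0 [c [c0 _ _ [e _ _] _]]]] := flag_analysis us.
by exists (C c * q1 u); rewrite e //; ring.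
Qed.

(** On the common kernel q i is a constant times t^m times the coordinate of the bottom line. If the
    constant were 0, the bottom line of (i, j, k) would lie in that of (j, i, k), which has another
    eigenvalue. *)
Lemma coords_line (i j k : 'I_3) : uniq [:: i; j; k] ->
  [/\ forall u, q k u = 0 -> q j u = 0 -> tm m (q i u),
      exists u, [/\ q k u = 0, q j u = 0 & q i u = t ^+ m] &
      forall u, q k u = 0 -> q j u = 0 -> q i u = 0 -> u = 0].
Proof.
move=> us; have us' : uniq [:: j; i; k] by move: us; rewrite /= !inE [j == i]eq_sym !negb_or !andbT; case/andP=> /andP[-> ->] ->.
have ij : i != j by move: us; rewrite /= !inE negb_or; case/andP => /andP[].
have [q1 [q0 [c [c0 K t0 [e _ [w0 w0K h0]] inj]]]] := flag_analysis us.
have [q1' [q0' [c' [c0' K' t0' [e' _ _] inj']]]] := flag_analysis us'.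
have kk u : q k u = 0 -> q j u = 0 -> q k u = 0 /\ q1 u = 0.
  by move=> u2 uj; split=> //; apply: (Ct_reg c0 (n := m2)); rewrite -e.
have hr u : q k u = 0 /\ q1 u = 0 -> q0 u = 0 -> q i u = 0.
  by move=> [u2 u1] u0; rewrite (inj u u2 u1 u0); apply: tw0 pgsubT (qt i).
have [f z] := factor K t0 (tw_sub (fun _ _ => I) (qt i)) (a0 i) (a0 i) w0K h0 hr.
have ni : q i w0 != 0.
  apply/eqP => z0; have sub u : q k u = 0 /\ q1 u = 0 -> q k u = 0 /\ q1' u = 0.
    move=> Ku; have [u2 _] := Ku; split=> //; apply: (Ct_reg c0' (n := m2)).
    by rewrite -e' // f // z0 mulr0.
  have hr' u : q k u = 0 /\ q1 u = 0 -> q0 u = 0 -> q0' u = 0.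
    by move=> [u2 u1] u0; rewrite (inj u u2 u1 u0); apply: tw0 K' t0'.
  have [_ [z0'|[ab]]] := factor K t0 (tw_sub sub t0') (a0 i) (a0 j) w0K h0 hr'; last first.
    by case/eqP: (an ij).
  have [s1 s2] := sub _ w0K; have w00 := inj' _ s1 s2 z0'.
  by have /eqP := h0; rewrite w00 (tw0 K t0) eq_sym oner_eq0.
case: z ni => [->|[_ _ [d z]] ni]; first by rewrite eqxx.
have d0 : d != 0 by apply: contraNneq ni => d0; rewrite z d0 const0 mul0r.
split.
- by move=> u u2 uj; rewrite f ?z; [exists (C d * q0 u); ring|apply: kk].
- have qz r := tw0 pgsubT (qt r); exists (C d^-1 *: w0 + 0).
  have [w2 w1] := w0K; have ql r := let: And3 l _ _ := qt r in l.
  rewrite !ql // !qz w2 (e _ w2) w1 z !mul0r !mulr0 !addr0; split=> //.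
  by rewrite mulrA -constM mulVf // mul1r.
move=> u u2 uj ui; have Ku := kk u u2 uj; have [_ u1] := Ku; apply: inj => //.
by apply: (Ct_reg d0 (n := m)); rewrite -z -f.
Qed.

End Coords3.

Lemma coords3_ex (D : pgmod E) (a : 3.-tuple E) (h : 3.-tuple int) :
  (forall w : 'S_3, triangulated D (fun r => unr_z (tnth a ((w^-1)%g r)) (tnth h r))) ->
  exists q : 'I_3 -> D -> rb, forall r, tw (fun=> True) (q r) (tnth a r) (tnth h (inord 2)) /\
    exists u, q r u = 1.
Proof.
move=> tri; suff /choice[q hq] : forall k, exists q, tw (fun=> True) q (tnth a k) (tnth h (inord 2)) /\
  exists u : D, q u = 1 by exists q.
move=> k.
have [i [j us]] : exists i j, uniq [:: i; j; k].
  case: k => -[|[|[|//]]] kk; pose o n : 'I_3 := inord n.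
  - by exists (o 1%N), (o 2%N); rewrite /= !inE -!val_eqE /= !inordK.
  - by exists (o 0%N), (o 2%N); rewrite /= !inE -!val_eqE /= !inordK.
  - by exists (o 0%N), (o 1%N); rewrite /= !inE -!val_eqE /= !inordK.
have [q2 [q1 [q0 [[t2 _ _] _ [w2 _ _] _]]]] := flag3 O tri us.
by exists q2.
Qed.

End Structure.

Section HomAndRankTwo.
Variables (R : realType) (p : nat) (Qp : padicNumType R p) (E : ultraFieldExtType Qp).
Variable O : robba_ops E.
Local Notation rb := (robba E).
Local Notation C := (@robba_const R E).
Local Notation ph := (op_phi O).
Local Notation gm := (op_gamma O).
Local Notation t := (robba_t E).
Local Notation tw := (tw O).
Local Notation TT := (fun=> True).

Section Hom3.
Variables (D : pgmod E) (a : 3.-tuple E) (h : 3.-tuple int).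
Hypothesis a0 : forall i, tnth a i != 0.
Hypothesis an : forall i j, i != j -> tnth a i != tnth a j.
Hypothesis tri : forall w : 'S_3,
  triangulated D (fun r => unr_z (tnth a ((w^-1)%g r)) (tnth h r)).
Local Notation H2 := (tnth h (inord 2)).

Lemma hom3 (i j k : 'I_3) (q r : D -> rb) : uniq [:: i; j; k] ->
  tw TT q (tnth a k) H2 -> tw TT r (tnth a k) H2 -> (exists u, q u = 1) ->
  exists c, forall u, r u = C c * q u.
Proof.
move=> us tq tr [v qv]; have [ij ik jk] : [/\ i != j, i != k & j != k].
  by move: us; rewrite /= !inE negb_or andbT; case/andP => /andP[].
have [q2 [q1 [q0 [[t2 t1 t0] [K1 K0] [[w2 h2] [w1 w1K h1] [w0 w0K h0]] inj]]]] := flag3 O tri us.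
have key s : tw TT s (tnth a k) H2 -> exists c, forall u, s u = q2 u * C c.
  move=> ts; have s0 u : q2 u = 0 /\ q1 u = 0 -> s u = 0.
    have hr w : q2 w = 0 /\ q1 w = 0 -> q0 w = 0 -> s w = 0.
      by move=> [x2 x1] x0; rewrite (inj w x2 x1 x0); apply: tw0 (@pgsubT _ _ _ _ D) ts.
    have [e [z|[ab]]] := factor K0 t0 (tw_sub (fun _ _ => I) ts) (a0 i) (a0 k) w0K h0 hr.
      by move=> Ku; rewrite e // z mulr0.
    by case/eqP: (an ik).
  have s1 u : True -> q2 u = 0 -> s u = 0.
    have [e [z|[ab]]] := factor K1 t1 (tw_sub (fun _ _ => I) ts) (a0 j) (a0 k) w1K h1
      (fun u u2 u1 => s0 u (conj u2 u1)).
      by move=> _ Ku; rewrite e // z mulr0.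
    by case/eqP: (an jk).
  have [e z] := factor (@pgsubT _ _ _ _ D) t2 ts (a0 k) (a0 k) (w := w2) I h2 s1.
  case: z => [z|[_ _ [c z]]]; [exists 0|exists c] => u; rewrite e // z ?const0 //.
  by rewrite subrr expr0 mulr1.
have [c hc] := key r tr; have [d hd] := key q tq.
have d0 : d != 0.
  by apply/eqP => z; move: qv; rewrite hd z const0 mulr0 => /eqP; rewrite eq_sym oner_eq0.
exists (c / d) => u; rewrite hc hd mulrCA -constM divfK //; ring.
Qed.
End Hom3.

Section Rank2.
Variables (M : pgmod E) (a : 2.-tuple E) (h : 2.-tuple int).
Hypothesis a0 : forall i, tnth a i != 0.
Hypothesis an : forall i j, i != j -> tnth a i != tnth a j.
Hypothesis tri : forall w : 'S_2,
  triangulated M (fun r => unr_z (tnth a ((w^-1)%g r)) (tnth h r)).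
Local Notation H0 := (tnth h (inord 0)).
Local Notation H1 := (tnth h (inord 1)).
Local Notation n := `|H0 - H1|%N.

Lemma coords2_ex : exists q : 'I_2 -> M -> rb,
  [/\ forall r, tw TT (q r) (tnth a r) H1, forall r, exists u, q r u = 1,
   forall i j, i != j -> [/\ forall u, q j u = 0 -> tm n (q i u),
     exists u, q j u = 0 /\ q i u = t ^+ n & forall u, q j u = 0 -> q i u = 0 -> u = 0] &
   forall i j b k (r : M -> rb), i != j -> b != 0 -> tnth a i != b -> tw TT r b k ->
     exists e, (forall u, r u = q j u * e) /\ (e = 0 \/
       [/\ tnth a j = b, k <= H1 & exists c, e = C c * t ^+ `|H1 - k|%N])].
Proof.
have oth (j : 'I_2) : exists i : 'I_2, i != j.
  by case: (eqVneq j ord0) => [->|]; [exists ord_max|exists ord0; rewrite eq_sym].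
have us (i j : 'I_2) : i != j -> uniq [:: i; j] by rewrite /= inE andbT.
have /choice[q hq] : forall j, exists q, exists2 q0, forall i, i != j ->
   [/\ tw TT q (tnth a j) H1, tw (fun u => q u = 0) q0 (tnth a i) H0,
   is_pgsub (fun u => q u = 0), exists2 u : M, q u = 0 & q0 u = 1 &
   forall u, q u = 0 -> q0 u = 0 -> u = 0] & exists u : M, q u = 1.
  move=> j; have [i ij] := oth j.
  have [q1 [q0 [[t1 t0] K [o1 o0] inj]]] := flag2 O tri (us i j ij).
  exists q1, q0 => // i' ij'; suff -> : i' = i by [].
  apply/val_inj; move: ij' ij; rewrite -!val_eqE /=.
  by case: i i' j {K t1 t0 o1 o0 inj} => [[|[|//]]?] [[|[|//]]?] [[|[|//]]?].
have hom i j b k (r : M -> rb) : i != j -> b != 0 -> tnth a i != b -> tw TT r b k ->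
     exists e, (forall u, r u = q j u * e) /\ (e = 0 \/
       [/\ tnth a j = b, k <= H1 & exists c, e = C c * t ^+ `|H1 - k|%N]).
  move=> ij b0 ib tr; have [q0 hq0 [w1 h1]] := hq j; have [t1 t0 K [w0 w0K h0] inj] := hq0 i ij.
  have hr u : q j u = 0 -> q0 u = 0 -> r u = 0.
    by move=> u1 u0; rewrite (inj u u1 u0); apply: tw0 (@pgsubT _ _ _ _ M) tr.
  have r0 u : True -> q j u = 0 -> r u = 0.
    have [e [z|[ab]]] := factor K t0 (tw_sub (fun _ _ => I) tr) (a0 i) b0 w0K h0 hr.
      by move=> _ Ku; rewrite e // z mulr0.
    by case/eqP: ib.
  have [e z] := factor (@pgsubT _ _ _ _ M) t1 tr (a0 j) b0 (w := w1) I h1 r0.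
  by exists (r w1); split=> // u; apply: e.
exists q; split=> //.
- by move=> r; have [i ir] := oth r; have [q0 hq0 _] := hq r; have [] := hq0 i ir.
- by move=> r; have [q0 _ ?] := hq r.
move=> i j ij; have [q0 hq0 [w1 h1]] := hq j; have [t1 t0 K [w0 w0K h0] inj] := hq0 i ij.
have ti : tw TT (q i) (tnth a i) H1.
  by have [q0' hq0' _] := hq i; have [] := hq0' j; rewrite // eq_sym.
have hr u : q j u = 0 -> q0 u = 0 -> q i u = 0.
  by move=> u1 u0; rewrite (inj u u1 u0); apply: tw0 (@pgsubT _ _ _ _ M) ti.
have [e z] := factor K t0 (tw_sub (fun _ _ => I) ti) (a0 i) (a0 i) w0K h0 hr.
have ni : q i w0 != 0.
  apply/eqP => z0; have kill u : True -> q j u = 0 -> q i u = 0 by move=> _ Ku; rewrite e // z0 mulr0.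
  have [f [zz|[ab]]] := factor (@pgsubT _ _ _ _ M) t1 ti (a0 j) (a0 i) (w := w1) I h1 kill.
    have [q0' _ [w hw]] := hq i; have /eqP := hw.
    by rewrite f // zz mulr0 eq_sym oner_eq0.
  by case/eqP: (an ij).
case: z ni => [->|[_ _ [d z]] ni]; first by rewrite eqxx.
have d0 : d != 0 by apply: contraNneq ni => d0; rewrite z d0 const0 mul0r.
split.
- by move=> u uj; rewrite e // z; exists (C d * q0 u); ring.
- have [[K00 Kl _ _] [ql _ _]] := (K, ti); have [qjl _ _] := t1.
  exists (C d^-1 *: w0 + 0); rewrite ql // qjl // w0K z.
  rewrite (tw0 (@pgsubT _ _ _ _ M) ti) (tw0 (@pgsubT _ _ _ _ M) t1) mulr0 !addr0; split=> //.
  by rewrite mulrA -constM mulVf // mul1r.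
move=> u uj ui; apply: inj => //.
by apply: (Ct_reg O d0 (n := n)); rewrite -z -e.
Qed.
End Rank2.
End HomAndRankTwo.

(** * Submodules of R^2 described by the class c12 *)

Section ImagePairs.
Variables (R : realType) (p : nat) (Qp : padicNumType R p) (E : ultraFieldExtType Qp).
Variable O : robba_ops E.
Local Notation rb := (robba E).
Local Notation C := (@robba_const R E).
Local Notation ph := (op_phi O).
Local Notation gm := (op_gamma O).
Local Notation t := (robba_t E).
Local Notation tm := (@tm R p Qp E).
Implicit Types (f g : rb) (x y : Qp).

Variables (l : Qp -> E) (a1 a2 : E) (M : nat).
Hypotheses (a10 : a1 != 0) (a20 : a2 != 0) (M0 : (0 < M)%N).
Variables (W12 : weight_class O l (a1 / a2) M) (W21 : weight_class O l (a2 / a1) M).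
Local Notation c12 := (wc W12).
Local Notation c21 := (wc W21).

Lemma inv_prod m b1 b2 f g : (0 < m)%N -> b1 != 0 -> b2 != 0 ->
  tm m (C (b1 / b2) * ph f - f) -> tm m (C (b2 / b1) * ph g - g) ->
  (forall x, Zp_unit x -> tm m (gm x f - f)) -> (forall x, Zp_unit x -> tm m (gm x g - g)) ->
  exists k, tm m (f * g - C k).
Proof.
move=> m0 b10 b20 pf pg gf gg; have [| |c [B cE]] := @inv_mod_t R p Qp E O m (f * g) m0.
- have e : C (b1 / b2) * C (b2 / b1) = 1 by rewrite -constM mulrA divfK // divff // const1.
  have -> : ph (f * g) - f * g = (C (b1 / b2) * ph f - f) * (C (b2 / b1) * ph g) + f * (C (b2 / b1) * ph g - g).
    rewrite [ph (f * g)]rmorphM -[X in X - f * g]mul1r -e.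
    by move: (ph f) (ph g) (C (b1 / b2)) (C (b2 / b1)) => a b c d; ring.
  exact: tmD (tmMr _ pf) (tmMl _ pg).
- move=> x xu; have -> : gm x (f * g) - f * g = (gm x f - f) * gm x g + f * (gm x g - g).
    by rewrite [gm x (f * g)]rmorphM; move: (gm x f) (gm x g) => a b; ring.
  exact: tmD (tmMr _ (gf x xu)) (tmMl _ (gg x xu)).
by exists c, B; rewrite cE addrC addKr.
Qed.

(** The product is invariant modulo t^M, hence constant there; modulo a cyclotomic factor it is a
    product of two nonzero constants. *)
Lemma wc_prod : exists2 k, k != 0 & tm M (c12 * c21 - C k).
Proof.
have [k hk] : exists k, tm M (c12 * c21 - C k).
  exact: inv_prod M0 a10 a20 (wc_ph W12) (wc_ph W21) (wc_gm W12) (wc_gm W21).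
have [B hB] := hk; have hp : plus (c12 * c21 - C k).
  by apply: plusB; [apply: plusM; apply: wc_plus|apply: plus_const].
have [N hN] := tau_of_t O hp hB; have hQ := dvp_Qtau (leqnn N) M0 (hN N (leqnn N)).
have [k1 k10 h1] := wc_const W12 N; have [k2 k20 h2] := wc_const W21 N.
exists k => //; apply/eqP => kz; rewrite kz const0 subr0 in hQ.
apply: (@QN_proper R p Qp E O N (k1 * k2)); first by rewrite mulf_neq0.
have -> : C (k1 * k2) = c12 * c21 - ((c12 - C k1) * c21 + C k1 * (c21 - C k2)).
  by rewrite constM; ring.
exact: dvpB hQ (dvpD (dvpMr h1 (wc_plus W21)) (dvpMl h2 (plus_const k1))).
Qed.

Lemma tm_cancel_wc m a : (0 < m <= M)%N -> tm m (C a * c12) -> a = 0.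
Proof.
move=> /andP[m0 mM] h; have [k k0 hk] := wc_prod.
suff : a * k = 0 by move/eqP; rewrite mulf_eq0 (negbTE k0) orbF => /eqP.
apply: (tm_C O m0); have -> : C (a * k) = C a * c12 * c21 - C a * (c12 * c21 - C k).
  by rewrite constM; ring.
exact: tmB (tmMr _ h) (tmMl _ (tm_le mM hk)).
Qed.

(* A submodule of R^2 projecting onto both factors is the preimage of the graph of an isomorphism
   of R/t^m; as such an isomorphism is unique up to scalars by [inv_mod_t], it is a multiple of c12. *)
Lemma image_pairs (I : rb -> rb -> Prop) b (k : int) m :
  (forall e f g f' g', I f g -> I f' g' -> I (e * f + f') (e * g + g')) ->
  (forall f g, I f g -> I (C (a1 * b) * ph f) (C (a2 * b) * ph g)) ->
  (forall x, Zp_unit x -> forall f g, I f g ->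
     I (C (x%:A ^ k) * gm x f) (C (x%:A ^ k) * gm x g)) ->
  b != 0 -> (exists f, I f 1) -> (exists g, I 1 g) -> (forall f, I f 0 <-> tm m f) ->
  (0 < m <= M)%N ->
  exists2 c, c != 0 & forall f g, I f g <-> tm m (f - C c * c12 * g).
Proof.
move=> Il Ip Ig b0 [s hs] [g1 hg1] I0 /andP[m0 mM].
have I00 : I 0 0 by apply/I0/tm0.
have IZ e f g : I f g -> I (e * f) (e * g).
  by move=> h; have := Il e f g 0 0 h I00; rewrite !addr0.
have IB f g f' : I f g -> I f' g -> tm m (f - f').
  by move=> h h'; apply/I0; have := Il (-1) f' g f g h' h; rewrite !mulN1r addNr addrC.
have ps : tm m (C (a1 / a2) * ph s - s).
  have e : a1 / a2 = (a2 * b)^-1 * (a1 * b) by rewrite [RHS]mulrC -mulf_div divff ?mulr1.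
  have := IZ (C (a2 * b)^-1) _ _ (Ip _ _ hs).
  rewrite rmorph1 mulr1 mulrA -!constM -e mulVf ?mulf_neq0 // const1 => h.
  exact: IB h hs.
have gs x : Zp_unit x -> tm m (gm x s - s).
  move=> xu; have x0 : (x%:A : E) ^ k != 0 by rewrite expfz_neq0 // alg_neq0.
  have := IZ (C ((x%:A ^ k)^-1)) _ _ (Ig x xu _ _ hs).
  rewrite rmorph1 mulr1 mulrA -!constM mulVf // const1 mul1r => h.
  exact: IB h hs.
have wp21 := tm_le mM (wc_ph W21); have wg21 x (xu : Zp_unit x) := tm_le mM (wc_gm W21 xu).
have [sg hsg] := inv_prod m0 a10 a20 ps wp21 gs wg21.
have [kp kp0 hkp] := wc_prod; have {}hkp := tm_le mM hkp.
have sE : tm m (s - C (sg / kp) * c12).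
  apply: (tm_Cl kp0); rewrite mulrBr mulrA -constM mulrCA divff // mulr1.
  have -> : C kp * s - C sg * c12 = (s * c21 - C sg) * c12 - s * (c12 * c21 - C kp) by ring.
  exact: tmB (tmMr _ hsg) (tmMl _ hkp).
exists (sg / kp); first apply/eqP => z.
  rewrite z const0 mul0r subr0 in sE; have h01 : I 0 1.
    by have := Il (-1) _ _ _ _ (proj2 (I0 s) sE) hs; rewrite !mulN1r addNr oppr0 add0r.
  have h10 : I 1 0 by have := Il (- g1) _ _ _ _ h01 hg1; rewrite mulr0 add0r mulr1 addNr.
  have : (1 : E) = 0 by apply: (tm_C O m0); rewrite const1; apply/I0.
  by move/eqP; rewrite oner_eq0.
move=> f g; have e : tm m (f - C (sg / kp) * c12 * g) <-> I (f - g * s) 0.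
  rewrite I0; have -> : f - C (sg / kp) * c12 * g = f - g * s + g * (s - C (sg / kp) * c12) by ring.
  split=> h; last exact: tmD h (tmMl _ sE).
  by have := tmB h (tmMl g sE); rewrite addrK.
rewrite e; split=> h.
  by have := Il (- g) _ _ _ _ hs h; rewrite mulr1 addNr mulNr addrC.
by have := Il g _ _ _ _ hs h; rewrite mulr1 addr0 addrC subrK.
Qed.

End ImagePairs.

(** * Coordinates adapted to D1, C1 and D *)

Section NormalForms.
Variables (R : realType) (p : nat) (Qp : padicNumType R p) (E : ultraFieldExtType Qp).
Variable O : robba_ops E.
Local Notation rb := (robba E).
Local Notation C := (@robba_const R E).
Local Notation ph := (op_phi O).
Local Notation gm := (op_gamma O).
Local Notation t := (robba_t E).
Local Notation tm := (@tm R p Qp E).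
Local Notation tw := (tw O).
Local Notation TT := (fun=> True).
Implicit Types (f g : rb) (x y : Qp).

Variables (l : Qp -> E) (a1 a2 a3 : E) (M : nat).
Hypotheses (a10 : a1 != 0) (a20 : a2 != 0) (a30 : a3 != 0).
Hypotheses (a12 : a1 != a2) (a13 : a1 != a3) (a23 : a2 != a3) (M0 : (0 < M)%N).
Variables (W12 : weight_class O l (a1 / a2) M) (W21 : weight_class O l (a2 / a1) M).
Local Notation c12 := (wc W12).

Lemma C_VK c f : c != 0 -> C c^-1 * (C c * f) = f.
Proof. by move=> c0; rewrite mulrA -constM mulVf // mul1r. Qed.
Lemma C_KV c f : c != 0 -> C c * (C c^-1 * f) = f.
Proof. by move=> c0; rewrite mulrA -constM mulfV // mul1r. Qed.

Lemma tw_C (D : pgmod E) K (q : D -> rb) a k c : tw K q a k -> tw K (fun u => C c * q u) a k.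
Proof.
move=> [ql qp qg]; split=> [e u v Ku Kv|u Ku|x xu u Ku].
- by rewrite ql //; ring.
- by rewrite qp // [ph (C c * _)]rmorphM [ph (C c)]ph_C; ring.
by rewrite qg // [gm x (C c * _)]rmorphM (gm_C O c xu); ring.
Qed.

Lemma tw_t (D : pgmod E) K (q : D -> rb) a k n :
  tw K q a (k + n%:Z) -> tw K (fun u => t ^+ n * q u) a k.
Proof.
have p0 := E_p_neq0 E; move=> [ql qp qg]; split=> [e u v Ku Kv|u Ku|x xu u Ku].
- by rewrite ql //; ring.
- have e : C (a * p%:R ^ (k + n%:Z)) = C (a * p%:R ^ k) * C (p%:R ^+ n).
    by rewrite expfzDr // mulrA constM.
  by rewrite qp // ph_tX e; ring.
have e : C (x%:A ^ (k + n%:Z)) = C (x%:A ^ k) * C (x%:A ^+ n).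
  by rewrite expfzDr ?alg_neq0 // constM.
by rewrite qg // gm_tX // e; ring.
Qed.

Lemma nf2_ex (N : pgmod E) (k0 k1 : int) : k1 < k0 -> (`|k0 - k1| <= M)%N ->
  (forall w : 'S_2, triangulated N
     (fun r => unr_z (tnth [tuple a1; a2] ((w^-1)%g r)) (tnth [tuple k0; k1] r))) ->
  exists q1 q2 : N -> rb, [/\ tw TT q1 a1 k1 /\ tw TT q2 a2 k1,
    forall f g, (exists u, q1 u = f /\ q2 u = g) <-> tm `|k0 - k1| (f - c12 * g),
    forall u, q1 u = 0 -> q2 u = 0 -> u = 0 &
    forall k (r : N -> rb), [/\ tw TT r a1 k -> exists c, forall u, r u = C c * (t ^+ `|k1 - k| * q1 u),
      tw TT r a2 k -> exists c, forall u, r u = C c * (t ^+ `|k1 - k| * q2 u) &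
      tw TT r a3 k -> forall u, r u = 0]].
Proof.
move=> kk kM tri; pose o0 : 'I_2 := @Ordinal 2 0 isT; pose o1 : 'I_2 := @Ordinal 2 1 isT.
have at0 r : tnth [tuple a1; a2] r != 0 by case: r => -[|[|//]] ?.
have atn r s : r != s -> tnth [tuple a1; a2] r != tnth [tuple a1; a2] s.
  have inj : injective (tnth [tuple a1; a2]).
    by apply/tuple_uniqP; rewrite /= inE a12.
  by apply: contra => /eqP/inj->.
have i0 : (inord 0 : 'I_2) = 0%N :> nat by rewrite inordK.
have i1 : (inord 1 : 'I_2) = 1%N :> nat by rewrite inordK.
have e0 : tnth [tuple k0; k1] (inord 0) = k0 by rewrite (tnth_nth k0) i0.
have e1 : tnth [tuple k0; k1] (inord 1) = k1 by rewrite (tnth_nth k0) i1.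
have [q [qt qo qc qh]] := coords2_ex O at0 atn tri; rewrite e0 e1 in qt qc qh.
have t1 : tw TT (q o0) a1 k1 by exact: qt o0.
have t2 : tw TT (q o1) a2 k1 by exact: qt o1.
have [ql1 qp1 qg1] := t1; have [ql2 qp2 qg2] := t2.
have [c01 [u01 [z01 v01]] inj] := qc o0 o1 isT.
have n0 : (0 < `|k0 - k1| <= M)%N by rewrite kM absz_gt0 subr_eq0 gt_eqF.
have p0 : (p%:R : E) ^ k1 != 0 by rewrite expfz_neq0 // E_p_neq0.
have [|f g [u [<- <-]]|x xu f g [u [<- <-]]|||f|c c0 hc] := @image_pairs R p Qp E O l a1 a2 M
  a10 a20 M0 W12 W21 (fun f g => exists u, q o0 u = f /\ q o1 u = g) (p%:R ^ k1) k1 _ _ _ _ p0 _ _ _ n0.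
- move=> e f g f' g' [u [<- <-]] [v [<- <-]]; exists (e *: u + v).
  by rewrite ql1 // ql2.
- by exists (pg_phi u); rewrite qp1 // qp2.
- by exists (pg_gamma x u); rewrite qg1 // qg2.
- by have [u hu] := qo o1; exists (q o0 u), u.
- by have [u hu] := qo o0; exists (q o1 u), u.
- split=> [[u [<- uz]]|[B ->]]; first exact: c01.
  have [K0 _ _ _] := @pgsubT _ _ _ _ N; exists (B *: u01 + 0).
  rewrite ql1 // ql2 // z01 v01 (tw0 (@pgsubT _ _ _ _ N) t1) (tw0 (@pgsubT _ _ _ _ N) t2).
  by rewrite mulr0 !addr0 mulrC.
exists (fun u => C c^-1 * q o0 u), (q o1); split=> //.
- by split=> //; apply: tw_C.
- move=> f g; have -> : (exists u, C c^-1 * q o0 u = f /\ q o1 u = g) <-> (exists u, q o0 u = C c * f /\ q o1 u = g).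
    by split=> -[u [hu hg]]; exists u; split=> //; [rewrite -hu C_KV|rewrite hu C_VK].
  rewrite hc; have -> : C c * f - C c * c12 * g = C c * (f - c12 * g) by ring.
  by split=> [|h]; [apply: tm_Cl|apply: tmMl].
- by move=> u u1 u2; apply: inj => //; rewrite -[q o0 u](C_KV _ c0) u1 mulr0.
have a21 : a2 != a1 by rewrite eq_sym.
move=> k r; split=> tr.
- have [e [re z]] := qh o1 o0 a1 k r isT a10 a21 tr.
  have [c' ee] : exists c', e = C c' * t ^+ `|k1 - k|.
    by case: z => [->|[_ _ //]]; exists 0; rewrite const0 mul0r.
  exists (c' * c) => u; rewrite re ee constM -{1}[q o0 u](C_KV _ c0).
  by move: (C c^-1 * _) => v; ring.
- have [e [re z]] := qh o0 o1 a2 k r isT a20 a12 tr.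
  have [c' ee] : exists c', e = C c' * t ^+ `|k1 - k|.
    by case: z => [->|[_ _ //]]; exists 0; rewrite const0 mul0r.
  by exists c' => u; rewrite re ee; ring.
move=> u; have [e [re [z|[ab]]]] := qh o1 o0 a3 k r isT a30 a23 tr; first by rewrite re z mulr0.
by case/eqP: a13.
Qed.

Variables (h1 h2 h3 : int).
Hypotheses (h12 : h2 < h1) (h23 : h3 < h2).
Local Notation m1 := `|h1 - h2|%N.
Local Notation m2 := `|h2 - h3|%N.
Local Notation m := `|h1 - h3|%N.
Hypothesis mM : (m <= M)%N.

Definition IC f g := tm m2 (f - c12 * g).
(** The coordinates of D1 naturally have weight h2; the factor t^m2 brings them to the weight h3
    used for C1 and D. *)
Definition ID f g := exists f' g', [/\ f = t ^+ m2 * f', g = t ^+ m2 * g' & tm m1 (f' - c12 * g')].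

Record nf2 (N : pgmod E) (I : rb -> rb -> Prop) (q1 q2 : N -> rb) : Prop := NF2 {
  nf2_t1 : tw TT q1 a1 h3; nf2_t2 : tw TT q2 a2 h3;
  nf2_im : forall f g, (exists u, q1 u = f /\ q2 u = g) <-> I f g;
  nf2_inj : forall u, q1 u = 0 -> q2 u = 0 -> u = 0 }.

(* [q1, q2] map D onto C1 up to the scalar [A], and identify the kernel of [q3] with D1; [A] turns
   out to be the only invariant of D. *)
Record nf3 (D : pgmod E) (A : E) (q1 q2 q3 : D -> rb) : Prop := NF3 {
  nf3_t1 : tw TT q1 a1 h3; nf3_t2 : tw TT q2 a2 h3; nf3_t3 : tw TT q3 a3 h3;
  nf3_im : forall f g, (exists u, q1 u = f /\ q2 u = g) <-> tm m2 (f - C A * c12 * g);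
  nf3_ker : forall f g, (exists u, [/\ q3 u = 0, q1 u = f & q2 u = g]) <-> ID f g;
  nf3_one : exists u, q3 u = 1;
  nf3_gen : exists u, [/\ q1 u = 0, q2 u = 0 & q3 u = t ^+ m];
  nf3_tm : forall u, q1 u = 0 -> q2 u = 0 -> tm m (q3 u);
  nf3_inj : forall u, q1 u = 0 -> q2 u = 0 -> q3 u = 0 -> u = 0;
  nf3_hom1 : forall r, tw TT r a1 h3 -> exists c, forall u, r u = C c * q1 u;
  nf3_hom2 : forall r, tw TT r a2 h3 -> exists c, forall u, r u = C c * q2 u }.

Lemma mE : m = (m1 + m2)%N. Proof. by clear -h12 h23; lia. Qed.
Lemma m10 : (0 < m1)%N. Proof. by clear -h12; lia. Qed.
Lemma m20 : (0 < m2)%N. Proof. by clear -h23; lia. Qed.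

Lemma nf2_C (N : pgmod E) : PhiGamma_nc [tuple a1; a2] [tuple h2; h3] N ->
  exists q1 q2, nf2 (N := N) IC q1 q2.
Proof.
move=> [_ _ _ _ tri]; have m2M : (m2 <= M)%N by rewrite (leq_trans _ mM) // mE leq_addl.
have [q1 [q2 [[t1 t2] im inj _]]] := nf2_ex h23 m2M tri.
by exists q1, q2; split.
Qed.

Lemma nf2_D (N : pgmod E) : PhiGamma_nc [tuple a1; a2] [tuple h1; h2] N ->
  exists q1 q2, nf2 (N := N) ID q1 q2 /\
    forall r, [/\ tw TT r a1 h3 -> exists c, forall u, r u = C c * q1 u,
      tw TT r a2 h3 -> exists c, forall u, r u = C c * q2 u &
      tw TT r a3 h3 -> forall u, r u = 0].
Proof.
move=> [_ _ _ _ tri]; have m1M : (m1 <= M)%N by rewrite (leq_trans _ mM) // mE leq_addr.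
have hE : h2 = h3 + m2%:Z by lia.
have [q1 [q2 [[t1 t2] im inj hom]]] := nf2_ex h12 m1M tri; rewrite {1 2}hE in t1 t2.
exists (fun u => t ^+ m2 * q1 u), (fun u => t ^+ m2 * q2 u); split; last by move=> r; apply: hom.
split; [exact: tw_t|exact: tw_t| |].
- move=> f g; split=> [[u [<- <-]]|[f' [g' [-> -> /im[u [<- <-]]]]]]; last by exists u.
  by exists (q1 u), (q2 u); split=> //; apply/im; exists u.
by move=> u u1 u2; apply: inj; apply: (t_regI O (m := m2)); rewrite mulr0.
Qed.

Lemma nf3_ex (D : pgmod E) : PhiGamma_nc [tuple a1; a2; a3] [tuple h1; h2; h3] D ->
  exists A q1 q2 q3, A != 0 /\ nf3 (D := D) A q1 q2 q3.
Proof.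
move=> [_ _ _ _ tri]; pose o0 : 'I_3 := @Ordinal 3 0 isT; pose o1 : 'I_3 := @Ordinal 3 1 isT; pose o2 : 'I_3 := @Ordinal 3 2 isT.
have at0 r : tnth [tuple a1; a2; a3] r != 0 by case: r => -[|[|[|//]]] ?.
have atn r s : r != s -> tnth [tuple a1; a2; a3] r != tnth [tuple a1; a2; a3] s.
  have inj : injective (tnth [tuple a1; a2; a3]).
    by apply/tuple_uniqP; rewrite /= !inE negb_or a12 a13 a23.
  by apply: contra => /eqP/inj->.
have i0 : (inord 0 : 'I_3) = 0%N :> nat by rewrite inordK.
have e0 : tnth [tuple h1; h2; h3] (inord 0) = h1 by rewrite (tnth_nth h1) i0.
have i1 : (inord 1 : 'I_3) = 1%N :> nat by rewrite inordK.
have e1 : tnth [tuple h1; h2; h3] (inord 1) = h2 by rewrite (tnth_nth h1) i1.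
have i2 : (inord 2 : 'I_3) = 2%N :> nat by rewrite inordK.
have e2 : tnth [tuple h1; h2; h3] (inord 2) = h3 by rewrite (tnth_nth h1) i2.
have [q hq] := coords3_ex O tri.
have qt r := (hq r).1; have qo r := (hq r).2; have sT := @pgsubT _ _ _ _ D.
have cp := coords_pair at0 atn tri qt qo; have ct := coords_tm at0 atn tri qt qo.
have cl := coords_line at0 atn tri qt qo.
have hm := hom3 at0 atn tri.
rewrite e2 in qt hm; rewrite e1 e2 in cp ct; rewrite e0 e2 in cl.
have t1 : tw TT (q o0) a1 h3 by exact: qt o0.
have t2 : tw TT (q o1) a2 h3 by exact: qt o1.
have t3 : tw TT (q o2) a3 h3 by exact: qt o2.
have [ql1 qp1 qg1] := t1; have [ql2 qp2 qg2] := t2; have [ql3 qp3 qg3] := t3.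
have z1 := tw0 sT t1; have z2 := tw0 sT t2; have z3 := tw0 sT t3.
have p0 := E_p_neq0 E; have ph0 : (p%:R : E) ^ h3 != 0 by rewrite expfz_neq0.
have ph2 : (p%:R : E) ^ h3 * p%:R ^+ m2 != 0 by rewrite mulf_neq0 // expf_neq0.
have m2M : (0 < m2 <= M)%N by rewrite m20 (leq_trans _ mM) // mE leq_addl.
have m1M : (0 < m1 <= M)%N by rewrite m10 (leq_trans _ mM) // mE leq_addr.
have [|f g [u [<- <-]]|x xu f g [u [<- <-]]|||f|cA cA0 hA] := @image_pairs R p Qp E O l a1 a2 M
  a10 a20 M0 W12 W21 (fun f g => exists u, q o0 u = f /\ q o1 u = g) (p%:R ^ h3) h3 _ _ _ _ ph0 _ _ _ m2M.
- move=> e f g f' g' [u [<- <-]] [v [<- <-]]; exists (e *: u + v).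
  by rewrite ql1 // ql2.
- by exists (pg_phi u); rewrite qp1 // qp2.
- by exists (pg_gamma x u); rewrite qg1 // qg2.
- by have [u hu] := qo o1; exists (q o0 u), u.
- by have [u hu] := qo o0; exists (q o1 u), u.
- split=> [[u [<- uz]]|[B ->]]; first exact: (ct o2 o0 o1).
  by have [u [u1 u0]] := cp o2 o0 o1 B isT; exists u.
have alg (x y z T : rb) : x * (T * (y * z)) = T * ((x * y) * z) by ring.
have eb b : C (b * (p%:R ^ h3 * p%:R ^+ m2)) = C (b * p%:R ^ h3) * C (p%:R ^+ m2).
  by rewrite mulrA constM.
pose J f g := exists u, [/\ q o2 u = 0, q o0 u = t ^+ m2 * f & q o1 u = t ^+ m2 * g].
have [|f g [u [u2 u0 u1]]|x xu f g [u [u2 u0 u1]]|||f|cB cB0 hB] := @image_pairs R p Qp E O l a1 a2 M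
  a10 a20 M0 W12 W21 J (p%:R ^ h3 * p%:R ^+ m2) (h3 + m2%:Z) _ _ _ _ ph2 _ _ _ m1M.
- move=> e f g f' g' [u [u2 u0 u1]] [v [v2 v0 v1]]; exists (e *: u + v).
  by rewrite ql1 // ql2 // ql3 // u2 u0 u1 v2 v0 v1; split; ring.
- exists (pg_phi u); rewrite qp1 // qp2 // qp3 // u2 u0 u1 rmorph0 mulr0 !ph_tX !eb.
  by split; [by []|exact: alg|exact: alg].
- exists (pg_gamma x u); rewrite qg1 // qg2 // qg3 // u2 u0 u1 rmorph0 mulr0 !gm_tX //.
  by rewrite expfzDr ?alg_neq0 // constM; split; [by []|exact: alg|exact: alg].
- have [u [u2 u1]] := cp o0 o1 o2 1 isT; have [f hf] := ct o1 o0 o2 u isT u2.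
  by exists f, u.
- have [u [u2 u1]] := cp o1 o0 o2 1 isT; have [f hf] := ct o0 o1 o2 u isT u2.
  by exists f, u.
- have [c1 [w [w2 w1 w0]] _] := cl o0 o1 o2 isT; split=> [[u [u2 u0 u1]]|[B ->]].
    rewrite mulr0 in u1; have [B] := c1 u u2 u1; rewrite u0 mE addnC exprD -mulrA.
    by move/(t_regI O) ->; exists B.
  exists (B *: w + 0); rewrite ql1 // ql2 // ql3 // w2 w1 w0 z1 z2 z3 !mulr0 !addr0.
  by split=> //; rewrite mE exprD; ring.
(* cA is the scalar of the image of (q1, q2) and cB that of the kernel of q3; dividing q1 by cB
   normalizes the latter and leaves the quotient as invariant. *)
exists (cA / cB), (fun u => C cB^-1 * q o0 u), (q o1), (q o2).
split; first by rewrite mulf_neq0 ?invr_eq0.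
have r1 f g u : C cB^-1 * q o0 u = f /\ q o1 u = g <-> q o0 u = C cB * f /\ q o1 u = g.
  by split=> -[hu hg]; split=> //; [rewrite -hu C_KV|rewrite hu C_VK].
split=> //.
- exact: tw_C.
- move=> f g; have -> : (exists u, C cB^-1 * q o0 u = f /\ q o1 u = g) <-> (exists u, q o0 u = C cB * f /\ q o1 u = g).
    by split=> -[u /r1 hu]; exists u.
  rewrite hA; have -> : C cB * f - C cA * c12 * g = C cB * (f - C (cA / cB) * c12 * g).
    have -> : C cA = C cB * C (cA / cB) by rewrite -constM mulrC divfK.
    by move: (C (cA / cB)) => c; ring.
  by split=> [|hh]; [apply: tm_Cl|apply: tmMl].
- move=> f g; have kB f' g' : J (C cB * f') g' <-> tm m1 (f' - c12 * g').
    rewrite hB; have -> : C cB * f' - C cB * c12 * g' = C cB * (f' - c12 * g') by ring.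
    by split=> [|hh]; [apply: tm_Cl|apply: tmMl].
  split=> [[u [u2 u0 u1]]|[f' [g' [-> -> /kB[u [u2 u0 u1]]]]]].
    have [f' hf] := ct o1 o0 o2 u isT u2; have [g' hg] := ct o0 o1 o2 u isT u2.
    exists (C cB^-1 * f'), g'; split; [by rewrite -u0 hf mulrCA|by rewrite -u1|].
    by apply/kB; exists u; rewrite C_KV.
  by exists u; split=> //; rewrite u0 mulrCA C_VK.
- have [c1 [w [w2 w1 w0]] _] := cl o2 o0 o1 isT; exists w; split=> //.
  by rewrite w1 mulr0.
- move=> u u0 u1; have [c1 _ _] := cl o2 o0 o1 isT; apply: c1 => //.
  by rewrite -[q o0 u](C_KV _ cB0) u0 mulr0.
- move=> u u0 u1 u2; have [_ _ inj] := cl o2 o0 o1 isT; apply: inj => //.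
  by rewrite -[q o0 u](C_KV _ cB0) u0 mulr0.
- move=> r tr; have [c hc] := hm O o2 o1 o0 (q o0) r isT t1 tr (qo o0).
  by exists (c * cB) => u; rewrite hc constM -mulrA C_KV.
by move=> r tr; apply: (hm O o2 o0 o1 (q o1) r isT t2 tr (qo o1)).
Qed.

End NormalForms.

(** * Modules with the same invariant are isomorphic *)

Section Isomorphism.
Variables (R : realType) (p : nat) (Qp : padicNumType R p) (E : ultraFieldExtType Qp).
Variable O : robba_ops E.
Local Notation rb := (robba E).
Local Notation C := (@robba_const R E).
Local Notation ph := (op_phi O).
Local Notation gm := (op_gamma O).
Local Notation t := (robba_t E).
Local Notation tm := (@tm R p Qp E).
Local Notation tw := (tw O).
Local Notation TT := (fun=> True).
Implicit Types (f g : rb) (x y : Qp).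

Lemma coord_inj (N : lmodType rb) (K : Type) (r : K -> N -> rb) :
  (forall i (e : rb) u v, r i (e *: u + v) = e * r i u + r i v) ->
  (forall v, (forall i, r i v = 0) -> v = 0) -> forall u v, (forall i, r i u = r i v) -> u = v.
Proof.
move=> rl inj u v e; apply/eqP; rewrite -subr_eq0; apply/eqP; apply: inj => i.
by rewrite addrC -scaleN1r rl e mulN1r addNr.
Qed.

(** As the coordinates are jointly injective, any choice of preimages is automatically linear. *)
Lemma coord_lin (L N : lmodType rb) (K : Type) (r : K -> N -> rb) (s : K -> L -> rb) :
  (forall i (e : rb) u v, r i (e *: u + v) = e * r i u + r i v) ->
  (forall i (e : rb) u v, s i (e *: u + v) = e * s i u + s i v) ->
  (forall v, (forall i, r i v = 0) -> v = 0) ->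
  (forall u, exists v, forall i, r i v = s i u) ->
  exists F, linf F /\ forall u i, r i (F u) = s i u.
Proof.
move=> rl sl inj /choice[F hF]; exists F; split=> // e u v.
by apply: (coord_inj rl inj) => i; rewrite rl !hF sl.
Qed.

Lemma coord_pgmap (L N : pgmod E) (K : Type) (al : K -> E) k (r : K -> N -> rb) (s : K -> L -> rb) :
  (forall i, tw TT (r i) (al i) k) -> (forall i, tw TT (s i) (al i) k) ->
  (forall v, (forall i, r i v = 0) -> v = 0) ->
  (forall u, exists v, forall i, r i v = s i u) ->
  exists F, is_pgmap F /\ forall u i, r i (F u) = s i u.
Proof.
move=> rt st inj ex; have rl i (e : rb) u v : r i (e *: u + v) = e * r i u + r i v.
  by have [l _ _] := rt i; apply: l.
have sl i (e : rb) u v : s i (e *: u + v) = e * s i u + s i v.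
  by have [l _ _] := st i; apply: l.
have [F [Fl FE]] := coord_lin rl sl inj ex; exists F; split=> //; split=> //.
  move=> u; apply: (coord_inj rl inj) => i; have [_ rp _] := rt i; have [_ sp _] := st i.
  by rewrite FE rp // sp // FE.
move=> x xu u; apply: (coord_inj rl inj) => i; have [_ _ rg] := rt i; have [_ _ sg] := st i.
by rewrite FE rg // sg // FE.
Qed.

Variables (l : Qp -> E) (a1 a2 a3 : E) (M : nat).
Hypothesis a30 : a3 != 0.
Variable W12 : weight_class O l (a1 / a2) M.
Variables (h1 h2 h3 : int).
Hypotheses (h12 : h2 < h1) (h23 : h3 < h2).
Local Notation m := `|h1 - h3|%N.
Local Notation nf3 := (nf3 a3 W12 h1 h2 h3).

Section Correspondence.
Variables (D D' : pgmod E) (A : E) (q1 q2 q3 : D -> rb) (q1' q2' q3' : D' -> rb).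
Hypotheses (nD : nf3 A q1 q2 q3) (nD' : nf3 A q1' q2' q3').

Lemma corr_ker u u' : q1 u = q1' u' -> q2 u = q2' u' -> q3' u' = 0 -> tm m (q3 u).
Proof.
move=> e1 e2 z; have /(nf3_ker nD)[k [k3 k1 k2]] : ID W12 h1 h2 h3 (q1 u) (q2 u).
  by apply/(nf3_ker nD'); exists u'.
have [l1 _ _] := nf3_t1 nD; have [l2 _ _] := nf3_t2 nD; have [l3 _ _] := nf3_t3 nD.
have := @nf3_tm _ _ _ _ _ _ _ _ _ _ _ _ _ _ _ _ _ _ _ nD ((-1) *: k + u).
by rewrite l1 // l2 // l3 // k1 k2 k3 mulr0 add0r !mulN1r !addNr; apply.
Qed.

Lemma corr_ex u' : exists u, q1 u = q1' u' /\ q2 u = q2' u'.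
Proof. by apply/(nf3_im nD)/(nf3_im nD'); exists u'. Qed.

(* D is the set of pairs (z, h) such that z - h z0 lies in D1, for a lift z0 of 1; the condition
   determines h modulo t^m, so two such modules with the same A differ by a scalar modulo t^m. *)
Lemma corr_scale w u0' : q3' u0' = 1 -> q1 w = q1' u0' -> q2 w = q2' u0' ->
  forall u u', q1 u = q1' u' -> q2 u = q2' u' -> tm m (q3 u - q3' u' * q3 w).
Proof.
move=> z e1 e2 u u' f1 f2.
have [l1 _ _] := nf3_t1 nD; have [l2 _ _] := nf3_t2 nD; have [l3 _ _] := nf3_t3 nD.
have [l1' _ _] := nf3_t1 nD'; have [l2' _ _] := nf3_t2 nD'; have [l3' _ _] := nf3_t3 nD'.
have := @corr_ker (- q3' u' *: w + u) (- q3' u' *: u0' + u').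
rewrite l1 // l2 // l3 // l1' // l2' // l3' // e1 e2 f1 f2 z mulr1 addNr => /(_ erefl erefl erefl) h.
by have -> : q3 u - q3' u' * q3 w = - q3' u' * q3 w + q3 u by ring.
Qed.
End Correspondence.

(** The third coordinate needs to be right only modulo t^m: the element of [nf3_gen] changes it by
    multiples of t^m without touching the other two. *)
Lemma lift_coords (D D' : pgmod E) A A' (q1 q2 q3 : D -> rb) (q1' q2' q3' : D' -> rb) c :
  nf3 A q1 q2 q3 -> nf3 A' q1' q2' q3' ->
  (forall u, exists u', [/\ q1' u' = q1 u, q2' u' = q2 u & tm m (q3' u' - C c * q3 u)]) ->
  exists F : D -> D', [/\ is_pgmap F, forall u, q1' (F u) = q1 u, forall u, q2' (F u) = q2 u &
    forall u, q3' (F u) = C c * q3 u].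
Proof.
move=> nD nD' ex; pose al i := if i is Some b then if b then a1 else a2 else a3.
pose r i := if i is Some b then if b then q1' else q2' else q3'.
pose s i := if i is Some b then if b then q1 else q2 else (fun u => C c * q3 u).
have [l1' _ _] := nf3_t1 nD'; have [l2' _ _] := nf3_t2 nD'; have [l3' _ _] := nf3_t3 nD'.
have [|||u|F [Fp FE]] := @coord_pgmap D D' (option bool) al h3 r s.
- by case=> [[]|]; [apply: nf3_t1 nD'|apply: nf3_t2 nD'|apply: nf3_t3 nD'].
- by case=> [[]|]; [apply: nf3_t1 nD|apply: nf3_t2 nD|apply: tw_C (nf3_t3 nD)].
- by move=> v h; apply: (nf3_inj nD' (h (Some true)) (h (Some false)) (h None)).
- have [u' [e1 e2 [B hB]]] := ex u; have [s0 [s1 s2 s3]] := nf3_gen nD'.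
  exists (- B *: s0 + u') => -[[]|] /=; first by rewrite l1' // s1 mulr0 add0r.
    by rewrite l2' // s2 mulr0 add0r.
  by rewrite l3' // s3 mulNr mulrC -hB; ring.
by exists F; split=> // u; [apply: (FE u (Some true))|apply: (FE u (Some false))|apply: (FE u None)].
Qed.

(** An element w matching the first two coordinates of u0' has third coordinate invariant modulo
    t^m, so a constant c by [inv_mod_t]; c = 0 would put 1 into t^m R. Scaling the third coordinate
    by c^-1 and by c gives inverse maps. *)
Lemma nf3_iso (D D' : pgmod E) A (q1 q2 q3 : D -> rb) (q1' q2' q3' : D' -> rb) :
  nf3 A q1 q2 q3 -> nf3 A q1' q2' q3' -> pg_iso D D'.
Proof.
move=> nD nD'; have [u0' z'] := nf3_one nD'; have [w [e1 e2]] := corr_ex nD nD' u0'.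
have sc := corr_scale nD nD' z' e1 e2.
have [_ p1 g1] := nf3_t1 nD; have [_ p2 g2] := nf3_t2 nD; have [_ p3 g3] := nf3_t3 nD.
have [_ p1' g1'] := nf3_t1 nD'; have [_ p2' g2'] := nf3_t2 nD'; have [_ p3' g3'] := nf3_t3 nD'.
have m0 : (0 < m)%N by lia.
have b0 : a3 * p%:R ^ h3 != 0 by rewrite mulf_neq0 // expfz_neq0 // E_p_neq0.
have [||c [B rE]] := @inv_mod_t R p Qp E O m (q3 w) m0.
- apply: (tm_Cl b0); have := sc (pg_phi w) (pg_phi u0').
  rewrite p1 // p2 // p3 // p1' // p2' // p3' // e1 e2 z' rmorph1 mulr1 => /(_ erefl erefl).
  by rewrite mulrBr.
- move=> x xu; have x0 : (x%:A : E) ^ h3 != 0 by rewrite expfz_neq0 // alg_neq0.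
  apply: (tm_Cl x0); have := sc (pg_gamma x w) (pg_gamma x u0').
  rewrite g1 // g2 // g3 // g1' // g2' // g3' // e1 e2 z' rmorph1 mulr1 => /(_ erefl erefl).
  by rewrite mulrBr.
have {}sc u u' : q1 u = q1' u' -> q2 u = q2' u' -> tm m (q3 u - C c * q3' u').
  move=> f1 f2; have -> : q3 u - C c * q3' u' = (q3 u - q3' u' * q3 w) + t ^+ m * (B * q3' u').
    by rewrite rE; ring.
  by apply: tmD (sc _ _ f1 f2) _; eexists.
have c0 : c != 0.
  apply/eqP => c0; have [u0 z] := nf3_one nD; have [w' [f1 f2]] := corr_ex nD' nD u0.
  have := sc u0 w' (esym f1) (esym f2); rewrite c0 z const0 mul0r subr0 -const1.
  by move/(tm_C O m0)/eqP; rewrite oner_eq0.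
have [u|F [Fp F1 F2 F3]] := lift_coords (c := c^-1) nD nD'.
  have [u' [f1 f2]] := corr_ex nD' nD u; exists u'; split=> //.
  have -> : q3' u' - C c^-1 * q3 u = - (C c^-1 * (q3 u - C c * q3' u')).
    by rewrite mulrBr (C_VK _ c0) opprB.
  by apply: tmN; apply: tmMl; apply: sc.
have [u'|G [Gp G1 G2 G3]] := lift_coords (c := c) nD' nD.
  by have [u [f1 f2]] := corr_ex nD nD' u'; exists u; split=> //; apply: sc.
exists F => //; exists G => u.
  apply: (@coord_inj D (option bool) (fun i => if i is Some b then if b then q1 else q2 else q3)).
  - by move=> i e v v'; case: i => [[]|]; [have [h _ _] := nf3_t1 nD|have [h _ _] := nf3_t2 nD|have [h _ _] := nf3_t3 nD]; apply: h.
  - by move=> v h; apply: (nf3_inj nD (h (Some true)) (h (Some false)) (h None)).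
  by case=> [[]|]; rewrite ?G1 ?F1 ?G2 ?F2 ?G3 ?F3 ?C_KV.
apply: (@coord_inj D' (option bool) (fun i => if i is Some b then if b then q1' else q2' else q3')).
- by move=> i e v v'; case: i => [[]|]; [have [h _ _] := nf3_t1 nD'|have [h _ _] := nf3_t2 nD'|have [h _ _] := nf3_t3 nD']; apply: h.
- by move=> v h; apply: (nf3_inj nD' (h (Some true)) (h (Some false)) (h None)).
by case=> [[]|]; rewrite ?F1 ?G1 ?F2 ?G2 ?F3 ?G3 ?C_VK.
Qed.

End Isomorphism.

(** * Elements of the kernel *)

Section DualSequences.
Variables (R : realType) (p : nat) (Qp : padicNumType R p) (E : ultraFieldExtType Qp).
Variable O : robba_ops E.
Local Notation Ee := (dual E : ultraAlgType Qp).
Local Notation rb := (robba E).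
Local Notation rbe := (robba Ee).
Local Notation C := (@robba_const R E).
Local Notation ph := (op_phi O).
Local Notation gm := (op_gamma O).
Local Notation t := (robba_t E).
Local Notation tm := (@tm R p Qp E).
Local Notation tw := (tw O).
Local Notation TT := (fun=> True).
Local Notation Eps := (robba_const (eps : Ee)).

(** The analogue of [cocycle] for maps between two modules, so that a single object yields cocycles
    on either of them and on D by composition, see [coc_comp]. *)
Record bicocycle (L N : pgmod E) (np : L -> N) (ng : Qp -> L -> N) : Prop := Bicocycle {
  bic_lin : linf np;
  bic_M : forall x y, Zp_unit x -> Zp_unit y -> forall u,
    ng (x * y) (pg_gamma x (pg_gamma y u)) =
    ng x (pg_gamma x (pg_gamma y u)) + pg_gamma x (ng y (pg_gamma y u));
  bic_P : forall x, Zp_unit x -> forall u,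
    np (pg_phi (pg_gamma x u)) + pg_phi (ng x (pg_gamma x u)) =
    ng x (pg_gamma x (pg_phi u)) + pg_gamma x (np (pg_phi u));
  bic_cvg : exists (r : nat) (f : 'I_r -> Qp -> rb) (T : 'I_r -> L -> N),
    [/\ forall i, linf (T i), forall i x, Zp_unit x -> robba_cvg (f i) x (f i x) &
        forall x, Zp_unit x -> forall u, ng x u = \sum_i f i x *: T i u] }.

Lemma coc_comp (L N M : pgmod E) (np : L -> N) (ng : Qp -> L -> N) (al : M -> L) (be : N -> M) :
  bicocycle np ng -> is_pgmap al -> is_pgmap be ->
  cocycle (fun u => be (np (al u))) (fun x u => be (ng x (al u))).
Proof.
move=> [nl nM nP [r [f [T [Tl fc nE]]]]] [al1 alp alg] [bl bp bg]; split.
- by move=> a u v; rewrite al1 nl bl.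
- move=> x y xu yu u; rewrite -bg // -(linfD bl) !alg // -nM //; do !congr (_ _).
- by move=> x xu u; rewrite -bp -bg // -!(linfD bl) !(alp, alg x xu) nP.
exists r, f, (fun i u => be (T i (al u))); split=> //.
  by move=> i a u v; rewrite al1 Tl bl.
move=> x xu u; rewrite nE // (linf_sum bl); apply: eq_bigr => i _.
by rewrite (linfZ bl).
Qed.

Lemma coc_zero (M : pgmod E) : (pg_phi 0 = 0 :> M) ->
  (forall x, Zp_unit x -> pg_gamma x 0 = 0 :> M) ->
  cocycle (M := M) (fun=> 0) (fun _ _ => 0).
Proof.
move=> p0 g0; split.
- by move=> a u v; rewrite scaler0 addr0.
- by move=> x y xu yu u; rewrite g0 // addr0.
- by move=> x xu u; rewrite p0 g0.
exists 0%N, (fun _ _ => 0), (fun _ _ => 0); split=> [i|i|x xu u].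
- by case: i.
- by case: i.
by rewrite big_ord0.
Qed.

Lemma pgmap_opp (N M : pgmod E) n (F : N -> M) : is_phiGamma M n -> is_pgmap F ->
  is_pgmap (fun u => - F u).
Proof.
move=> [phl gml _ _ _] [Fl Fp Fg]; split.
- by move=> a u v; rewrite Fl opprD scalerN.
- have p0 : pg_phi 0 = 0 :> M.
    by have := phl (-1) 0 0; rewrite -(op_phiE O) rmorphN rmorph1 !scaleN1r !addNr.
  by move=> u; have := phl (-1) (F u) 0; rewrite -(op_phiE O) rmorphN rmorph1 !scaleN1r !addr0 p0 addr0 Fp.
move=> x xu u; have g0 : pg_gamma x 0 = 0 :> M.
  by have := gml x xu (-1) 0 0; rewrite -(op_gammaE O xu) rmorphN rmorph1 !scaleN1r !addNr.
have := gml x xu (-1) (F u) 0.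
by rewrite -(op_gammaE O xu) rmorphN rmorph1 !scaleN1r !addr0 g0 addr0 Fg.
Qed.

Definition dpair (L N : lmodType rb) (F : L -> N) (u : dmodT L) : dmodT N := (F u.1, F u.2).

Section Exact.
Variables (L N : pgmod E) (F : L -> N) (Np : L -> L) (Ng : Qp -> L -> L).
Variables (Np' : N -> N) (Ng' : Qp -> N -> N).
Hypotheses (FP : is_pgmap F) (cp : forall u, F (Np u) = Np' (F u)).
Hypothesis cg : forall x u, Zp_unit x -> F (Ng x u) = Ng' x (F u).

Lemma dpair_pgmap : is_pgmap (M := dmod Np Ng) (N := dmod Np' Ng') (dpair F).
Proof.
have [Fl Fp Fg] := FP; split=> [a u v|u|x xu u].
- by rewrite /dpair !dscaleE /= !(linfD Fl) !(linfZ Fl).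
- by rewrite /dpair /= (linfD Fl) cp !Fp.
by rewrite /dpair /= (linfD Fl) cg // !Fg.
Qed.
End Exact.

Lemma dpair_exact (L N K : pgmod E) (i : L -> N) (q : N -> K) NpL NgL NpN NgN NpK NgK :
  short_exact i q ->
  (forall u, i (NpL u) = NpN (i u)) -> (forall x u, Zp_unit x -> i (NgL x u) = NgN x (i u)) ->
  (forall u, q (NpN u) = NpK (q u)) -> (forall x u, Zp_unit x -> q (NgN x u) = NgK x (q u)) ->
  short_exact (L := dmod NpL NgL) (M := dmod NpN NgN) (N := dmod NpK NgK) (dpair i) (dpair q).
Proof.
move=> [ip qp ii ex on] i1 i2 q1 q2; have [il _ _] := ip; have [ql _ _] := qp.
split; [exact: dpair_pgmap|exact: dpair_pgmap| | |].
- by move=> [u v] [u' v'] [/ii-> /ii->].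
- move=> [u v]; split=> [[/ex[u' ->] /ex[v' ->]]|[[u' v'] [-> ->]]]; first by exists (u', v').
  have q0 w : q (i w) = 0 by apply/ex; exists w.
  by rewrite /dpair /= !q0.
by move=> [u v]; have [u' <-] := on u; have [v' <-] := on v; exists (u', v').
Qed.

Section RankOne.
Variables (a : E) (k : int).
Local Notation ch := (pg_char (unr_z a k : Qp -> E)).
Local Notation cht := (pg_char (const_char (unr_z a k) : Qp -> Ee)).
Local Notation dch := (dmod (M := ch) (fun=> 0) (fun _ _ => 0)).

Lemma mk_scale (b : E) (f g : rb) : robba_const ((b, b * 0) : Ee) * mk f g = mk (C b * f) (C b * g).
Proof. by rewrite mulr0 -mk_const mkM const0 mul0r addr0. Qed.

Lemma char_join : is_pgmap (M := dch) (N := cht) (fun u => mk (u.1 : rb) u.2).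
Proof.
split=> [b [u v] [u' v']|[u v]|x xu [u v]] /=.
- transitivity (b * mk (u : rb) v + mk (u' : rb) v'); last by [].
  by rewrite [in RHS](mk_red_im b) mkM mkD.
- by rewrite addr0 (phi_mk O) mk_scale.
by rewrite addr0 (gamma_mk O) // mk_scale.
Qed.

Lemma char_split : is_pgmap (M := cht) (N := dch) (fun f => (robba_red f, im f)).
Proof.
split=> [b u v|u|x xu u].
- apply: (congr2 pair).
    by transitivity (robba_red (b * u + v)); rewrite ?redD ?redM.
  transitivity (im (b * u + v)); first by [].
  by rewrite imD imM.
- have e : robba_const (const_char (unr_z a k) p%:R) * robba_phi u =
      mk (C (unr_z a k p%:R) * robba_phi (robba_red u)) (C (unr_z a k p%:R) * robba_phi (im u)).
    by rewrite [in LHS](mk_red_im u) (phi_mk O) mk_scale.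
  by rewrite /= e red_mk im_mk addr0.
have e : robba_const (const_char (unr_z a k) x) * robba_gamma x u =
    mk (C (unr_z a k x) * robba_gamma x (robba_red u)) (C (unr_z a k x) * robba_gamma x (im u)).
  by rewrite [in LHS](mk_red_im u) (gamma_mk O) // mk_scale.
by rewrite /= e red_mk im_mk addr0.
Qed.
End RankOne.

Lemma comp_pgmap (A : ultraAlgType Qp) (L N K : pgmod A) (F : L -> N) (G : N -> K) :
  is_pgmap F -> is_pgmap G -> is_pgmap (fun u => G (F u)).
Proof.
move=> [Fl Fp Fg] [Gl Gp Gg]; split=> [a u v|u|x xu u]; first by rewrite Fl Gl.
  by rewrite Fp Gp.
by rewrite Fg // Gg.
Qed.

Lemma exact_right (A : ultraAlgType Qp) (L N K K' : pgmod A) (i : L -> N) (q : N -> K) (J : K -> K') :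
  short_exact i q -> is_pgmap J -> (forall w, J w = 0 <-> w = 0) -> (forall w, exists v, J v = w) ->
  short_exact i (fun u => J (q u)).
Proof.
move=> [ip qp ii ex on] Jp J0 Jo; split=> //; first exact: comp_pgmap.
- by move=> v; rewrite J0.
by move=> w; have [v <-] := Jo w; have [u <-] := on v; exists u.
Qed.

Lemma exact_left (A : ultraAlgType Qp) (L' L N K : pgmod A) (J : L' -> L) (i : L -> N) (q : N -> K) :
  short_exact i q -> is_pgmap J -> injective J -> (forall w, exists v, J v = w) ->
  short_exact (fun u => i (J u)) q.
Proof.
move=> [ip qp ii ex on] Jp J0 Jo; split=> //; first exact: comp_pgmap.
- by move=> u v /ii/J0.
move=> v; rewrite ex; split=> -[u ->]; last by exists (J u).
by have [w <-] := Jo u; exists w.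
Qed.

Lemma compat_right (L N : pgmod E) a k (i : L -> N) (q : N -> pg_char (unr_z a k)) NpL NgL NpN NgN :
  short_exact i q ->
  (forall u, i (NpL u) = NpN (i u)) -> (forall x u, Zp_unit x -> i (NgL x u) = NgN x (i u)) ->
  (forall u, q (NpN u) = 0) -> (forall x u, Zp_unit x -> q (NgN x u) = 0) ->
  compatible_exact (N := pg_char (unr_z a k)) (Lt := dmod NpL NgL) (Mt := dmod NpN NgN)
    (Nt := pg_char (const_char (unr_z a k)))
    (fun u : dmodT L => u.1) (fun u : dmodT N => u.1) (@robba_red R p Qp E).
Proof.
move=> ex h1 h2 h3 h4; exists i, q, (dpair i), (fun u => mk ((dpair q u).1 : rb) (dpair q u).2).
split=> //; last by move=> v; rewrite red_mk.
apply: exact_right (dpair_exact ex h1 h2 h3 h4) (char_join a k) _ _.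
  move=> [u v]; split=> [|[-> ->]]; last by exact: mk00.
  by rewrite /= -(mk00 E) => /mk_inj[-> ->].
by move=> w; exists ((robba_red w, im w) : dmodT (pg_char (unr_z a k))); rewrite /= -mk_red_im.
Qed.

Lemma compat_left (N K : pgmod E) a k (i : pg_char (unr_z a k) -> N) (q : N -> K) NpN NgN NpK NgK :
  short_exact i q ->
  (forall u, NpN (i u) = 0) -> (forall x u, Zp_unit x -> NgN x (i u) = 0) ->
  (forall u, q (NpN u) = NpK (q u)) -> (forall x u, Zp_unit x -> q (NgN x u) = NgK x (q u)) ->
  compatible_exact (L := pg_char (unr_z a k)) (Lt := pg_char (const_char (unr_z a k))) (Mt := dmod NpN NgN) (Nt := dmod NpK NgK)
    (@robba_red R p Qp E) (fun u : dmodT N => u.1) (fun u : dmodT K => u.1).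
Proof.
move=> ex h1 h2 h3 h4; have [[il _ _] _ _ _ _] := ex; have i0 := linf0 il.
exists i, q, (fun f => dpair i ((robba_red f, im f) : dmodT (pg_char (unr_z a k)))), (dpair q).
split=> //; apply: exact_left (char_split a k) _ _.
- by apply: dpair_exact h3 h4 => // *; rewrite i0 ?h1 ?h2.
- by move=> u v [eu ev]; rewrite (mk_red_im u) (mk_red_im v) eu ev.
by move=> [u v]; exists (mk (u : rb) v); rewrite red_mk im_mk.
Qed.

End DualSequences.

Section TheCocycle.
Variables (R : realType) (p : nat) (Qp : padicNumType R p) (E : ultraFieldExtType Qp).
Variable O : robba_ops E.
Local Notation Ee := (dual E : ultraAlgType Qp).
Local Notation rb := (robba E).
Local Notation rbe := (robba Ee).
Local Notation C := (@robba_const R E).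
Local Notation ph := (op_phi O).
Local Notation gm := (op_gamma O).
Local Notation t := (robba_t E).
Local Notation tm := (@tm R p Qp E).
Local Notation tw := (tw O).
Local Notation TT := (fun=> True).
Local Notation Eps := (robba_const (eps : Ee)).
Variables (l : Qp -> E) (a1 a2 : E) (M : nat).
Hypotheses (a10 : a1 != 0) (a20 : a2 != 0).
Hypothesis lM : forall x y, Zp_unit x -> Zp_unit y -> l (x * y) = l x + l y.
Hypothesis lc : forall x, Zp_unit x -> robba_cvg (fun y => C (l y)) x (C (l x)).
Variables (W12 : weight_class O l (a1 / a2) M) (W21 : weight_class O l (a2 / a1) M).
Local Notation c12 := (wc W12).
Local Notation c21 := (wc W21).
Variables (h1 h2 h3 : int).
Hypotheses (h12 : h2 < h1) (h23 : h3 < h2).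
Hypothesis mM : (`|h1 - h3| <= M)%N.
Local Notation m1 := `|h1 - h2|%N.
Local Notation m2 := `|h2 - h3|%N.
Local Notation ID := (ID W12 h1 h2 h3).
Local Notation IC := (IC W12 h2 h3).
Variables (D1 C1 : pgmod E) (P1 P2 : C1 -> rb) (R1 R2 : D1 -> rb) (n : nat).
Hypotheses (nC : nf2 O a1 a2 h3 IC P1 P2) (nD : nf2 O a1 a2 h3 ID R1 R2).
Hypothesis C1P : is_phiGamma C1 n.
Variable kap : E.
Hypothesis hkap : tm M (c12 * c21 - C kap).

Lemma ID_big f g : ID (t ^+ M * f) (t ^+ M * g).
Proof.
have ME : M = (m2 + (M - m2))%N by rewrite subnKC // (leq_trans _ mM) // (mE h12 h23) leq_addl.
have [d dE] : exists d, (M - m2 = m1 + d)%N.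
  by exists (M - m2 - m1)%N; have := mM; rewrite (mE h12 h23); lia.
have tE : t ^+ M = t ^+ m2 * (t ^+ m1 * t ^+ d) :> rb by rewrite {1}ME dE !exprD.
exists (t ^+ m1 * t ^+ d * f), (t ^+ m1 * t ^+ d * g); rewrite tE; split; [by rewrite -mulrA|by rewrite -mulrA|].
by exists (t ^+ d * f - c12 * (t ^+ d * g)); ring.
Qed.

Lemma ID_D f g f' g' : ID f g -> ID f' g' -> ID (f + f') (g + g').
Proof.
move=> [x [y [-> -> h]]] [x' [y' [-> -> h']]]; exists (x + x'), (y + y').
split; rewrite ?mulrDr //; have -> : x + x' - (c12 * y + c12 * y') = (x - c12 * y) + (x' - c12 * y') by ring.
exact: tmD.
Qed.

(** This matrix is the coefficient of l(x) in the cocycle. On C1 its first row is kap times f - c12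
    g, and modulo t^M its second row is c21 times f - c12 g, because c12 c21 is kap there. *)
Lemma ID_theta f g : IC f g -> ID (C kap * (f - c12 * g)) (c21 * f - C kap * g).
Proof.
move=> [B hB]; have [K hK] := hkap.
have -> : C kap * (f - c12 * g) = C kap * (t ^+ m2 * B) + t ^+ M * 0 by rewrite hB; ring.
have -> : c21 * f - C kap * g = c21 * (t ^+ m2 * B) + t ^+ M * (K * g).
  have -> : c21 * f - C kap * g = c21 * (f - c12 * g) + (c12 * c21 - C kap) * g by ring.
  by rewrite hB hK; ring.
apply: ID_D (ID_big _ _); exists (C kap * B), (c21 * B); split; [ring|ring|].
have -> : C kap * B - c12 * (c21 * B) = - (c12 * c21 - C kap) * B by ring.
apply: tmMr; apply: tmN; apply: tm_le hkap.
by rewrite (leq_trans _ mM) // (mE h12 h23) leq_addr.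
Qed.

Let rl1 (e : rb) u v : R1 (e *: u + v) = e * R1 u + R1 v. Proof. by have [h _ _] := nf2_t1 nD; apply: h. Qed.
Let rl2 (e : rb) u v : R2 (e *: u + v) = e * R2 u + R2 v. Proof. by have [h _ _] := nf2_t2 nD; apply: h. Qed.
Let pl1 (e : rb) u v : P1 (e *: u + v) = e * P1 u + P1 v. Proof. by have [h _ _] := nf2_t1 nC; apply: h. Qed.
Let pl2 (e : rb) u v : P2 (e *: u + v) = e * P2 u + P2 v. Proof. by have [h _ _] := nf2_t2 nC; apply: h. Qed.
Let rz1 : R1 0 = 0. Proof. exact: tw0 (@pgsubT _ _ _ _ D1) (nf2_t1 nD). Qed.
Let rz2 : R2 0 = 0. Proof. exact: tw0 (@pgsubT _ _ _ _ D1) (nf2_t2 nD). Qed.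
Let rZ1 (e : rb) u : R1 (e *: u) = e * R1 u. Proof. by rewrite -[e *: u]addr0 rl1 rz1 addr0. Qed.
Let rZ2 (e : rb) u : R2 (e *: u) = e * R2 u. Proof. by rewrite -[e *: u]addr0 rl2 rz2 addr0. Qed.
Let rD1 u v : R1 (u + v) = R1 u + R1 v. Proof. by rewrite -[u]scale1r rl1 rZ1 !mul1r. Qed.
Let rD2 u v : R2 (u + v) = R2 u + R2 v. Proof. by rewrite -[u]scale1r rl2 rZ2 !mul1r. Qed.

Lemma mat_lin (A B G H : rb) : (forall u, ID (A * P1 u + B * P2 u) (G * P1 u + H * P2 u)) ->
  exists T : C1 -> D1, [/\ linf T, forall u, R1 (T u) = A * P1 u + B * P2 u &
    forall u, R2 (T u) = G * P1 u + H * P2 u].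
Proof.
move=> hI; pose r b := if b then R1 else R2.
pose s b u := if b then A * P1 u + B * P2 u else G * P1 u + H * P2 u.
have [||v h|u|T [Tl TE]] := @coord_lin _ _ _ _ C1 D1 bool r s.
- by case; [exact: rl1|exact: rl2].
- by case=> e u v; rewrite /s pl1 pl2; ring.
- exact: (nf2_inj nD (h true) (h false)).
- by have /(nf2_im nD)[v [v1 v2]] := hI u; exists v; case.
by exists T; split=> // u; [apply: (TE u true)|apply: (TE u false)].
Qed.

Lemma D1_ext u v : R1 u = R1 v -> R2 u = R2 v -> u = v.
Proof.
move=> e1 e2; apply: (@coord_inj _ _ _ _ D1 bool (fun b => if b then R1 else R2)); last by case.
  by case; [exact: rl1|exact: rl2].
by move=> w h; apply: (nf2_inj nD (h true) (h false)).
Qed.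

(* In the coordinates of C1 and of D1 the Gamma-part at x is the matrix with rows
   (kap l(x), - kap wb12(x)) and (wb21(x), - kap l(x)). *)
Lemma bic_ex : exists (np : C1 -> D1) (ng : Qp -> C1 -> D1), bicocycle np ng /\
  forall x u, Zp_unit x -> R2 (ng x u) = wb W21 x * P1 u - C (l x) * C kap * P2 u.
Proof.
have [|T0 [T0l T01 T02]] := @mat_lin (C kap) (- (C kap * c12)) c21 (- C kap).
  move=> u; have -> : C kap * P1 u + - (C kap * c12) * P2 u = C kap * (P1 u - c12 * P2 u) by ring.
  by rewrite mulNr; apply: ID_theta; apply/(nf2_im nC); exists u.
have [|T1 [T1l T11 T12]] := @mat_lin 0 (- (C kap * t ^+ M)) 0 0.
  move=> u; have -> : 0 * P1 u + - (C kap * t ^+ M) * P2 u = t ^+ M * (- C kap * P2 u) by ring.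
  have -> : 0 * P1 u + 0 * P2 u = t ^+ M * 0 by ring.
  exact: ID_big.
have [|T2 [T2l T21 T22]] := @mat_lin 0 0 (t ^+ M) 0.
  move=> u; have -> : 0 * P1 u + 0 * P2 u = t ^+ M * 0 by ring.
  have -> : t ^+ M * P1 u + 0 * P2 u = t ^+ M * P1 u by ring.
  exact: ID_big.
have [|np [npl np1 np2]] := @mat_lin 0 (C kap * (t ^+ M * weta W12)) (- (t ^+ M * weta W21)) 0.
  move=> u; have -> : 0 * P1 u + C kap * (t ^+ M * weta W12) * P2 u = t ^+ M * (C kap * weta W12 * P2 u) by ring.
  have -> : - (t ^+ M * weta W21) * P1 u + 0 * P2 u = t ^+ M * (- weta W21 * P1 u) by ring.
  exact: ID_big.
(* T0, T1 and T2 do not depend on x: all dependence sits in the continuous scalars l and ws, as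
   [bic_cvg] requires. *)
pose ng x u := C (l x) *: T0 u + (ws W12 x *: T1 u + ws W21 x *: T2 u).
have g1 x u : R1 (ng x u) = C kap * (C (l x) * P1 u - wb W12 x * P2 u).
  by rewrite /ng !rD1 !rZ1 T01 T11 T21 /wb; ring.
have g2 x u : R2 (ng x u) = wb W21 x * P1 u - C (l x) * C kap * P2 u.
  by rewrite /ng !rD2 !rZ2 T02 T12 T22 /wb; ring.
have ngE x u : ng x u = C (l x) *: T0 u + (ws W12 x *: T1 u + ws W21 x *: T2 u) by [].
clearbody ng; exists np, ng; split=> //; have [_ rp1 rg1] := nf2_t1 nD; have [_ rp2 rg2] := nf2_t2 nD.
have [_ pp1 pg1] := nf2_t1 nC; have [_ pp2 pg2] := nf2_t2 nC.
have gC x c : Zp_unit x -> gm x (C c) = C c by move=> xu; exact: gm_C.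
split=> //.
- move=> x y xu yu u; move: (pg_gamma y u) => v; have b12 := wb_gm W12 xu yu; have b21 := wb_gm W21 xu yu.
  have lxy : C (l (x * y)) = C (l x) + C (l y) by rewrite lM // constD.
  apply: D1_ext; rewrite ?rD1 ?rD2 ?rg1 ?rg2 // ?g1 ?g2 ?g1 ?g2 ?g1 ?g2 (pg1 x xu v I) (pg2 x xu v I) ?b12 ?b21 lxy.
    have -> : gm x (C kap * (C (l y) * P1 v - wb W12 y * P2 v)) =
        C kap * (C (l y) * gm x (P1 v) - gm x (wb W12 y) * gm x (P2 v)).
      rewrite [LHS]rmorphM gC //; congr (_ * _); rewrite [LHS]rmorphB; congr (_ - _).
        by rewrite [LHS]rmorphM gC.
      exact: rmorphM.
    by move: (gm x (P1 v)) (gm x (P2 v)) (gm x (wb W12 y)) => A B G; ring.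
  have -> : gm x (wb W21 y * P1 v - C (l y) * C kap * P2 v) =
      gm x (wb W21 y) * gm x (P1 v) - C (l y) * C kap * gm x (P2 v).
    rewrite [LHS]rmorphB; congr (_ - _); first exact: rmorphM.
    by rewrite -constM [LHS]rmorphM gC.
  by move: (gm x (P1 v)) (gm x (P2 v)) (gm x (wb W21 y)) => A B G; ring.
- move=> x xu u; set v := pg_gamma x u; set u' := pg_phi u; pose w := pg_phi v.
  have wE : w = pg_gamma x u' by have [_ _ _ h _] := C1P; apply: h.
  have b12 := wb_ph W12 xu; have b21 := wb_ph W21 xu.
  have ab : C (a1 * p%:R ^ h3) = C (a1 / a2) * C (a2 * p%:R ^ h3) by rewrite -constM mulrA divfK.
  have ba : C (a2 * p%:R ^ h3) = C (a2 / a1) * C (a1 * p%:R ^ h3) by rewrite -constM mulrA divfK.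
  have w1 : P1 w = C (a1 * p%:R ^ h3) * ph (P1 v) by rewrite /w pp1.
  have w2 : P2 w = C (a2 * p%:R ^ h3) * ph (P2 v) by rewrite /w pp2.
  have x1 : P1 w = C (x%:A ^ h3) * gm x (P1 u') by rewrite wE pg1.
  have x2 : P2 w = C (x%:A ^ h3) * gm x (P2 u') by rewrite wE pg2.
  rewrite -wE -/w; apply: D1_ext; rewrite ?rD1 ?rD2.
    rewrite rp1 // rg1 // np1 np1 !g1.
    have -> : C (a1 * p%:R ^ h3) * ph (C kap * (C (l x) * P1 v - wb W12 x * P2 v)) =
        C kap * (C (l x) * P1 w - C (a1 / a2) * ph (wb W12 x) * P2 w).
      have -> : ph (C kap * (C (l x) * P1 v - wb W12 x * P2 v)) =
          C kap * (C (l x) * ph (P1 v) - ph (wb W12 x) * ph (P2 v)).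
        rewrite [LHS]rmorphM [ph (C kap)]ph_C; congr (_ * _); rewrite [LHS]rmorphB; congr (_ - _).
          by rewrite [LHS]rmorphM [ph (C _)]ph_C.
        exact: rmorphM.
      by rewrite w1 w2 ab; move: (ph (P1 v)) (ph (P2 v)) (ph (wb W12 x)) => A B G; ring.
    have -> : C (x%:A ^ h3) * gm x (0 * P1 u' + C kap * (t ^+ M * weta W12) * P2 u') =
        C kap * gm x (t ^+ M * weta W12) * P2 w.
      rewrite mul0r add0r x2 [gm x (_ * P2 u')]rmorphM [gm x (C kap * _)]rmorphM gC //.
      by move: (gm x (P2 u')) (gm x (t ^+ M * weta W12)) => A B; ring.
    have -> : gm x (t ^+ M * weta W12) = t ^+ M * weta W12 + (wb W12 x - C (a1 / a2) * ph (wb W12 x)).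
      by rewrite b12 addrC subrK.
    by move: (ph (wb W12 x)) => A; ring.
  rewrite rp2 // rg2 // np2 np2 !g2.
  have -> : C (a2 * p%:R ^ h3) * ph (wb W21 x * P1 v - C (l x) * C kap * P2 v) =
      C (a2 / a1) * ph (wb W21 x) * P1 w - C (l x) * C kap * P2 w.
    have -> : ph (wb W21 x * P1 v - C (l x) * C kap * P2 v) =
        ph (wb W21 x) * ph (P1 v) - C (l x) * C kap * ph (P2 v).
      rewrite [LHS]rmorphB; congr (_ - _); first exact: rmorphM.
      by rewrite -constM [LHS]rmorphM [ph (C _)]ph_C.
    by rewrite w1 w2 ba; move: (ph (P1 v)) (ph (P2 v)) (ph (wb W21 x)) => A B G; ring.
  have -> : C (x%:A ^ h3) * gm x (- (t ^+ M * weta W21) * P1 u' + 0 * P2 u') =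
      - (gm x (t ^+ M * weta W21) * P1 w).
    rewrite mul0r addr0 x1 [gm x (_ * P1 u')]rmorphM [gm x (- _)]rmorphN.
    by move: (gm x (P1 u')) (gm x (t ^+ M * weta W21)) => A B; ring.
  have -> : gm x (t ^+ M * weta W21) = t ^+ M * weta W21 + (wb W21 x - C (a2 / a1) * ph (wb W21 x)).
    by rewrite b21 addrC subrK.
  by move: (ph (wb W21 x)) => A; ring.
exists 3%N, (fun i x => match val i with 0%N => C (l x) | 1%N => ws W12 x | _ => ws W21 x end),
  (fun i => match val i with 0%N => T0 | 1%N => T1 | _ => T2 end); split.
- by case=> -[|[|[|//]]] ?.
- case=> -[|[|[|//]]] ? x xu /=; [exact: lc|exact: ws_cvg|exact: ws_cvg].
by move=> x xu u; rewrite !big_ord_recl big_ord0 addr0 ngE.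
Qed.

End TheCocycle.

Section KernelMembership.
Variables (R : realType) (p : nat) (Qp : padicNumType R p) (E : ultraFieldExtType Qp).
Variable O : robba_ops E.
Local Notation Ee := (dual E : ultraAlgType Qp).
Local Notation rb := (robba E).
Local Notation rbe := (robba Ee).
Local Notation C := (@robba_const R E).
Local Notation ph := (op_phi O).
Local Notation gm := (op_gamma O).
Local Notation t := (robba_t E).
Local Notation tm := (@tm R p Qp E).
Local Notation tw := (tw O).
Local Notation TT := (fun=> True).
Local Notation Eps := (robba_const (eps : Ee)).

Lemma triangulated_dmod (D : pgmod E) m (del : 'I_m -> Qp -> E) : triangulated D del ->
  triangulated (dmod (M := D) (fun=> 0) (fun _ _ => 0)) (fun i => deform_char (del i) (fun=> 0)).
Proof.
move=> [Fil [F0 Fm Fs Fq]].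
exists (fun i => [set u : dmodT D | Fil i u.1 /\ Fil i u.2]%classic); split.
- apply/funext => -[u v]; apply/propext; rewrite F0 /=.
  by split=> [[-> ->]|[-> ->]].
- by apply/funext => u; apply/propext; rewrite Fm /=.
- move=> i im'; have [[s0 sl sp sg] sat] := Fs i im'.
  have sZ (b : rb) u : Fil i u -> Fil i (b *: u) by move=> h; have := sl b u 0 h s0; rewrite addr0.
  have sD u v : Fil i u -> Fil i v -> Fil i (u + v).
    by move=> h h'; have := sl 1 u v h h'; rewrite scale1r.
  split; first split=> //.
  + move=> b [u v] [u' v'] [/= hu hv] [/= hu' hv']; split; first exact: sl.
    by apply: (sD _ _ _ hv'); apply: sD; apply: sZ.
  + by move=> [u v] [/= hu hv]; split=> /=; [apply: sp|rewrite addr0; apply: sp].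
  + by move=> x xu [u v] [/= hu hv]; split=> /=; [apply: sg|rewrite addr0; apply: sg].
  move=> b [u v] br [/= hu hv]; have rr : GRing.lreg (robba_red b).
    move=> f g fg; have e : b * mk 0 f = b * mk 0 g.
      by rewrite (mk_red_im b) !mkM /= fg !mulr0.
    by have [] := mk_inj (br _ _ e).
  have h1 : Fil i u by apply: sat rr hu.
  split=> //; apply: sat rr _; have := sD _ _ hv (sZ (- im b) _ h1).
  by rewrite scaleNr addrK.
move=> i; have [s12 [q [ql qp qg qo qk]]] := Fq i; split; first by move=> [u v] [/s12 ? /s12 ?].
have q0 : q 0 = 0 by apply/qk; have [[? _ _ _] _] := Fs i (ltnW (ltn_ord i)); [apply: s12|].
have i1 : (i.+1 <= m)%N by exact: ltn_ord.
have [[s0 sl _ _] _] := Fs _ i1.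
have sZ (b : rb) u : Fil i.+1 u -> Fil i.+1 (b *: u) by move=> h; have := sl b u 0 h s0; rewrite addr0.
have sD u v : Fil i.+1 u -> Fil i.+1 v -> Fil i.+1 (u + v).
  by move=> h h'; have := sl 1 u v h h'; rewrite scale1r.
have qZ (b : rb) u : Fil i.+1 u -> q (b *: u) = b *: q u.
  by move=> h; have := ql b u 0 h s0; rewrite !addr0 q0 addr0.
have qD u v : Fil i.+1 u -> Fil i.+1 v -> q (u + v) = q u + q v.
  by move=> h h'; have := ql 1 u v h h'; rewrite !scale1r.
exists (fun u => mk (q u.1 : rb) (q u.2)); split.
- move=> b [u v] [u' v'] [/= hu hv] [/= hu' hv'].
  transitivity (b * mk (q u : rb) (q v) + mk (q u' : rb) (q v')); last by [].
  rewrite [in RHS](mk_red_im b) mkM mkD; congr mk; first exact: ql.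
  apply: etrans (qD _ _ (sD _ _ (sZ _ _ hv) (sZ _ _ hu)) hv') _; congr (_ + _).
  by apply: etrans (qD _ _ (sZ _ _ hv) (sZ _ _ hu)) _; congr (_ + _); apply: qZ.
- by move=> [u v] [/= hu hv]; rewrite addr0 !qp // (phi_mk O) mk_scale.
- by move=> x xu [u v] [/= hu hv]; rewrite addr0 !qg // (gamma_mk O) // mk_scale.
- move=> w; have [u hu eu] := qo (robba_red w); have [v hv ev] := qo (im w).
  by exists (u, v) => //=; rewrite eu ev -mk_red_im.
move=> [u v] [/= hu hv]; rewrite -(mk00 E); split=> [/mk_inj[/(qk u hu) ? /(qk v hv) ?]//|[]].
by move=> /(qk u hu) -> /(qk v hv) ->.
Qed.

Variables (a1 a2 a3 : E) (h1 h2 h3 : int) (D1 C1 D : pgmod E).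
Hypotheses (D1P : is_phiGamma D1 2) (C1P : is_phiGamma C1 2) (DP : is_phiGamma D 3).
Variables (np : C1 -> D1) (ng : Qp -> C1 -> D1).
Hypothesis B : bicocycle np ng.
Variables (i : D1 -> D) (q : D -> C1).
Hypotheses (ip : is_pgmap i) (qp : is_pgmap q).

Lemma idp (N : pgmod E) : is_pgmap (fun u : N => u). Proof. by []. Qed.

Lemma coc_D1 : cocycle (fun u => np (q (i u))) (fun x u => ng x (q (i u))).
Proof. exact: coc_comp B (comp_pgmap ip qp) (@idp D1). Qed.
Lemma coc_C1 : cocycle (fun u => - q (i (np u))) (fun x u => - q (i (ng x u))).
Proof. exact: coc_comp B (@idp C1) (pgmap_opp O C1P (comp_pgmap ip qp)). Qed.

Definition D1t : deform D1 := Deform (dmod_deform O D1P coc_D1).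
Definition C1t : deform C1 := Deform (dmod_deform O C1P coc_C1).

Hypothesis tri : triangulated D
  (fun j => unr_z (tnth [tuple a1; a2; a3] ((1^-1 : 'S_3)%g j)) (tnth [tuple h1; h2; h3] j)).
Variables (q3 : D -> pg_char (unr_z a3 h3)) (j : pg_char (unr_z a3 h1) -> D).
Hypotheses (ex1 : short_exact i q3) (ex2 : short_exact j q).

(** With n the bicocycle, i n q and -(i n q) define deformations of D over those of D1 and C1, since
    i (n q i) = (i n q) i and q (-(i n q)) = -(q i n) q. Their Baer sum is the trivial
    deformation. *)
Lemma ker_mem : in_ker_f a1 a2 a3 h1 h2 h3 D D1t C1t.
Proof.
have cF : cocycle (fun u => i (np (q u))) (fun x u => i (ng x (q u))).
  exact: coc_comp B qp ip.
have cG : cocycle (fun u => - i (np (q u))) (fun x u => - i (ng x (q u))).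
  exact: coc_comp B qp (pgmap_opp O DP ip).
have [phl gml _ _ _] := DP.
have phD u v : pg_phi (u + v) = pg_phi u + pg_phi v :> D.
  by have := phl 1 u v; rewrite -(op_phiE O) rmorph1 !scale1r.
have gmD x u v : Zp_unit x -> pg_gamma x (u + v) = pg_gamma x u + pg_gamma x v :> D.
  by move=> xu; have := gml x xu 1 u v; rewrite -(op_gammaE O xu) rmorph1 !scale1r.
have p0 : pg_phi 0 = 0 :> D by have := phD 0 0; rewrite addr0 -{1}[pg_phi 0]addr0 => /addrI.
have g0 x : Zp_unit x -> pg_gamma x 0 = 0 :> D.
  by move=> xu; have := gmD x 0 0 xu; rewrite addr0 -{1}[pg_gamma x 0]addr0 => /addrI.
have cS : cocycle (M := D) (fun=> 0) (fun _ _ => 0) by apply: coc_zero.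
have [il _ _] := ip; have [ql _ _] := qp.
have iq3 u : q3 (i u) = 0 by have [_ _ _ h _] := ex1; apply/h; exists u.
have qj u : q (j u) = 0 by have [_ _ _ h _] := ex2; apply/h; exists u.
have np0 := linf0 (bic_lin B); have ng0 x : Zp_unit x -> ng x 0 = 0.
  have [r [f [T [Tl _ nE]]]] := bic_cvg B; move=> xu; rewrite nE //.
  by rewrite big1 // => k _; rewrite (linf0 (Tl k)) scaler0.
exists (Deform (dmod_deform O DP cF)), (Deform (dmod_deform O DP cG)), (Deform (dmod_deform O DP cS)).
split.
- exact: (compat_right O ex1).
- apply: (compat_left O ex2) => [u|x u xu|u|x u xu].
  + by rewrite qj np0 (linf0 il) oppr0.
  + by rewrite qj ng0 // (linf0 il) oppr0.
  + by rewrite (linfN ql).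
  by rewrite (linfN ql).
- exists (fun u v : dmodT D => (u.1, u.2 + v.2)).
  have redE : robba_red Eps = 0 by rewrite -mk01 red_mk.
  have imE' : im Eps = 1 by rewrite -mk01 im_mk.
  have rin b : robba_red (robba_incl b) = b by rewrite mk_incl red_mk.
  have iin b : im (robba_incl b) = 0 by rewrite mk_incl im_mk.
  split=> //.
  + move=> b [u1 u1'] [u2 u2'] [v1 v1'] [v2 v2'] /= e1 e2; rewrite !dscaleE /= !rin !iin !scale0r !addr0.
    by congr pair; rewrite scalerDr addrACA.
  + move=> [u u'] [v v'] /= ->; congr pair; rewrite phD !addr0 addrACA subrr addr0; reflexivity.
  + move=> x xu [u u'] [v v'] /= ->; congr pair; rewrite gmD // !addr0 addrACA subrr addr0; reflexivity.
  move=> [u u'] [v v'] [w w'] /= e; rewrite !dscaleE /= !redE !imE' !scale0r !add0r !scale1r.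
  by rewrite -e.
split; last exact: triangulated_dmod.
move=> k; split=> [x y _ _|x _ e e0]; first by rewrite addr0.
by exists 1 => // y _ _; rewrite subrr unorm0.
Qed.
End KernelMembership.

(** * The kernel determines the invariant *)

Section DeformationLemmas.
Variables (R : realType) (p : nat) (Qp : padicNumType R p) (E : ultraFieldExtType Qp).
Variable O : robba_ops E.
Local Notation Ee := (dual E : ultraAlgType Qp).
Local Notation rb := (robba E).
Local Notation rbe := (robba Ee).
Local Notation C := (@robba_const R E).
Local Notation ph := (op_phi O).
Local Notation gm := (op_gamma O).
Local Notation t := (robba_t E).
Local Notation tm := (@tm R p Qp E).
Local Notation tw := (tw O).
Local Notation TT := (fun=> True).
Local Notation Eps := (robba_const (eps : Ee)).

Lemma red_eps : robba_red Eps = 0. Proof. by rewrite -mk01 red_mk. Qed.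
Lemma im_eps : im Eps = 1. Proof. by rewrite -mk01 im_mk. Qed.
Lemma eps2 : Eps * Eps = 0. Proof. by rewrite -mk01 mkM !mul0r mulr0 addr0 mk00. Qed.
Lemma eps_mk f : Eps * f = mk 0 (robba_red f).
Proof. by rewrite -mk01 [in LHS](mk_red_im f) mkM !mul0r mul1r add0r. Qed.
Lemma red_incl (b : rb) : robba_red (robba_incl b) = b. Proof. by rewrite mk_incl red_mk. Qed.
Lemma im_incl (b : rb) : im (robba_incl b) = 0. Proof. by rewrite mk_incl im_mk. Qed.
Lemma incl_const (b : E) : robba_const ((b, b * 0) : Ee) = robba_incl (C b).
Proof. by rewrite mk_incl mulr0 -mk_const const0. Qed.
Lemma inclN (b : rb) : robba_incl (- b) = - robba_incl b.
Proof. by rewrite !mk_incl mkN oppr0. Qed.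

Section OneDeformation.
Variables (N : pgmod E) (Nt : deform N).
Local Notation pr := (@df_pr R p Qp E N Nt).
Lemma df_lin (a : rbe) u v : pr (a *: u + v) = robba_red a *: pr u + pr v.
Proof. by have [_ h _ _ _] := df_ax Nt. Qed.
Lemma df0 : pr 0 = 0.
Proof.
have := df_lin (-1) 0 0; rewrite scaler0 addr0 => e.
have r1 : robba_red (-1 : rbe) = -1 by rewrite -mk10 mkN red_mk.
by rewrite e r1 scaleN1r addNr.
Qed.
Lemma dfZ (a : rbe) u : pr (a *: u) = robba_red a *: pr u.
Proof. by have := df_lin a u 0; rewrite df0 !addr0. Qed.
Lemma dfD u v : pr (u + v) = pr u + pr v.
Proof. by have := df_lin 1 u v; rewrite !scale1r red1 scale1r. Qed.
Lemma dfB u v : pr (u - v) = pr u - pr v.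
Proof.
have r1 : robba_red (-1 : rbe) = -1 by rewrite -mk10 mkN red_mk.
by rewrite dfD -scaleN1r dfZ r1 scaleN1r.
Qed.
Lemma df_phi u : pr (pg_phi u) = pg_phi (pr u).
Proof. by have [_ _ [h _] _ _] := df_ax Nt. Qed.
Lemma df_gamma x u : Zp_unit x -> pr (pg_gamma x u) = pg_gamma x (pr u).
Proof. by have [_ _ [_ h] _ _] := df_ax Nt; move=> xu; apply: h. Qed.
Lemma df_onto w : exists u, pr u = w.
Proof. by have [_ _ _ h _] := df_ax Nt. Qed.
Lemma df_ker u : pr u = 0 <-> exists v, u = Eps *: v.
Proof. by have [_ _ _ _ h] := df_ax Nt. Qed.
Lemma df_eps v : pr (Eps *: v) = 0. Proof. by apply/df_ker; exists v. Qed.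

(** By freeness over the dual Robba ring: a coefficient killed by eps is a multiple of eps. *)
Lemma df_free u : Eps *: u = 0 -> pr u = 0.
Proof.
move=> e0; have [[m [_ _ _ _ [b [hb _ _]]]] _ _ _ _] := df_ax Nt.
have [c [uE _]] := hb u; have [d [_ dU]] := hb 0.
have hc k : Eps * c 0 k = 0.
  have e1 : d = \row_k (Eps * c 0 k).
    apply: dU; transitivity (Eps *: u); first by rewrite e0.
    rewrite [in LHS]uE scaler_sumr; apply: eq_bigr => i _.
    by rewrite mxE scalerA.
  have e2 : d = 0.
    by apply: dU; rewrite big1 // => i _; rewrite mxE scale0r.
  by have := congr1 (fun r : 'rV_m => r 0 k) e1; rewrite e2 !mxE.
apply/df_ker; exists (\sum_k mk (im (c 0 k)) 0 *: b k).
rewrite {1}uE scaler_sumr; apply: eq_bigr => k _; rewrite scalerA eps_mk red_mk; congr (_ *: _).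
have := hc k; rewrite eps_mk -(mk00 E) => /mk_inj[_ r0].
by rewrite [LHS](mk_red_im (c 0 k)) r0.
Qed.

Lemma df_gamma_lin x (a : rbe) (u v : Nt) : Zp_unit x ->
  pg_gamma x (a *: u + v) = robba_gamma x a *: pg_gamma x u + pg_gamma x v.
Proof. by have [[m [_ h _ _ _]] _ _ _ _] := df_ax Nt; move=> xu; apply: h. Qed.

Lemma gamma_eps x : Zp_unit x -> robba_gamma x Eps = Eps.
Proof. by move=> xu; rewrite -mk01 (gamma_mk O) // -!(op_gammaE O xu) rmorph0 rmorph1. Qed.

(** In Ext_0 the parameters psi vanish, so the generator s of the bottom line is an exact
    eigenvector, eps included. If s reduced to 0, then eps s = 0, whereas eps is nonzero in the rank
    one module. *)
Lemma first_line a1 a2 a3 (h1 h2 h3 : int) :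
  in_Ext_0 [tuple a1; a2; a3] [tuple h1; h2; h3] Nt ->
  exists s : Nt, [/\ pr s <> 0, pg_phi (pr s) = C (a1 * p%:R ^ h1) *: pr s &
    forall x, Zp_unit x -> pg_gamma x s = robba_incl (C (x%:A ^ h1)) *: s].
Proof.
move=> [_ [Fil [F0 _ Fs Fq]]]; have [_] := Fq ord0; rewrite invg1 perm1.
have -> : tnth [tuple a1; a2; a3] ord0 = a1 by [].
have -> : tnth [tuple h1; h2; h3] ord0 = h1 by [].
have dE x : deform_char (unr_z a1 h1) (fun=> 0) x = (unr_z a1 h1 x, unr_z a1 h1 x * 0) by [].
move: (deform_char _ _) dE => del dE [q [ql qp qg qo qk]].
have [s Fs1 hs] := qo 1; have [[s0 sl sp sg] _] := Fs 1%N isT.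
have [[_ _ _ _] _] := Fs 0%N isT; have q00 : q 0 = 0 by apply/qk => //; rewrite F0.
have qZ (b : rbe) u : Fil 1%N u -> q (b *: u) = b *: q u.
  by move=> hu; have := ql b u 0 hu s0; rewrite !addr0 q00 addr0.
have eig (b : rbe) u : Fil 1%N u -> q u = b -> u = b *: s.
  move=> Fu e; have Fd : Fil 1%N (- b *: s + u) by apply: sl.
  have : q (- b *: s + u) = 0.
    rewrite ql // hs e; transitivity (- b * 1 + b); first by [].
    by rewrite mulr1 addNr.
  by move/(qk _ Fd); rewrite F0 /= scaleNr => /eqP; rewrite addrC subr_eq0 => /eqP.
have e1 : robba_phi (1 : rbe) = 1 by rewrite -mk10 (phi_mk O) -!(op_phiE O) rmorph0 rmorph1.
have e2 x : Zp_unit x -> robba_gamma x (1 : rbe) = 1.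
  by move=> xu; rewrite -mk10 (gamma_mk O) // -!(op_gammaE O xu) rmorph0 rmorph1.
exists s; split.
- move=> /df_ker[v sE]; have : q (Eps *: s) = Eps.
    by rewrite qZ // hs; transitivity (Eps * 1); [|rewrite mulr1].
  have -> : Eps *: s = 0 by rewrite sE scalerA eps2 scale0r.
  by rewrite q00 -mk01 -(mk00 E) => /mk_inj[_ /eqP]; rewrite eq_sym oner_eq0.
- rewrite -df_phi; have -> : pg_phi s = robba_incl (C (a1 * p%:R ^ h1)) *: s.
    apply: eig; first exact: sp.
    by rewrite qp // hs /= e1 mulr1 dE unr_zp incl_const.
  by rewrite dfZ red_incl.
move=> x xu; apply: eig; first exact: sg.
by rewrite qg // hs /= e2 // mulr1 dE unr_zu // incl_const.
Qed.
End OneDeformation.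

(** Arbitrary lifts of the reduction of s produce s up to some eps v, which is itself the image of a
    pair of the form (eps v1, 0). *)
Lemma baer_lift (N : pgmod E) (N1 N2 N3 : deform N) (sg : N1 -> N2 -> N3) (s : N3) :
  (forall (a : rb) u1 u2 v1 v2, df_pr u1 = df_pr u2 -> df_pr v1 = df_pr v2 ->
         sg (robba_incl a *: u1 + v1) (robba_incl a *: u2 + v2) =
         robba_incl a *: sg u1 u2 + sg v1 v2) ->
  (forall u1 u2, df_pr u1 = df_pr u2 -> df_pr (sg u1 u2) = df_pr u1) ->
  (forall u1 u2 u3, df_pr u3 = df_pr u1 + df_pr u2 -> sg (Eps *: u1) (Eps *: u2) = Eps *: u3) ->
  exists u1 u2, [/\ df_pr u1 = df_pr s, df_pr u2 = df_pr s & sg u1 u2 = s].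
Proof.
move=> sl sp se; have [u1 e1] := df_onto N1 (df_pr s); have [u2 e2] := df_onto N2 (df_pr s).
have /df_ker[v hv] : df_pr (s - sg u1 u2) = 0 by rewrite dfB sp ?e1 ?e2 // subrr.
have [v1 f1] := df_onto N1 (df_pr v).
have i1 : robba_incl (1 : rb) = 1 by rewrite mk_incl mk10.
exists (robba_incl 1 *: (Eps *: v1) + u1), (robba_incl 1 *: (Eps *: 0) + u2); split.
- by rewrite i1 scale1r dfD df_eps add0r.
- by rewrite i1 scale1r dfD df_eps add0r.
rewrite sl ?df_eps ?e1 ?e2 // (se _ _ v) ?df0 ?addr0 ?f1 // -hv i1 scale1r.
by rewrite subrK.
Qed.

End DeformationLemmas.

Section KernelInvariant.
Variables (R : realType) (p : nat) (Qp : padicNumType R p) (E : ultraFieldExtType Qp).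
Variable O : robba_ops E.
Local Notation Ee := (dual E : ultraAlgType Qp).
Local Notation rb := (robba E).
Local Notation rbe := (robba Ee).
Local Notation C := (@robba_const R E).
Local Notation ph := (op_phi O).
Local Notation gm := (op_gamma O).
Local Notation t := (robba_t E).
Local Notation tm := (@tm R p Qp E).
Local Notation tw := (tw O).
Local Notation TT := (fun=> True).
Local Notation Eps := (robba_const (eps : Ee)).
Variables (l : Qp -> E) (a1 a2 a3 : E) (M : nat).
Hypotheses (a10 : a1 != 0) (a20 : a2 != 0) (a30 : a3 != 0).
Hypotheses (a12 : a1 != a2) (a13 : a1 != a3) (M0 : (0 < M)%N).
Hypothesis lx0 : forall n, l (x0n p n)%:R != 0.
Variables (W12 : weight_class O l (a1 / a2) M) (W21 : weight_class O l (a2 / a1) M).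
Local Notation c12 := (wc W12).
Local Notation c21 := (wc W21).
Variables (h1 h2 h3 : int).
Hypotheses (h12 : h2 < h1) (h23 : h3 < h2).
Local Notation m1 := `|h1 - h2|%N.
Local Notation m2 := `|h2 - h3|%N.
Local Notation m := `|h1 - h3|%N.
Hypothesis mM : (m <= M)%N.
Local Notation ID := (ID W12 h1 h2 h3).
Local Notation IC := (IC W12 h2 h3).

Lemma tw_pgmap (L N : pgmod E) (F : L -> N) (q : N -> rb) a k :
  is_pgmap F -> tw TT q a k -> tw TT (fun u => q (F u)) a k.
Proof.
move=> [Fl Fp Fg] [ql qp qg]; split=> [e u v _ _|u _|x xu u _]; first by rewrite Fl ql.
  by rewrite Fp qp.
by rewrite Fg // qg.
Qed.

Lemma tw_char (N : pgmod E) a k (q : N -> pg_char (unr_z a k)) :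
  is_pgmap q -> tw TT (q : N -> rb) a k.
Proof.
move=> [ql qp qg]; split=> [e u v _ _|u _|x xu u _]; first by rewrite ql.
  by rewrite qp /= unr_zp op_phiE.
by rewrite qg //= unr_zu // op_gammaE.
Qed.

Lemma twZ (N : pgmod E) (q : N -> rb) a k (e : rb) u : tw TT q a k -> q (e *: u) = e * q u.
Proof.
move=> tq; have [ql _ _] := tq.
by rewrite -[e *: u]addr0 ql // (tw0 (@pgsubT _ _ _ _ N) tq) addr0.
Qed.

Lemma twD (N : pgmod E) (q : N -> rb) a k u v : tw TT q a k -> q (u + v) = q u + q v.
Proof. by move=> tq; have [ql _ _] := tq; rewrite -[u]scale1r ql // (twZ _ _ tq) !mul1r. Qed.

(** Dividing by x^h3 leaves the twist x^m and the function x^m l(x), still nonzero at x0n n; the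
    part of [wb] in t^M, as M > 0, goes into the higher order term of [no_coboundary]. *)
Lemma coboundary_entry H lam :
  (forall x, Zp_unit x ->
    C (x%:A ^ h3) * gm x H - C (x%:A ^ h1) * H + C (x%:A ^ h1) * (wb W21 x * (C lam * t ^+ m)) = 0) ->
  lam = 0.
Proof.
move=> hH; apply/eqP; rewrite -oppr_eq0; apply/eqP.
apply: (@no_coboundary R p Qp E O m H (- lam) c21 (fun x => x%:A ^+ m * l x)
  (fun x => C (x%:A ^+ m) * (t ^+ M.-1 * ws W21 x))).
- exact: wc_const.
- exact: wc_plus.
- move=> x xu; apply: plusM; first exact: plus_const.
  by apply: plusM; [apply: plusX; apply: plus_t|apply: ws_plus].
- by move=> n; rewrite mulf_neq0 // expf_neq0 // alg_neq0 // x0n_unit.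
move=> x xu; have x0 := alg_neq0 E xu.
have xh : C (x%:A ^ h1) = C (x%:A ^ h3) * C (x%:A ^+ m).
  rewrite -constM; congr C; have hE : h1 = h3 + m%:Z by clear -h12 h23; lia.
  by rewrite {1}hE expfzDr.
have tM : t ^+ M = t * t ^+ M.-1 :> rb by rewrite -exprS prednK.
have := hH x xu; rewrite xh /wb tM constM constN => e.
apply: (mulrI (C_unit (expfz_neq0 h3 x0))); move: e.
move: (C (x%:A ^ h3)) (C (x%:A ^+ m)) (gm x H) (C (l x)) (C lam) (ws W21 x) (t ^+ m) => Z Y G L A W T e.
apply/eqP; rewrite -subr_eq0; apply/eqP; rewrite -e; ring.
Qed.

Variables (D1 C1 D' : pgmod E) (P1 P2 : C1 -> rb) (R1 R2 : D1 -> rb).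
Variables (A A' : E) (q1 q2 q3 : D' -> rb).
Hypotheses (A0 : A != 0).
Hypotheses (nC : nf2 O a1 a2 h3 IC P1 P2) (nD : nf2 O a1 a2 h3 ID R1 R2).
Hypothesis hD : forall r, [/\ tw TT r a1 h3 -> exists c, forall u, r u = C c * R1 u,
      tw TT r a2 h3 -> exists c, forall u, r u = C c * R2 u &
      tw TT r a3 h3 -> forall u, r u = 0].
Hypothesis nD' : nf3 a3 W12 h1 h2 h3 A' q1 q2 q3.

(** [compatible_exact] only provides some injection of D1. Both coordinates are determined up to a
    scalar, and the two scalars agree because c12 times a nonzero constant is not in t^m1 R. *)
Lemma hom_D1 (i : D1 -> D') : is_pgmap i -> injective i ->
  exists2 x, x != 0 & forall d, [/\ q1 (i d) = C x * R1 d, q2 (i d) = C x * R2 d & q3 (i d) = 0].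
Proof.
move=> ip ii; have [hD1 _ _] := hD (fun d => q1 (i d)); have [_ hD2 _] := hD (fun d => q2 (i d)).
have [_ _ hD3] := hD (fun d => q3 (i d)).
have [x1 e1] := hD1 (tw_pgmap ip (nf3_t1 nD')); have [x2 e2] := hD2 (tw_pgmap ip (nf3_t2 nD')).
have e3 := hD3 (tw_pgmap ip (nf3_t3 nD')).
have /(nf2_im nD)[d [d1 d2]] : ID (t ^+ m2 * c12) (t ^+ m2 * 1).
  by exists c12, 1; split=> //; rewrite mulr1 subrr; apply: tm0.
have m1M : (0 < m1 <= M)%N by rewrite (m10 h12) (leq_trans _ mM) // (mE h12 h23) leq_addr.
have [f [g [f1 g1 fg]]] : ID (q1 (i d)) (q2 (i d)) by apply/(nf3_ker nD'); exists (i d).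
have x12 : x1 = x2.
  apply/eqP; rewrite -subr_eq0; apply/eqP; apply: (tm_cancel_wc a10 a20 M0 (W12 := W12) W21 m1M).
  have -> : C (x1 - x2) * c12 = C x1 * c12 - c12 * (C x2 * 1) by rewrite constB; ring.
  have -> : C x1 * c12 = f by apply: (t_regI O (m := m2)); rewrite -f1 e1 d1 mulrCA.
  have -> // : C x2 * 1 = g by apply: (t_regI O (m := m2)); rewrite -g1 e2 d2 mulrCA.
exists x1; last by move=> u; rewrite e1 e2 x12.
apply/eqP => z; have d0 : d = 0.
  apply: ii; have [il _ _] := ip; rewrite (linf0 il); apply: (nf3_inj nD'); last exact: e3.
    by rewrite e1 z const0 mul0r.
  by rewrite e2 -x12 z const0 mul0r.
have := d2; rewrite d0 (tw0 (@pgsubT _ _ _ _ D1) (nf2_t2 nD)) => /esym.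
rewrite -[RHS](mulr0 (t ^+ m2)) => /(t_regI O)/eqP.
by rewrite oner_eq0.
Qed.

(** The second scalar is A' times the first because the image of D' is described by A' c12 and that
    of C1 by c12. *)
Lemma hom_C1 (q : D' -> C1) : is_pgmap q -> (forall v, exists u, q u = v) ->
  exists2 y, y != 0 & forall u, P1 (q u) = C y * q1 u /\ P2 (q u) = C (A' * y) * q2 u.
Proof.
move=> qp qo; have [y1 e1] := nf3_hom1 nD' (tw_pgmap qp (nf2_t1 nC)).
have [y2 e2] := nf3_hom2 nD' (tw_pgmap qp (nf2_t2 nC)).
have /(nf3_im nD')[u [u1 u2]] : tm m2 (C A' * c12 - C A' * c12 * 1).
  by rewrite mulr1 subrr; apply: tm0.
have m2M : (0 < m2 <= M)%N by rewrite (m20 h23) (leq_trans _ mM) // (mE h12 h23) leq_addl.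
have hI : IC (P1 (q u)) (P2 (q u)) by apply/(nf2_im nC); exists (q u).
have y12 : A' * y1 = y2.
  apply/eqP; rewrite -subr_eq0; apply/eqP; apply: (tm_cancel_wc a10 a20 M0 (W12 := W12) W21 m2M).
  have <- // : P1 (q u) - c12 * P2 (q u) = C (A' * y1 - y2) * c12.
  by rewrite e1 e2 u1 u2 constB constM; ring.
exists y1; last by move=> v; rewrite e1 e2 y12.
apply/eqP => z; have /(nf2_im nC)[w [w1 w2]] : IC c12 1 by rewrite /IC mulr1 subrr; apply: tm0.
have [v hv] := qo w; move: w2; rewrite -hv e2 -y12 z mulr0 const0 mul0r => /eqP.
by rewrite eq_sym oner_eq0.
Qed.

Variables (np : C1 -> D1) (ng : Qp -> C1 -> D1) (kap : E).
Hypothesis B : bicocycle np ng.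
Hypothesis ngE : forall x u, Zp_unit x ->
  R2 (ng x u) = wb W21 x * P1 u - C (l x) * C kap * P2 u.
Variable D : pgmod E.
Variables (i : D1 -> D) (q : D -> C1).
Hypotheses (ip : is_pgmap i) (qp : is_pgmap q).
Hypotheses (iq1 : forall d, P1 (q (i d)) = C A^-1 * R1 d) (iq2 : forall d, P2 (q (i d)) = R2 d).
Hypotheses (D1P : is_phiGamma D1 2) (C1P : is_phiGamma C1 2).
Local Notation D1t := (D1t O D1P B ip qp).
Local Notation C1t := (C1t O C1P B ip qp).

Lemma zalg (V : zmodType) (x y z v : V) : (x + (y + z)) - (v + y) = z + (x - v).
Proof. by rewrite opprD [y + z]addrC [x + (z + y)]addrA [x + z]addrC addrACA subrr addr0 addrA. Qed.

(* A generator s of the first step of the triangulation of the sum of the two deformations lifts to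
   u1 + u2; applying gamma_x - x^h1 and the second coordinate gives a coboundary whose coefficient is
   a nonzero multiple of A' - A. *)
Lemma ker_invariant : in_ker_f a1 a2 a3 h1 h2 h3 D' D1t C1t -> A = A'.
Proof.
move=> [DF [DG [DS [fF fG [sg [sl _ sgm sp se]] hS]]]].
have [s [s0 sph sgam]] := first_line O hS.
have [u1 [u2 [e1 e2 es]]] := baer_lift s sl sp se.
have [i' [Q [it [_ [[i'p Qp' i'i Qk _] [itp _ _ _ _] c1 _]]]]] := fF.
have [_ [q' [_ [qt [[_ q'p _ _ q'o] [_ qtp _ _ _] _ c2]]]]] := fG.
set sb := df_pr s in s0 sph e1 e2.
have [x x0 hx] := hom_D1 i'p i'i; have [y y0 hy] := hom_C1 q'p q'o.
have sbg z : Zp_unit z -> pg_gamma z sb = C (z%:A ^ h1) *: sb.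
  by move=> zu; rewrite -df_gamma // sgam // dfZ red_incl.
(* Only the eigenvalue a1 can occur on sb, so q1 is its only nonzero coordinate and sb comes from
   D1. *)
have eig a r : tw TT r a h3 -> a != 0 -> r sb = 0 \/ a1 = a /\ exists c, r sb = C c * t ^+ m.
  move=> tr an; have [_ rp rg] := tr.
  have [||z|[z _ z']] := @hom_char R p Qp E O (r sb) a1 a h1 h3 a10 an; [| |by left|by right].
    by rewrite -rp // sph (twZ _ _ tr).
  by move=> z zu; rewrite -rg // sbg // (twZ _ _ tr).
have z2 : q2 sb = 0 by case: (eig _ _ (nf3_t2 nD') a20) => // -[/eqP]; rewrite (negbTE a12).
have z3 : q3 sb = 0 by case: (eig _ _ (nf3_t3 nD') a30) => // -[/eqP]; rewrite (negbTE a13).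
have zQ : Q sb = 0 by case: (eig _ _ (tw_char Qp') a30) => // -[/eqP]; rewrite (negbTE a13).
have [c c0 z1] : exists2 c, c != 0 & q1 sb = C c * t ^+ m.
  have nz : q1 sb <> 0 by move=> z; apply: s0; apply: (nf3_inj nD').
  case: (eig _ _ (nf3_t1 nD') a10) => // -[_ [c hc]]; exists c => //.
  by apply/eqP => z; apply: nz; rewrite hc z const0 mul0r.
have [d sd] : exists d, sb = i' d by apply/Qk.
have d1 : R1 d = C (x^-1 * c) * t ^+ m.
  by have [h _ _] := hx d; rewrite -sd z1 in h; rewrite constM -mulrA h (C_VK _ x0).
have d2 : R2 d = 0.
  by have [_ h _] := hx d; rewrite -sd z2 in h; rewrite -[R2 d](C_VK _ x0) -h mulr0.
(* On the explicit lift (d, 0) the action of gamma is given by the cocycle; u1 differs from its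
   image by some eps v. *)
pose dd : D1t := (d, 0); have [v hv] : exists v, u1 - it dd = Eps *: v.
  by apply/df_ker; rewrite dfB c1 e1 sd subrr.
pose e := df_pr v; pose z := (qt u2).2 : C1.
have qtu : qt u2 = (q' sb, z) :> dmodT C1.
  by rewrite [LHS]surjective_pairing; congr pair; rewrite -e2; exact: c2.
(* In the coefficient of wb21, DF contributes A' y A^-1 c and DG contributes - y c. *)
suff : (A' * y * A^-1 - y) * c = 0.
  move/eqP; rewrite mulf_eq0 (negbTE c0) orbF subr_eq0 mulrAC => /eqP h.
  have h1' : A' * A^-1 = 1 by apply: (mulIf y0); rewrite mul1r.
  by rewrite -[A]mul1r -h1' divfK.
(* H adds the second coordinates in C1 of q'(e) and of z, the eps-parts attached to u1 and u2. *)
apply: (@coboundary_entry (C (A' * y) * q2 e + P2 z)) => w wu; set ch := C (w%:A ^ h1).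
pose ci : rbe := robba_incl ch.
have chE : robba_red ci = ch by exact: red_incl.
have [itl _ itg] := itp; have [qtl _ qtg] := qtp; have [i'l _ i'g] := i'p; have [q'l _ q'g] := q'p.
have dg : pg_gamma w d = ch *: d by apply: i'i; rewrite i'g // (linfZ i'l) -sd sbg.
pose nd : D1 := ng w (q (i (ch *: d))).
have g0 : pg_gamma w 0 = 0 :> D1.
  have [_ gl _ _ _] := D1P; have := gl w wu (-1) 0 0.
  by rewrite -(op_gammaE O wu) rmorphN rmorph1 !scaleN1r !addNr.
have gdd : pg_gamma w dd = ci *: dd + Eps *: ((nd, 0) : dmodT D1).
  rewrite !dscaleE /= chE red_eps im_eps im_incl scale0r !scaler0 !scale0r.
  rewrite dg g0 scale1r; congr pair; first by rewrite addr0.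
  by rewrite !add0r.
pose w1 := it ((nd, 0) : dmodT D1) + (pg_gamma w v - ci *: v).
have du1 : pg_gamma w u1 - ci *: u1 = Eps *: w1.
  have uE : u1 = Eps *: v + it dd by rewrite -hv subrK.
  have itD a b : it (a *: dd + Eps *: b) = a *: it dd + Eps *: it b.
    by rewrite itl -[Eps *: b]addr0 itl (_ : it 0 = 0) ?addr0 //; have := itl (-1) 0 0; rewrite scaler0 addr0 scaleN1r addNr.
  rewrite uE (df_gamma_lin _ _ _ wu) (gamma_eps O wu) -itg // gdd itD /w1.
  have -> : ci *: (Eps *: v + it dd) = Eps *: (ci *: v) + ci *: it dd.
    by rewrite scalerDr !scalerA mulrC.
  by rewrite [RHS]scalerDr [Eps *: (_ - _)]scalerBr; apply: zalg.
have [w2 du2] : exists w2, pg_gamma w u2 - ci *: u2 = Eps *: w2.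
  by apply/df_ker; rewrite dfB df_gamma // dfZ e2 chE sbg // subrr.
(* sigma sends the pair (eps w1, eps w2) to gamma_w(s) - w^h1 s = 0, so [df_free] applies in DS. *)
have sum0 : df_pr w1 + df_pr w2 = 0.
  have [w3 hw3] := df_onto DS (df_pr w1 + df_pr w2); rewrite -hw3; apply: df_free.
  rewrite -(se w1 w2) // -du1 -du2 ![_ - ci *: _]addrC -!scaleNr -inclN sl ?df_gamma ?e1 ?e2 //.
  by rewrite sgm ?e1 ?e2 // es sgam // inclN scaleNr addNr.
have dw1 : df_pr w1 = i' nd + (pg_gamma w e - ch *: e).
  by rewrite dfD dfB c1 df_gamma // dfZ chE.
have dw2 : q' (df_pr w2) = pg_gamma w z - ch *: z - q (i (ng w (q' (ch *: sb)))).
  have qtl0 : qt 0 = 0 by have := qtl (-1) 0 0; rewrite scaler0 addr0 scaleN1r addNr.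
  have : qt (Eps *: w2) = qt (pg_gamma w u2 - ci *: u2) by rewrite du2.
  rewrite -[Eps *: w2]addr0 qtl qtl0 addr0 addrC -scaleNr qtl qtg // qtu => /(congr1 snd).
  rewrite !dscaleE /= red_eps im_eps scale0r add0r scale1r => h.
  transitivity (qt w2).1; first by symmetry; exact: c2.
  rewrite h.
  rewrite -inclN red_incl im_incl scale0r addr0 -q'g // sbg // scaleNr addrA.
  by rewrite [- _ + _]addrC.
have [_ _ pg2] := nf2_t2 nC; have [_ _ qg2] := nf3_t2 nD'.
have tP2 := nf2_t2 nC; have tq2 := nf3_t2 nD'; have [_ rg2 _] := hx nd.
have Nn (N : pgmod E) (r : N -> rb) a k b : tw TT r a k -> r (- b) = - r b.
  by move=> tr; rewrite -scaleN1r (twZ _ _ tr) mulN1r.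
have xc : C x * C (x^-1 * c) = C c by rewrite -constM mulrA mulfV // mul1r.
have kA : C x * R2 nd = wb W21 w * (ch * (C A^-1 * (C c * t ^+ m))).
  rewrite /nd ngE // iq1 iq2 (twZ _ _ (nf2_t1 nD)) (twZ _ _ (nf2_t2 nD)) d1 d2 !mulr0 subr0 -xc.
  by move: (wb W21 w) (C (x^-1 * c)) => b f; ring.
have kB : P2 (q (i (ng w (q' (ch *: sb))))) = wb W21 w * (C y * (ch * (C c * t ^+ m))).
  rewrite iq2 ngE // (hy _).1 (hy _).2 (twZ _ _ (nf3_t1 nD')) (twZ _ _ tq2) z1 z2.
  by rewrite !mulr0 subr0.
have E1 : P2 (q' (df_pr w1)) = C (A' * y) * (C x * R2 nd + (C (w%:A ^ h3) * gm w (q2 e) - ch * q2 e)).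
  by rewrite (hy _).2 dw1 !(twD _ _ tq2) (Nn _ _ _ _ _ tq2) (twZ _ _ tq2) rg2 qg2.
have E2 : P2 (q' (df_pr w2)) = C (w%:A ^ h3) * gm w (P2 z) - ch * P2 z - wb W21 w * (C y * (ch * (C c * t ^+ m))).
  by rewrite dw2 !(twD _ _ tP2) !(Nn _ _ _ _ _ tP2) (twZ _ _ tP2) kB pg2.
have E0 : P2 (q' (df_pr w1)) + P2 (q' (df_pr w2)) = 0.
  by rewrite -(twD _ _ tP2) -(linfD q'l) sum0 (linf0 q'l) (tw0 (@pgsubT _ _ _ _ C1) tP2).
have gH : gm w (C (A' * y) * q2 e + P2 z) = C (A' * y) * gm w (q2 e) + gm w (P2 z).
  by rewrite [LHS]rmorphD; congr (_ + _); rewrite [LHS]rmorphM; congr (_ * _); exact: gm_C.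
have lE : C ((A' * y * A^-1 - y) * c) = (C (A' * y) * C A^-1 - C y) * C c.
  by rewrite -constM -constB -constM.
rewrite gH lE -E0 E1 E2 kA.
move: (C (w%:A ^ h3)) (gm w (q2 e)) (gm w (P2 z)) (wb W21 w) (C (A' * y)) (C A^-1) => g b f v' r s'.
by ring.
Qed.
End KernelInvariant.

(** * Transport along isomorphisms *)

Section ExactSequences.
Variables (R : realType) (p : nat) (Qp : padicNumType R p) (E : ultraFieldExtType Qp).
Variable O : robba_ops E.
Local Notation Ee := (dual E : ultraAlgType Qp).
Local Notation rb := (robba E).
Local Notation rbe := (robba Ee).
Local Notation C := (@robba_const R E).
Local Notation ph := (op_phi O).
Local Notation gm := (op_gamma O).
Local Notation t := (robba_t E).
Local Notation tm := (@tm R p Qp E).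
Local Notation tw := (tw O).
Local Notation TT := (fun=> True).
Local Notation Eps := (robba_const (eps : Ee)).
Variables (l : Qp -> E) (a1 a2 a3 : E) (M : nat).
Variable W12 : weight_class O l (a1 / a2) M.
Local Notation c12 := (wc W12).
Variables (h1 h2 h3 : int).
Hypotheses (h12 : h2 < h1) (h23 : h3 < h2).
Local Notation m2 := `|h2 - h3|%N.
Local Notation m := `|h1 - h3|%N.
Local Notation ID := (ID W12 h1 h2 h3).
Local Notation IC := (IC W12 h2 h3).
Variables (D1 C1 D : pgmod E) (P1 P2 : C1 -> rb) (R1 R2 : D1 -> rb).
Variables (A : E) (q1 q2 q3 : D -> rb).
Hypotheses (A0 : A != 0).
Hypotheses (nC : nf2 O a1 a2 h3 IC P1 P2) (nD1 : nf2 O a1 a2 h3 ID R1 R2).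
Hypothesis nD : nf3 a3 W12 h1 h2 h3 A q1 q2 q3.

Let al i := if i is Some b then if b then a1 else a2 else a3.
Let r i := if i is Some b then if b then q1 else q2 else q3.
Let rt i : tw TT (r i) (al i) h3.
Proof. by case: i => [[]|]; [apply: nf3_t1 nD|apply: nf3_t2 nD|apply: nf3_t3 nD]. Qed.
Let ri v : (forall i, r i v = 0) -> v = 0.
Proof. by move=> h; apply: (nf3_inj nD (h (Some true)) (h (Some false)) (h None)). Qed.
Let rl i (e : rb) u v : r i (e *: u + v) = e * r i u + r i v.
Proof. by have [h _ _] := rt i; apply: h. Qed.

Lemma tw_zero (N : pgmod E) a k : tw TT (fun _ : N => 0 : rb) a k.
Proof. by split=> [e u v _ _|u _|x xu u _]; rewrite ?rmorph0 ?mulr0 ?addr0. Qed.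

Lemma char_tw (N : pgmod E) a k (q : N -> rb) :
  tw TT q a k -> is_pgmap (q : N -> pg_char (unr_z a k)).
Proof.
move=> [ql qp qg]; split=> [e u v|u|x xu u]; first by rewrite ql.
  by rewrite qp // /= unr_zp op_phiE.
by rewrite qg //= unr_zu // op_gammaE.
Qed.

(** All maps are prescribed by coordinates: i sets q3 to 0, q divides q1 by A, and j is
    multiplication by t^m in the third coordinate. The factor A^-1 in the composite q i is what
    later detects the invariant. *)
Lemma nf_exact : exists (i : D1 -> D) (q : D -> C1) (Q : D -> pg_char (unr_z a3 h3))
  (j : pg_char (unr_z a3 h1) -> D), [/\ short_exact i Q, short_exact j q,
    forall d, P1 (q (i d)) = C A^-1 * R1 d & forall d, P2 (q (i d)) = R2 d].
Proof.
pose si i := if i is Some b then if b then R1 else R2 else (fun=> 0).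
have [[[]|]|u|i [ip iE]] := @coord_pgmap _ _ _ _ O D1 D (option bool) al h3 r si rt _ ri.
- exact: nf2_t1 nD1.
- exact: nf2_t2 nD1.
- exact: tw_zero.
- have /(nf3_ker nD)[v [v3 v1 v2]] : ID (R1 u) (R2 u) by apply/(nf2_im nD1); exists u.
  by exists v => -[[]|].
have i1 u := iE u (Some true); have i2 u := iE u (Some false); have i3 u := iE u None.
rewrite /= in i1 i2 i3.
pose sq b := if b then (fun u => C A^-1 * q1 u) else q2.
pose rq b := if b then P1 else P2.
have rqi v : (forall b, rq b v = 0) -> v = 0.
  by move=> h; apply: (nf2_inj nC (h true) (h false)).
have rqt b : tw TT (rq b) (if b then a1 else a2) h3.
  by case: b; [apply: nf2_t1 nC|apply: nf2_t2 nC].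
have imq f g : IC (C A^-1 * f) g <-> tm m2 (f - C A * c12 * g).
  have -> : f - C A * c12 * g = C A * (C A^-1 * f - c12 * g).
    by rewrite mulrBr (C_KV _ A0) mulrA.
  by split=> [|h]; [apply: tmMl|apply: tm_Cl A0 h].
have [[]|u|q [qp qE]] := @coord_pgmap _ _ _ _ O D C1 bool (fun b => if b then a1 else a2) h3 rq sq rqt _ rqi.
- exact: tw_C (nf3_t1 nD).
- exact: nf3_t2 nD.
- have /(nf2_im nC)[v [v1 v2]] : IC (C A^-1 * q1 u) (q2 u).
    by apply/imq; apply/(nf3_im nD); exists u.
  by exists v => -[].
have pq1 u := qE u true; have pq2 u := qE u false; rewrite /= in pq1 pq2.
pose ch := pg_char (unr_z a3 h1 : Qp -> E).
pose sj (i : option bool) : ch -> rb := if i is Some b then (fun=> 0) else (fun u => t ^+ m * (u : rb)).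
have [[b|]|u|j [jp jE]] := @coord_pgmap _ _ _ _ O ch D (option bool) al h3 r sj rt _ ri.
- exact: tw_zero.
- apply: (tw_t (k := h3)); have <- : h1 = h3 + m%:Z by clear -h12 h23; lia.
  by apply: (@tw_char R p Qp E O ch a3 h1 (fun u => u)); apply: idp.
- have [s [s1 s2 s3]] := nf3_gen nD; exists ((u : rb) *: s); case=> [[]|] /=.
  + by rewrite (twZ _ _ (nf3_t1 nD)) s1 mulr0.
  + by rewrite (twZ _ _ (nf3_t2 nD)) s2 mulr0.
  by rewrite (twZ _ _ (nf3_t3 nD)) s3 mulrC.
have j1 u := jE u (Some true); have j2 u := jE u (Some false); have j3 u := jE u None.
rewrite /= in j1 j2 j3.
have Dext u v : q1 u = q1 v -> q2 u = q2 v -> q3 u = q3 v -> u = v.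
  by move=> e1 e2 e3; apply: (coord_inj rl ri) => -[[]|].
have [ql _ _] := qp; have [il _ _] := ip; have [jl _ _] := jp.
exists i, q, q3, j; split; last 2 first.
- by move=> d; rewrite pq1 i1.
- by move=> d; rewrite pq2 i2.
- split=> //; first exact: char_tw (nf3_t3 nD).
  + move=> u v e; apply/eqP; rewrite -subr_eq0; apply/eqP; apply: (nf2_inj nD1).
      by rewrite -i1 (linfB il) e subrr; apply: tw0 (@pgsubT _ _ _ _ D) (nf3_t1 nD).
    by rewrite -i2 (linfB il) e subrr; apply: tw0 (@pgsubT _ _ _ _ D) (nf3_t2 nD).
  + move=> v; split=> [v3|[u ->] //].
    have /(nf2_im nD1)[u [u1 u2]] : ID (q1 v) (q2 v) by apply/(nf3_ker nD); exists v.
    by exists u; apply: Dext; rewrite ?i1 ?i2 ?i3.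
  move=> w; have [u hu] := nf3_one nD; exists ((w : rb) *: u).
  by rewrite (twZ _ _ (nf3_t3 nD)) hu mulr1.
split=> //.
- by move=> u v e; apply: (t_regI O (m := m)); rewrite -!j3 e.
- move=> v; split=> [v0|[u ->]].
    have z1 : q1 v = 0.
      by rewrite -[q1 v](C_KV _ A0) -pq1 v0 (tw0 (@pgsubT _ _ _ _ C1) (nf2_t1 nC)) mulr0.
    have z2 : q2 v = 0 by rewrite -pq2 v0; apply: tw0 (@pgsubT _ _ _ _ C1) (nf2_t2 nC).
    have [f hf] := nf3_tm nD z1 z2.
    by exists f; apply: Dext; rewrite ?j1 ?j2 ?j3.
  by apply: (nf2_inj nC); rewrite ?pq1 ?pq2 ?j1 ?j2 ?mulr0.
move=> w; have : IC (P1 w) (P2 w) by apply/(nf2_im nC); exists w.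
rewrite -[P1 w](C_VK _ A0) => /imq/(nf3_im nD)[u [u1 u2]]; exists u.
apply: (coord_inj _ rqi) => [b e x y|b]; first by have [h _ _] := rqt b; apply: h.
by case: b; rewrite /= ?pq1 ?pq2 ?u1 ?u2 ?(C_VK _ A0).
Qed.
End ExactSequences.

Section Transport.
Variables (R : realType) (p : nat) (Qp : padicNumType R p) (E : ultraFieldExtType Qp).
Local Notation rb := (robba E).
Variables (D D' : pgmod E) (F : D -> D') (G : D' -> D).
Hypotheses (Fp : is_pgmap F) (FK : cancel F G) (GK : cancel G F).

Lemma pgmap_inv : is_pgmap G.
Proof.
have [Fl Fph Fg] := Fp; split=> [e u v|u|x xu u]; apply: (can_inj FK); rewrite GK.
- by rewrite Fl !GK.
- by rewrite Fph GK.
by rewrite Fg // GK.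
Qed.

Lemma transport_ax (Nt : deform D) : is_deform (fun u : Nt => F (df_pr u)).
Proof.
have [Fl Fph Fg] := Fp; have [h1 h2 [h3 h4] h5 h6] := df_ax Nt; split=> //.
- by move=> a u v; rewrite h2 Fl.
- by split=> [u|x xu u]; [rewrite h3 Fph|rewrite h4 // Fg].
- by move=> w; have [u hu] := h5 (G w); exists u; rewrite hu GK.
move=> u; rewrite -h6 -[X in _ = X <-> _](linf0 Fl); split=> [/(can_inj FK)//|->//].
Qed.

Definition transport (Nt : deform D) : deform D' := Deform (transport_ax Nt).

(** The deformed modules stay the same; only their projections and the exact sequences below them
    are composed with F or its inverse. *)
Lemma ker_transport a1 a2 a3 (h1 h2 h3 : int) (D1 C1 : pgmod E) (D1t : deform D1) (C1t : deform C1) :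
  in_ker_f a1 a2 a3 h1 h2 h3 D D1t C1t -> in_ker_f a1 a2 a3 h1 h2 h3 D' D1t C1t.
Proof.
have Gp := pgmap_inv; have Fi := can_inj FK; have [Fl _ _] := Fp; have [Gl _ _] := Gp.
move=> [DF [DG [DS [fF fG [sg [s1 s2 s3 s4 s5]] hS]]]].
exists (transport DF), (transport DG), (transport DS); split.
- have [i [q [it [qt [[ip qp ii ik io] hE c1 c2]]]]] := fF.
  exists (fun u => F (i u)), (fun u => q (G u)), it, qt; split=> //.
  + split; [exact: comp_pgmap ip Fp|exact: comp_pgmap Gp qp|by move=> u v /Fi/ii| |].
    * move=> v; rewrite ik; split=> [[u hu]|[u ->]]; exists u; last by rewrite FK.
      by rewrite -hu GK.
    by move=> w; have [v hv] := io w; exists (F v); rewrite FK.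
  + by move=> u; rewrite /= c1.
  by move=> v; rewrite c2 /= FK.
- have [i [q [it [qt [[ip qp ii ik io] hE c1 c2]]]]] := fG.
  exists (fun u => F (i u)), (fun u => q (G u)), it, qt; split=> //.
  + split; [exact: comp_pgmap ip Fp|exact: comp_pgmap Gp qp|by move=> u v /Fi/ii| |].
    * move=> v; rewrite ik; split=> [[u hu]|[u ->]]; exists u; last by rewrite FK.
      by rewrite -hu GK.
    by move=> w; have [v hv] := io w; exists (F v); rewrite FK.
  + by move=> u; rewrite /= c1.
  by move=> v; rewrite c2 /= FK.
- exists sg; split=> [a u1 u2 v1 v2 /Fi e /Fi e'|u1 u2 /Fi e|x xu u1 u2 /Fi e|u1 u2 /Fi e|u1 u2 u3 e].
  + exact: s1.
  + exact: s2.
  + exact: s3.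
  + by congr F; apply: s4.
  by apply: s5; apply: Fi; rewrite (linfD Fl).
exact: hS.
Qed.
End Transport.

Theorem theorem1p7 (R : realType) (p : nat) (Qp : padicNumType R p)
    (E : ultraFieldExtType Qp) (a1 a2 a3 : E) (h1 h2 h3 : int)
    (a_generic : generic [tuple a1; a2; a3]) (h12 : h2 < h1) (h23 : h3 < h2)
    (D1 C1 : pgmod E)
    (D1P : PhiGamma_nc [tuple a1; a2] [tuple h1; h2] D1)
    (C1P : PhiGamma_nc [tuple a1; a2] [tuple h2; h3] C1)
    (D D' : pgmod E)
    (DP : PhiGamma_nc [tuple a1; a2; a3] [tuple h1; h2; h3] D)
    (D'P : PhiGamma_nc [tuple a1; a2; a3] [tuple h1; h2; h3] D') :
  pg_iso D D' <->
  (forall (D1t : deform D1) (C1t : deform C1),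
     in_ker_f a1 a2 a3 h1 h2 h3 D D1t C1t <->
     in_ker_f a1 a2 a3 h1 h2 h3 D' D1t C1t).
Proof.
split=> [[F Fp [G FK GK]] D1t C1t|hker].
  by split; [exact: ker_transport Fp FK GK _ _ _ _ _ _ _ _ _ _|
             exact: ker_transport (pgmap_inv Fp FK GK) GK FK _ _ _ _ _ _ _ _ _ _].
pose o0 : 'I_3 := @Ordinal 3 0 isT; pose o1 : 'I_3 := @Ordinal 3 1 isT; pose o2 : 'I_3 := @Ordinal 3 2 isT.
have [a0 an] := a_generic.
have a10 : a1 != 0 := a0 o0; have a20 : a2 != 0 := a0 o1; have a30 : a3 != 0 := a0 o2.
have [a12 a12p] : a1 != a2 /\ a1 / a2 != p%:R := an o0 o1 isT.
have [_ a21p] : a2 != a1 /\ a2 / a1 != p%:R := an o1 o0 isT.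
have [a13 _] : a1 != a3 /\ a1 / a3 != p%:R := an o0 o2 isT.
have [a23 _] : a2 != a3 /\ a2 / a3 != p%:R := an o1 o2 isT.
have [DPh _ _ _ Dtri] := DP; have [D1Ph _ _ _ _] := D1P; have [C1Ph _ _ _ _] := C1P.
(* D itself is the module from which the multiplicativity of phi and gamma is deduced. *)
have [ph [gm [e1 e2 e3 e4 e5]]] := robba_morphisms DPh.
pose O : robba_ops E := RobbaOps e1 e2 e3 e4 e5; clearbody O.
have [kap kapL] := kappa_ex O.
have small b : exists N, forall n, (N <= n)%N -> unorm (b * p%:R ^+ n : E) < 1.
  have [N hN] := geometric_small (unorm b) (prV_lt1 Qp) (@ltr01 R).
  by exists N => n /hN; rewrite unormM unormX normE_p.
have [N1 hN1] := small (a1 / a2); have [N2 hN2] := small (a2 / a1).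
(* M bounds all exponents of t occurring in D, and it makes |lam p^M| < 1 for both lam = a1/a2 and
   lam = a2/a1. *)
pose M := maxn `|h1 - h3|%N (maxn N1 N2).
have mM : (`|h1 - h3| <= M)%N by rewrite leq_maxl.
have M0 : (0 < M)%N by rewrite (leq_trans _ mM) // (mE h12 h23) addn_gt0 (m10 h12).
(* Genericity in the form required of lam = b/c: the condition p lam != 1 is c/b != p. *)
have lam_ok b c : b != 0 -> c != 0 -> b != c -> c / b != p%:R ->
    [/\ b / c != 0, b / c != 1 & p%:R * (b / c) != 1 :> E].
  move=> b0 c0 bc pbc; split; first by rewrite mulf_neq0 ?invr_eq0.
    by apply: contraNneq bc => e; rewrite -[c]mul1r -e divfK.
  apply: contraNneq pbc => e; apply/eqP; have bc0 : b / c != 0 by rewrite mulf_neq0 ?invr_eq0.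
  by apply: (mulIf bc0); rewrite e mulrA divfK // divff.
have [l0 l1 lp] := lam_ok _ _ a10 a20 a12 a21p.
have a21 : a2 != a1 by rewrite eq_sym.
have [l0' l1' lp'] := lam_ok _ _ a20 a10 a21 a12p.
have M1 : unorm (a1 / a2 * p%:R ^+ M) < 1 by apply: hN1; rewrite !leq_max leqnn orbT.
have M2 : unorm (a2 / a1 * p%:R ^+ M) < 1 by apply: hN2; rewrite !leq_max leqnn !orbT.
have [W12 _] := weight_class_ex kapL M0 l0 l1 lp M1.
have [W21 _] := weight_class_ex kapL M0 l0' l1' lp' M2.
have [A [q1 [q2 [q3 [A0 nD]]]]] := nf3_ex a10 a20 a30 a12 a13 a23 M0 W12 W21 h12 h23 mM DP.
have [A' [r1 [r2 [r3 [_ nD']]]]] := nf3_ex a10 a20 a30 a12 a13 a23 M0 W12 W21 h12 h23 mM D'P.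
have [P1 [P2 nC1]] := nf2_C a10 a20 a30 a12 a13 a23 M0 W12 W21 h12 h23 mM C1P.
have [R1 [R2 [nD1 hom]]] := nf2_D a10 a20 a30 a12 a13 a23 M0 W12 W21 h12 h23 mM D1P.
have [k _ hk] := wc_prod a10 a20 M0 W12 W21.
have [np [ng [B ngE]]] := bic_ex a10 a20 (lgM kapL) (@lg_cvg _ _ _ _ O kap) h12 h23 mM nC1 nD1 C1Ph hk.
have [i [q [Q [j [ex1 ex2 iq1 iq2]]]]] := nf_exact h12 h23 A0 nC1 nD1 nD.
have [ip _ _ _ _] := ex1; have [_ qp _ _ _] := ex2.
have mem := ker_mem O D1Ph C1Ph DPh B ip qp (Dtri 1%g) ex1 ex2.
move/hker: mem => mem.
have AA : A = A'.
  exact: (ker_invariant a10 a20 a30 a12 a13 M0 (lg_x0n kapL) h12 h23 mM A0 nC1 nD1 hom nD'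
    ngE iq1 iq2 mem).
by rewrite -AA in nD'; exact: (nf3_iso a30 h12 h23 nD nD').
Qed.
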